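(* Let $\lambda\in\mathbb{R}$. A complete, rotational $\lambda$-translator in $\mathrm{Nil}_3$ that intersects the rotation axis is one of the surfaces $M_+$, $M_-$, where $M_+$ and $M_-$ are the unique rotational $\lambda$-translators intersecting the rotation axis orthogonally and whose unit normal at this intersection is $\partial_z$ and $-\partial_z$, respectively. Both $M_\pm$ are proper immersions of a disk and behave as follows: 1. $M_+$ is embedded and its end has third coordinate diverging to $\infty$. Furthermore, it converges to the vertical cylinder $\mathcal{C}_\lambda$ of constant mean curvature $\lambda$ and radius $1/(2\lambda)$. 2. $M_-$ has infinitely many self-intersections and its end has third coordinate diverging to $-\infty$. Furthermore, its distance to the rotation axis is unbounded. Moreover, assume that $p_0=(0,0,z_0)$ is the intersection of $M_-$ with the rotation axis. Then: (a) If $\lambda\geq 1$, then $M_-$ is a strictly convex vertical graph around $p_0$, in the sense that $M_-$ lies locally above the plane $\{z=z_0\}$ around $p_0$ when this plane is endowed with the downwards orientation. (b) If $\lambda<1$, then $M_-$ is a strictly concave vertical graph around $p_0$, in the sense that $M_-$ lies locally below the plane $\{z=z_0\}$ around $p_0$ when this plane is endowed with the downwards orientation.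
   Context: The Heisenberg space $\mathrm{Nil}_3$ is $\mathbb{R}^3$ with coordinates $(x,y,z)$ and metric $\langle\cdot,\cdot\rangle=dx^2+dy^2+(dz+\tau(y\,dx-x\,dy))^2$, where $\tau$ is a fixed constant. The mean curvature $H$ is half the trace of the second fundamental form with respect to the unit normal $N$. Given $\lambda\in\mathbb{R}$, an oriented surface $M$ in $\mathrm{Nil}_3$ is a $\lambda$-translator if $H(p)=\langle N(p),\partial_z\rangle+\lambda$ for all $p\in M$. A rotational surface is one invariant under the usual Euclidean rotations about the $z$-axis (the rotation axis), which are isometries of $\mathrm{Nil}_3$; it is parametrized as $\psi(s,t)=(x(s)\cos t,x(s)\sin t,z(s))$, where $\alpha(s)=(x(s),0,z(s))$ is its profile curve. The existence of $M_\pm$ is known, and their uniqueness is understood up to vertical translations $(x,y,z)\mapsto(x,y,z+t)$. ''Above'' (resp. ''below'') the plane $\{z=z_0\}$ endowed with the downwards orientation refers to the side to which the downward normal $-\partial_z$ points (resp. the opposite side).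
   Formalization: The end behaviour in items 1 and 2 (embeddedness, self-intersections, limits, cylinder) is stated for λ>0 only, since it is false or undefined for λ≤0 (reversing orientation swaps M₊ and M₋, and the radius is 1/(2λ)); τ≠0 is assumed, as for τ=0 the space is Euclidean. *)

(* Defs.v *)
From Stdlib Require Import Reals List.
From Coquelicot Require Import Coquelicot.
Open Scope R_scope.

(* Points of [Nil_3], and tangent vectors in the coordinate frame
   [(d/dx, d/dy, d/dz)], are both triples of reals. *)
Definition pt : Type := (R * R * R)%type.

Definition cx (p : pt) : R := fst (fst p).
Definition cy (p : pt) : R := snd (fst p).
Definition cz (p : pt) : R := snd p.

Inductive axis : Type := ax | ay | az.

Definition coord (i : axis) (p : pt) : R :=
  match i with ax => cx p | ay => cy p | az => cz p end.

Definition basis (i : axis) : pt :=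
  match i with ax => (1, 0, 0) | ay => (0, 1, 0) | az => (0, 0, 1) end.

Definition dz : pt := (0, 0, 1).
Definition minus_dz : pt := (0, 0, -1).

Definition sum3 (f : axis -> R) : R := f ax + f ay + f az.

Definition shift (p : pt) (i : axis) (h : R) : pt :=
  (cx p + h * cx (basis i), cy p + h * cy (basis i), cz p + h * cz (basis i)).

(* [dx^2 + dy^2 + (dz + tau (y dx - x dy))^2] *)
Definition contact (tau : R) (p v : pt) : R :=
  cz v + tau * (cy p * cx v - cx p * cy v).

Definition inner (tau : R) (p v w : pt) : R :=
  cx v * cx w + cy v * cy w + contact tau p v * contact tau p w.

Definition dmetric (tau : R) (p : pt) (a i j : axis) : R :=
  Derive (fun h => inner tau (shift p a h) (basis i) (basis j)) 0.

(* Christoffel symbols of the first kind, [<nabla_a d_b, d_l>] for the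
   Levi-Civita connection [nabla]. *)
Definition christoffel (tau : R) (p : pt) (a b l : axis) : R :=
  (dmetric tau p a b l + dmetric tau p b a l - dmetric tau p l a b) / 2.

Definition du (F : R -> R -> pt) (u v : R) : pt :=
  (Derive (fun a => cx (F a v)) u,
   Derive (fun a => cy (F a v)) u,
   Derive (fun a => cz (F a v)) u).

Definition dv (F : R -> R -> pt) (u v : R) : pt :=
  (Derive (fun b => cx (F u b)) v,
   Derive (fun b => cy (F u b)) v,
   Derive (fun b => cz (F u b)) v).

(* [<nabla_V W, n>], where [VW] is the coordinatewise derivative of the vector
   field [W] along the surface in the direction [V]. *)
Definition nabla_inner (tau : R) (p V W VW n : pt) : R :=
  inner tau p VW n +
  sum3 (fun a => sum3 (fun b => sum3 (fun l =>
    christoffel tau p a b l * coord a V * coord b W * coord l n))).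

(* Half the trace of the second fundamental form (coefficients [e], [f], [g])
   with respect to the first one (coefficients [E], [F0], [G]). *)
Definition mean_curvature (tau : R) (F n : R -> R -> pt) (u v : R) : R :=
  let p := F u v in
  let Fu := du F u v in
  let Fv := dv F u v in
  let E := inner tau p Fu Fu in
  let F0 := inner tau p Fu Fv in
  let G := inner tau p Fv Fv in
  let e := nabla_inner tau p Fu Fu (du (du F) u v) (n u v) in
  let f := nabla_inner tau p Fu Fv (du (dv F) u v) (n u v) in
  let g := nabla_inner tau p Fv Fv (dv (dv F) u v) (n u v) in
  (e * G - 2 * f * F0 + g * E) / (2 * (E * G - F0 * F0)).

Definition plane (u v : R) : Prop := True.
Definition disc (rho u v : R) : Prop := u * u + v * v < rho * rho.

Definition smooth_on (D : R -> R -> Prop) (h : R -> R -> R) : Prop :=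
  forall (k : nat) (u v : R), D u v -> ex_diff_n h k u v.

(* [F] is a smooth immersion of the open set [D] into [Nil_3] and [n] is a
   continuous unit normal field along it. *)
Record oriented_immersion (tau : R) (D : R -> R -> Prop) (F n : R -> R -> pt) :
  Prop := {
  imm_smooth : forall i : axis, smooth_on D (fun a b => coord i (F a b));
  imm_rank : forall u v : R, D u v -> forall a b : R,
    (forall i : axis,
       a * coord i (du F u v) + b * coord i (dv F u v) = 0) ->
    a = 0 /\ b = 0;
  imm_normal_continuous : forall (i : axis) (u v : R), D u v ->
    continuity_2d_pt (fun a b => coord i (n a b)) u v;
  imm_normal_unit : forall u v : R, D u v ->
    inner tau (F u v) (n u v) (n u v) = 1;
  imm_normal_orthogonal : forall u v : R, D u v ->
    inner tau (F u v) (n u v) (du F u v) = 0 /\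
    inner tau (F u v) (n u v) (dv F u v) = 0
}.

Definition translator_equation (tau lambda : R) (D : R -> R -> Prop)
    (F n : R -> R -> pt) : Prop :=
  forall u v : R, D u v ->
    mean_curvature tau F n u v = inner tau (F u v) (n u v) dz + lambda.

(* The surface swept out by the profile curve [s |-> (rad s, 0, hgt s)], where
   [s] ranges over [dom].  [nrm s t] is the chosen unit normal at
   [rot_map S s t].  The values of the fields outside [dom] are irrelevant. *)
Record rot_data : Type := {
  dom : R -> Prop;
  rad : R -> R;
  hgt : R -> R;
  nrm : R -> R -> pt
}.

Definition rot_map (S : rot_data) (s t : R) : pt :=
  (rad S s * cos t, rad S s * sin t, hgt S s).

(* Local parametrizations [F], with unit normal [n], of the surface around the
   points [rot_map S s t].  Off the rotation axis they are given by [rot_map]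
   itself.  On the axis [rot_map] is degenerate: there [(r, t)] become polar
   coordinates on a disc, and the profile curve starts ([sigma = 1]) or stops
   ([sigma = -1]) at [s]. *)
Inductive local_param (S : rot_data) (s : R) (D : R -> R -> Prop)
    (F n : R -> R -> pt) : Prop :=
| param_off_axis (delta : R) :
    0 < delta ->
    0 < rad S s ->
    (forall r : R, Rabs (r - s) < delta -> dom S r) ->
    (forall u v : R, D u v <-> Rabs (u - s) < delta) ->
    (forall u v : R, D u v -> F u v = rot_map S u v /\ n u v = nrm S u v) ->
    local_param S s D F n
| param_on_axis (sigma delta : R) :
    0 < delta ->
    rad S s = 0 ->
    sigma = 1 \/ sigma = -1 ->
    (forall r : R, Rabs r < delta -> (dom S (s + sigma * r) <-> 0 <= r)) ->
    (forall u v : R, D u v <-> disc delta u v) ->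
    (forall r t : R, 0 <= r < delta ->
       F (r * cos t) (r * sin t) = rot_map S (s + sigma * r) t /\
       n (r * cos t) (r * sin t) = nrm S (s + sigma * r) t) ->
    local_param S s D F n.

(* A connected, smoothly immersed, oriented surface without boundary,
   invariant under the rotations about the z-axis. *)
Record is_rotational_surface (tau : R) (S : rot_data) : Prop := {
  rot_nonempty : exists s : R, dom S s;
  rot_interval : forall a b s : R, dom S a -> dom S b -> a <= s <= b -> dom S s;
  rot_half_plane : forall s : R, dom S s -> 0 <= rad S s;
  rot_immersed : forall s : R, dom S s ->
    exists (D : R -> R -> Prop) (F n : R -> R -> pt),
      local_param S s D F n /\ oriented_immersion tau D F n
}.

Definition is_translator (tau lambda : R) (S : rot_data) : Prop :=
  forall (s : R) (D : R -> R -> Prop) (F n : R -> R -> pt),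
    dom S s -> local_param S s D F n -> oriented_immersion tau D F n ->
    translator_equation tau lambda D F n.

Definition rotational_translator (tau lambda : R) (S : rot_data) : Prop :=
  is_rotational_surface tau S /\ is_translator tau lambda S.

Definition intersects_axis (S : rot_data) : Prop :=
  exists s : R, dom S s /\ rad S s = 0.

(* For [e] equal to [dz] or [minus_dz] the tangent plane at this point is
   horizontal, so that the surface meets the axis orthogonally. *)
Definition intersects_axis_with_normal (S : rot_data) (e : pt) : Prop :=
  exists s : R, dom S s /\ rad S s = 0 /\ forall t : R, nrm S s t = e.

Definition arc_length (tau : R) (c : R -> pt) (a b : R) : R :=
  let c' := fun u => (Derive (fun w => cx (c w)) u,
                      Derive (fun w => cy (c w)) u,
                      Derive (fun w => cz (c w)) u) in
  RInt (fun u => sqrt (inner tau (c u) (c' u) (c' u))) a b.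

(* Every divergent curve of the surface has infinite length.  A compact part of
   the surface lies over a compact subinterval of [dom], so a curve diverges
   exactly when its profile parameter [a] leaves each of these.  Such a curve
   eventually avoids the (at most two) points of the axis, whence the use of
   the coordinates [(s, t)]. *)
Definition complete (tau : R) (S : rot_data) : Prop :=
  forall a b : R -> R,
    (forall u : R, 0 <= u < 1 ->
       dom S (a u) /\ 0 < rad S (a u) /\
       ex_derive a u /\ ex_derive b u /\
       continuous (Derive a) u /\ continuous (Derive b) u) ->
    (forall s0 s1 : R, (forall s : R, s0 <= s <= s1 -> dom S s) ->
       exists u0 : R, u0 < 1 /\
         forall u : R, u0 < u < 1 -> ~ (s0 <= a u <= s1)) ->
    forall L : R, exists u : R, 0 <= u < 1 /\
      L < arc_length tau (fun w => rot_map S (a w) (b w)) 0 u.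

(* [S] is, as an oriented surface and up to the vertical translation by [c], a
   connected piece of [M]; [phi] is the change of profile parameter.  Vertical
   translations do not affect the components of the normal. *)
Definition piece_via (phi : R -> R) (c : R) (S M : rot_data) : Prop :=
  (forall s : R, dom S s ->
     filterlim phi (within (dom S) (locally s)) (locally (phi s))) /\
  (forall s s' : R, dom S s -> dom S s' -> phi s = phi s' -> s = s') /\
  (forall s : R, dom S s ->
     dom M (phi s) /\
     rad S s = rad M (phi s) /\
     hgt S s = hgt M (phi s) + c /\
     forall t : R, nrm S s t = nrm M (phi s) t).

Definition piece_of (S M : rot_data) : Prop :=
  exists (phi : R -> R) (c : R), piece_via phi c S M.

Definition same_surface (S M : rot_data) : Prop :=
  exists (phi : R -> R) (c : R),
    piece_via phi c S M /\
    forall r : R, dom M r -> exists s : R, dom S s /\ phi s = r.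

(* [F] immerses the whole plane, and the profile parameter of [S] is the
   distance to the origin of the plane. *)
Definition disk_parametrization (tau : R) (S : rot_data) (F n : R -> R -> pt) :
  Prop :=
  oriented_immersion tau plane F n /\
  (forall s : R, dom S s <-> 0 <= s) /\
  (forall s t : R, 0 <= s ->
     F (s * cos t) (s * sin t) = rot_map S s t /\
     n (s * cos t) (s * sin t) = nrm S s t).

Definition plane_infinity (P : R * R -> Prop) : Prop :=
  exists K : R, forall u v : R, K < u * u + v * v -> P (u, v).

Definition tends_at_infinity (h : R -> R -> R) (l : Rbar) : Prop :=
  filterlim (fun w : R * R => h (fst w) (snd w)) plane_infinity (Rbar_locally l).

Definition sqdist (p q : pt) : R :=
  (cx p - cx q) ^ 2 + (cy p - cy q) ^ 2 + (cz p - cz q) ^ 2.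

(* Compact subsets of R^2 and R^3 are the closed bounded ones, so properness says
   that [F] goes to infinity at infinity. *)
Definition proper (F : R -> R -> pt) : Prop :=
  tends_at_infinity (fun u v => sqdist (F u v) (0, 0, 0)) p_infty.

(* Stated for an immersion [F]: injective, with continuous inverse. *)
Definition embedded (F : R -> R -> pt) : Prop :=
  (forall u v u' v' : R, F u v = F u' v' -> u = u' /\ v = v') /\
  (forall (u v : R) (eps : R), 0 < eps -> exists delta : R, 0 < delta /\
     forall u' v' : R, sqdist (F u' v') (F u v) < delta ->
       disc eps (u' - u) (v' - v)).

Definition axis_dist (p : pt) : R := sqrt (cx p ^ 2 + cy p ^ 2).

Definition axis_dist_unbounded (F : R -> R -> pt) : Prop :=
  forall C : R, exists u v : R, C < axis_dist (F u v).

(* A self-intersection of a rotational surface is a whole circle about the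
   axis, determined by its radius and its height: the set of these circles is
   infinite. *)
Definition infinitely_many_self_intersections (F : R -> R -> pt) : Prop :=
  forall l : list (R * R), exists u v u' v' : R,
    (u, v) <> (u', v') /\ F u v = F u' v' /\
    ~ In (axis_dist (F u v), cz (F u v)) l.

Definition cylinder (rho a b : R) : pt := (rho * cos a, rho * sin a, b).
Definition cylinder_normal (a b : R) : pt := (- cos a, - sin a, 0).

Definition is_cmc (tau H : R) (F n : R -> R -> pt) : Prop :=
  oriented_immersion tau plane F n /\
  forall u v : R, mean_curvature tau F n u v = H.

(* The inward unit normal at [p] of the vertical cylinder through [p]; it is
   [cylinder_normal a b] at [p = cylinder rho a b], [rho > 0]. *)
Definition inward_normal (p : pt) : pt :=
  (- cx p / axis_dist p, - cy p / axis_dist p, 0).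

(* C^1 convergence of the end to the cylinder of radius [rho]: its points and
   its unit normals approach those of the cylinder.  The distance from [p] to
   the cylinder is [Rabs (axis_dist p - rho)], also for the metric [inner]
   since [Nil_3 -> R^2] is a Riemannian submersion. *)
Definition converges_to_cylinder (tau rho : R) (F n : R -> R -> pt) : Prop :=
  tends_at_infinity (fun u v => axis_dist (F u v)) rho /\
  tends_at_infinity
    (fun u v => inner tau (F u v) (n u v) (inward_normal (F u v))) 1.

(* Near [F u0 v0 = (0, 0, z0)] the surface is the graph [z = h x y] of a smooth
   function on a disc, whose points other than [(0, 0, z0)] satisfy [side]. *)
Definition local_vertical_graph (F : R -> R -> pt) (u0 v0 : R)
    (side : pt -> Prop) : Prop :=
  exists (delta eps : R) (h : R -> R -> R),
    0 < delta /\ 0 < eps /\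
    smooth_on (disc eps) h /\
    (forall u v : R, disc delta (u - u0) (v - v0) ->
       disc eps (cx (F u v)) (cy (F u v)) /\
       cz (F u v) = h (cx (F u v)) (cy (F u v))) /\
    (forall a b : R, disc eps a b ->
       exists! w : R * R,
         disc delta (fst w - u0) (snd w - v0) /\
         F (fst w) (snd w) = (a, b, h a b)) /\
    (forall a b : R, disc eps a b -> (a, b) <> (0, 0) -> side (a, b, h a b)).

(* Sides of the plane [z = z0] oriented by [- d/dz]: "above" is the side to
   which this normal points. *)
Definition above_downwards_plane (z0 : R) (p : pt) : Prop := cz p < z0.
Definition below_downwards_plane (z0 : R) (p : pt) : Prop := z0 < cz p.

(* Main.v *)
(* With [W = sqrt (1 + tau^2 x^2)], the profile of a rotational translator, parametrized by
   arc length for [dx^2 + dz^2 / W^2], satisfies [x' = cos th], [z' = W sin th] and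
   [th' = 2 (cos th / W + mu) - sin th / x], where [mu = e lambda] and [e = 1] or [e = -1]
   is the sign of the normal on the axis.  The solution starting on the axis is obtained
   from a Volterra equation for [th]; [x / s], [sin th / x] and [z] are smooth functions of
   [s^2], so that the surface is smooth on the axis.  Since [J = x sin th - mu x^2]
   satisfies [J' = 2 x cos^2 th / W], a profile leaving the axis never returns to it.  A
   Gronwall estimate starting at the axis identifies every translator meeting the axis with
   one of the two models, and completeness forces it to be the whole model.

   For [mu > 0] the function [J] is bounded, [cos th] and [th'] tend to [0] by Barbalat's
   lemma, and [x] tends to [1 / (2 mu)].  For [mu < 0] the radius is unbounded and [th]
   keeps turning, so the profile makes larger and larger loops.  The metric twists the loops
   by a vertical drift of about [- |tau| / (2 |mu|)] per unit length; consecutive loops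
   overlap and must cross. *)
Require Import Defs.
From Stdlib Require Import Reals Lra Lia List Classical ClassicalEpsilon FunctionalExtensionality.
From Coquelicot Require Import Coquelicot.
(* [Rtopology.disc] would otherwise shadow [Defs.disc]. *)
Import Defs.
Open Scope R_scope.

(** * Real analysis *)

(** The obstacle is the quotient [sin th / x], singular on the axis, for existence as well as for
    uniqueness. For existence, [(x sin th)' = 2 x cos th (mu + cos th / W)] contains no quotient:
    [sin th / x] becomes a primitive divided by [x^2], and only [x / s] has to be kept away from
    [0], which a cutoff does until the monotonicity of [J] shows it to be inactive. For uniqueness,
    the singular terms enter the energy estimate with the favourable sign once the error in [x] is
    measured relative to [x]. Orientation enters only through [mu]: reversing the normal changes the
    signs of [H] and of [<N, d/dz>] but not that of [lambda], so one family of profiles yields both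
    surfaces. The hypothesis [tau <> 0] makes [W] grow like [|tau| x]. This gives the drift of the
    loops for [mu < 0], the divergence of the height for [mu >= 0] without control of [x], and, at
    [lambda = 1], where the second-order term on the axis vanishes, the strict inequality
    [cos th / W < 1] that decides the side of the plane. *)

Lemma continuity_pt_continuous (f : R -> R) (x : R) :
  continuous f x -> continuity_pt f x.
Proof. apply continuity_pt_filterlim. Qed.

Lemma continuous_continuity_pt (f : R -> R) (x : R) :
  continuity_pt f x -> continuous f x.
Proof. apply continuity_pt_filterlim. Qed.

Lemma is_derive_continuous (f : R -> R) (x l : R) :
  is_derive f x l -> continuous f x.
Proof. intros H. apply (@ex_derive_continuous R_AbsRing R_NormedModule). now exists l. Qed.

Lemma is_derive_eq (f : R -> R) (x l l' : R) :
  is_derive f x l -> l = l' -> is_derive f x l'.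
Proof. intros H ->. exact H. Qed.

Lemma continuous_eps (f : R -> R) (x : R) :
  continuous f x <->
  (forall eps, 0 < eps -> exists d, 0 < d /\
     forall y, Rabs (y - x) < d -> Rabs (f y - f x) < eps).
Proof.
  split.
  - intros H eps He.
    destruct (proj1 (filterlim_locally f (f x)) H (mkposreal eps He)) as [d Hd].
    exists d. split; [apply cond_pos|]. intros y Hy. apply (Hd y), Hy.
  - intros H. apply filterlim_locally. intros eps.
    destruct (H eps (cond_pos eps)) as [d [Hd H1]].
    exists (mkposreal d Hd). intros y Hy. apply (H1 y), Hy.
Qed.

Lemma mean_value (f df : R -> R) (a b : R) : a < b ->
  (forall x, a <= x <= b -> continuous f x) ->
  (forall x, a < x < b -> is_derive f x (df x)) ->
  exists c, a < c < b /\ f b - f a = df c * (b - a).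
Proof.
  intros Hab Hc Hd.
  assert (pr1 : forall c, a < c < b -> derivable_pt f c).
  { intros c Hcc. exists (df c). apply is_derive_Reals, Hd, Hcc. }
  assert (pr2 : forall c, a < c < b -> derivable_pt id c).
  { intros c _. apply derivable_pt_id. }
  destruct (MVT f id a b pr1 pr2 Hab) as [c [P E]].
  - intros c Hcc. apply continuity_pt_continuous, Hc, Hcc.
  - intros c _. apply derivable_continuous_pt, derivable_pt_id.
  - exists c. split; [exact P|].
    assert (E1 : derive_pt f c (pr1 c P) = df c).
    { apply derive_pt_eq_0, is_derive_Reals, Hd, P. }
    assert (E2 : derive_pt id c (pr2 c P) = 1).
    { apply derive_pt_eq_0, derivable_pt_lim_id. }
    rewrite E1, E2 in E. unfold id in E. lra.
Qed.

Lemma increasing_of_deriv (f df : R -> R) (a b : R) : a < b ->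
  (forall x, a <= x <= b -> continuous f x) ->
  (forall x, a < x < b -> is_derive f x (df x)) ->
  (forall x, a < x < b -> 0 < df x) -> f a < f b.
Proof.
  intros Hab Hc Hd Hp. destruct (mean_value f df a b Hab Hc Hd) as [c [P E]].
  specialize (Hp c P). nra.
Qed.

Lemma nondecreasing_of_deriv (f df : R -> R) (a b : R) : a <= b ->
  (forall x, a <= x <= b -> continuous f x) ->
  (forall x, a < x < b -> is_derive f x (df x)) ->
  (forall x, a < x < b -> 0 <= df x) -> f a <= f b.
Proof.
  intros [Hab| ->] Hc Hd Hp; [|lra].
  destruct (mean_value f df a b Hab Hc Hd) as [c [P E]].
  specialize (Hp c P). nra.
Qed.

Lemma constant_of_deriv (f : R -> R) (a b : R) : a <= b ->
  (forall x, a <= x <= b -> continuous f x) ->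
  (forall x, a < x < b -> is_derive f x 0) -> f a = f b.
Proof.
  intros [Hab| ->] Hc Hd; [|reflexivity].
  destruct (mean_value f (fun _ => 0) a b Hab Hc Hd) as [c [P E]]. lra.
Qed.

Lemma deriv_lipschitz (f df : R -> R) (L a b : R) : a <= b ->
  (forall x, a <= x <= b -> continuous f x) ->
  (forall x, a < x < b -> is_derive f x (df x)) ->
  (forall x, a < x < b -> Rabs (df x) <= L) -> Rabs (f b - f a) <= L * (b - a).
Proof.
  intros [Hab| ->] Hc Hd Hp.
  - destruct (mean_value f df a b Hab Hc Hd) as [c [P E]].
    rewrite E, Rabs_mult, (Rabs_right (b - a)) by lra.
    apply Rmult_le_compat_r; [lra|apply Hp, P].
  - rewrite Rminus_diag, Rabs_R0. lra.
Qed.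

(** The supremum of the points up to which [Q] holds satisfies [Q] by the first hypothesis and is
    passed by the second. At [s = a] the first hypothesis has an empty premise and serves as the
    base case. *)
Lemma real_induction (Q : R -> Prop) (a : R) :
  (forall s, a <= s -> (forall r, a <= r < s -> Q r) -> Q s) ->
  (forall s, a <= s -> Q s -> exists d, 0 < d /\ forall r, s <= r < s + d -> Q r) ->
  forall s, a <= s -> Q s.
Proof.
  intros H1 H2 s Hs. apply NNPP. intros Hn.
  set (E := fun r => a <= r /\ forall r', a <= r' < r -> Q r').
  assert (Hb : bound E).
  { exists s. intros r [Hr Hr']. apply Rnot_lt_le. intros Hlt. apply Hn, Hr'. lra. }
  assert (Hne : exists x, E x). { exists a. split; [lra|]. intros; lra. }
  destruct (completeness E Hb Hne) as [m [Hm1 Hm2]].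
  assert (Ham : a <= m). { apply Hm1. split; [lra|]. intros; lra. }
  assert (Hm : forall r, a <= r < m -> Q r).
  { intros r Hr. apply NNPP. intros Hq.
    assert (m <= r); [|lra]. apply Hm2. intros x [Hx Hx'].
    apply Rnot_lt_le. intros Hlt. apply Hq, Hx'. lra. }
  assert (Qm : Q m) by (apply H1; assumption).
  destruct (H2 m Ham Qm) as [d [Hd Hd']].
  assert (E (m + d)).
  { split; [lra|]. intros r Hr. destruct (Rlt_le_dec r m); [apply Hm|apply Hd']; lra. }
  specialize (Hm1 _ H). lra.
Qed.

Lemma exp_le_mono (x y : R) : x <= y -> exp x <= exp y.
Proof. intros [H| ->]; [left; now apply exp_increasing|right; reflexivity]. Qed.

(* [D exp(-L x)] is nonincreasing. *)
Lemma gronwall_zero (D dD : R -> R) (L a b : R) :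
  (forall x, a < x <= b -> is_derive D x (dD x)) ->
  (forall x, a < x <= b -> 0 <= D x) ->
  (forall x, a < x <= b -> dD x <= L * D x) ->
  (forall eps, 0 < eps -> exists d, 0 < d /\ forall x, a < x < a + d -> D x < eps) ->
  forall x, a < x <= b -> D x = 0.
Proof.
  intros Hd Hp HL H0 x Hx.
  destruct (Rle_lt_or_eq_dec 0 (D x) (Hp x Hx)) as [Hpos|]; [exfalso|now symmetry].
  (* If [D x] were positive, the weighted monotonicity would bound [D] below by [m] at every point
     between [a] and [x]. Nothing is assumed at [a] itself, which in the application is the point of
     the axis. *)
  set (m := D x * exp (- (Rabs L) * (b - a))).
  assert (Hm : 0 < m). { apply Rmult_lt_0_compat; [exact Hpos|apply exp_pos]. }
  destruct (H0 m Hm) as [d [Hd0 Hd1]].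
  set (y := a + Rmin d (x - a) / 2).
  assert (Hmin : 0 < Rmin d (x - a)) by (apply Rmin_glb_lt; lra).
  assert (Hy : a < y < x /\ y < a + d).
  { unfold y. pose proof (Rmin_l d (x - a)). pose proof (Rmin_r d (x - a)). lra. }
  assert (Hlt := Hd1 y ltac:(lra)).
  assert (- (D y * exp (- L * y)) <= - (D x * exp (- L * x))).
  { apply (nondecreasing_of_deriv (fun t => - (D t * exp (- L * t)))
       (fun t => - (dD t - L * D t) * exp (- L * t))); [lra| | |].
    - intros t Ht. apply (is_derive_continuous _ _ (- (dD t - L * D t) * exp (- L * t))).
      assert (HD := Hd t ltac:(lra)). auto_derive.
      + now exists (dD t).
      + replace (Derive (fun x0 : R => D x0) t) with (dD t); [ring|].
        symmetry. now apply is_derive_unique.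
    - intros t Ht.
      assert (HD := Hd t ltac:(lra)). auto_derive.
      + now exists (dD t).
      + replace (Derive (fun x0 : R => D x0) t) with (dD t); [ring|].
        symmetry. now apply is_derive_unique.
    - intros t Ht. pose proof (HL t ltac:(lra)). pose proof (exp_pos (- L * t)). nra. }
  assert (E : D x * exp (- L * x) <= D y * exp (- L * y)) by lra.
  assert (E2 : D x * exp (- L * (x - y)) <= D y).
  { replace (- L * (x - y)) with (- L * x + L * y) by ring. rewrite exp_plus.
    assert (F : exp (- L * y) * exp (L * y) = 1).
    { rewrite <- exp_plus. replace (- L * y + L * y) with 0 by ring. apply exp_0. }
    pose proof (exp_pos (L * y)).
    replace (D y) with (D y * exp (- L * y) * exp (L * y)) by (rewrite Rmult_assoc, F; ring).
    rewrite <- Rmult_assoc. apply Rmult_le_compat_r; lra. }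
  assert (E3 : exp (- (Rabs L) * (b - a)) <= exp (- L * (x - y))).
  { apply exp_le_mono. pose proof (Rle_abs L). pose proof (Rabs_pos L). nra. }
  unfold m in *. nra.
Qed.

(* Barbalat *)
Lemma derivative_vanishes_at_infinity (f g h : R -> R) (L S l : R) :
  (forall s, S <= s -> is_derive f s (g s)) ->
  (forall s, S <= s -> is_derive g s (h s)) ->
  (forall s, S <= s -> Rabs (h s) <= L) ->
  is_lim f p_infty l -> is_lim g p_infty 0.
Proof.
  intros Hf Hg HL Hl.
  assert (HL1 : exists L', 0 < L' /\ forall s, S <= s -> Rabs (h s) <= L').
  { exists (Rabs L + 1). split; [pose proof (Rabs_pos L); lra|].
    intros s Hs. pose proof (HL s Hs). pose proof (Rle_abs L). lra. }
  clear HL L. destruct HL1 as [L [HLp HL]].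
  apply is_lim_spec. intros eps. apply is_lim_spec in Hl.
  pose proof (cond_pos eps) as He. set (e := pos eps) in *.
  (* Over a length [d] the derivative [g] changes by at most [e / 2], so [|g s| >= e] forces [f] to
     vary by at least [e d / 2], whereas the tail of [f] only allows [2 e d / 5]. *)
  set (d := e / (2 * L)).
  assert (Hd : 0 < d) by (unfold d; apply Rdiv_lt_0_compat; lra).
  assert (Hed : 0 < e * d / 5). { assert (0 < e * d) by nra. lra. }
  destruct (Hl (mkposreal _ Hed)) as [M HM]. simpl in HM.
  exists (Rmax M S). intros s Hs.
  assert (HsM : M < s) by (eapply Rle_lt_trans; [apply Rmax_l|exact Hs]).
  assert (HsS : S < s) by (eapply Rle_lt_trans; [apply Rmax_r|exact Hs]).
  assert (H1 := HM s HsM). assert (H2 := HM (s + d) ltac:(lra)).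
  rewrite Rminus_0_r. apply Rnot_le_lt. intros Habs.
  destruct (mean_value f g s (s + d)) as [c [Hc E]]; [lra| | |].
  { intros x Hx. eapply is_derive_continuous, Hf. lra. }
  { intros x Hx. apply Hf. lra. }
  assert (H3 : Rabs (g c - g s) <= L * (c - s)).
  { apply (deriv_lipschitz g h); [lra| | |].
    - intros x Hx. eapply is_derive_continuous, Hg. lra.
    - intros x Hx. apply Hg. lra.
    - intros x Hx. apply HL. lra. }
  assert (H4 : L * (c - s) <= e / 2).
  { assert (L * d = e / 2) by (unfold d; field; lra). nra. }
  assert (H5 : e / 2 <= Rabs (g c)).
  { pose proof (Rabs_triang_inv (g s) (g c)). rewrite Rabs_minus_sym in H3. lra. }
  assert (H6 : Rabs (f (s + d) - f s) = Rabs (g c) * d).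
  { rewrite E, Rabs_mult. f_equal. replace (s + d - s) with d by ring.
    apply Rabs_right. lra. }
  assert (H7 : Rabs (f (s + d) - f s) < 2 * (e * d / 5)).
  { replace (f (s + d) - f s) with ((f (s + d) - l) - (f s - l)) by ring.
    eapply Rle_lt_trans; [apply Rabs_triang|]. rewrite Rabs_Ropp. lra. }
  nra.
Qed.

Lemma bounded_monotone_limit (f : R -> R) (S C : R) :
  (forall s r, S <= s <= r -> f s <= f r) ->
  (forall s, S <= s -> f s <= C) ->
  exists l : R, is_lim f p_infty l.
Proof.
  intros Hm Hb.
  set (E := fun y => exists s, S <= s /\ y = f s).
  destruct (completeness E) as [l [H1 H2]].
  - exists C. intros y [s [Hs ->]]. now apply Hb.
  - exists (f S), S. split; [lra|reflexivity].
  - exists l. apply is_lim_spec. intros eps. pose proof (cond_pos eps).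
    destruct (classic (exists s, S <= s /\ l - eps < f s)) as [[s [Hs Hfs]]|Hn].
    + exists s. intros r Hr. assert (f s <= f r) by (apply Hm; lra).
      assert (f r <= l) by (apply H1; exists r; split; [lra|reflexivity]).
      apply Rabs_def1; lra.
    + assert (l <= l - eps); [|lra]. apply H2. intros y [s [Hs ->]].
      apply Rnot_lt_le. intros Hlt. apply Hn. now exists s.
Qed.

Lemma ivt (f : R -> R) (a b y : R) : a <= b ->
  (forall x, a <= x <= b -> continuous f x) ->
  f a <= y <= f b \/ f b <= y <= f a -> exists c, a <= c <= b /\ f c = y.
Proof.
  intros Hab Hc Hy.
  assert (K : forall g : R -> R, (forall x, a <= x <= b -> continuous g x) ->
     g a <= 0 <= g b -> exists c, a <= c <= b /\ g c = 0).
  { intros g Hg [Ha Hb].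
    destruct Ha as [Ha|Ha]; [|exists a; lra].
    destruct Hb as [Hb|Hb]; [|exists b; lra].
    destruct Hab as [Hab| ->]; [|lra].
    destruct (Ranalysis5.IVT_interv g a b) as [c Hcc]; try lra.
    - intros x Hx. apply continuity_pt_continuous, Hg, Hx.
    - exists c. exact Hcc. }
  destruct Hy as [Hy|Hy].
  - destruct (K (fun x => f x - y)) as [c [H1 H2]].
    + intros x Hx. apply (continuous_minus f (fun _ => y)); [now apply Hc|apply continuous_const].
    + lra.
    + exists c. split; [exact H1|lra].
  - destruct (K (fun x => y - f x)) as [c [H1 H2]].
    + intros x Hx. apply (continuous_minus (fun _ => y) f); [apply continuous_const|now apply Hc].
    + lra.
    + exists c. split; [exact H1|lra].
Qed.

(** A change of sign would have to cross [0]. This is how the orientation of the normal is shown to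
    be locally constant. *)
Lemma sign_constant (f : R -> R) (a b : R) :
  (forall x, Rmin a b <= x <= Rmax a b -> continuous f x) ->
  (forall x, Rmin a b <= x <= Rmax a b -> f x = 1 \/ f x = -1) -> f a = f b.
Proof.
  assert (K : forall f : R -> R, forall a b, a <= b ->
    (forall x, a <= x <= b -> continuous f x) ->
    (forall x, a <= x <= b -> f x = 1 \/ f x = -1) -> f a = f b).
  { clear. intros f a b Hab Hc Hs.
    destruct (Hs a ltac:(lra)) as [Ha|Ha], (Hs b ltac:(lra)) as [Hb|Hb];
      rewrite Ha, Hb; try reflexivity; exfalso;
      (destruct (ivt f a b 0) as [c [H1 H2]]; [lra|exact Hc|lra|]);
      destruct (Hs c H1); lra. }
  intros Hc Hs. destruct (Rle_dec a b) as [H|H].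
  - rewrite Rmin_left, Rmax_right in * by lra. now apply K.
  - rewrite Rmin_right, Rmax_left in * by lra. symmetry. apply K; [lra|assumption|assumption].
Qed.

(** * Continuity and derivative rules for explicit real functions *)

Lemma cont_const (c s : R) : continuous (fun _ : R => c) s.
Proof. apply continuous_const. Qed.

Lemma cont_id (s : R) : continuous (fun s : R => s) s.
Proof. apply continuous_id. Qed.

Lemma cont_plus (f g : R -> R) (s : R) :
  continuous f s -> continuous g s -> continuous (fun s => f s + g s) s.
Proof. intros Hf Hg. exact (continuous_plus f g s Hf Hg). Qed.

Lemma cont_minus (f g : R -> R) (s : R) :
  continuous f s -> continuous g s -> continuous (fun s => f s - g s) s.
Proof. intros Hf Hg. exact (continuous_minus f g s Hf Hg). Qed.

Lemma cont_mult (f g : R -> R) (s : R) :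
  continuous f s -> continuous g s -> continuous (fun s => f s * g s) s.
Proof. intros Hf Hg. exact (continuous_mult f g s Hf Hg). Qed.

Lemma cont_comp (f g : R -> R) (s : R) :
  continuous f s -> continuous g (f s) -> continuous (fun s => g (f s)) s.
Proof. intros Hf Hg. exact (continuous_comp f g s Hf Hg). Qed.

Lemma cont_inv (f : R -> R) (s : R) :
  continuous f s -> f s <> 0 -> continuous (fun s => / f s) s.
Proof.
  intros Hf H0. apply continuous_continuity_pt.
  exact (continuity_pt_inv f s (continuity_pt_continuous _ _ Hf) H0).
Qed.

Lemma deriv_const (c s : R) : is_derive (fun _ : R => c) s 0.
Proof. exact (is_derive_const c s). Qed.

Lemma deriv_id (s : R) : is_derive (fun s : R => s) s 1.
Proof. exact (is_derive_id s). Qed.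

Lemma deriv_plus (f g : R -> R) (s a b : R) :
  is_derive f s a -> is_derive g s b -> is_derive (fun s => f s + g s) s (a + b).
Proof. intros Hf Hg. exact (is_derive_plus f g s a b Hf Hg). Qed.

Lemma deriv_minus (f g : R -> R) (s a b : R) :
  is_derive f s a -> is_derive g s b -> is_derive (fun s => f s - g s) s (a - b).
Proof. intros Hf Hg. exact (is_derive_minus f g s a b Hf Hg). Qed.

Lemma deriv_opp (f : R -> R) (s a : R) :
  is_derive f s a -> is_derive (fun s => - f s) s (- a).
Proof. intros Hf. exact (is_derive_opp f s a Hf). Qed.

Lemma deriv_mult (f g : R -> R) (s a b : R) :
  is_derive f s a -> is_derive g s b -> is_derive (fun s => f s * g s) s (a * g s + f s * b).
Proof. intros Hf Hg. apply (is_derive_mult f g s a b Hf Hg). intros; apply Rmult_comm. Qed.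

Lemma deriv_scal (c : R) (f : R -> R) (s a : R) :
  is_derive f s a -> is_derive (fun s => c * f s) s (c * a).
Proof. intros Hf. exact (is_derive_scal f s c a Hf). Qed.

Lemma deriv_div (f g : R -> R) (s a b : R) :
  is_derive f s a -> is_derive g s b -> g s <> 0 ->
  is_derive (fun s => f s / g s) s ((a * g s - f s * b) / (g s * g s)).
Proof.
  intros Hf Hg H0. eapply is_derive_eq; [exact (is_derive_div f g s a b Hf Hg H0)|].
  field. exact H0.
Qed.

Lemma deriv_comp (g f : R -> R) (s a b : R) :
  is_derive f s a -> is_derive g (f s) b -> is_derive (fun s => g (f s)) s (a * b).
Proof. intros Hf Hg. exact (is_derive_comp g f s b a Hg Hf). Qed.

Ltac continuity_arith :=
  lazymatch goal with
  | |- continuous (fun _ => ?c) _ => apply cont_const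
  | |- continuous (fun a => @?f a + @?g a) ?s => apply (cont_plus f g s); continuity_arith
  | |- continuous (fun a => @?f a - @?g a) ?s => apply (cont_minus f g s); continuity_arith
  | |- continuous (fun a => @?f a * @?g a) ?s => apply (cont_mult f g s); continuity_arith
  | |- continuous (fun a => @?f a / @?g a) ?s => apply (cont_mult f (fun a => / g a) s); continuity_arith
  | |- _ => assumption
  end.

(** * Volterra equations *)

Lemma is_derive_primitive (g : R -> R) (s : R) :
  (forall t, continuous g t) -> is_derive (fun s => RInt g 0 s) s (g s).
Proof.
  intros Hg. apply (is_derive_RInt g (fun s => RInt g 0 s) 0 s); [|apply Hg].
  exists (mkposreal 1 Rlt_0_1). intros t _. apply (@RInt_correct R_CompleteNormedModule).
  apply (@ex_RInt_continuous R_CompleteNormedModule). intros z _. apply Hg.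
Qed.

(** The weight [exp (2 L |s|)] absorbs the Lipschitz constant: integrating [L M exp (2 L |t|)] gives
    at most half of [M exp (2 L |s|)], which makes the Picard map a contraction of ratio [1/2] on
    intervals of any length. *)
Lemma exp_weighted_bound (f g : R -> R) (L M s : R) :
  0 < L -> 0 <= M -> f 0 = 0 ->
  (forall t, is_derive f t (g t)) ->
  (forall t, Rabs t <= Rabs s -> Rabs (g t) <= L * M * exp (2 * L * Rabs t)) ->
  Rabs (f s) <= M / 2 * exp (2 * L * Rabs s).
Proof.
  intros HL HM.
  assert (One : forall (f g : R -> R) s, 0 <= s -> f 0 = 0 ->
    (forall t, is_derive f t (g t)) ->
    (forall t, 0 <= t <= s -> g t <= L * M * exp (2 * L * t)) ->
    f s <= M / 2 * exp (2 * L * s)).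
  { clear f g s. intros f g s Hs H0 Hf Hg.
    assert (K : forall t, is_derive (fun t => M / 2 * exp (2 * L * t) - f t) t
                  (L * M * exp (2 * L * t) - g t)).
    { intros t. assert (H := Hf t). auto_derive; [now exists (g t)|].
      replace (Derive (fun x => f x) t) with (g t) by (symmetry; now apply is_derive_unique).
      field. }
    assert (H : M / 2 * exp (2 * L * 0) - f 0 <= M / 2 * exp (2 * L * s) - f s).
    { apply (nondecreasing_of_deriv (fun t => M / 2 * exp (2 * L * t) - f t)
         (fun t => L * M * exp (2 * L * t) - g t)); [exact Hs| | |].
      - intros x _. eapply is_derive_continuous, K.
      - intros x _. apply K.
      - intros x Hx. specialize (Hg x ltac:(lra)). lra. }
    rewrite H0 in H. pose proof (exp_pos (2 * L * 0)). nra. }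
  assert (Two : forall (f g : R -> R) s, 0 <= s -> f 0 = 0 ->
    (forall t, is_derive f t (g t)) ->
    (forall t, 0 <= t <= s -> Rabs (g t) <= L * M * exp (2 * L * t)) ->
    Rabs (f s) <= M / 2 * exp (2 * L * s)).
  { clear f g s. intros f g s Hs H0 Hf Hg. apply Rabs_le. split.
    - assert (- f s <= M / 2 * exp (2 * L * s)); [|lra].
      apply (One (fun t => - f t) (fun t => - g t)); [exact Hs|lra| |].
      + intros t. apply (is_derive_opp f t (g t)), Hf.
      + intros t Ht. specialize (Hg t Ht). pose proof (Rabs_maj2 (g t)). lra.
    - apply (One f g); [exact Hs|lra|exact Hf|].
      intros t Ht. specialize (Hg t Ht). pose proof (Rle_abs (g t)). lra. }
  intros H0 Hf Hg. destruct (Rle_dec 0 s) as [Hs|Hs].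
  - rewrite (Rabs_right s) by lra. apply (Two f g); try assumption.
    intros t Ht. specialize (Hg t). rewrite !Rabs_right in Hg by lra.
    apply Hg. lra.
  - rewrite (Rabs_left s) by lra.
    replace (f s) with (f (- - s)) by (f_equal; ring).
    apply (Two (fun t => f (- t)) (fun t => - g (- t))); [lra|now rewrite Ropp_0| |].
    + intros t. pose proof (Hf (- t)) as H. auto_derive; [now exists (g (- t))|].
      replace (Derive (fun x => f x) (- t)) with (g (- t)) by (symmetry; now apply is_derive_unique).
      ring.
    + intros t Ht. specialize (Hg (- t)). rewrite !Rabs_Ropp in Hg.
      rewrite Rabs_Ropp. rewrite (Rabs_left s), (Rabs_right t) in Hg by lra.
      apply Hg. lra.
Qed.

Lemma zero_of_geometric_bound (C x : R) :
  (forall n, Rabs x <= C * (/ 2) ^ n) -> x = 0.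
Proof.
  intros H. apply Rabs_eq_0. apply Rle_antisym; [|apply Rabs_pos].
  apply (is_lim_seq_le (fun _ => Rabs x) (fun n => C * (/ 2) ^ n) (Rabs x) 0).
  - exact H.
  - apply is_lim_seq_const.
  - replace (Finite 0) with (Rbar_mult C 0) by (simpl; f_equal; ring).
    apply is_lim_seq_scal_l, is_lim_seq_geom. rewrite Rabs_right; lra.
Qed.

Section Volterra.
Variable K : (R -> R) -> R -> R.
Let cont (f : R -> R) := forall s, continuous f s.
Hypothesis K_continuous : forall th, cont th -> cont (K th).
(** [K] is causal: [K th s] depends only on [th] on [[- |s|, |s|]]. Both signs of [s] are kept
    because the solution is needed as an odd function on the whole line, a property that [K_even]
    hands on from one iterate to the next. *)
Hypothesis K_lipschitz : forall T, 0 < T -> exists L, 0 < L /\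
  forall th ph, cont th -> cont ph -> forall s M, Rabs s <= T ->
    (forall r, Rabs r <= Rabs s -> Rabs (th r - ph r) <= M) ->
    Rabs (K th s - K ph s) <= L * M.
Hypothesis K_even : forall th, cont th -> (forall s, th (- s) = - th s) ->
  forall s, K th (- s) = K th s.

Fixpoint picard (n : nat) : R -> R :=
  match n with
  | O => fun _ => 0
  | S n => fun s => RInt (K (picard n)) 0 s
  end.

Lemma picard_continuous (n : nat) : cont (picard n).
Proof.
  induction n as [|n IH]; intros s.
  - apply continuous_const.
  - eapply is_derive_continuous. apply is_derive_primitive, K_continuous, IH.
Qed.

Lemma picard_derive (n : nat) (s : R) : is_derive (picard (S n)) s (K (picard n) s).
Proof. apply is_derive_primitive, K_continuous, picard_continuous. Qed.

Lemma picard_0 (n : nat) : picard n 0 = 0.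
Proof. destruct n; [reflexivity|]. apply (@RInt_point R_CompleteNormedModule). Qed.

Lemma picard_odd (n : nat) : forall s, picard n (- s) = - picard n s.
Proof.
  induction n as [|n IH]; intros s; [simpl; ring|].
  assert (E : picard (S n) (- s) + picard (S n) s = 0); [|lra].
  assert (Hd : forall t, is_derive (fun t => picard (S n) (- t) + picard (S n) t) t 0).
  { intros t. pose proof (picard_derive n t) as H1. pose proof (picard_derive n (- t)) as H2.
    rewrite (K_even _ (picard_continuous n) IH) in H2.
    set (P := picard (S n)) in *. set (k := K (picard n) t) in *. clearbody P k.
    auto_derive; [split; [now exists k|split; [now exists k|exact I]]|].
    replace (Derive (fun x => P x) (- t)) with k by (symmetry; now apply is_derive_unique).
    replace (Derive (fun x => P x) t) with k by (symmetry; now apply is_derive_unique).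
    ring. }
  assert (C : forall a b, a <= b -> picard (S n) (- a) + picard (S n) a =
                          picard (S n) (- b) + picard (S n) b).
  { intros a b Hab. apply (constant_of_deriv (fun t => picard (S n) (- t) + picard (S n) t)).
    - exact Hab.
    - intros x _. eapply is_derive_continuous, Hd.
    - intros x _. apply Hd. }
  assert (Z : picard (S n) (- 0) + picard (S n) 0 = 0).
  { rewrite Ropp_0, picard_0. ring. }
  destruct (Rle_dec 0 s) as [Hs|Hs].
  - rewrite <- (C 0 s Hs). exact Z.
  - rewrite (C s 0) by lra. exact Z.
Qed.

(** [C] bounds the first iterate on [[- T, T]]; from there each use of [exp_weighted_bound] halves
    the weighted distance between consecutive iterates. *)
Lemma picard_step (T L : R) : 0 < T -> 0 < L ->
  (forall th ph, cont th -> cont ph -> forall s M, Rabs s <= T ->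
    (forall r, Rabs r <= Rabs s -> Rabs (th r - ph r) <= M) ->
    Rabs (K th s - K ph s) <= L * M) ->
  exists C, 0 <= C /\ forall n s, Rabs s <= T ->
    Rabs (picard (S n) s - picard n s) <= C * (/ 2) ^ n * exp (2 * L * Rabs s).
Proof.
  intros HT HL HK.
  assert (HC : exists C, 0 <= C /\ forall s, Rabs s <= T -> Rabs (picard 1 s) <= C).
  { destruct (continuity_ab_maj (fun s => Rabs (picard 1 s)) (- T) T) as [m [Hm1 Hm2]].
    - lra.
    - intros c _. apply (continuity_pt_comp (picard 1) Rabs).
      + apply continuity_pt_continuous, picard_continuous.
      + apply Rcontinuity_abs.
    - exists (Rabs (picard 1 m)). split; [apply Rabs_pos|].
      intros s Hs. apply Hm1. apply Rabs_le_between in Hs. lra. }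
  destruct HC as [C [HC0 HC]]. exists C. split; [exact HC0|].
  induction n as [|n IH]; intros s Hs.
  - replace (picard 1 s - picard 0 s) with (picard 1 s) by (symmetry; apply Rminus_0_r).
    specialize (HC s Hs). simpl pow.
    assert (1 <= exp (2 * L * Rabs s)).
    { rewrite <- exp_0. apply exp_le_mono. pose proof (Rabs_pos s). nra. }
    nra.
  - replace (C * (/ 2) ^ S n) with (C * (/ 2) ^ n / 2) by (simpl; field).
    apply (exp_weighted_bound (fun s => picard (S (S n)) s - picard (S n) s)
             (fun s => K (picard (S n)) s - K (picard n) s)).
    + exact HL.
    + apply Rmult_le_pos; [exact HC0|apply pow_le; lra].
    + rewrite !picard_0. ring.
    + intros t. apply (is_derive_minus (picard (S (S n))) (picard (S n)));
        apply picard_derive.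
    + intros t Ht. rewrite Rmult_assoc. apply HK; try apply picard_continuous.
      * lra.
      * intros r Hr. eapply Rle_trans; [apply IH; lra|].
        apply Rmult_le_compat_l.
        -- apply Rmult_le_pos; [exact HC0|apply pow_le; lra].
        -- apply exp_le_mono. nra.
Qed.

Lemma picard_cauchy (T : R) : 0 < T -> exists C, 0 <= C /\
  forall n m s, Rabs s <= T -> Rabs (picard (n + m) s - picard n s) <= C * (/ 2) ^ n.
Proof.
  intros HT. destruct (K_lipschitz T HT) as [L [HL HK]].
  destruct (picard_step T L HT HL HK) as [C [HC H]].
  pose proof (exp_pos (2 * L * T)) as Hexp.
  exists (2 * C * exp (2 * L * T)). split; [nra|].
  intros n m s Hs.
  assert (E : forall k, Rabs (picard (S k) s - picard k s) <= C * exp (2 * L * T) * (/ 2) ^ k).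
  { intros k. eapply Rle_trans; [apply H, Hs|].
    assert (exp (2 * L * Rabs s) <= exp (2 * L * T)) by (apply exp_le_mono; nra).
    assert (0 <= C * (/ 2) ^ k) by (apply Rmult_le_pos; [exact HC|apply pow_le; lra]).
    nra. }
  set (B := C * exp (2 * L * T)) in *.
  assert (HB : 0 <= B) by (unfold B; nra).
  (* The partial geometric sum is kept exactly; a bound by [(/ 2) ^ n] alone would not pass through
     the induction on [m]. *)
  assert (G : Rabs (picard (n + m) s - picard n s) <= 2 * B * ((/ 2) ^ n - (/ 2) ^ (n + m))).
  { induction m as [|m IH].
    - rewrite Nat.add_0_r, !Rminus_diag, Rabs_R0. lra.
    - replace (n + S m)%nat with (S (n + m)) by lia.
      replace (picard (S (n + m)) s - picard n s) with
        ((picard (S (n + m)) s - picard (n + m) s) + (picard (n + m) s - picard n s)) by ring.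
      eapply Rle_trans; [apply Rabs_triang|].
      specialize (E (n + m)%nat). simpl pow. lra. }
  assert (0 <= (/ 2) ^ (n + m)) by (apply pow_le; lra).
  assert (2 * C * exp (2 * L * T) = 2 * B) by (unfold B; ring). nra.
Qed.

Theorem volterra_solution : exists th : R -> R,
  th 0 = 0 /\ (forall s, th (- s) = - th s) /\ forall s, is_derive th s (K th s).
Proof.
  set (th := fun s => real (Lim_seq (fun n => picard n s))).
  assert (Hlim : forall s, is_lim_seq (fun n => picard n s) (th s)).
  { intros s. apply Lim_seq_correct'. apply ex_lim_seq_cauchy_corr. intros eps.
    destruct (picard_cauchy (Rabs s + 1)) as [C [HC H]]; [pose proof (Rabs_pos s); lra|].
    assert (Hg : is_lim_seq (fun n => C * (/ 2) ^ n) 0).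
    { replace (Finite 0) with (Rbar_mult C 0) by (simpl; f_equal; ring).
      apply is_lim_seq_scal_l, is_lim_seq_geom. rewrite Rabs_right; lra. }
    apply is_lim_seq_spec in Hg.
    destruct (Hg (pos_div_2 eps)) as [N HN]. exists N. intros n m Hn Hm.
    assert (A : forall k, (N <= k)%nat -> Rabs (picard k s - picard N s) < eps / 2).
    { intros k Hk. replace k with (N + (k - N))%nat by lia.
      eapply Rle_lt_trans; [apply H; lra|].
      specialize (HN N (Nat.le_refl N)). simpl in HN.
      eapply Rle_lt_trans; [|exact HN]. rewrite Rminus_0_r. apply Rle_abs. }
    replace (picard n s - picard m s) with
      ((picard n s - picard N s) - (picard m s - picard N s)) by ring.
    eapply Rle_lt_trans; [apply Rabs_triang|]. rewrite Rabs_Ropp.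
    pose proof (A n Hn). pose proof (A m Hm). lra. }
  assert (Hunif : forall T, 0 < T -> exists C, 0 <= C /\ forall n s, Rabs s <= T ->
            Rabs (th s - picard n s) <= C * (/ 2) ^ n).
  { intros T HT. destruct (picard_cauchy T HT) as [C [HC H]]. exists C. split; [exact HC|].
    intros n s Hs.
    apply (is_lim_seq_le (fun m => Rabs (picard (m + n) s - picard n s))
             (fun _ => C * (/ 2) ^ n) (Rabs (th s - picard n s)) (C * (/ 2) ^ n)).
    - intros m. rewrite Nat.add_comm. now apply H.
    - apply (is_lim_seq_abs _ (th s - picard n s)). apply is_lim_seq_minus'.
      + apply (is_lim_seq_incr_n (fun m => picard m s)). apply Hlim.
      + apply is_lim_seq_const.
    - apply is_lim_seq_const. }
  assert (Hc : cont th).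
  { intros s. apply continuous_eps. intros eps He.
    destruct (Hunif (Rabs s + 1)) as [C [HC H]]; [pose proof (Rabs_pos s); lra|].
    assert (Hn : exists n, C * (/ 2) ^ n < eps / 3).
    { assert (Hg : is_lim_seq (fun n => C * (/ 2) ^ n) 0).
      { replace (Finite 0) with (Rbar_mult C 0) by (simpl; f_equal; ring).
        apply is_lim_seq_scal_l, is_lim_seq_geom. rewrite Rabs_right; lra. }
      apply is_lim_seq_spec in Hg. assert (He3 : 0 < eps / 3) by lra.
      destruct (Hg (mkposreal _ He3)) as [N HN]. exists N.
      specialize (HN N (Nat.le_refl N)). simpl in HN. rewrite Rminus_0_r in HN.
      eapply Rle_lt_trans; [apply Rle_abs|exact HN]. }
    destruct Hn as [n Hn].
    destruct (proj1 (continuous_eps (picard n) s) (picard_continuous n s) (eps / 3))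
      as [d [Hd1 Hd2]]; [lra|].
    exists (Rmin d 1). split; [apply Rmin_glb_lt; lra|]. intros y Hy.
    assert (Hy1 : Rabs (y - s) < d) by (eapply Rlt_le_trans; [exact Hy|apply Rmin_l]).
    assert (Hy2 : Rabs (y - s) < 1) by (eapply Rlt_le_trans; [exact Hy|apply Rmin_r]).
    assert (Hy3 : Rabs y <= Rabs s + 1).
    { replace y with (y - s + s) by ring. eapply Rle_trans; [apply Rabs_triang|lra]. }
    specialize (Hd2 y Hy1).
    pose proof (H n y Hy3). pose proof (H n s ltac:(lra)).
    replace (th y - th s) with
      ((th y - picard n y) + (picard n y - picard n s) - (th s - picard n s)) by ring.
    eapply Rle_lt_trans; [apply Rabs_triang|]. rewrite Rabs_Ropp.
    eapply Rle_lt_trans; [apply Rplus_le_compat_r, Rabs_triang|]. lra. }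
  (* Both sides are compared with [picard (S n)]: one error is [O((/ 2) ^ n)] by uniform
     convergence, the other by the Lipschitz bound on [K]. *)
  assert (Hfix : forall s, th s = RInt (K th) 0 s).
  { intros s. apply Rminus_diag_uniq.
    destruct (Hunif (Rabs s + 1)) as [C [HC H]]; [pose proof (Rabs_pos s); lra|].
    destruct (K_lipschitz (Rabs s + 1)) as [L [HL HK]]; [pose proof (Rabs_pos s); lra|].
    apply (zero_of_geometric_bound (C + L * C * Rabs s)). intros n.
    replace (th s - RInt (K th) 0 s) with
      ((th s - picard (S n) s) - (RInt (K th) 0 s - picard (S n) s)) by ring.
    eapply Rle_trans; [apply Rabs_triang|]. rewrite Rabs_Ropp.
    assert (H1 : Rabs (th s - picard (S n) s) <= C * (/ 2) ^ n).
    { eapply Rle_trans; [apply H; lra|]. simpl pow.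
      assert (0 <= C * (/ 2) ^ n) by (apply Rmult_le_pos; [exact HC|apply pow_le; lra]). nra. }
    assert (H2 : Rabs (RInt (K th) 0 s - picard (S n) s) <= L * (C * (/ 2) ^ n) * Rabs s).
    { assert (Hb : Rabs ((fun r => RInt (K th) 0 r - picard (S n) r) s -
                (fun r => RInt (K th) 0 r - picard (S n) r) 0)
              <= L * (C * (/ 2) ^ n) * Rabs (s - 0)).
      { apply (bounded_variation (fun r => RInt (K th) 0 r - picard (S n) r)
                 (fun r => K th r - K (picard n) r)).
        intros t Ht. rewrite !Rminus_0_r in Ht. split.
        - apply (is_derive_minus (fun r => RInt (K th) 0 r) (picard (S n))).
          + apply is_derive_primitive, K_continuous, Hc.
          + apply picard_derive.
        - apply HK; [exact Hc|apply picard_continuous|lra|]. intros r Hr. apply H. lra. }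
      cbv beta in Hb. rewrite picard_0 in Hb.
      replace (RInt (K th) 0 0) with 0 in Hb by (symmetry; apply (@RInt_point R_CompleteNormedModule)).
      rewrite !Rminus_0_r in Hb. exact Hb. }
    lra. }
  exists th. split; [|split].
  - rewrite Hfix. apply (@RInt_point R_CompleteNormedModule).
  - intros s. assert (E : Finite (th (- s)) = Finite (- th s)); [|now inversion E].
    rewrite <- (is_lim_seq_unique _ _ (Hlim (- s))).
    assert (H1 : is_lim_seq (fun n => - picard n s) (- th s)).
    { apply (is_lim_seq_opp _ (th s)), Hlim. }
    rewrite <- (is_lim_seq_unique _ _ H1). apply Lim_seq_ext. intros n. apply picard_odd.
  - intros s. apply (is_derive_ext (fun s => RInt (K th) 0 s)).
    + intros t. symmetry. apply Hfix.
    + apply is_derive_primitive, K_continuous, Hc.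
Qed.
End Volterra.

(** * Functions of the square of the parameter *)

(** [s^(k+1) * avg k f s] is the primitive of [r^k * f r] vanishing at [0]. Dividing by the power of
    [s] inside the integral makes the quotient regular at [s = 0]. *)
Definition avg (k : nat) (f : R -> R) (s : R) : R :=
  RInt (fun r => r ^ k * f (s * r)) 0 1.

Lemma continuous_pow_comp (k : nat) (f : R -> R) (s r : R) :
  (forall t, continuous f t) -> continuous (fun r => r ^ k * f (s * r)) r.
Proof.
  intros Hf. apply (continuous_mult (fun r => r ^ k) (fun r => f (s * r))).
  - apply (is_derive_continuous _ _ (INR k * 1 * r ^ pred k)).
    apply (is_derive_pow (fun r => r) k r 1). apply (is_derive_id (K := R_AbsRing)).
  - apply (continuous_comp (fun r => s * r) f); [|apply Hf].
    apply (is_derive_continuous _ _ s). auto_derive; [exact I|ring].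
Qed.

Lemma avg_ex (k : nat) (f : R -> R) (s : R) :
  (forall t, continuous f t) -> ex_RInt (fun r => r ^ k * f (s * r)) 0 1.
Proof.
  intros Hf. apply (@ex_RInt_continuous R_CompleteNormedModule).
  intros z _. now apply continuous_pow_comp.
Qed.

Lemma avg_lipschitz (k : nat) (f g : R -> R) (s M : R) :
  (forall t, continuous f t) -> (forall t, continuous g t) ->
  (forall r, Rabs r <= Rabs s -> Rabs (f r - g r) <= M) ->
  Rabs (avg k f s - avg k g s) <= M.
Proof.
  intros Hf Hg HM. unfold avg.
  rewrite <- (RInt_minus (V := R_CompleteNormedModule)
    (fun r => r ^ k * f (s * r)) (fun r => r ^ k * g (s * r))) by (now apply avg_ex).
  replace M with ((1 - 0) * M) by ring. apply abs_RInt_le_const; [lra| |].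
  - apply (ex_RInt_minus (V := R_NormedModule) (fun r => r ^ k * f (s * r)) (fun r => r ^ k * g (s * r)));
      now apply avg_ex.
  - intros r Hr. change (Rabs (r ^ k * f (s * r) - r ^ k * g (s * r)) <= M).
    replace (r ^ k * f (s * r) - r ^ k * g (s * r)) with (r ^ k * (f (s * r) - g (s * r))) by ring.
    rewrite Rabs_mult, (Rabs_right (r ^ k)) by (apply Rle_ge, pow_le; lra).
    assert (Hk : r ^ k <= 1).
    { rewrite <- (pow1 k). apply pow_incr. lra. }
    assert (0 <= r ^ k) by (apply pow_le; lra).
    assert (Rabs (f (s * r) - g (s * r)) <= M).
    { apply HM. rewrite Rabs_mult, (Rabs_right r) by lra. pose proof (Rabs_pos s). nra. }
    pose proof (Rabs_pos (f (s * r) - g (s * r))). nra.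
Qed.

Lemma avg_zero (k : nat) (s : R) : avg k (fun _ => 0) s = 0.
Proof.
  unfold avg. rewrite (RInt_ext _ (fun _ => 0)).
  - rewrite (RInt_const (V := R_CompleteNormedModule)). change ((1 - 0) * 0 = 0). ring.
  - intros x _. apply Rmult_0_r.
Qed.

Lemma avg_bound (k : nat) (f : R -> R) (s M : R) :
  (forall t, continuous f t) -> (forall r, Rabs r <= Rabs s -> Rabs (f r) <= M) ->
  Rabs (avg k f s) <= M.
Proof.
  intros Hf HM. rewrite <- (Rminus_0_r (avg k f s)), <- (avg_zero k s).
  apply avg_lipschitz; [exact Hf|intros; apply continuous_const|].
  intros r Hr. rewrite Rminus_0_r. now apply HM.
Qed.

Lemma avg_even (k : nat) (f : R -> R) (s : R) :
  (forall s, f (- s) = f s) -> avg k f (- s) = avg k f s.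
Proof.
  intros H. unfold avg. apply RInt_ext. intros r _. f_equal.
  rewrite <- H. f_equal. ring.
Qed.

Lemma avg_at_0 (k : nat) (f : R -> R) : avg k f 0 = f 0 / INR (S k).
Proof.
  unfold avg. rewrite (RInt_ext _ (fun r => f 0 * r ^ k)).
  2:{ intros x _. rewrite Rmult_0_l. apply Rmult_comm. }
  assert (H : is_RInt (fun r => f 0 * r ^ k) 0 1 (f 0 / INR (S k))).
  { replace (f 0 / INR (S k)) with
      (minus (f 0 / INR (S k) * 1 ^ S k) (f 0 / INR (S k) * 0 ^ S k)).
    - apply (is_RInt_derive (fun r => f 0 / INR (S k) * r ^ S k)).
      + intros x _. assert (INR (S k) <> 0) by (apply not_0_INR; lia).
        auto_derive; [exact I|]. change (pred (S k)) with k.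
        change (match k with 0%nat => 1 | S _ => INR k + 1 end) with (INR (S k)).
        field. assumption.
      + intros x _. apply continuous_continuity_pt. apply derivable_continuous_pt.
        apply derivable_pt_mult; [apply derivable_pt_const|apply derivable_pt_pow].
    - unfold minus, plus, opp; simpl. rewrite pow1. ring. }
  apply is_RInt_unique, H.
Qed.

Lemma avg_continuous (k : nat) (f : R -> R) (s : R) :
  (forall t, continuous f t) -> continuous (avg k f) s.
Proof.
  intros Hf. apply continuous_eps. intros eps He.
  assert (H2 : forall x, 0 <= x <= 1 -> continuity_2d_pt (fun x y => f (y * x)) x s).
  { intros x _. apply (continuity_1d_2d_pt_comp f (fun x y => y * x)).
    - apply continuity_pt_continuous, Hf.
    - apply continuity_2d_pt_mult; [apply continuity_2d_pt_id2|apply continuity_2d_pt_id1]. }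
  assert (He2 : 0 < eps / 2) by lra.
  destruct (uniform_continuity_2d_1d _ 0 1 s H2 (mkposreal _ He2)) as [d Hd].
  exists d. split; [apply cond_pos|]. intros y Hy. simpl in Hd.
  apply Rle_lt_trans with (eps / 2); [|lra].
  unfold avg.
  rewrite <- (RInt_minus (V := R_CompleteNormedModule)
    (fun r => r ^ k * f (y * r)) (fun r => r ^ k * f (s * r))) by (now apply avg_ex).
  replace (eps / 2) with ((1 - 0) * (eps / 2)) by ring.
  apply abs_RInt_le_const; [lra| |].
  - apply (ex_RInt_minus (V := R_NormedModule) (fun r => r ^ k * f (y * r)) (fun r => r ^ k * f (s * r)));
      now apply avg_ex.
  - intros r Hr. change (Rabs (r ^ k * f (y * r) - r ^ k * f (s * r)) <= eps / 2).
    replace (r ^ k * f (y * r) - r ^ k * f (s * r)) with (r ^ k * (f (y * r) - f (s * r))) by ring.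
    rewrite Rabs_mult, (Rabs_right (r ^ k)) by (apply Rle_ge, pow_le; lra).
    assert (Hk : r ^ k <= 1).
    { rewrite <- (pow1 k). apply pow_incr. lra. }
    assert (0 <= r ^ k) by (apply pow_le; lra).
    assert (Rabs (f (y * r) - f (s * r)) < eps / 2).
    { pose proof (cond_pos d). apply Rabs_def2 in Hy. apply (Hd r s r y); try lra.
      rewrite Rminus_diag, Rabs_R0. lra. }
    pose proof (Rabs_pos (f (y * r) - f (s * r))). nra.
Qed.

Lemma avg_primitive (k : nat) (f : R -> R) (s : R) :
  (forall t, continuous f t) ->
  is_derive (fun s => s ^ S k * avg k f s) s (s ^ k * f s).
Proof.
  intros Hf.
  apply (is_derive_ext (fun s => RInt (fun r => r ^ k * f r) 0 s)).
  - intros t. unfold avg.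
    rewrite <- (RInt_scal (V := R_CompleteNormedModule) _ 0 1 (t ^ S k)) by (now apply avg_ex).
    symmetry. etransitivity.
    + apply (RInt_ext _ (fun y => scal t ((fun r => r ^ k * f r) (t * y)))).
      intros x _. change (t ^ S k * (x ^ k * f (t * x)) = t * ((t * x) ^ k * f (t * x))).
      rewrite Rpow_mult_distr. simpl. ring.
    + rewrite (RInt_comp (V := R_CompleteNormedModule) (fun r => r ^ k * f r) (fun y => t * y) (fun _ => t)).
      * now rewrite Rmult_0_r, Rmult_1_r.
      * intros x _. pose proof (continuous_pow_comp k f 1 (t * x) Hf) as H.
        eapply continuous_ext; [|exact H]. intros y. simpl. now rewrite Rmult_1_l.
      * intros x _. split; [|apply continuous_const]. auto_derive; [exact I|ring].
  - apply (is_derive_primitive (fun r => r ^ k * f r)). intros t.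
    pose proof (continuous_pow_comp k f 1 t Hf) as H.
    eapply continuous_ext; [|exact H]. intros y. simpl. now rewrite Rmult_1_l.
Qed.

(** Under the integral the chain rule produces a factor [r] and the hypothesis on [f] another
    [s * r]: the weight goes up by two and a factor [s] comes out, so that averaging preserves
    smoothness in [s^2]. *)
Lemma avg_derive (k : nat) (f g : R -> R) (s : R) :
  (forall t, is_derive f t (t * g t)) -> (forall t, continuous g t) ->
  is_derive (avg k f) s (s * avg (S (S k)) g s).
Proof.
  intros Hf Hg.
  assert (Hd : forall r t, is_derive (fun u => r ^ k * f (u * r)) t (r ^ S (S k) * (t * g (t * r)))).
  { intros r t. pose proof (Hf (t * r)) as H. auto_derive.
    - now exists (t * r * g (t * r)).
    - replace (Derive (fun x => f x) (t * r)) with (t * r * g (t * r))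
        by (symmetry; now apply is_derive_unique).
      simpl. ring. }
  eapply is_derive_eq.
  - apply (is_derive_RInt_param (fun s r => r ^ k * f (s * r)) 0 1 s).
    + exists (mkposreal 1 Rlt_0_1). intros y _ t _. eexists. apply Hd.
    + intros t _. apply (continuity_2d_pt_ext (fun u v => v ^ S (S k) * (u * g (u * v)))).
      * intros x y. symmetry. apply is_derive_unique, Hd.
      * apply continuity_2d_pt_mult; [|apply continuity_2d_pt_mult; [apply continuity_2d_pt_id1|]].
        -- apply (continuity_1d_2d_pt_comp (fun v => v ^ S (S k)) (fun _ v => v)).
           ++ apply derivable_continuous_pt, derivable_pt_pow.
           ++ apply continuity_2d_pt_id2.
        -- apply (continuity_1d_2d_pt_comp g (fun u v => u * v)).
           ++ apply continuity_pt_continuous, Hg.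
           ++ apply continuity_2d_pt_mult; [apply continuity_2d_pt_id1|apply continuity_2d_pt_id2].
    + exists (mkposreal 1 Rlt_0_1). intros y _. apply avg_ex.
      intros t. eapply is_derive_continuous, Hf.
  - unfold avg at 1. rewrite <- (RInt_scal (V := R_CompleteNormedModule)) by (now apply avg_ex).
    apply RInt_ext. intros x _. etransitivity; [apply is_derive_unique, Hd|].
    change (x ^ S (S k) * (s * g (s * x)) = s * (x ^ S (S k) * g (s * x))). ring.
Qed.

(* Writing [f s = h (s ^ 2)], differentiability with respect to [s ^ 2], [m] times:
   [f' s = s * g s] amounts to [g s = 2 h' (s ^ 2)].  This is the notion that makes
   [f (sqrt (u ^ 2 + v ^ 2))] smooth in [(u, v)] at the origin. *)
Fixpoint radial (I : R -> Prop) (m : nat) (f : R -> R) : Prop :=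
  match m with
  | O => forall s, I s -> continuous f s
  | S m => exists g, radial I m g /\ forall s, I s -> is_derive f s (s * g s)
  end.

Section Radial.
Variable I : R -> Prop.

Lemma radial_continuous (m : nat) (f : R -> R) (s : R) :
  radial I m f -> I s -> continuous f s.
Proof.
  destruct m as [|m]; [intros H Hs; now apply H|].
  intros [g [_ H]] Hs. eapply is_derive_continuous. now apply H.
Qed.

Lemma radial_pred (m : nat) : forall f, radial I (S m) f -> radial I m f.
Proof.
  induction m as [|m IH]; intros f Hf.
  - intros s Hs. now apply (radial_continuous 1).
  - destruct Hf as [g [Hg Hd]]. exists g. split; [now apply IH|exact Hd].
Qed.

Lemma radial_const (m : nat) (c : R) : radial I m (fun _ => c).
Proof.
  revert c. induction m as [|m IH]; intros c.
  - intros s _. apply continuous_const.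
  - exists (fun _ => 0). split; [apply IH|]. intros s _. rewrite Rmult_0_r.
    apply (is_derive_const (K := R_AbsRing) c).
Qed.

Lemma radial_plus (m : nat) : forall f g, radial I m f -> radial I m g ->
  radial I m (fun s => f s + g s).
Proof.
  induction m as [|m IH]; intros f g Hf Hg.
  - intros s Hs. apply (continuous_plus f g); auto.
  - destruct Hf as [f' [Hf1 Hf2]], Hg as [g' [Hg1 Hg2]].
    exists (fun s => f' s + g' s). split; [now apply IH|]. intros s Hs.
    rewrite Rmult_plus_distr_l. apply (is_derive_plus f g); auto.
Qed.

Lemma is_derive_mul (f g : R -> R) (s a b : R) :
  is_derive f s a -> is_derive g s b -> is_derive (fun s => f s * g s) s (a * g s + f s * b).
Proof. intros Hf Hg. apply (is_derive_mult f g); try assumption. intros; apply Rmult_comm. Qed.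

Lemma radial_mult (m : nat) : forall f g, radial I m f -> radial I m g ->
  radial I m (fun s => f s * g s).
Proof.
  induction m as [|m IH]; intros f g Hf Hg.
  - intros s Hs. apply (continuous_mult f g); auto.
  - pose proof (radial_pred _ _ Hf) as Hf0. pose proof (radial_pred _ _ Hg) as Hg0.
    destruct Hf as [f' [Hf1 Hf2]], Hg as [g' [Hg1 Hg2]].
    exists (fun s => f' s * g s + f s * g' s). split.
    + apply radial_plus; now apply IH.
    + intros s Hs. eapply is_derive_eq; [apply is_derive_mul; auto|ring].
Qed.

Lemma radial_opp (m : nat) (f : R -> R) : radial I m f -> radial I m (fun s => - f s).
Proof.
  intros Hf. replace (fun s => - f s) with (fun s => -1 * f s)
    by (apply functional_extensionality; intros; ring).
  apply radial_mult; [apply radial_const|exact Hf].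
Qed.

Lemma radial_minus (m : nat) (f g : R -> R) : radial I m f -> radial I m g ->
  radial I m (fun s => f s - g s).
Proof. intros Hf Hg. apply radial_plus; [exact Hf|now apply radial_opp]. Qed.

Lemma radial_inv (m : nat) : forall f, (forall s, I s -> f s <> 0) ->
  radial I m f -> radial I m (fun s => / f s).
Proof.
  induction m as [|m IH]; intros f H0 Hf.
  - intros s Hs. apply continuous_continuity_pt. apply continuity_pt_inv.
    + apply continuity_pt_continuous, Hf, Hs.
    + now apply H0.
  - pose proof (radial_pred _ _ Hf) as Hf0. destruct Hf as [f' [Hf1 Hf2]].
    exists (fun s => - (f' s * (/ f s * / f s))). split.
    + apply radial_opp, radial_mult; [exact Hf1|]. apply radial_mult; now apply IH.
    + intros s Hs. eapply is_derive_eq; [apply is_derive_inv; [now apply Hf2|now apply H0]|].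
      field. now apply H0.
Qed.

Lemma radial_div (m : nat) (f g : R -> R) : (forall s, I s -> g s <> 0) ->
  radial I m f -> radial I m g -> radial I m (fun s => f s / g s).
Proof. intros H0 Hf Hg. apply radial_mult; [exact Hf|now apply radial_inv]. Qed.

Lemma radial_sqrt (m : nat) : forall f, (forall s, I s -> 0 < f s) ->
  radial I m f -> radial I m (fun s => sqrt (f s)).
Proof.
  induction m as [|m IH]; intros f H0 Hf.
  - intros s Hs. apply (continuous_comp f sqrt); [now apply Hf|].
    apply continuous_continuity_pt, continuity_pt_sqrt. left. now apply H0.
  - pose proof (radial_pred _ _ Hf) as Hf0. destruct Hf as [f' [Hf1 Hf2]].
    exists (fun s => f' s / (2 * sqrt (f s))). split.
    + apply radial_div.
      * intros s Hs. pose proof (sqrt_lt_R0 _ (H0 s Hs)). lra.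
      * exact Hf1.
      * apply radial_mult; [apply radial_const|now apply IH].
    + intros s Hs. pose proof (sqrt_lt_R0 _ (H0 s Hs)).
      eapply is_derive_eq; [apply (is_derive_sqrt f); [now apply Hf2|now apply H0]|].
      field. lra.
Qed.

Lemma radial_sqr (m : nat) : radial I m (fun s => s * s).
Proof.
  destruct m as [|m].
  - intros s _. apply (is_derive_continuous _ _ (2 * s)). auto_derive; [exact Logic.I|ring].
  - exists (fun _ => 2). split; [apply radial_const|]. intros s _. auto_derive; [exact Logic.I|ring].
Qed.

Lemma radial_ext (m : nat) (f g : R -> R) : (forall s, f s = g s) ->
  radial I m f -> radial I m g.
Proof. intros H Hf. replace g with f; [exact Hf|]. now apply functional_extensionality. Qed.
End Radial.

Definition everywhere (s : R) : Prop := True.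

Lemma radial_avg (m : nat) : forall k f,
  radial everywhere m f -> radial everywhere m (avg k f).
Proof.
  induction m as [|m IH]; intros k f Hf.
  - intros s _. apply avg_continuous. intros t. now apply Hf.
  - destruct Hf as [g [Hg Hd]]. exists (avg (S (S k)) g). split; [now apply IH|].
    intros s _. apply avg_derive; intros t; [now apply Hd|].
    now apply (radial_continuous everywhere m).
Qed.

(** * Existence of the profile *)

Definition W (tau x : R) : R := sqrt (1 + tau * tau * (x * x)).

Lemma W_arg_pos (tau x : R) : 0 < 1 + tau * tau * (x * x).
Proof. nra. Qed.

Lemma W_sqr (tau x : R) : W tau x * W tau x = 1 + tau * tau * (x * x).
Proof. apply sqrt_sqrt. left. apply W_arg_pos. Qed.

Lemma W_pos (tau x : R) : 0 < W tau x.
Proof. apply sqrt_lt_R0, W_arg_pos. Qed.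

Lemma W_ge_1 (tau x : R) : 1 <= W tau x.
Proof. pose proof (W_sqr tau x). pose proof (W_pos tau x). nra. Qed.

Lemma Winv_bounds (tau x : R) : 0 < / W tau x <= 1.
Proof.
  pose proof (W_ge_1 tau x). split; [apply Rinv_0_lt_compat; lra|].
  rewrite <- Rinv_1. apply Rinv_le_contravar; lra.
Qed.

Lemma W_derive (tau x : R) : is_derive (W tau) x (tau * tau * x / W tau x).
Proof.
  pose proof (W_pos tau x). pose proof (W_arg_pos tau x).
  unfold W in *. auto_derive; [assumption|]. field. lra.
Qed.

Lemma Winv_derive (tau x : R) :
  is_derive (fun x => / W tau x) x (- (tau * tau * x / (W tau x * W tau x * W tau x))).
Proof.
  pose proof (W_pos tau x). eapply is_derive_eq; [apply is_derive_inv; [apply W_derive|lra]|].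
  field. lra.
Qed.

Lemma W_incr (tau x y : R) : 0 <= x <= y -> W tau x <= W tau y.
Proof. intros H. apply sqrt_le_1_alt, Rplus_le_compat_l, Rmult_le_compat_l; nra. Qed.

Lemma cos_lipschitz (a b : R) : Rabs (cos a - cos b) <= Rabs (a - b).
Proof.
  rewrite <- (Rmult_1_l (Rabs (a - b))).
  apply (bounded_variation cos (fun t => - sin t)). intros t _. split.
  - apply is_derive_cos.
  - rewrite Rabs_Ropp. apply Rabs_le, SIN_bound.
Qed.

Lemma Winv_lipschitz (tau x y : R) :
  Rabs (/ W tau x - / W tau y) <= (1 + tau * tau) * Rabs (x - y).
Proof.
  apply (bounded_variation (fun x => / W tau x)
    (fun x => - (tau * tau * x / (W tau x * W tau x * W tau x)))).
  intros t _. split; [apply Winv_derive|].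
  pose proof (W_ge_1 tau t) as H1. pose proof (W_sqr tau t) as H2.
  rewrite Rabs_Ropp, Rabs_div by nra.
  rewrite (Rabs_right (W tau t * W tau t * W tau t)) by (apply Rle_ge; nra).
  assert (H3 : 0 < W tau t * W tau t * W tau t) by nra.
  apply Rle_div_l; [exact H3|].
  assert (H4 : Rabs (tau * tau * t) <= W tau t * W tau t * (1 + tau * tau)).
  { rewrite H2. apply Rabs_le. split; nra. }
  assert (0 <= 1 + tau * tau) by nra. nra.
Qed.

Lemma Rabs_prod_diff (a b a' b' B B' M M' : R) :
  Rabs b <= B -> Rabs a' <= B' -> Rabs (a - a') <= M -> Rabs (b - b') <= M' ->
  Rabs (a * b - a' * b') <= M * B + B' * M'.
Proof.
  intros H1 H2 H3 H4.
  replace (a * b - a' * b') with ((a - a') * b + a' * (b - b')) by ring.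
  eapply Rle_trans; [apply Rabs_triang|]. rewrite !Rabs_mult.
  pose proof (Rabs_pos b). pose proof (Rabs_pos a'). pose proof (Rabs_pos (a - a')).
  pose proof (Rabs_pos (b - b')).
  apply Rplus_le_compat; apply Rmult_le_compat; assumption.
Qed.

Lemma Rmax_lipschitz (a b m : R) : Rabs (Rmax a m - Rmax b m) <= Rabs (a - b).
Proof.
  unfold Rmax. destruct (Rle_dec a m), (Rle_dec b m); unfold Rabs;
    repeat match goal with |- context [Rcase_abs ?x] => destruct (Rcase_abs x) end; lra.
Qed.

Lemma continuous_Rmax (f g : R -> R) (s : R) :
  continuous f s -> continuous g s -> continuous (fun s => Rmax (f s) (g s)) s.
Proof.
  intros Hf Hg.
  apply (continuous_ext (fun s => (f s + g s + Rabs (f s - g s)) * / 2)).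
  - intros t. unfold Rmax. destruct (Rle_dec (f t) (g t)).
    + rewrite Rabs_left1 by lra. lra.
    + rewrite Rabs_right by lra. lra.
  - apply (cont_mult (fun s => f s + g s + Rabs (f s - g s)) (fun _ => / 2));
      [|apply continuous_const].
    apply (cont_plus (fun s => f s + g s) (fun s => Rabs (f s - g s))).
    + now apply (cont_plus f g).
    + apply (cont_comp (fun s => f s - g s) Rabs).
      * now apply (cont_minus f g).
      * apply continuous_Rabs.
Qed.

Lemma limit_ge (f : R -> R) (a s c : R) : a < s -> continuous f s ->
  (forall r, a <= r < s -> c <= f r) -> c <= f s.
Proof.
  intros Has Hf H. apply Rnot_lt_le. intros Hlt.
  destruct (proj1 (continuous_eps f s) Hf (c - f s)) as [d [Hd Hd']]; [lra|].
  set (r := s - Rmin (d / 2) (s - a)).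
  assert (0 < Rmin (d / 2) (s - a)) by (apply Rmin_glb_lt; lra).
  pose proof (Rmin_l (d / 2) (s - a)). pose proof (Rmin_r (d / 2) (s - a)).
  specialize (H r ltac:(unfold r; lra)).
  specialize (Hd' r). rewrite (Rabs_left (r - s)) in Hd' by (unfold r; lra).
  specialize (Hd' ltac:(unfold r; lra)). apply Rabs_def2 in Hd'. lra.
Qed.

Module ProfileExistence.
Section Profile.
Variables tau mu : R.

(* [x = s * A] is the distance to the axis, [sin th = x * q]; the quotient [q] is
   computed from the primitive [s ^ 2 * P] of [2 x cos th (mu + cos th / W)],
   with a cutoff [kap / (1 + s ^ 2)] which turns out to be inactive. *)
Definition s0 := / (2 * (1 + Rabs mu)).
(** The constants form a chain. Until [s0] one has [(1 + |mu|) x <= 1/2], which keeps [cos th] above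
    [1/2]; [j0] is what [J] has then gained at least; [x0] is the lower bound on [x] that [J >= j0]
    implies afterwards. [kap] is at most [1/8], below the [A^2 >= 1/4] valid before [s0], and less
    than [x0^2]; the decay of [cutoff] in [s] matches that of [A^2 = x^2 / s^2] for a merely bounded
    [x]. *)
Definition j0 := / W tau s0 * (s0 * s0) / 8.
Definition x0 := Rmin 1 (j0 / (1 + Rabs mu)).
Definition kap := x0 * x0 / 8.
Definition cutoff (s : R) := kap / (1 + s * s).
Definition Af (th : R -> R) := avg 0 (fun r => cos (th r)).
Definition Gf (th : R -> R) (r : R) :=
  Af th r * (cos (th r) * (mu + / W tau (r * Af th r) * cos (th r))).
Definition Pf (th : R -> R) (s : R) := 2 * avg 1 (Gf th) s.
Definition Kf (th : R -> R) (s : R) :=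
  2 * (cos (th s) * / W tau (s * Af th s) + mu)
  - Pf th s / Rmax (Af th s * Af th s) (cutoff s).

Lemma mu_pos : 0 < 1 + Rabs mu.
Proof. pose proof (Rabs_pos mu). lra. Qed.

Lemma s0_pos : 0 < s0.
Proof. apply Rinv_0_lt_compat. pose proof mu_pos. lra. Qed.

Lemma j0_pos : 0 < j0.
Proof.
  pose proof (Winv_bounds tau s0). pose proof s0_pos. unfold j0.
  apply Rdiv_lt_0_compat; [|lra]. apply Rmult_lt_0_compat; [lra|nra].
Qed.

Lemma x0_bounds : 0 < x0 <= 1.
Proof.
  split; [|apply Rmin_l]. apply Rmin_glb_lt; [lra|].
  apply Rdiv_lt_0_compat; [apply j0_pos|apply mu_pos].
Qed.

Lemma kap_bounds : 0 < kap <= / 8 /\ kap < x0 * x0.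
Proof. pose proof x0_bounds. unfold kap. split; [split|]; nra. Qed.

Lemma cutoff_pos (s : R) : 0 < cutoff s.
Proof. apply Rdiv_lt_0_compat; [apply kap_bounds|nra]. Qed.

Definition cont (f : R -> R) := forall s, continuous f s.

Lemma cos_cont (th : R -> R) : cont th -> cont (fun r => cos (th r)).
Proof. intros H s. apply (cont_comp th cos); [apply H|]. apply continuous_cos. Qed.

Lemma A_cont (th : R -> R) : cont th -> cont (Af th).
Proof. intros H s. exact (avg_continuous 0 _ s (cos_cont th H)). Qed.

Lemma w_cont (th : R -> R) : cont th -> cont (fun r => / W tau (r * Af th r)).
Proof.
  intros H s. apply (cont_comp (fun r => r * Af th r) (fun x => / W tau x)).
  - apply (cont_mult (fun r => r) (Af th)); [apply continuous_id|now apply A_cont].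
  - eapply is_derive_continuous, Winv_derive.
Qed.

Lemma G_cont (th : R -> R) : cont th -> cont (Gf th).
Proof.
  intros H s. apply (cont_mult (Af th) (fun r => cos (th r) * (mu + / W tau (r * Af th r) * cos (th r)))); [now apply A_cont|].
  apply (cont_mult (fun r => cos (th r)) (fun r => mu + / W tau (r * Af th r) * cos (th r))); [now apply cos_cont|].
  apply (cont_plus (fun _ => mu) (fun r => / W tau (r * Af th r) * cos (th r))); [apply continuous_const|].
  apply (cont_mult (fun r => / W tau (r * Af th r)) (fun r => cos (th r)));
    [now apply w_cont|now apply cos_cont].
Qed.

Lemma P_cont (th : R -> R) : cont th -> cont (Pf th).
Proof.
  intros H s. apply (cont_mult (fun _ => 2) (avg 1 (Gf th))); [apply continuous_const|].
  exact (avg_continuous 1 _ s (G_cont th H)).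
Qed.

Lemma max_pos (th : R -> R) (s : R) : 0 < Rmax (Af th s * Af th s) (cutoff s).
Proof. eapply Rlt_le_trans; [apply cutoff_pos|apply Rmax_r]. Qed.

Lemma K_cont (th : R -> R) : cont th -> cont (Kf th).
Proof.
  intros H s. apply (continuous_minus
    (fun s => 2 * (cos (th s) * / W tau (s * Af th s) + mu))
    (fun s => Pf th s / Rmax (Af th s * Af th s) (cutoff s))).
  - apply (cont_mult (fun _ => 2) (fun s => cos (th s) * / W tau (s * Af th s) + mu)); [apply continuous_const|].
    apply (cont_plus (fun s => cos (th s) * / W tau (s * Af th s)) (fun _ => mu));
      [|apply continuous_const].
    apply (cont_mult (fun r => cos (th r)) (fun r => / W tau (r * Af th r)));
      [now apply cos_cont|now apply w_cont].
  - apply (cont_mult (Pf th) (fun s => / Rmax (Af th s * Af th s) (cutoff s))); [now apply P_cont|].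
    apply continuous_continuity_pt, continuity_pt_inv.
    + apply continuity_pt_continuous. apply continuous_Rmax.
      * apply (cont_mult (Af th) (Af th)); now apply A_cont.
      * unfold cutoff. apply (is_derive_continuous _ _ (- kap * (2 * s) / ((1 + s * s) * (1 + s * s)))).
        assert (1 + s * s <> 0) by nra. auto_derive; [assumption|]. field. assumption.
    + pose proof (max_pos th s). lra.
Qed.

Lemma A_bound (th : R -> R) (s : R) : cont th -> Rabs (Af th s) <= 1.
Proof.
  intros H. apply (avg_bound 0 (fun r => cos (th r)) s 1 (cos_cont th H)).
  intros r _. apply Rabs_le, COS_bound.
Qed.

Lemma factor_bound (c w : R) : -1 <= c <= 1 -> 0 < w <= 1 -> Rabs (c * (mu + w * c)) <= 1 + Rabs mu.
Proof.
  intros Hc Hw. rewrite Rabs_mult.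
  assert (H1 : Rabs c <= 1) by (apply Rabs_le; lra).
  assert (H2 : Rabs (mu + w * c) <= 1 + Rabs mu).
  { eapply Rle_trans; [apply Rabs_triang|].
    assert (Rabs (w * c) <= 1) by (apply Rabs_le; nra). lra. }
  pose proof (Rabs_pos c). pose proof (Rabs_pos (mu + w * c)). nra.
Qed.

Lemma G_bound (th : R -> R) (s : R) : cont th -> Rabs (Gf th s) <= 1 + Rabs mu.
Proof.
  intros H. unfold Gf. rewrite Rabs_mult. pose proof (A_bound th s H).
  pose proof (factor_bound (cos (th s)) (/ W tau (s * Af th s)) (COS_bound _) (Winv_bounds _ _)).
  pose proof (Rabs_pos (Af th s)).
  pose proof (Rabs_pos (cos (th s) * (mu + / W tau (s * Af th s) * cos (th s)))). nra.
Qed.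

Lemma P_bound (th : R -> R) (s : R) : cont th -> Rabs (Pf th s) <= 2 * (1 + Rabs mu).
Proof.
  intros H. unfold Pf. rewrite Rabs_mult, (Rabs_right 2) by lra.
  apply Rmult_le_compat_l; [lra|]. apply (avg_bound 1 (Gf th) s _ (G_cont th H)).
  intros r _. now apply G_bound.
Qed.

Lemma K_lip (T : R) : 0 < T -> exists L, 0 < L /\
  forall th ph, cont th -> cont ph -> forall s M, Rabs s <= T ->
    (forall r, Rabs r <= Rabs s -> Rabs (th r - ph r) <= M) ->
    Rabs (Kf th s - Kf ph s) <= L * M.
Proof.
  intros HT. set (C := (1 + tau * tau) * T).
  assert (HC : 0 < C) by (unfold C; apply Rmult_lt_0_compat; [nra|exact HT]).
  set (B := 1 + Rabs mu). set (LG := 1 * B + 1 * (1 * B + 1 * (C + 1 * 1))).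
  (* The cutoff is at least [d0] on [[- T, T]], which bounds the reciprocals of both
     denominators. *)
  set (d0 := kap / (1 + T * T)).
  assert (Hd0 : 0 < d0) by (apply Rdiv_lt_0_compat; [apply kap_bounds|nra]).
  assert (HB : 0 < B) by exact mu_pos.
  assert (HLG : 0 < LG) by (unfold LG; lra).
  set (L := 2 * (1 + C) + (2 * LG / d0 + 2 * B * (2 / (d0 * d0)))).
  exists L. split.
  { unfold L. assert (0 < 2 * LG / d0) by (apply Rdiv_lt_0_compat; lra).
    assert (0 < 2 / (d0 * d0)) by (apply Rdiv_lt_0_compat; nra). nra. }
  intros th ph Hth Hph s M Hs HM.
  assert (HM0 : 0 <= M).
  { eapply Rle_trans; [apply Rabs_pos|apply (HM s); lra]. }
  assert (HE : forall r, Rabs r <= Rabs s -> Rabs (cos (th r) - cos (ph r)) <= M).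
  { intros r Hr. eapply Rle_trans; [apply cos_lipschitz|now apply HM]. }
  assert (HA : forall r, Rabs r <= Rabs s -> Rabs (Af th r - Af ph r) <= M).
  { intros r Hr. apply (avg_lipschitz 0 _ _ r M (cos_cont th Hth) (cos_cont ph Hph)).
    intros t Ht. apply HE. lra. }
  assert (Hw : forall r, Rabs r <= Rabs s ->
    Rabs (/ W tau (r * Af th r) - / W tau (r * Af ph r)) <= C * M).
  { intros r Hr. eapply Rle_trans; [apply Winv_lipschitz|]. unfold C. rewrite Rmult_assoc.
    apply Rmult_le_compat_l; [nra|].
    rewrite <- Rmult_minus_distr_l, Rabs_mult.
    apply Rmult_le_compat; try apply Rabs_pos; [lra|now apply HA]. }
  assert (HwE : forall r, Rabs r <= Rabs s ->
    Rabs (/ W tau (r * Af th r) * cos (th r) - / W tau (r * Af ph r) * cos (ph r)) <=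
    C * M * 1 + 1 * M).
  { intros r Hr. apply Rabs_prod_diff.
    - apply Rabs_le, COS_bound.
    - pose proof (Winv_bounds tau (r * Af ph r)). apply Rabs_le. lra.
    - now apply Hw.
    - now apply HE. }
  assert (HG : forall r, Rabs r <= Rabs s -> Rabs (Gf th r - Gf ph r) <= LG * M).
  { intros r Hr. unfold Gf.
    replace (LG * M) with (M * B + 1 * (M * B + 1 * (C * M * 1 + 1 * M))) by (unfold LG; ring).
    apply Rabs_prod_diff.
    - apply factor_bound; [apply COS_bound|apply Winv_bounds].
    - now apply A_bound.
    - now apply HA.
    - apply Rabs_prod_diff.
      + eapply Rle_trans; [apply Rabs_triang|]. unfold B.
        pose proof (Winv_bounds tau (r * Af th r)). pose proof (COS_bound (th r)).
        assert (Rabs (/ W tau (r * Af th r) * cos (th r)) <= 1) by (apply Rabs_le; nra). lra.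
      + apply Rabs_le, COS_bound.
      + now apply HE.
      + replace (mu + / W tau (r * Af th r) * cos (th r) - (mu + / W tau (r * Af ph r) * cos (ph r)))
          with (/ W tau (r * Af th r) * cos (th r) - / W tau (r * Af ph r) * cos (ph r)) by ring.
        now apply HwE. }
  assert (HP : Rabs (Pf th s - Pf ph s) <= 2 * (LG * M)).
  { unfold Pf. rewrite <- Rmult_minus_distr_l, Rabs_mult, (Rabs_right 2) by lra.
    apply Rmult_le_compat_l; [lra|]. exact (avg_lipschitz 1 _ _ s _ (G_cont th Hth) (G_cont ph Hph) HG). }
  set (d := Rmax (Af th s * Af th s) (cutoff s)).
  set (d' := Rmax (Af ph s * Af ph s) (cutoff s)).
  assert (Hcut : d0 <= cutoff s).
  { unfold d0, cutoff. apply Rmult_le_compat_l; [apply Rlt_le, kap_bounds|].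
    apply Rinv_le_contravar; [nra|]. apply Rabs_le_between in Hs. nra. }
  assert (Hd : d0 <= d) by (eapply Rle_trans; [exact Hcut|apply Rmax_r]).
  assert (Hd' : d0 <= d') by (eapply Rle_trans; [exact Hcut|apply Rmax_r]).
  assert (Hdd : Rabs (/ d - / d') <= 2 * M / (d0 * d0)).
  { replace (/ d - / d') with ((d' - d) / (d * d')) by (field; lra).
    assert (0 < d * d') by nra.
    rewrite Rabs_div, (Rabs_right (d * d')) by lra.
    assert (H1 : Rabs (d' - d) <= 2 * M).
    { eapply Rle_trans; [apply Rmax_lipschitz|].
      eapply Rle_trans; [apply (Rabs_prod_diff _ _ _ _ 1 1 M M)|lra].
      - now apply A_bound.
      - now apply A_bound.
      - rewrite Rabs_minus_sym. apply HA. lra.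
      - rewrite Rabs_minus_sym. apply HA. lra. }
    unfold Rdiv. apply Rmult_le_compat; [apply Rabs_pos| |exact H1|].
    - apply Rlt_le, Rinv_0_lt_compat. assumption.
    - apply Rinv_le_contravar; nra. }
  assert (Hq : Rabs (Pf th s / d - Pf ph s / d') <=
    2 * (LG * M) * / d0 + 2 * B * (2 * M / (d0 * d0))).
  { apply Rabs_prod_diff; [|now apply P_bound|exact HP|exact Hdd].
    rewrite Rabs_right; [apply Rinv_le_contravar; lra|].
    apply Rle_ge, Rlt_le, Rinv_0_lt_compat. lra. }
  assert (Hl : Rabs (2 * (cos (th s) * / W tau (s * Af th s) + mu) -
                     2 * (cos (ph s) * / W tau (s * Af ph s) + mu)) <= 2 * (1 + C) * M).
  { replace (2 * (cos (th s) * / W tau (s * Af th s) + mu) -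
             2 * (cos (ph s) * / W tau (s * Af ph s) + mu))
      with (2 * (/ W tau (s * Af th s) * cos (th s) - / W tau (s * Af ph s) * cos (ph s))) by ring.
    rewrite Rabs_mult, (Rabs_right 2) by lra.
    specialize (HwE s (Rle_refl _)). lra. }
  unfold Kf. fold d d'.
  match goal with |- Rabs (?a - ?b - (?c - ?e)) <= _ =>
    replace (a - b - (c - e)) with ((a - c) - (b - e)) by ring end.
  eapply Rle_trans; [apply Rabs_triang|]. rewrite Rabs_Ropp.
  replace (L * M) with (2 * (1 + C) * M + (2 * (LG * M) * / d0 + 2 * B * (2 * M / (d0 * d0))))
    by (unfold L; field; lra).
  now apply Rplus_le_compat.
Qed.

Lemma A_even (th : R -> R) : (forall s, th (- s) = - th s) -> forall s, Af th (- s) = Af th s.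
Proof. intros H s. apply (avg_even 0 (fun r => cos (th r))). intros r. now rewrite H, cos_neg. Qed.

Lemma W_even (x : R) : W tau (- x) = W tau x.
Proof. unfold W. f_equal. ring. Qed.

Lemma P_even (th : R -> R) : (forall s, th (- s) = - th s) -> forall s, Pf th (- s) = Pf th s.
Proof.
  intros H s. unfold Pf. f_equal. apply (avg_even 1 (Gf th)). intros r. unfold Gf.
  rewrite A_even, H, cos_neg, <- Ropp_mult_distr_l, W_even by exact H. reflexivity.
Qed.

Lemma K_evn (th : R -> R) : cont th -> (forall s, th (- s) = - th s) ->
  forall s, Kf th (- s) = Kf th s.
Proof.
  intros _ H s. unfold Kf, cutoff.
  rewrite A_even, P_even, H, cos_neg, <- Ropp_mult_distr_l, W_even by exact H.
  now rewrite Rmult_opp_opp.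
Qed.

Section Solution.
Variable th : R -> R.
Hypothesis th_0 : th 0 = 0.
Hypothesis th_odd : forall s, th (- s) = - th s.
Hypothesis th_derive : forall s, is_derive th s (Kf th s).

Definition A := Af th.
Definition E (s : R) := cos (th s).
Definition x (s : R) := s * A s.
(** The substitute for [x sin th]: for a true solution the terms in [sin th / x] cancel in
    [(x sin th)'], leaving the integrand [2 x cos th (mu + cos th / W)], and [N] is its
    primitive. *)
Definition N (s : R) := s * s * Pf th s.

Lemma th_cont : cont th.
Proof. intros s. eapply is_derive_continuous, th_derive. Qed.

Lemma A_0 : A 0 = 1.
Proof. unfold A, Af. rewrite avg_at_0, th_0, cos_0. simpl. field. Qed.

Lemma x_derive (s : R) : is_derive x s (E s).
Proof.
  pose proof (avg_primitive 0 (fun r => cos (th r)) s (cos_cont _ th_cont)) as H.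
  apply (is_derive_ext _ x) in H.
  - eapply is_derive_eq; [exact H|]. unfold E. simpl. ring.
  - intros t. unfold x, A, Af. simpl. ring.
Qed.

Lemma N_derive (s : R) : is_derive N s (2 * x s * (E s * (mu + / W tau (x s) * E s))).
Proof.
  pose proof (avg_primitive 1 (Gf th) s (G_cont _ th_cont)) as H.
  apply (is_derive_scal _ s 2) in H.
  apply (is_derive_ext _ N) in H.
  - eapply is_derive_eq; [exact H|]. unfold Gf, x, E, A. simpl. ring.
  - intros t. unfold N, Pf. simpl. ring.
Qed.

Lemma J_derive (s : R) :
  is_derive (fun s => N s - mu * (x s * x s)) s (2 * x s * / W tau (x s) * (E s * E s)).
Proof.
  eapply is_derive_eq.
  - apply (is_derive_minus N (fun s => mu * (x s * x s))); [apply N_derive|].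
    apply (is_derive_scal (fun s => x s * x s)). apply is_derive_mul; apply x_derive.
  - change (2 * x s * (E s * (mu + / W tau (x s) * E s)) - mu * (E s * x s + x s * E s) =
      2 * x s * / W tau (x s) * (E s * E s)). ring.
Qed.

Lemma x_cont (s : R) : continuous x s.
Proof. eapply is_derive_continuous, x_derive. Qed.

(** The three properties imply each other at later parameters and are therefore carried along the
    half-line together by [real_induction]. The second one says that the cutoff is inactive. *)
Definition good (s : R) := 0 < A s /\ cutoff s < A s * A s /\ (s <= s0 -> / 2 < E s).

Lemma E_cont (s : R) : continuous E s.
Proof. exact (cos_cont th th_cont s). Qed.

(** While the cutoff is inactive, [sin th] and [N / x] have the same derivative. The quotient is
    written [s P / A], which is continuous and vanishes at [0]. *)
Lemma sin_eq (s : R) : 0 <= s -> (forall r, 0 <= r < s -> good r) -> 0 < A s ->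
  sin (th s) = s * Pf th s / A s.
Proof.
  intros Hs Hg HA.
  assert (Hpos : forall r, 0 <= r <= s -> 0 < A r).
  { intros r Hr. destruct (Req_dec r s) as [->|]; [exact HA|]. apply Hg. lra. }
  assert (Hc : sin (th 0) - 0 * Pf th 0 / A 0 = sin (th s) - s * Pf th s / A s).
  { apply (constant_of_deriv (fun s => sin (th s) - s * Pf th s / A s)); [exact Hs| |].
    - intros r Hr. apply (cont_minus (fun s => sin (th s)) (fun s => s * Pf th s / A s)).
      + apply (cont_comp th sin); [apply th_cont|apply continuous_sin].
      + apply (cont_mult (fun s => s * Pf th s) (fun s => / A s)).
        * apply (cont_mult (fun s => s) (Pf th)); [apply continuous_id|exact (P_cont th th_cont r)].
        * apply continuous_continuity_pt, continuity_pt_inv.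
          -- apply continuity_pt_continuous. exact (A_cont th th_cont r).
          -- specialize (Hpos r Hr). unfold A in *. lra.
    - intros r Hr. assert (HAr : 0 < A r) by (apply Hpos; lra).
      assert (Hxr : 0 < x r) by (unfold x; apply Rmult_lt_0_compat; lra).
      apply (is_derive_ext_loc (fun s => sin (th s) - N s / x s)).
      + exists (mkposreal r (proj1 Hr)). intros y Hy.
        assert (Hy1 : Rabs (y - r) < r) by exact Hy. apply Rabs_def2 in Hy1.
        change (sin (th y) - N y / x y = sin (th y) - y * Pf th y / A y).
        destruct (Req_dec (A y) 0) as [HAy|HAy].
        * unfold N, x. rewrite HAy. unfold Rdiv. now rewrite Rmult_0_r, Rinv_0, !Rmult_0_r.
        * unfold N, x. field. split; [exact HAy|lra].
      + assert (HK : Kf th r = 2 * (E r * / W tau (x r) + mu) - N r / (x r * x r)).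
        { unfold Kf. rewrite Rmax_left by (apply Rlt_le, Hg; lra).
          fold A. fold (x r). fold (E r). f_equal. unfold N, x. field. lra. }
        eapply is_derive_eq.
        * apply (deriv_minus (fun s => sin (th s)) (fun s => N s / x s)).
          -- apply (deriv_comp sin th); [apply th_derive|apply is_derive_sin].
          -- apply (deriv_div N x); [apply N_derive|apply x_derive|lra].
        * rewrite HK. fold (E r). generalize (/ W tau (x r)). intros w. field. lra. }
  rewrite th_0, sin_0 in Hc. unfold Rdiv in *. rewrite !Rmult_0_l in Hc. lra.
Qed.

(** As long as [x] and [cos th] are nonnegative, [|N'| <= 2 (1 + |mu|) x cos th], and this is the
    derivative of [(1 + |mu|) x^2]. *)
Lemma N_bound (s : R) : 0 <= s -> (forall r, 0 < r < s -> 0 <= x r /\ 0 <= E r) ->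
  Rabs (N s) <= (1 + Rabs mu) * (x s * x s).
Proof.
  intros Hs H.
  assert (Hd : forall r, is_derive (fun r => (1 + Rabs mu) * (x r * x r)) r
                 ((1 + Rabs mu) * (2 * x r * E r))).
  { intros r. eapply is_derive_eq.
    - apply (is_derive_scal (fun s => x s * x s)). apply is_derive_mul; apply x_derive.
    - change ((1 + Rabs mu) * (E r * x r + x r * E r) = (1 + Rabs mu) * (2 * x r * E r)). ring. }
  assert (H0 : x 0 = 0 /\ N 0 = 0).
  { unfold x, N. split; ring. }
  destruct H0 as [H0 H0'].
  assert (Hw : forall r, - (1 + Rabs mu) <= mu + / W tau (x r) * E r <= 1 + Rabs mu).
  { intros r. pose proof (Winv_bounds tau (x r)). pose proof (COS_bound (th r)). unfold E in *.
    pose proof (Rle_abs mu). pose proof (Rabs_maj2 mu). split; nra. }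
  apply Rabs_le. split.
  - assert (N 0 + (1 + Rabs mu) * (x 0 * x 0) <= N s + (1 + Rabs mu) * (x s * x s)); [|rewrite H0, H0' in *; lra].
    apply (nondecreasing_of_deriv (fun r => N r + (1 + Rabs mu) * (x r * x r))
      (fun r => 2 * x r * (E r * (mu + / W tau (x r) * E r)) + (1 + Rabs mu) * (2 * x r * E r)));
      [exact Hs| | |].
    + intros r _. eapply is_derive_continuous.
      apply (is_derive_plus N (fun r => (1 + Rabs mu) * (x r * x r))); [apply N_derive|apply Hd].
    + intros r _. apply (is_derive_plus N (fun r => (1 + Rabs mu) * (x r * x r))); [apply N_derive|apply Hd].
    + intros r Hr. specialize (H r Hr). specialize (Hw r).
      replace (2 * x r * (E r * (mu + / W tau (x r) * E r)) + (1 + Rabs mu) * (2 * x r * E r))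
        with (2 * (x r * E r) * ((mu + / W tau (x r) * E r) + (1 + Rabs mu))) by ring.
      apply Rmult_le_pos; [|lra]. assert (0 <= x r * E r) by (apply Rmult_le_pos; lra). lra.
  - assert ((1 + Rabs mu) * (x 0 * x 0) - N 0 <= (1 + Rabs mu) * (x s * x s) - N s); [|rewrite H0, H0' in *; lra].
    apply (nondecreasing_of_deriv (fun r => (1 + Rabs mu) * (x r * x r) - N r)
      (fun r => (1 + Rabs mu) * (2 * x r * E r) - 2 * x r * (E r * (mu + / W tau (x r) * E r))));
      [exact Hs| | |].
    + intros r _. eapply is_derive_continuous.
      apply (is_derive_minus (fun r => (1 + Rabs mu) * (x r * x r)) N); [apply Hd|apply N_derive].
    + intros r _. apply (is_derive_minus (fun r => (1 + Rabs mu) * (x r * x r)) N); [apply Hd|apply N_derive].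
    + intros r Hr. specialize (H r Hr). specialize (Hw r).
      replace ((1 + Rabs mu) * (2 * x r * E r) - 2 * x r * (E r * (mu + / W tau (x r) * E r)))
        with (2 * (x r * E r) * ((1 + Rabs mu) - (mu + / W tau (x r) * E r))) by ring.
      apply Rmult_le_pos; [|lra]. assert (0 <= x r * E r) by (apply Rmult_le_pos; lra). lra.
Qed.

Lemma x_ge_half (s : R) : 0 <= s -> (forall r, 0 < r < s -> / 2 <= E r) -> s / 2 <= x s.
Proof.
  intros Hs H.
  assert (x 0 - 0 / 2 <= x s - s / 2); [|unfold x in *; lra].
  apply (nondecreasing_of_deriv (fun r => x r - r / 2) (fun r => E r - / 2)); [exact Hs| | |].
  - intros r _. apply (cont_minus x (fun r => r / 2)); [apply x_cont|].
    apply (is_derive_continuous _ _ (/ 2)). auto_derive; [exact I|field].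
  - intros r _. apply (is_derive_minus x (fun r => r / 2)); [apply x_derive|].
    auto_derive; [exact I|field].
  - intros r Hr. specialize (H r Hr). lra.
Qed.

Lemma x_le_s (s : R) : 0 <= s -> x s <= s.
Proof.
  intros Hs. assert (0 - x 0 <= s - x s); [|unfold x in *; lra].
  apply (nondecreasing_of_deriv (fun r => r - x r) (fun r => 1 - E r)); [exact Hs| | |].
  - intros r _. apply (cont_minus (fun r => r) x); [apply continuous_id|apply x_cont].
  - intros r _. apply (is_derive_minus (fun r => r) x); [apply (is_derive_id (K := R_AbsRing))|apply x_derive].
  - intros r _. pose proof (COS_bound (th r)). unfold E. lra.
Qed.

(** On [[0, s0]] the bounds [r / 2 <= x <= r] and [cos th > 1/2] give [J' >= r / (4 W)] with [W]
    taken at [s0]. *)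
Lemma J_lower : (forall r, 0 <= r <= s0 -> good r) -> j0 <= N s0 - mu * (x s0 * x s0).
Proof.
  intros Hg. pose proof s0_pos as Hs0.
  set (c := / W tau s0).
  assert (Hx : forall r, 0 <= r <= s0 -> r / 2 <= x r <= r).
  { intros r Hr. split; [|apply x_le_s; lra]. apply x_ge_half; [lra|].
    intros t Ht. left. apply Hg; lra. }
  assert ((N 0 - mu * (x 0 * x 0)) - c * (0 * 0) / 8 <= (N s0 - mu * (x s0 * x s0)) - c * (s0 * s0) / 8).
  { apply (nondecreasing_of_deriv (fun r => (N r - mu * (x r * x r)) - c * (r * r) / 8)
      (fun r => 2 * x r * / W tau (x r) * (E r * E r) - c * r / 4)); [lra| | |].
    - intros r _. apply (cont_minus (fun r => N r - mu * (x r * x r)) (fun r => c * (r * r) / 8)).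
      + eapply is_derive_continuous, J_derive.
      + apply (is_derive_continuous _ _ (c * r / 4)). auto_derive; [exact I|field].
    - intros r _. apply (is_derive_minus (fun r => N r - mu * (x r * x r)) (fun r => c * (r * r) / 8)).
      + apply J_derive.
      + auto_derive; [exact I|field].
    - intros r Hr. destruct (Hx r ltac:(lra)) as [H1 H2].
      assert (HE : / 2 < E r) by (apply Hg; lra).
      assert (Hc : c <= / W tau (x r)).
      { apply Rinv_le_contravar; [apply W_pos|]. apply W_incr. lra. }
      assert (0 < c) by apply Winv_bounds.
      assert (H3 : / 4 <= E r * E r) by nra.
      assert (H4 : r * c <= 2 * x r * / W tau (x r)).
      { assert (r * c <= (2 * x r) * c) by (apply Rmult_le_compat_r; lra).
        assert ((2 * x r) * c <= (2 * x r) * / W tau (x r)) by (apply Rmult_le_compat_l; lra). lra. }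
      assert (0 <= r * c) by (apply Rmult_le_pos; lra).
      assert (r * c * / 4 <= 2 * x r * / W tau (x r) * (E r * E r)) by (apply Rmult_le_compat; lra).
      lra. }
  assert (N 0 - mu * (x 0 * x 0) = 0) by (unfold N, x; ring).
  unfold j0. fold c. lra.
Qed.

Lemma E_0 : E 0 = 1.
Proof. unfold E. rewrite th_0. apply cos_0. Qed.

Lemma sin_cos_sqr (s : R) : sin (th s) * sin (th s) + E s * E s = 1.
Proof. pose proof (sin2_cos2 (th s)). unfold Rsqr in *. exact H. Qed.

(** From [|x sin th| = |N| <= (1 + |mu|) x^2] and [x <= s0] one gets [|sin th| <= 1/2]. The bound
    [cos th >= 1/2] inherited by continuity thus improves to [cos^2 th >= 3/4]. *)
Lemma good_near_axis (s : R) : 0 < s <= s0 -> (forall r, 0 <= r < s -> good r) -> good s.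
Proof.
  intros Hs Hg. pose proof mu_pos. pose proof kap_bounds as [Hk _].
  assert (Hx : s / 2 <= x s).
  { apply x_ge_half; [lra|]. intros r Hr. left. apply Hg; lra. }
  assert (HA : / 2 <= A s).
  { apply (Rmult_le_reg_l s); [lra|]. unfold x in Hx. lra. }
  assert (Hcut : cutoff s <= kap).
  { unfold cutoff. apply Rle_div_l; nra. }
  split; [lra|]. split; [nra|]. intros _.
  assert (HN : Rabs (N s) <= (1 + Rabs mu) * (x s * x s)).
  { apply N_bound; [lra|]. intros r Hr. split.
    - assert (0 < A r) by (apply Hg; lra). unfold x. apply Rmult_le_pos; lra.
    - assert (/ 2 < E r) by (apply Hg; lra). lra. }
  assert (Hsin := sin_eq s ltac:(lra) Hg ltac:(lra)).
  assert (Hsx : x s * sin (th s) = N s).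
  { rewrite Hsin. unfold x, N. field. lra. }
  assert (Hxs : 0 < x s <= s) by (split; [lra|apply x_le_s; lra]).
  assert (H1 : Rabs (sin (th s)) <= / 2).
  { apply (Rmult_le_reg_l (x s)); [lra|].
    rewrite <- (Rabs_right (x s)) at 1 by lra. rewrite <- Rabs_mult, Hsx.
    eapply Rle_trans; [exact HN|].
    assert ((1 + Rabs mu) * s0 = / 2) by (unfold s0; field; lra).
    assert ((1 + Rabs mu) * x s <= / 2) by nra. nra. }
  assert (H2 : / 2 <= E s).
  { apply (limit_ge E 0); [lra|apply E_cont|]. intros r Hr. left. apply Hg; lra. }
  pose proof (sin_cos_sqr s). apply Rabs_le_between in H1. nra.
Qed.

(** [J] is at least [j0] from [s0] on, so [j0 <= x sin th - mu x^2 <= (1 + |mu| x) x]. This keeps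
    [x] above [x0], hence [A^2 = x^2 / s^2] above the cutoff. *)
Lemma good_far (s : R) : s0 < s -> (forall r, 0 <= r < s -> good r) -> good s.
Proof.
  intros Hs Hg. pose proof s0_pos as Hs0. pose proof mu_pos as Hmu. pose proof j0_pos as Hj.
  assert (HA0 : 0 <= A s).
  { apply (limit_ge A 0); [lra|apply A_cont, th_cont|]. intros r Hr. left. now apply Hg. }
  assert (HJ : forall r, s0 <= r < s -> j0 <= (1 + Rabs mu * x r) * x r).
  { intros r Hr. assert (Hxr : 0 < x r).
    { unfold x. apply Rmult_lt_0_compat; [lra|apply Hg; lra]. }
    assert (HJr : N s0 - mu * (x s0 * x s0) <= N r - mu * (x r * x r)).
    { apply (nondecreasing_of_deriv (fun r => N r - mu * (x r * x r))
        (fun r => 2 * x r * / W tau (x r) * (E r * E r))); [lra| | |].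
      - intros t _. eapply is_derive_continuous, J_derive.
      - intros t _. apply J_derive.
      - intros t Ht. assert (0 < A t) by (apply Hg; lra).
        assert (0 < x t) by (unfold x; apply Rmult_lt_0_compat; lra).
        pose proof (Winv_bounds tau (x t)).
        apply Rmult_le_pos; [apply Rmult_le_pos; lra|nra]. }
    assert (HJ0 : j0 <= N s0 - mu * (x s0 * x s0)).
    { apply J_lower. intros t Ht. apply Hg. lra. }
    assert (Hsin := sin_eq r ltac:(lra) (fun t Ht => Hg t ltac:(lra)) ltac:(apply Hg; lra)).
    assert (Hsx : N r = x r * sin (th r)).
    { assert (0 < A r) by (apply Hg; lra). rewrite Hsin. unfold x, N. field. lra. }
    pose proof (SIN_bound (th r)). pose proof (Rabs_maj2 mu).
    rewrite Hsx in HJr.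
    assert (x r * sin (th r) <= x r * 1) by (apply Rmult_le_compat_l; lra).
    assert (- mu * (x r * x r) <= Rabs mu * (x r * x r)) by (apply Rmult_le_compat_r; nra).
    lra. }
  assert (HJs : j0 <= (1 + Rabs mu * x s) * x s).
  { apply (limit_ge (fun r => (1 + Rabs mu * x r) * x r) s0); [exact Hs| |exact HJ].
    apply (cont_mult (fun r => 1 + Rabs mu * x r) x); [|apply x_cont].
    apply (cont_plus (fun _ => 1) (fun r => Rabs mu * x r)); [apply continuous_const|].
    apply (cont_mult (fun _ => Rabs mu) x); [apply continuous_const|apply x_cont]. }
  assert (Hx0 : x0 <= x s).
  { destruct (Rle_dec 1 (x s)) as [H1|H1].
    - eapply Rle_trans; [apply Rmin_l|exact H1].
    - eapply Rle_trans; [apply Rmin_r|]. apply Rle_div_l; [exact Hmu|].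
      assert (0 <= x s) by (unfold x; apply Rmult_le_pos; lra).
      pose proof (Rabs_pos mu).
      assert (Rabs mu * x s <= Rabs mu * 1) by (apply Rmult_le_compat_l; lra). nra. }
  pose proof x0_bounds as Hb. pose proof kap_bounds as [Hk1 Hk2].
  assert (HA : 0 < A s).
  { destruct HA0 as [|HA0]; [assumption|]. exfalso. unfold x in Hx0. rewrite <- HA0 in Hx0. lra. }
  split; [exact HA|]. split; [|intros; lra].
  unfold cutoff. apply Rlt_div_l; [nra|].
  assert (H1 : x0 * x0 <= x s * x s) by nra.
  assert (H2 : x s * x s = A s * A s * (s * s)) by (unfold x; ring).
  assert (0 <= A s * A s) by nra. nra.
Qed.

Lemma good_all (s : R) : 0 <= s -> good s.
Proof.
  apply real_induction.
  - intros r Hr Hg. destruct (Req_dec r 0) as [->|Hr0].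
    + pose proof kap_bounds. pose proof A_0 as HA0. split; [rewrite HA0; lra|]. split.
      * rewrite HA0. unfold cutoff. apply Rlt_div_l; lra.
      * intros _. rewrite E_0. lra.
    + destruct (Rle_dec r s0); [apply good_near_axis|apply good_far]; try assumption; lra.
  - intros r Hr [H1 [H2 H3]].
    assert (HA : exists d, 0 < d /\ forall t, Rabs (t - r) < d -> 0 < A t).
    { destruct (proj1 (continuous_eps A r) (A_cont _ th_cont r) (A r) H1) as [d [Hd Hd']].
      exists d. split; [exact Hd|]. intros t Ht. specialize (Hd' t Ht). apply Rabs_def2 in Hd'. lra. }
    assert (HC : exists d, 0 < d /\ forall t, Rabs (t - r) < d -> cutoff t < A t * A t).
    { assert (Hc : continuous (fun t => A t * A t - cutoff t) r).
      { apply (cont_minus (fun t => A t * A t) cutoff).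
        - apply (cont_mult A A); apply A_cont, th_cont.
        - unfold cutoff. apply (is_derive_continuous _ _ (- kap * (2 * r) / ((1 + r * r) * (1 + r * r)))).
          assert (1 + r * r <> 0) by nra. auto_derive; [assumption|]. field. assumption. }
      destruct (proj1 (continuous_eps _ r) Hc (A r * A r - cutoff r)) as [d [Hd Hd']]; [lra|].
      exists d. split; [exact Hd|]. intros t Ht. specialize (Hd' t Ht). apply Rabs_def2 in Hd'. lra. }
    assert (HE : exists d, 0 < d /\ forall t, r <= t -> Rabs (t - r) < d -> t <= s0 -> / 2 < E t).
    { destruct (Rle_dec r s0) as [Hrs|Hrs].
      - specialize (H3 Hrs).
        destruct (proj1 (continuous_eps E r) (E_cont r) (E r - / 2)) as [d [Hd Hd']]; [lra|].
        exists d. split; [exact Hd|]. intros t _ Ht _. specialize (Hd' t Ht).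
        apply Rabs_def2 in Hd'. lra.
      - exists 1. split; [lra|]. intros. lra. }
    destruct HA as [d1 [Hd1 HA]], HC as [d2 [Hd2 HC]], HE as [d3 [Hd3 HE]].
    exists (Rmin d1 (Rmin d2 d3)). split; [repeat apply Rmin_glb_lt; assumption|].
    intros t Ht. pose proof (Rmin_l d1 (Rmin d2 d3)). pose proof (Rmin_r d1 (Rmin d2 d3)).
    pose proof (Rmin_l d2 d3). pose proof (Rmin_r d2 d3).
    assert (Htr : Rabs (t - r) < Rmin d1 (Rmin d2 d3)) by (rewrite Rabs_right; lra).
    split; [apply HA; lra|]. split; [apply HC; lra|]. intros Hts. apply HE; lra.
Qed.

Lemma A_pos (s : R) : 0 < A s.
Proof.
  destruct (Rle_dec 0 s); [now apply good_all|].
  rewrite <- (Ropp_involutive s). unfold A. rewrite A_even by exact th_odd.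
  apply good_all. lra.
Qed.

Definition q (s : R) := Pf th s / (A s * A s).

Lemma th_equation (s : R) : is_derive th s (2 * (E s * / W tau (x s) + mu) - q s).
Proof.
  eapply is_derive_eq; [apply th_derive|]. unfold Kf, q. rewrite Rmax_left; [reflexivity|].
  destruct (Rle_dec 0 s); [left; now apply good_all|].
  rewrite <- (Ropp_involutive s).
  replace (cutoff (- - s)) with (cutoff (- s)) by (unfold cutoff; now rewrite !Rmult_opp_opp).
  rewrite (A_even th th_odd (- s)). left. apply good_all. lra.
Qed.

Lemma q_even (s : R) : q (- s) = q s.
Proof. unfold q, A. now rewrite P_even, A_even by exact th_odd. Qed.

Lemma sin_equation (s : R) : sin (th s) = x s * q s.
Proof.
  assert (H : forall s, 0 <= s -> sin (th s) = x s * q s).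
  { intros r Hr. rewrite sin_eq; [|exact Hr|intros; apply good_all; lra|apply A_pos].
    unfold x, q. pose proof (A_pos r). field. lra. }
  destruct (Rle_dec 0 s) as [Hs|Hs]; [now apply H|].
  specialize (H (- s) ltac:(lra)). rewrite th_odd, sin_neg, q_even in H.
  assert (Hx : x (- s) = - x s).
  { unfold x, A. rewrite A_even by exact th_odd. ring. }
  rewrite Hx in H. lra.
Qed.

(** A bootstrap: [A], [W] and [q] are as smooth as [cos th], being averages and algebraic functions
    of it. Conversely [sin th = s A q] turns [(cos th)' = - sin th * th'] into [s] times an
    expression in these functions, which gains one order for [cos th]. *)
Lemma radial_all (m : nat) : radial everywhere m E /\ radial everywhere m A /\
  radial everywhere m (fun s => W tau (x s)) /\ radial everywhere m q.
Proof.
  assert (K : forall m, radial everywhere m E -> radial everywhere m E /\ radial everywhere m A /\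
    radial everywhere m (fun s => W tau (x s)) /\ radial everywhere m q).
  { clear m. intros m HE.
    assert (HA : radial everywhere m A) by exact (radial_avg m 0 E HE).
    assert (HW : radial everywhere m (fun s => W tau (x s))).
    { apply radial_sqrt.
      - intros s _. apply W_arg_pos.
      - apply radial_plus; [apply radial_const|]. apply radial_mult; [apply radial_const|].
        apply (radial_ext _ _ (fun s => s * s * (A s * A s))).
        + intros s. unfold x. ring.
        + apply radial_mult; [apply radial_sqr|now apply radial_mult]. }
    assert (Hw : radial everywhere m (fun s => / W tau (x s))).
    { apply radial_inv; [|exact HW]. intros s _. pose proof (W_pos tau (x s)). lra. }
    repeat split; try assumption. unfold q. apply radial_div.
    - intros s _. pose proof (A_pos s). nra.
    - unfold Pf. apply radial_mult; [apply radial_const|]. apply (radial_avg m 1 (Gf th)).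
      unfold Gf. apply radial_mult; [exact HA|]. apply radial_mult; [exact HE|].
      apply radial_plus; [apply radial_const|]. now apply radial_mult.
    - now apply radial_mult. }
  induction m as [|m IH].
  - apply K. intros s _. apply E_cont.
  - apply K. destruct IH as [HE [HA [HW Hq]]].
    exists (fun s => - (A s * q s * (2 * (E s * / W tau (x s) + mu) - q s))). split.
    + apply radial_opp, radial_mult; [now apply radial_mult|].
      apply radial_minus; [|exact Hq]. apply radial_mult; [apply radial_const|].
      apply radial_plus; [|apply radial_const]. apply radial_mult; [exact HE|].
      apply radial_inv; [|exact HW]. intros s _. pose proof (W_pos tau (x s)). lra.
    + intros s _. eapply is_derive_eq.
      * apply (is_derive_comp cos th); [apply is_derive_cos|apply th_equation].
      * change ((2 * (E s * / W tau (x s) + mu) - q s) * - sin (th s) =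
          s * - (A s * q s * (2 * (E s * / W tau (x s) + mu) - q s))).
        rewrite sin_equation. unfold x. ring.
Qed.
End Solution.
End Profile.
End ProfileExistence.

(* The profile curve [(x, z)] of slope angle [th] in the metric
   [dx^2 + dz^2 / W^2] of the orbit space, parametrized by arc length from the axis. *)
Record profile (tau mu : R) (A q th z : R -> R) : Prop := {
  pr_A_pos : forall s, 0 < A s;
  pr_A_0 : A 0 = 1;
  pr_A_even : forall s, A (- s) = A s;
  pr_th_0 : th 0 = 0;
  pr_sin : forall s, sin (th s) = s * A s * q s;
  pr_x : forall s, is_derive (fun s => s * A s) s (cos (th s));
  pr_th : forall s, is_derive th s (2 * (cos (th s) * / W tau (s * A s) + mu) - q s);
  pr_z : forall s, is_derive z s (sin (th s) * W tau (s * A s));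
  pr_z_0 : z 0 = 0;
  pr_radial_A : forall m, radial everywhere m A;
  pr_radial_q : forall m, radial everywhere m q;
  pr_radial_cos : forall m, radial everywhere m (fun s => cos (th s));
  pr_radial_W : forall m, radial everywhere m (fun s => W tau (s * A s));
  pr_radial_z : forall m, radial everywhere m z
}.

Theorem profile_exists (tau mu : R) : exists A q th z, profile tau mu A q th z.
Proof.
  destruct (volterra_solution (ProfileExistence.Kf tau mu)) as [th [H0 [Hodd Hd]]].
  - apply ProfileExistence.K_cont.
  - apply ProfileExistence.K_lip.
  - apply ProfileExistence.K_evn.
  - set (A := ProfileExistence.A th).
    set (q := ProfileExistence.q tau mu th).
    assert (Hr := ProfileExistence.radial_all tau mu th H0 Hodd Hd).
    assert (Hs := ProfileExistence.sin_equation tau mu th H0 Hodd Hd).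
    assert (Hz : forall s, is_derive (fun s => RInt (fun r => sin (th r) * W tau (r * A r)) 0 s) s
                   (sin (th s) * W tau (s * A s))).
    { intros s. apply (is_derive_primitive (fun r => sin (th r) * W tau (r * A r))). intros t.
      apply (cont_mult (fun r => sin (th r)) (fun r => W tau (r * A r))).
      - apply (cont_comp th sin); [eapply is_derive_continuous, Hd|apply continuous_sin].
      - destruct (Hr O) as [_ [_ [H _]]]. now apply H. }
    exists A, q, th, (fun s => RInt (fun r => sin (th r) * W tau (r * A r)) 0 s).
    constructor.
    + intros s. now apply (ProfileExistence.A_pos tau mu).
    + now apply (ProfileExistence.A_0 th).
    + now apply ProfileExistence.A_even.
    + exact H0.
    + exact Hs.
    + intros s. now apply (ProfileExistence.x_derive tau mu).
    + intros s. now apply (ProfileExistence.th_equation tau mu).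
    + exact Hz.
    + apply (@RInt_point R_CompleteNormedModule).
    + intros m. apply Hr.
    + intros m. apply Hr.
    + intros m. apply Hr.
    + intros m. apply Hr.
    + intros m. destruct m as [|m].
      * intros s _. eapply is_derive_continuous, Hz.
      * exists (fun s => A s * q s * W tau (s * A s)). split.
        -- apply radial_mult; [apply radial_mult|]; apply Hr.
        -- intros s _. eapply is_derive_eq; [apply Hz|]. rewrite Hs. unfold ProfileExistence.x. fold A q. ring.
Qed.

(** * Curvature of rotational surfaces *)

(** Components of the contact form [dz + tau (y dx - x dy)]; [dform] lists their partial
    derivatives. As [dx^2 + dy^2] has constant coefficients, the derivatives of the metric come from
    the square of this form alone. *)
Definition form (tau : R) (p : pt) (i : axis) : R :=
  match i with ax => tau * cy p | ay => - tau * cx p | az => 1 end.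

Definition dform (tau : R) (a i : axis) : R :=
  match a, i with ay, ax => tau | ax, ay => - tau | _, _ => 0 end.

Lemma dmetric_formula (tau : R) (p : pt) (a i j : axis) :
  dmetric tau p a i j = dform tau a i * form tau p j + form tau p i * dform tau a j.
Proof.
  destruct p as [[x y] w]. apply is_derive_unique.
  destruct a, i, j; unfold inner, contact, shift, basis, form, dform, cx, cy, cz; simpl;
    (auto_derive; [exact I|ring]).
Qed.

(** Half of the exterior derivative of the contact form, evaluated on [(V, n)]. *)
Definition twist (tau : R) (V n : pt) : R := tau * (cy V * cx n - cx V * cy n).

(** [dform] is antisymmetric, so in the Christoffel sum the terms carrying the contact component of
    [n] cancel, and those left assemble into exterior derivatives of the contact form. *)
Lemma nabla_inner_formula (tau : R) (p V X VX n : pt) :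
  nabla_inner tau p V X VX n =
  inner tau p VX n + contact tau p X * twist tau V n + contact tau p V * twist tau X n.
Proof.
  unfold nabla_inner, christoffel, sum3. rewrite !dmetric_formula.
  destruct p as [[x y] w], V as [[v1 v2] v3], X as [[x1 x2] x3], n as [[n1 n2] n3].
  unfold form, dform, contact, twist, coord, cx, cy, cz; simpl. field.
Qed.

(** The vector with radial, angular and vertical components [a], [b], [d] at the rotation angle of
    cosine [c] and sine [s]. In these components all inner products lose their dependence on the
    angle. *)
Definition frame (c s a b d : R) : pt := (a * c - b * s, a * s + b * c, d).

Lemma inner_frame (tau x c s z a b d a' b' d' : R) : c * c + s * s = 1 ->
  inner tau (x * c, x * s, z) (frame c s a b d) (frame c s a' b' d') =
  a * a' + b * b' + (d - tau * x * b) * (d' - tau * x * b').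
Proof.
  intros H. unfold inner, contact, frame, cx, cy, cz; simpl.
  assert (H1 : forall a b d, d + tau * (x * s * (a * c - b * s) - x * c * (a * s + b * c)) =
            d - tau * x * b).
  { intros a0 b0 d0. transitivity (d0 - tau * x * b0 * (c * c + s * s)); [ring|rewrite H; ring]. }
  rewrite !H1. f_equal.
  transitivity ((a * a' + b * b') * (c * c + s * s)); [ring|rewrite H; ring].
Qed.

Lemma contact_frame (tau x c s z a b d : R) : c * c + s * s = 1 ->
  contact tau (x * c, x * s, z) (frame c s a b d) = d - tau * x * b.
Proof.
  intros H. unfold contact, frame, cx, cy, cz; simpl.
  transitivity (d - tau * x * b * (c * c + s * s)); [ring|rewrite H; ring].
Qed.

Lemma twist_frame (tau c s a b d a' b' d' : R) : c * c + s * s = 1 ->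
  twist tau (frame c s a b d) (frame c s a' b' d') = tau * (b * a' - a * b').
Proof.
  intros H. unfold twist, frame, cx, cy, cz; simpl.
  transitivity (tau * (b * a' - a * b') * (c * c + s * s)); [ring|rewrite H; ring].
Qed.

(* [C], [Sn] are the cosine and sine of the slope angle of the profile at distance [x]
   from the axis, [c], [s] those of the rotation angle; [e = 1] or [e = -1] is the
   orientation. *)
Definition unit_normal (tau e x C Sn c s : R) : pt :=
  frame c s (- e * Sn) (e * tau * x * C / W tau x) (e * W tau x * C).

(** The angular component of the normal is the one that makes [b] disappear here: the normal is
    orthogonal to the orbits of the rotations. *)
Lemma inner_unit_normal (tau e x C Sn c s z a b d : R) : c * c + s * s = 1 ->
  inner tau (x * c, x * s, z) (frame c s a b d) (unit_normal tau e x C Sn c s) =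
  e * (d * C / W tau x - a * Sn).
Proof.
  intros Hcs. unfold unit_normal. rewrite inner_frame by exact Hcs.
  pose proof (W_pos tau x) as Hw. pose proof (W_sqr tau x) as HW.
  assert (E : e * W tau x * C - tau * x * (e * tau * x * C / W tau x) = e * C / W tau x).
  { transitivity (e * C / W tau x * (W tau x * W tau x - tau * tau * (x * x))); [field; lra|].
    rewrite HW. ring. }
  rewrite E. field. lra.
Qed.

Lemma unit_normal_unit (tau e x C Sn c s z : R) :
  c * c + s * s = 1 -> C * C + Sn * Sn = 1 -> e * e = 1 ->
  inner tau (x * c, x * s, z) (unit_normal tau e x C Sn c s) (unit_normal tau e x C Sn c s) = 1.
Proof.
  intros Hcs HC He. unfold unit_normal at 1. rewrite inner_unit_normal by exact Hcs.
  pose proof (W_pos tau x). transitivity (e * e * (C * C + Sn * Sn)); [field; lra|].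
  rewrite He, HC. ring.
Qed.

Section Curvature.
Variables tau e x v v1 C Sn k c s z : R.
Hypothesis Hx : x <> 0.
Hypothesis Hv : v <> 0.
Hypothesis HC : C * C + Sn * Sn = 1.
Hypothesis Hcs : c * c + s * s = 1.

Let w := W tau x.
Let p : pt := (x * c, x * s, z).
Let n := unit_normal tau e x C Sn c s.
(** These are the first and second derivatives of [(x cos t, x sin t, z)] when [x' = v C],
    [z' = v W Sn], [C' = - v Sn k], [Sn' = v C k] and [v' = v1]. A general speed [v] is kept because
    the surfaces to be classified come with an arbitrary profile parameter. *)
Let Fs := frame c s (v * C) 0 (v * w * Sn).
Let Ft := frame c s 0 x 0.
Let Fss := frame c s (v1 * C - v * v * Sn * k) 0
  (v1 * w * Sn + v * (v * C * (tau * tau * x / w)) * Sn + v * w * (v * C * k)).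
Let Fst := frame c s 0 (v * C) 0.
Let Ftt := frame c s (- x) 0 0.

Lemma polar_det :
  inner tau p Fs Fs * inner tau p Ft Ft - inner tau p Fs Ft * inner tau p Fs Ft =
  x * x * (w * w) * (v * v).
Proof.
  unfold p, Fs, Ft. rewrite !inner_frame by exact Hcs.
  pose proof (W_sqr tau x) as HW. fold w in HW.
  transitivity (x * x * (v * v) *
    (C * C * (1 + tau * tau * (x * x)) + Sn * Sn * (w * w))); [ring|].
  rewrite <- HW. transitivity (x * x * (w * w) * (v * v) * (C * C + Sn * Sn)); [ring|rewrite HC; ring].
Qed.

(** Together with [polar_det] this yields [H = e (k + Sn / x) / 2], where [k] is the derivative of
    the slope angle by arc length: formally the expression for rotational surfaces of Euclidean
    space, the terms in [tau] cancelling through [w^2 = 1 + tau^2 x^2]. *)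
Lemma polar_numerator :
  nabla_inner tau p Fs Fs Fss n * inner tau p Ft Ft
  - 2 * nabla_inner tau p Fs Ft Fst n * inner tau p Fs Ft
  + nabla_inner tau p Ft Ft Ftt n * inner tau p Fs Fs =
  e * (x * x * (w * w) * (v * v) * (k + Sn / x)).
Proof.
  rewrite !nabla_inner_formula. unfold p, n, unit_normal, Fs, Ft, Fss, Fst, Ftt. fold w.
  rewrite !inner_frame, !contact_frame, !twist_frame by exact Hcs.
  pose proof (W_sqr tau x) as HW. fold w in HW. pose proof (W_pos tau x) as Hw0. fold w in Hw0.
  set (T := tau * tau * (x * x)) in HW.
  (* [He], [Hf] and [Hg] evaluate the three coefficients of the second fundamental form. *)
  assert (He : (v1 * C - v * v * Sn * k) * (- e * Sn) + 0 * (e * tau * x * C / w) +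
    (v1 * w * Sn + v * (v * C * (tau * tau * x / w)) * Sn + v * w * (v * C * k) - tau * x * 0) *
    (e * w * C - tau * x * (e * tau * x * C / w)) +
    (v * w * Sn - tau * x * 0) * (tau * (0 * (- e * Sn) - v * C * (e * tau * x * C / w))) +
    (v * w * Sn - tau * x * 0) * (tau * (0 * (- e * Sn) - v * C * (e * tau * x * C / w))) =
    e * (v * v) * (k + tau * tau * x * (C * C) * Sn * (/ (w * w) - 2))).
  { assert (E1 : e * w * C - tau * x * (e * tau * x * C / w) = e * C / w).
    { transitivity (e * C / w * (w * w - T)); [unfold T; field; lra|rewrite HW; ring]. }
    rewrite E1.
    transitivity (e * (v * v) * (k * (C * C + Sn * Sn) +
       tau * tau * x * (C * C) * Sn * (/ (w * w) - 2))); [field; lra|rewrite HC; ring]. }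
  assert (Hf : 0 * (- e * Sn) + v * C * (e * tau * x * C / w) +
    (0 - tau * x * (v * C)) * (e * w * C - tau * x * (e * tau * x * C / w)) +
    (0 - tau * x * x) * (tau * (0 * (- e * Sn) - v * C * (e * tau * x * C / w))) +
    (v * w * Sn - tau * x * 0) * (tau * (x * (- e * Sn) - 0 * (e * tau * x * C / w))) =
    e * v * tau * x * (C * C * w - C * C / w - Sn * Sn * w)).
  { assert (E1 : e * w * C - tau * x * (e * tau * x * C / w) = e * C / w).
    { transitivity (e * C / w * (w * w - T)); [unfold T; field; lra|rewrite HW; ring]. }
    rewrite E1.
    transitivity (e * v * tau * x * (C * C / w * (1 + T) - C * C / w - Sn * Sn * w));
      [unfold T; field; lra|rewrite <- HW; field; lra]. }
  assert (Hg : - x * (- e * Sn) + 0 * (e * tau * x * C / w) +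
    (0 - tau * x * 0) * (e * w * C - tau * x * (e * tau * x * C / w)) +
    (0 - tau * x * x) * (tau * (x * (- e * Sn) - 0 * (e * tau * x * C / w))) +
    (0 - tau * x * x) * (tau * (x * (- e * Sn) - 0 * (e * tau * x * C / w))) =
    e * x * Sn * (2 * (w * w) - 1)).
  { transitivity (e * x * Sn * (2 * (1 + T) - 1)); [unfold T; field; lra|rewrite <- HW; ring]. }
  rewrite He, Hf, Hg. clear He Hf Hg.
  replace (0 * 0 + x * x + (0 - tau * x * x) * (0 - tau * x * x)) with (x * x * (w * w))
    by (rewrite HW; unfold T; ring).
  replace (v * C * 0 + 0 * x + (v * w * Sn - tau * x * 0) * (0 - tau * x * x))
    with (- tau * (x * x) * v * w * Sn) by ring.
  replace (v * C * (v * C) + 0 * 0 + (v * w * Sn - tau * x * 0) * (v * w * Sn - tau * x * 0))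
    with (v * v * (C * C + w * w * (Sn * Sn))) by ring.
  (* Once [C^2] and then [T = w^2 - 1] are eliminated, the factor of [Sn] is a polynomial in [w] and
     [Sn] that reduces to [w^2]. *)
  replace (C * C) with (1 - Sn * Sn) by lra.
  transitivity (e * (v * v) * x * (x * (w * w) * k + Sn *
    (T * (1 - Sn * Sn) * (1 - 2 * (w * w)) + 2 * T * ((1 - Sn * Sn) * (w * w) - (1 - Sn * Sn) - Sn * Sn * (w * w))
     + (2 * (w * w) - 1) * ((1 - Sn * Sn) + w * w * (Sn * Sn))))); [unfold T; field; lra|].
  replace T with (w * w - 1) by lra. field. exact Hx.
Qed.
End Curvature.

Lemma locally_abs_lt (s d a : R) : Rabs (a - s) < d -> locally a (fun y => Rabs (y - s) < d).
Proof.
  intros H. assert (Hp : 0 < d - Rabs (a - s)) by lra.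
  exists (mkposreal _ Hp). intros y Hy. assert (Hy1 : Rabs (y - a) < d - Rabs (a - s)) by exact Hy.
  replace (y - s) with ((y - a) + (a - s)) by ring.
  eapply Rle_lt_trans; [apply Rabs_triang|lra].
Qed.

Lemma Derive_locally (f g : R -> R) (a l : R) :
  locally a (fun y => g y = f y) -> is_derive g a l -> Derive f a = l.
Proof.
  intros H Hg. apply is_derive_unique. now apply (is_derive_ext_loc g).
Qed.

Lemma pt_eq (a b c a' b' c' : R) : a = a' -> b = b' -> c = c' -> (a, b, c) = (a', b', c').
Proof. now intros -> -> ->. Qed.

Section Polar.
Variables (tau e : R) (F n : R -> R -> pt) (u t : R) (x z v C Sn : R -> R) (v1 k d : R).
Hypothesis Hd : 0 < d.
Hypothesis HF : forall a b, Rabs (a - u) < d -> F a b = (x a * cos b, x a * sin b, z a).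
Hypothesis Hx1 : forall a, Rabs (a - u) < d -> is_derive x a (v a * C a).
Hypothesis Hz1 : forall a, Rabs (a - u) < d -> is_derive z a (v a * W tau (x a) * Sn a).
Hypothesis Hv1 : is_derive v u v1.
Hypothesis HC1 : is_derive C u (- (v u * Sn u * k)).
Hypothesis HS1 : is_derive Sn u (v u * C u * k).

Lemma Hu : Rabs (u - u) < d.
Proof. now rewrite Rminus_diag, Rabs_R0. Qed.

Lemma polar_du (a b : R) : Rabs (a - u) < d ->
  du F a b = frame (cos b) (sin b) (v a * C a) 0 (v a * W tau (x a) * Sn a).
Proof.
  intros Ha. pose proof (locally_abs_lt _ _ _ Ha) as Hl.
  unfold du, frame. apply pt_eq.
  - apply (Derive_locally _ (fun a => x a * cos b)).
    + revert Hl. apply filter_imp. intros y Hy. now rewrite HF.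
    + eapply is_derive_eq; [apply deriv_mult; [now apply Hx1|apply deriv_const]|cbv beta; ring].
  - apply (Derive_locally _ (fun a => x a * sin b)).
    + revert Hl. apply filter_imp. intros y Hy. now rewrite HF.
    + eapply is_derive_eq; [apply deriv_mult; [now apply Hx1|apply deriv_const]|cbv beta; ring].
  - apply (Derive_locally _ z).
    + revert Hl. apply filter_imp. intros y Hy. now rewrite HF.
    + now apply Hz1.
Qed.

Lemma polar_dv (a b : R) : Rabs (a - u) < d -> dv F a b = frame (cos b) (sin b) 0 (x a) 0.
Proof.
  intros Ha. unfold dv, frame. apply pt_eq.
  - apply (Derive_locally _ (fun b => x a * cos b)).
    + apply filter_forall. intros y. now rewrite HF.
    + auto_derive; [exact I|ring].
  - apply (Derive_locally _ (fun b => x a * sin b)).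
    + apply filter_forall. intros y. now rewrite HF.
    + auto_derive; [exact I|ring].
  - apply (Derive_locally _ (fun _ => z a)).
    + apply filter_forall. intros y. now rewrite HF.
    + apply deriv_const.
Qed.

Lemma polar_dudu : du (du F) u t = frame (cos t) (sin t) (v1 * C u - v u * v u * Sn u * k) 0
  (v1 * W tau (x u) * Sn u + v u * (v u * C u * (tau * tau * x u / W tau (x u))) * Sn u
   + v u * W tau (x u) * (v u * C u * k)).
Proof.
  pose proof (locally_abs_lt _ _ _ Hu) as Hl.
  unfold du at 1, frame. apply pt_eq.
  - apply (Derive_locally _ (fun a => v a * C a * cos t)).
    + revert Hl. apply filter_imp. intros y Hy. rewrite polar_du by exact Hy.
      unfold frame, cx; simpl. ring.
    + eapply is_derive_eq; [apply deriv_mult; [apply deriv_mult; [exact Hv1|exact HC1]|apply deriv_const]|].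
      cbv beta. ring.
  - apply (Derive_locally _ (fun a => v a * C a * sin t)).
    + revert Hl. apply filter_imp. intros y Hy. rewrite polar_du by exact Hy.
      unfold frame, cy; simpl. ring.
    + eapply is_derive_eq; [apply deriv_mult; [apply deriv_mult; [exact Hv1|exact HC1]|apply deriv_const]|].
      cbv beta. ring.
  - apply (Derive_locally _ (fun a => v a * W tau (x a) * Sn a)).
    + revert Hl. apply filter_imp. intros y Hy. now rewrite polar_du by exact Hy.
    + eapply is_derive_eq; [apply deriv_mult; [apply deriv_mult; [exact Hv1|]|exact HS1]|].
      * apply deriv_comp; [apply Hx1, Hu|apply W_derive].
      * cbv beta. ring.
Qed.

Lemma polar_dudv : du (dv F) u t = frame (cos t) (sin t) 0 (v u * C u) 0.
Proof.
  pose proof (locally_abs_lt _ _ _ Hu) as Hl.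
  unfold du, frame. apply pt_eq.
  - apply (Derive_locally _ (fun a => - (x a * sin t))).
    + revert Hl. apply filter_imp. intros y Hy. rewrite polar_dv by exact Hy.
      unfold frame, cx; simpl. ring.
    + eapply is_derive_eq; [apply deriv_opp, deriv_mult; [apply Hx1, Hu|apply deriv_const]|cbv beta; ring].
  - apply (Derive_locally _ (fun a => x a * cos t)).
    + revert Hl. apply filter_imp. intros y Hy. rewrite polar_dv by exact Hy.
      unfold frame, cy; simpl. ring.
    + eapply is_derive_eq; [apply deriv_mult; [apply Hx1, Hu|apply deriv_const]|cbv beta; ring].
  - apply (Derive_locally _ (fun _ => 0)).
    + revert Hl. apply filter_imp. intros y Hy. now rewrite polar_dv by exact Hy.
    + apply deriv_const.
Qed.

Lemma polar_dvdv : dv (dv F) u t = frame (cos t) (sin t) (- x u) 0 0.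
Proof.
  unfold dv at 1, frame. apply pt_eq.
  - apply (Derive_locally _ (fun b => - (x u * sin b))).
    + apply filter_forall. intros y. rewrite polar_dv by exact Hu. unfold frame, cx; simpl. ring.
    + auto_derive; [exact I|ring].
  - apply (Derive_locally _ (fun b => x u * cos b)).
    + apply filter_forall. intros y. rewrite polar_dv by exact Hu. unfold frame, cy; simpl. ring.
    + auto_derive; [exact I|ring].
  - apply (Derive_locally _ (fun _ => 0)).
    + apply filter_forall. intros y. now rewrite polar_dv by exact Hu.
    + apply deriv_const.
Qed.

Lemma sqr_sum_trig (b : R) : cos b * cos b + sin b * sin b = 1.
Proof. pose proof (sin2_cos2 b). unfold Rsqr in *. lra. Qed.

Lemma mean_curvature_polar : x u <> 0 -> v u <> 0 -> C u * C u + Sn u * Sn u = 1 ->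
  n u t = unit_normal tau e (x u) (C u) (Sn u) (cos t) (sin t) ->
  mean_curvature tau F n u t = e * (k + Sn u / x u) / 2.
Proof.
  intros Hx Hv HC Hn. unfold mean_curvature. cbv zeta.
  rewrite polar_dudu, polar_dudv, polar_dvdv, Hn, polar_du, polar_dv, HF by exact Hu.
  rewrite polar_numerator, polar_det by (try assumption; apply sqr_sum_trig).
  pose proof (W_pos tau (x u)). field. repeat split; try assumption. lra.
Qed.
End Polar.

(** * Radial functions and smoothness on the plane *)

Definition rho (u v : R) : R := sqrt (u * u + v * v).

Lemma rho_sqr (u v : R) : rho u v * rho u v = u * u + v * v.
Proof. apply sqrt_sqrt. nra. Qed.

Lemma rho_pos (u v : R) : 0 <= rho u v.
Proof. apply sqrt_pos. Qed.

Lemma rho_zero (u v : R) : rho u v = 0 -> u = 0 /\ v = 0.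
Proof. intros H. pose proof (rho_sqr u v) as E. rewrite H in E. split; nra. Qed.

Lemma rho_0 : rho 0 0 = 0.
Proof. unfold rho. rewrite Rmult_0_r, Rplus_0_r. apply sqrt_0. Qed.

Lemma rho_polar (s t : R) : 0 <= s -> rho (s * cos t) (s * sin t) = s.
Proof.
  intros Hs. unfold rho.
  replace (s * cos t * (s * cos t) + s * sin t * (s * sin t)) with
    (s * s * (cos t * cos t + sin t * sin t)) by ring.
  rewrite sqr_sum_trig, Rmult_1_r. now apply sqrt_square.
Qed.

Lemma rho_continuous (u v : R) : continuity_2d_pt rho u v.
Proof.
  apply (continuity_1d_2d_pt_comp sqrt (fun u v => u * u + v * v)).
  - apply continuity_pt_sqrt. nra.
  - apply continuity_2d_pt_plus; apply continuity_2d_pt_mult;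
      (apply continuity_2d_pt_id1 || apply continuity_2d_pt_id2).
Qed.

Lemma rho_sym (u v : R) : rho u v = rho v u.
Proof. unfold rho. f_equal. ring. Qed.

(** Away from the origin the factor [rho] in the derivative of [f] cancels the denominator of
    [u / rho]. At the origin [f' = 0] and [rho h 0 = |h|], so the difference quotient at [h] is, up
    to sign, that of [f] at [|h|]. *)
Lemma radial_partial_u (f : R -> R) (g u v : R) :
  is_derive f (rho u v) (rho u v * g) -> is_derive (fun a => f (rho a v)) u (u * g).
Proof.
  intros Hf. destruct (Rle_lt_or_eq_dec 0 (rho u v) (rho_pos u v)) as [Hp|Hz].
  - assert (Hq : 0 < u * u + v * v) by (rewrite <- rho_sqr; nra).
    assert (Hr : is_derive (fun a => rho a v) u (u / rho u v)).
    { unfold rho in *. auto_derive; [exact Hq|]. field. lra. }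
    eapply is_derive_eq; [apply (deriv_comp f (fun a => rho a v)); [exact Hr|exact Hf]|].
    cbv beta. field. lra.
  - destruct (rho_zero u v (eq_sym Hz)) as [-> ->]. rewrite <- Hz, Rmult_0_l in Hf.
    rewrite Rmult_0_l. apply is_derive_Reals in Hf. apply is_derive_Reals.
    intros eps He. destruct (Hf eps He) as [d Hd]. exists d. intros h Hh Hhd.
    assert (E : rho h 0 = Rabs h).
    { unfold rho. rewrite Rmult_0_r, Rplus_0_r. apply (sqrt_Rsqr_abs h). }
    rewrite rho_0, Rplus_0_l, E.
    specialize (Hd (Rabs h)). rewrite Rplus_0_l, Rabs_Rabsolu in Hd.
    assert (Hh' : Rabs h <> 0) by now apply Rabs_no_R0.
    specialize (Hd Hh' Hhd). rewrite Rminus_0_r in *.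
    unfold Rdiv in *. rewrite Rabs_mult, Rabs_inv in *. now rewrite Rabs_Rabsolu in Hd.
Qed.

Lemma radial_partial_v (f : R -> R) (g u v : R) :
  is_derive f (rho u v) (rho u v * g) -> is_derive (fun b => f (rho u b)) v (v * g).
Proof.
  intros Hf. rewrite rho_sym in Hf. apply radial_partial_u in Hf.
  apply (is_derive_ext (fun b => f (rho b u))); [|exact Hf]. intros b. now rewrite rho_sym.
Qed.

Section Smooth2d.
Variable D : R -> R -> Prop.

(** Class [C^m] on [D] in two variables, which is what the digit stands for. The partial derivatives
    are existential witnesses and not terms in [Derive], so that closure under sums, products and
    radial composition is a plain induction. *)
Fixpoint C2 (m : nat) (f : R -> R -> R) : Prop :=
  (forall u v, D u v -> continuity_2d_pt f u v) /\
  match m with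
  | O => True
  | S m => exists fu fv, C2 m fu /\ C2 m fv /\ forall u v, D u v ->
      is_derive (fun a => f a v) u (fu u v) /\ is_derive (fun b => f u b) v (fv u v)
  end.

Lemma C2_pred (m : nat) : forall f, C2 (S m) f -> C2 m f.
Proof.
  induction m as [|m IH]; intros f Hf.
  - destruct Hf as [H _]. now split.
  - destruct Hf as [H [fu [fv [H1 [H2 H3]]]]]. split; [exact H|].
    exists fu, fv. split; [now apply IH|]. split; [now apply IH|exact H3].
Qed.

Lemma C2_continuous (m : nat) (f : R -> R -> R) (u v : R) :
  C2 m f -> D u v -> continuity_2d_pt f u v.
Proof. intros Hf. destruct m; apply Hf. Qed.

Lemma C2_const (m : nat) (c : R) : C2 m (fun _ _ => c).
Proof.
  revert c. induction m as [|m IH]; intros c; (split; [intros; apply continuity_2d_pt_const|]).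
  - exact I.
  - exists (fun _ _ => 0), (fun _ _ => 0). split; [apply IH|]. split; [apply IH|].
    intros u v _. split; apply deriv_const.
Qed.

Lemma C2_plus (m : nat) : forall f g, C2 m f -> C2 m g -> C2 m (fun u v => f u v + g u v).
Proof.
  induction m as [|m IH]; intros f g Hf Hg;
    (split; [intros u v Huv; apply continuity_2d_pt_plus; eapply C2_continuous; eassumption|]).
  - exact I.
  - destruct Hf as [_ [fu [fv [Hf1 [Hf2 Hf3]]]]], Hg as [_ [gu [gv [Hg1 [Hg2 Hg3]]]]].
    exists (fun u v => fu u v + gu u v), (fun u v => fv u v + gv u v).
    split; [now apply IH|]. split; [now apply IH|].
    intros u v Huv. destruct (Hf3 u v Huv), (Hg3 u v Huv).
    split; [apply (deriv_plus (fun a => f a v) (fun a => g a v))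
          |apply (deriv_plus (fun b => f u b) (fun b => g u b))]; assumption.
Qed.

Lemma C2_mult (m : nat) : forall f g, C2 m f -> C2 m g -> C2 m (fun u v => f u v * g u v).
Proof.
  induction m as [|m IH]; intros f g Hf Hg;
    (split; [intros u v Huv; apply continuity_2d_pt_mult; eapply C2_continuous; eassumption|]).
  - exact I.
  - pose proof (C2_pred _ _ Hf) as Hf0. pose proof (C2_pred _ _ Hg) as Hg0.
    destruct Hf as [_ [fu [fv [Hf1 [Hf2 Hf3]]]]], Hg as [_ [gu [gv [Hg1 [Hg2 Hg3]]]]].
    exists (fun u v => fu u v * g u v + f u v * gu u v),
           (fun u v => fv u v * g u v + f u v * gv u v).
    split; [apply C2_plus; now apply IH|]. split; [apply C2_plus; now apply IH|].
    intros u v Huv. destruct (Hf3 u v Huv), (Hg3 u v Huv).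
    split; [apply (deriv_mult (fun a => f a v) (fun a => g a v))
          |apply (deriv_mult (fun b => f u b) (fun b => g u b))]; assumption.
Qed.

Lemma C2_proj1 (m : nat) : C2 m (fun u _ => u).
Proof.
  destruct m as [|m]; (split; [intros; apply continuity_2d_pt_id1|]); [exact I|].
  exists (fun _ _ => 1), (fun _ _ => 0). split; [apply C2_const|]. split; [apply C2_const|].
  intros u v _. split; [apply deriv_id|apply deriv_const].
Qed.

Lemma C2_proj2 (m : nat) : C2 m (fun _ v => v).
Proof.
  destruct m as [|m]; (split; [intros; apply continuity_2d_pt_id2|]); [exact I|].
  exists (fun _ _ => 0), (fun _ _ => 1). split; [apply C2_const|]. split; [apply C2_const|].
  intros u v _. split; [apply deriv_const|apply deriv_id].
Qed.

(** The partial derivatives [u * g (rho u v)] and [v * g (rho u v)] are again a coordinate times a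
    radial function, so the induction on the order closes. *)
Lemma C2_radial (I : R -> Prop) (m : nat) : (forall u v, D u v -> I (rho u v)) ->
  forall f, radial I m f -> C2 m (fun u v => f (rho u v)).
Proof.
  intros HI. induction m as [|m IH]; intros f Hf;
    (split; [intros u v Huv; apply (continuity_1d_2d_pt_comp f rho);
      [apply continuity_pt_continuous; eapply radial_continuous; [exact Hf|now apply HI]
      |apply rho_continuous]|]).
  - exact Logic.I.
  - destruct Hf as [g [Hg Hd]].
    exists (fun u v => u * g (rho u v)), (fun u v => v * g (rho u v)).
    split; [apply C2_mult; [apply C2_proj1|now apply IH]|].
    split; [apply C2_mult; [apply C2_proj2|now apply IH]|].
    intros u v Huv. specialize (Hd _ (HI u v Huv)).
    split; [now apply radial_partial_u|now apply radial_partial_v].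
Qed.

(** Off the axis the profile parameter is itself a coordinate; there [radial] serves only as
    smoothness in one variable. *)
Lemma C2_first (m : nat) : forall f, radial everywhere m f -> C2 m (fun u _ => f u).
Proof.
  induction m as [|m IH]; intros f Hf;
    (split; [intros u v Huv; apply (continuity_1d_2d_pt_comp f (fun u _ => u));
      [apply continuity_pt_continuous; eapply radial_continuous; [exact Hf|exact I]
      |apply continuity_2d_pt_id1]|]).
  - exact I.
  - destruct Hf as [g [Hg Hd]].
    exists (fun u _ => u * g u), (fun _ _ => 0).
    split; [apply C2_mult; [apply C2_proj1|now apply IH]|]. split; [apply C2_const|].
    intros u v _. split; [now apply Hd|apply deriv_const].
Qed.

Lemma C2_trig (m : nat) : C2 m (fun _ v => cos v) /\ C2 m (fun _ v => sin v).
Proof.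
  induction m as [|m [IHc IHs]].
  - split; (split; [intros u v _|exact I]);
      [apply (continuity_1d_2d_pt_comp cos (fun _ v => v))|apply (continuity_1d_2d_pt_comp sin (fun _ v => v))];
      try apply continuity_2d_pt_id2; [apply continuity_cos|apply continuity_sin].
  - split; split.
    + intros u v Huv. eapply C2_continuous; eassumption.
    + exists (fun _ _ => 0), (fun _ v => -1 * sin v). split; [apply C2_const|].
      split; [apply C2_mult; [apply C2_const|exact IHs]|].
      intros u v _. split; [apply deriv_const|]. auto_derive; [exact I|ring].
    + intros u v Huv. eapply C2_continuous; eassumption.
    + exists (fun _ _ => 0), (fun _ v => cos v). split; [apply C2_const|]. split; [exact IHc|].
      intros u v _. split; [apply deriv_const|]. auto_derive; [exact I|ring].
Qed.

Hypothesis D_open : forall u v, D u v -> locally_2d D u v.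

Lemma C2_ex_diff (m : nat) : forall f, C2 m f -> forall u v, D u v -> ex_diff_n f m u v.
Proof.
  induction m as [|m IH]; intros f Hf u v Huv.
  - split; [now apply Hf|exact I].
  - destruct Hf as [Hc [fu [fv [H1 [H2 H3]]]]]. split; [now apply Hc|].
    split; [exists (fu u v); now apply H3|]. split; [exists (fv u v); now apply H3|].
    split.
    + apply (ex_diff_n_ext_loc fu); [|now apply IH].
      generalize (D_open u v Huv). apply locally_2d_impl, locally_2d_forall.
      intros a b Hab. symmetry. apply is_derive_unique. now apply H3.
    + apply (ex_diff_n_ext_loc fv); [|now apply IH].
      generalize (D_open u v Huv). apply locally_2d_impl, locally_2d_forall.
      intros a b Hab. symmetry. apply is_derive_unique. now apply H3.
Qed.

Lemma C2_smooth (f g : R -> R -> R) : (forall m, C2 m f) ->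
  (forall u v, D u v -> f u v = g u v) -> smooth_on D g.
Proof.
  intros Hf Hfg m u v Huv. apply (ex_diff_n_ext_loc f); [|now apply C2_ex_diff].
  generalize (D_open u v Huv). apply locally_2d_impl, locally_2d_forall. exact Hfg.
Qed.
End Smooth2d.

(** * Mean curvature of a disk in Cartesian coordinates, the axis included *)

Definition lin2 (a b : R) (V X : pt) : pt :=
  (a * cx V + b * cx X, a * cy V + b * cy X, a * cz V + b * cz X).

Definition lin3 (a b d : R) (V X Y : pt) : pt :=
  (a * cx V + b * cx X + d * cx Y, a * cy V + b * cy X + d * cy Y,
   a * cz V + b * cz X + d * cz Y).

(** Numerator and denominator of the mean curvature are both multiplied by the squared determinant
    [(c^2 + s^2)^2] of the change of basis of the parameter plane. *)
Lemma mean_curvature_rotated_basis (tau c s : R) (p Fu Fv Fuu Fuv Fvv n : pt) :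
  c * c + s * s = 1 ->
  let FR := lin2 c s Fu Fv in let FT := lin2 (- s) c Fu Fv in
  let FRR := lin3 (c * c) (2 * c * s) (s * s) Fuu Fuv Fvv in
  let FRT := lin3 (- c * s) (c * c - s * s) (c * s) Fuu Fuv Fvv in
  let FTT := lin3 (s * s) (- 2 * c * s) (c * c) Fuu Fuv Fvv in
  nabla_inner tau p Fu Fu Fuu n * inner tau p Fv Fv
  - 2 * nabla_inner tau p Fu Fv Fuv n * inner tau p Fu Fv
  + nabla_inner tau p Fv Fv Fvv n * inner tau p Fu Fu =
  nabla_inner tau p FR FR FRR n * inner tau p FT FT
  - 2 * nabla_inner tau p FR FT FRT n * inner tau p FR FT
  + nabla_inner tau p FT FT FTT n * inner tau p FR FR /\
  inner tau p Fu Fu * inner tau p Fv Fv - inner tau p Fu Fv * inner tau p Fu Fv =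
  inner tau p FR FR * inner tau p FT FT - inner tau p FR FT * inner tau p FR FT.
Proof.
  intros H FR FT FRR FRT FTT.
  assert (Hi : forall a b a' b', inner tau p (lin2 a b Fu Fv) (lin2 a' b' Fu Fv) =
    a * a' * inner tau p Fu Fu + (a * b' + a' * b) * inner tau p Fu Fv + b * b' * inner tau p Fv Fv).
  { intros. unfold inner, lin2, contact, cx, cy, cz; simpl. ring. }
  assert (Hn : forall a b a' b', nabla_inner tau p (lin2 a b Fu Fv) (lin2 a' b' Fu Fv)
      (lin3 (a * a') (a * b' + a' * b) (b * b') Fuu Fuv Fvv) n =
    a * a' * nabla_inner tau p Fu Fu Fuu n + (a * b' + a' * b) * nabla_inner tau p Fu Fv Fuv n
    + b * b' * nabla_inner tau p Fv Fv Fvv n).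
  { intros. rewrite !nabla_inner_formula.
    unfold inner, lin2, lin3, contact, twist, cx, cy, cz; simpl. ring. }
  unfold FR, FT. rewrite !Hi.
  replace FRR with (lin3 (c * c) (c * s + c * s) (s * s) Fuu Fuv Fvv)
    by (unfold FRR; f_equal; ring).
  replace FRT with (lin3 (c * - s) (c * c + - s * s) (s * c) Fuu Fuv Fvv)
    by (unfold FRT; f_equal; ring).
  replace FTT with (lin3 (- s * - s) (- s * c + - s * c) (c * c) Fuu Fuv Fvv)
    by (unfold FTT; f_equal; ring).
  rewrite !Hn.
  generalize (inner tau p Fu Fu), (inner tau p Fu Fv), (inner tau p Fv Fv),
    (nabla_inner tau p Fu Fu Fuu n), (nabla_inner tau p Fu Fv Fuv n),
    (nabla_inner tau p Fv Fv Fvv n). intros r1 r2 r3 r4 r5 r6.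
  split.
  - transitivity ((r4 * r3 - 2 * r5 * r2 + r6 * r1) * ((c * c + s * s) * (c * c + s * s)));
      [rewrite H; ring|ring].
  - transitivity ((r1 * r3 - r2 * r2) * ((c * c + s * s) * (c * c + s * s)));
      [rewrite H; ring|ring].
Qed.

Definition open_disc_locally (d u v : R) : disc d u v -> locally_2d (disc d) u v.
Proof.
  intros H.
  assert (Hc : continuity_2d_pt (fun u v => u * u + v * v) u v).
  { apply continuity_2d_pt_plus; apply continuity_2d_pt_mult;
      (apply continuity_2d_pt_id1 || apply continuity_2d_pt_id2). }
  assert (He : 0 < d * d - (u * u + v * v)) by (unfold disc in H; lra).
  destruct (Hc (mkposreal _ He)) as [r Hr]. exists r. intros a b Ha Hb.
  specialize (Hr a b Ha Hb). simpl in Hr. apply Rabs_def2 in Hr. unfold disc. lra.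
Qed.

Section RadialMap.
Variables (tau : R) (F : R -> R -> pt) (A A1 A2 z z1 z2 : R -> R) (d : R).
Hypothesis HA1 : forall s, is_derive A s (s * A1 s).
Hypothesis HA2 : forall s, is_derive A1 s (s * A2 s).
Hypothesis Hz1 : forall s, is_derive z s (s * z1 s).
Hypothesis Hz2 : forall s, is_derive z1 s (s * z2 s).
Hypothesis HF : forall a b, disc d a b -> F a b = (a * A (rho a b), b * A (rho a b), z (rho a b)).

Lemma disc_locally_u (a b : R) : disc d a b -> locally a (fun y => disc d y b).
Proof. intros H. apply (locally_2d_1d_const_y (disc d)). now apply open_disc_locally. Qed.

Lemma disc_locally_v (a b : R) : disc d a b -> locally b (fun y => disc d a y).
Proof. intros H. apply (locally_2d_1d_const_x (disc d)). now apply open_disc_locally. Qed.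

Ltac from_u H := let Hl := fresh in
  pose proof (disc_locally_u _ _ H) as Hl; revert Hl; apply filter_imp; intros y Hy.
Ltac from_v H := let Hl := fresh in
  pose proof (disc_locally_v _ _ H) as Hl; revert Hl; apply filter_imp; intros y Hy.

Lemma radial_du (a b : R) : disc d a b -> let r := rho a b in
  du F a b = (A r + a * a * A1 r, a * b * A1 r, a * z1 r).
Proof.
  intros H r. unfold du. apply pt_eq.
  - apply (Derive_locally _ (fun a => a * A (rho a b))).
    + from_u H. now rewrite HF.
    + eapply is_derive_eq; [apply deriv_mult; [apply deriv_id|apply radial_partial_u, HA1]|].
      cbv beta. unfold r. ring.
  - apply (Derive_locally _ (fun a => b * A (rho a b))).
    + from_u H. now rewrite HF.
    + eapply is_derive_eq; [apply deriv_scal, radial_partial_u, HA1|]. unfold r. ring.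
  - apply (Derive_locally _ (fun a => z (rho a b))).
    + from_u H. now rewrite HF.
    + apply radial_partial_u, Hz1.
Qed.

Lemma radial_dv (a b : R) : disc d a b -> let r := rho a b in
  dv F a b = (a * b * A1 r, A r + b * b * A1 r, b * z1 r).
Proof.
  intros H r. unfold dv. apply pt_eq.
  - apply (Derive_locally _ (fun b => a * A (rho a b))).
    + from_v H. now rewrite HF.
    + eapply is_derive_eq; [apply deriv_scal, radial_partial_v, HA1|]. unfold r. ring.
  - apply (Derive_locally _ (fun b => b * A (rho a b))).
    + from_v H. now rewrite HF.
    + eapply is_derive_eq; [apply deriv_mult; [apply deriv_id|apply radial_partial_v, HA1]|].
      cbv beta. unfold r. ring.
  - apply (Derive_locally _ (fun b => z (rho a b))).
    + from_v H. now rewrite HF.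
    + apply radial_partial_v, Hz1.
Qed.

Lemma radial_dudu (a b : R) : disc d a b -> let r := rho a b in
  du (du F) a b = (3 * a * A1 r + a * a * a * A2 r, b * A1 r + a * a * b * A2 r, z1 r + a * a * z2 r).
Proof.
  intros H r. unfold du at 1. apply pt_eq.
  - apply (Derive_locally _ (fun a => A (rho a b) + a * a * A1 (rho a b))).
    + from_u H. now rewrite radial_du.
    + eapply is_derive_eq.
      * apply (deriv_plus (fun a => A (rho a b)) (fun a => a * a * A1 (rho a b)));
          [apply radial_partial_u, HA1|].
        apply deriv_mult; [apply deriv_mult; apply deriv_id|apply radial_partial_u, HA2].
      * cbv beta. unfold r. ring.
  - apply (Derive_locally _ (fun a => a * b * A1 (rho a b))).
    + from_u H. now rewrite radial_du.
    + eapply is_derive_eq.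
      * apply deriv_mult; [apply deriv_mult; [apply deriv_id|apply deriv_const]|apply radial_partial_u, HA2].
      * cbv beta. unfold r. ring.
  - apply (Derive_locally _ (fun a => a * z1 (rho a b))).
    + from_u H. now rewrite radial_du.
    + eapply is_derive_eq; [apply deriv_mult; [apply deriv_id|apply radial_partial_u, Hz2]|].
      cbv beta. unfold r. ring.
Qed.

Lemma radial_dudv (a b : R) : disc d a b -> let r := rho a b in
  du (dv F) a b = (b * A1 r + a * a * b * A2 r, a * A1 r + a * b * b * A2 r, a * b * z2 r).
Proof.
  intros H r. unfold du at 1. apply pt_eq.
  - apply (Derive_locally _ (fun a => a * b * A1 (rho a b))).
    + from_u H. now rewrite radial_dv.
    + eapply is_derive_eq.
      * apply deriv_mult; [apply deriv_mult; [apply deriv_id|apply deriv_const]|apply radial_partial_u, HA2].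
      * cbv beta. unfold r. ring.
  - apply (Derive_locally _ (fun a => A (rho a b) + b * b * A1 (rho a b))).
    + from_u H. now rewrite radial_dv.
    + eapply is_derive_eq.
      * apply (deriv_plus (fun a => A (rho a b)) (fun a => b * b * A1 (rho a b)));
          [apply radial_partial_u, HA1|].
        apply deriv_scal, radial_partial_u, HA2.
      * cbv beta. unfold r. ring.
  - apply (Derive_locally _ (fun a => b * z1 (rho a b))).
    + from_u H. now rewrite radial_dv.
    + eapply is_derive_eq; [apply deriv_scal, radial_partial_u, Hz2|].
      cbv beta. unfold r. ring.
Qed.

Lemma radial_dvdv (a b : R) : disc d a b -> let r := rho a b in
  dv (dv F) a b = (a * A1 r + a * b * b * A2 r, 3 * b * A1 r + b * b * b * A2 r, z1 r + b * b * z2 r).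
Proof.
  intros H r. unfold dv at 1. apply pt_eq.
  - apply (Derive_locally _ (fun b => a * b * A1 (rho a b))).
    + from_v H. now rewrite radial_dv.
    + eapply is_derive_eq.
      * apply deriv_mult; [apply deriv_scal, deriv_id|apply radial_partial_v, HA2].
      * cbv beta. unfold r. ring.
  - apply (Derive_locally _ (fun b => A (rho a b) + b * b * A1 (rho a b))).
    + from_v H. now rewrite radial_dv.
    + eapply is_derive_eq.
      * apply (deriv_plus (fun b => A (rho a b)) (fun b => b * b * A1 (rho a b)));
          [apply radial_partial_v, HA1|].
        apply deriv_mult; [apply deriv_mult; apply deriv_id|apply radial_partial_v, HA2].
      * cbv beta. unfold r. ring.
  - apply (Derive_locally _ (fun b => b * z1 (rho a b))).
    + from_v H. now rewrite radial_dv.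
    + eapply is_derive_eq; [apply deriv_mult; [apply deriv_id|apply radial_partial_v, Hz2]|].
      cbv beta. unfold r. ring.
Qed.

(* Away from the origin, with respect to the orthonormal basis of radial and angular
   directions [R], [T] of the plane, the derivatives of [F] are those of the polar
   parametrization, up to powers of [r] and tangential terms. *)
Lemma mean_curvature_radial (e C Sn k u v : R) (n : R -> R -> pt) :
  disc d u v -> (u, v) <> (0, 0) -> let r := rho u v in let x := r * A r in
  0 < A r -> C * C + Sn * Sn = 1 ->
  A r + r * r * A1 r = C -> r * z1 r = W tau x * Sn ->
  3 * r * A1 r + r * r * r * A2 r = - (Sn * k) ->
  z1 r + r * r * z2 r = C * (tau * tau * x / W tau x) * Sn + W tau x * (C * k) ->
  n u v = unit_normal tau e x C Sn (u / r) (v / r) ->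
  mean_curvature tau F n u v = e * (k + Sn / x) / 2.
Proof.
  intros Huv H0 r x HA HC Hx1 Hzz Hx2 Hzz2 Hn.
  assert (Hr : 0 < r).
  { destruct (Rle_lt_or_eq_dec 0 r (rho_pos u v)) as [|Hz]; [assumption|].
    destruct (rho_zero u v (eq_sym Hz)) as [-> ->]. now elim H0. }
  set (c := u / r) in *. set (s := v / r) in *.
  assert (Hu : u = r * c) by (unfold c; field; lra).
  assert (Hv : v = r * s) by (unfold s; field; lra).
  assert (Hcs : c * c + s * s = 1).
  { pose proof (rho_sqr u v) as E. fold r in E. unfold c, s.
    transitivity ((u * u + v * v) / (r * r)); [field; lra|]. rewrite <- E. field. lra. }
  assert (Hx : 0 < x) by (unfold x; nra).
  unfold mean_curvature. cbv zeta.
  rewrite radial_dudu, radial_dudv, radial_dvdv, Hn, radial_du, radial_dv, HF by exact Huv.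
  fold r.
  match goal with |- context [nabla_inner tau ?p ?Fu ?Fu ?Fuu ?n * inner tau ?p ?Fv ?Fv
    - 2 * nabla_inner tau ?p ?Fu ?Fv ?Fuv ?n * _ + nabla_inner tau ?p ?Fv ?Fv ?Fvv ?n * _] =>
    destruct (mean_curvature_rotated_basis tau c s p Fu Fv Fuu Fuv Fvv n Hcs) as [E1 E2]
  end.
  rewrite E1, E2. clear E1 E2.
  replace (lin2 c s _ _) with (frame c s (1 * C) 0 (1 * W tau x * Sn)).
  2:{ unfold lin2, frame, cx, cy, cz; simpl. rewrite <- Hx1, !Rmult_1_l, <- Hzz, Hu, Hv.
      apply pt_eq.
      - transitivity (A r * c + r * r * A1 r * c * (c * c + s * s)); [rewrite Hcs; ring|ring].
      - transitivity (A r * s + r * r * A1 r * s * (c * c + s * s)); [rewrite Hcs; ring|ring].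
      - transitivity (r * z1 r * (c * c + s * s)); [rewrite Hcs; ring|ring]. }
  replace (lin2 (- s) c _ _) with (frame c s 0 (A r) 0).
  2:{ unfold lin2, frame, cx, cy, cz; simpl. rewrite Hu, Hv. apply pt_eq; ring. }
  replace (lin3 (c * c) _ _ _ _ _) with (frame c s (0 * C - 1 * 1 * Sn * k) 0
    (0 * W tau x * Sn + 1 * (1 * C * (tau * tau * x / W tau x)) * Sn + 1 * W tau x * (1 * C * k))).
  2:{ unfold lin3, frame, cx, cy, cz; simpl. rewrite Hu, Hv. apply pt_eq.
      - transitivity ((3 * r * A1 r + r * r * r * A2 r) * c); [rewrite Hx2; ring|].
        transitivity (3 * r * A1 r * c * (c * c + s * s)
          + r * r * r * A2 r * c * ((c * c + s * s) * (c * c + s * s))); [rewrite Hcs; ring|ring].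
      - transitivity ((3 * r * A1 r + r * r * r * A2 r) * s); [rewrite Hx2; ring|].
        transitivity (3 * r * A1 r * s * (c * c + s * s)
          + r * r * r * A2 r * s * ((c * c + s * s) * (c * c + s * s))); [rewrite Hcs; ring|ring].
      - transitivity (z1 r + r * r * z2 r); [rewrite Hzz2; ring|].
        transitivity (z1 r * (c * c + s * s)
          + r * r * z2 r * ((c * c + s * s) * (c * c + s * s))); [rewrite Hcs; ring|ring]. }
  replace (lin3 (- c * s) _ _ _ _ _) with (frame c s 0 (r * A1 r) 0).
  2:{ unfold lin3, frame, cx, cy, cz; simpl. rewrite Hu, Hv. apply pt_eq.
      - transitivity (- (r * A1 r * s * (c * c + s * s))); [rewrite Hcs; ring|ring].
      - transitivity (r * A1 r * c * (c * c + s * s)); [rewrite Hcs; ring|ring].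
      - ring. }
  replace (lin3 (s * s) _ _ _ _ _) with (frame c s (r * A1 r) 0 (z1 r)).
  2:{ unfold lin3, frame, cx, cy, cz; simpl. rewrite Hu, Hv. apply pt_eq.
      - transitivity (r * A1 r * c * (c * c + s * s)); [rewrite Hcs; ring|ring].
      - transitivity (r * A1 r * s * (c * c + s * s)); [rewrite Hcs; ring|ring].
      - transitivity (z1 r * (c * c + s * s)); [rewrite Hcs; ring|ring]. }
  replace (r * c * A r, r * s * A r, z r) with (x * c, x * s, z r)
    by (unfold x; apply pt_eq; ring).
  replace (u * A r, v * A r, z r) with (x * c, x * s, z r)
    by (rewrite Hu, Hv; unfold x; apply pt_eq; ring).
  assert (Hw : 0 < W tau x) by apply W_pos.
  pose proof (polar_det tau x 1 C Sn c s (z r) HC Hcs) as HD.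
  pose proof (polar_numerator tau e x 1 0 C Sn k c s (z r) (Rgt_not_eq _ _ Hx) HC Hcs) as HN.
  set (p := (x * c, x * s, z r)) in *. set (N := unit_normal tau e x C Sn c s) in *.
  set (FR := frame c s (1 * C) 0 (1 * W tau x * Sn)) in *.
  assert (HiT : forall V, inner tau p V (frame c s 0 x 0) = r * inner tau p V (frame c s 0 (A r) 0)).
  { intros V. unfold inner, contact, frame, cx, cy, cz, x; simpl. ring. }
  assert (HiT' : forall V, inner tau p (frame c s 0 x 0) V = r * inner tau p (frame c s 0 (A r) 0) V).
  { intros V. unfold inner, contact, frame, cx, cy, cz, x; simpl. ring. }
  assert (HoR : inner tau p FR N = 0).
  { unfold p, FR, N. rewrite inner_unit_normal by exact Hcs. field. lra. }
  assert (HoT : inner tau p (frame c s 0 (A r) 0) N = 0).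
  { unfold p, N. rewrite inner_unit_normal by exact Hcs. field. lra. }
  assert (Hf : nabla_inner tau p FR (frame c s 0 x 0) (frame c s 0 (1 * C) 0) N =
     r * nabla_inner tau p FR (frame c s 0 (A r) 0) (frame c s 0 (r * A1 r) 0) N).
  { transitivity (r * nabla_inner tau p FR (frame c s 0 (A r) 0) (frame c s 0 (r * A1 r) 0) N
      + inner tau p (frame c s 0 (A r) 0) N); [|rewrite HoT; ring].
    rewrite !nabla_inner_formula, <- Hx1.
    unfold inner, contact, twist, frame, cx, cy, cz, x; simpl. ring. }
  assert (Hg : nabla_inner tau p (frame c s 0 x 0) (frame c s 0 x 0) (frame c s (- x) 0 0) N =
     r * r * nabla_inner tau p (frame c s 0 (A r) 0) (frame c s 0 (A r) 0) (frame c s (r * A1 r) 0 (z1 r)) N).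
  { transitivity (r * r * nabla_inner tau p (frame c s 0 (A r) 0) (frame c s 0 (A r) 0) (frame c s (r * A1 r) 0 (z1 r)) N
      - r * inner tau p FR N); [|rewrite HoR; ring].
    rewrite !nabla_inner_formula. unfold FR. rewrite !Rmult_1_l, <- Hx1, <- Hzz.
    unfold inner, contact, twist, frame, cx, cy, cz, x; simpl. ring. }
  rewrite Hf, Hg, !HiT, !HiT' in HN. rewrite !HiT, !HiT' in HD.
  (* The angular basis vector is that of the polar parametrization divided by [r], so numerator and
     denominator both lack a factor [r^2] compared with the polar ones. *)
  match goal with |- ?a / (2 * ?b) = _ =>
    assert (Ea : r * r * a = e * (x * x * (W tau x * W tau x) * (1 * 1) * (k + Sn / x)));
    [rewrite <- HN; ring|];
    assert (Eb : r * r * b = x * x * (W tau x * W tau x) * (1 * 1));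
    [rewrite <- HD; ring|];
    assert (Hb : b <> 0); [intros Hb; rewrite Hb in Eb|]
  end.
  { assert (0 < x * x * (W tau x * W tau x) * (1 * 1)) by (repeat apply Rmult_lt_0_compat; lra). lra. }
  match goal with |- ?a / (2 * ?b) = _ =>
    transitivity ((r * r * a) / (2 * (r * r * b))); [field; split; [exact Hb|lra]|rewrite Ea, Eb]
  end.
  field. repeat split; lra.
Qed.

(** At the origin the two first derivatives are orthonormal and horizontal, and both pure second
    derivatives are vertical of size [z1 0]; the contact terms vanish there. *)
Lemma mean_curvature_radial_origin (e : R) (n : R -> R -> pt) :
  0 < d -> A 0 = 1 -> n 0 0 = (0, 0, e) -> mean_curvature tau F n 0 0 = e * z1 0.
Proof.
  intros Hd HA Hn. assert (H : disc d 0 0) by (unfold disc; nra).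
  unfold mean_curvature. cbv zeta.
  rewrite radial_dudu, radial_dudv, radial_dvdv, Hn, radial_du, radial_dv, HF by exact H.
  rewrite rho_0, HA, !nabla_inner_formula.
  unfold inner, contact, twist, cx, cy, cz; simpl. field.
Qed.
End RadialMap.

(** * The model surfaces *)

Definition rot_surface (tau e : R) (A th z : R -> R) : rot_data := {|
  dom := fun s => 0 <= s;
  rad := fun s => s * A s;
  hgt := z;
  nrm := fun s t => unit_normal tau e (s * A s) (cos (th s)) (sin (th s)) (cos t) (sin t)
|}.

Definition disk_map (A z : R -> R) (u v : R) : pt :=
  (u * A (rho u v), v * A (rho u v), z (rho u v)).

(** [unit_normal] with [sin th = r A q] and the rotation angle given by [(u / r, v / r)]: the
    divisions by [r] have been cancelled, which leaves an expression continuous at the origin. *)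
Definition disk_normal (tau e : R) (A q th : R -> R) (u v : R) : pt :=
  let r := rho u v in
  let b := e * tau * A r * cos (th r) / W tau (r * A r) in
  (- e * A r * q r * u - b * v, - e * A r * q r * v + b * u, e * W tau (r * A r) * cos (th r)).

Lemma polar_decomposition (u v : R) : exists c s,
  c * c + s * s = 1 /\ u = rho u v * c /\ v = rho u v * s.
Proof.
  destruct (Rle_lt_or_eq_dec 0 (rho u v) (rho_pos u v)) as [H|H].
  - exists (u / rho u v), (v / rho u v). repeat split; try (field; lra).
    transitivity ((u * u + v * v) / (rho u v * rho u v)); [field; lra|].
    rewrite <- rho_sqr. field. lra.
  - exists 1, 0. rewrite <- H. destruct (rho_zero u v (eq_sym H)) as [-> ->].
    repeat split; ring.
Qed.

Lemma polar_angle (u v : R) : exists t, u = rho u v * cos t /\ v = rho u v * sin t.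
Proof.
  destruct (polar_decomposition u v) as [c [s [Hcs [Hu Hv]]]].
  assert (Hc : -1 <= c <= 1) by nra.
  assert (Hsin : s = sqrt (1 - c²) \/ s = - sqrt (1 - c²)).
  { assert (E : sqrt (1 - c²) * sqrt (1 - c²) = s * s).
    { rewrite sqrt_sqrt by (unfold Rsqr; nra). unfold Rsqr. lra. }
    assert ((s - sqrt (1 - c²)) * (s + sqrt (1 - c²)) = 0) by lra.
    destruct (Rmult_integral _ _ H); [left|right]; lra. }
  destruct Hsin as [Hs|Hs].
  - exists (acos c). rewrite cos_acos, sin_acos by exact Hc. now rewrite <- Hs.
  - exists (- acos c). rewrite cos_neg, sin_neg, cos_acos, sin_acos by exact Hc. now rewrite <- Hs.
Qed.

Section Surface.
Variables (tau mu e : R) (A q th z : R -> R).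
Hypothesis He : e * e = 1.
Hypothesis HP : profile tau mu A q th z.

Let x (s : R) := s * A s.

Let x_deriv (s : R) : is_derive x s (cos (th s)).
Proof. exact (pr_x _ _ _ _ _ _ HP s). Qed.

Let th_deriv (s : R) : is_derive th s (2 * (cos (th s) * / W tau (x s) + mu) - q s).
Proof. exact (pr_th _ _ _ _ _ _ HP s). Qed.

Let z_deriv (s : R) : is_derive z s (sin (th s) * W tau (x s)).
Proof. exact (pr_z _ _ _ _ _ _ HP s). Qed.

Lemma disk_map_frame (u v c s : R) : u = rho u v * c -> v = rho u v * s ->
  disk_map A z u v = (x (rho u v) * c, x (rho u v) * s, z (rho u v)).
Proof.
  intros Hu Hv. unfold disk_map, x. apply pt_eq; [rewrite Hu at 1|rewrite Hv at 1|]; ring.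
Qed.

Lemma disk_normal_frame (u v c s : R) : u = rho u v * c -> v = rho u v * s ->
  let r := rho u v in
  disk_normal tau e A q th u v = unit_normal tau e (x r) (cos (th r)) (sin (th r)) c s.
Proof.
  intros Hu Hv r. unfold disk_normal, unit_normal, frame. fold r. fold r in Hu, Hv.
  cbv zeta. pose proof (W_pos tau (r * A r)). unfold x.
  rewrite (pr_sin _ _ _ _ _ _ HP). apply pt_eq; rewrite ?Hu, ?Hv; field; lra.
Qed.

Lemma disk_map_rot (s t : R) : 0 <= s ->
  disk_map A z (s * cos t) (s * sin t) = rot_map (rot_surface tau e A th z) s t.
Proof.
  intros Hs. rewrite (disk_map_frame _ _ (cos t) (sin t)) by (now rewrite rho_polar).
  rewrite rho_polar by exact Hs. reflexivity.
Qed.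

Lemma disk_normal_rot (s t : R) : 0 <= s ->
  disk_normal tau e A q th (s * cos t) (s * sin t) = nrm (rot_surface tau e A th z) s t.
Proof.
  intros Hs. rewrite (disk_normal_frame _ _ (cos t) (sin t)) by (now rewrite rho_polar).
  rewrite rho_polar by exact Hs. reflexivity.
Qed.

Lemma sqr_cos_sin (s : R) : cos (th s) * cos (th s) + sin (th s) * sin (th s) = 1.
Proof. apply sqr_sum_trig. Qed.

(** The data required by [mean_curvature_radial]. The identities for the second derivatives come
    from differentiating [cos th = A + s^2 A1] and [W sin th = s z1] in two ways. *)
Lemma radial_derivatives : exists A1 A2 z2,
  let z1 := fun s => A s * q s * W tau (x s) in
  (forall s, is_derive A s (s * A1 s)) /\ (forall s, is_derive A1 s (s * A2 s)) /\
  (forall s, is_derive z s (s * z1 s)) /\ (forall s, is_derive z1 s (s * z2 s)) /\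
  (forall s, A s + s * s * A1 s = cos (th s)) /\
  (forall s, s * z1 s = W tau (x s) * sin (th s)) /\
  (forall s, let k := 2 * (cos (th s) * / W tau (x s) + mu) - q s in
     3 * s * A1 s + s * s * s * A2 s = - (sin (th s) * k) /\
     z1 s + s * s * z2 s =
       cos (th s) * (tau * tau * x s / W tau (x s)) * sin (th s) + W tau (x s) * (cos (th s) * k)).
Proof.
  destruct (pr_radial_A _ _ _ _ _ _ HP 2) as [A1 [[A2 [_ HA2]] HA1]].
  assert (Hr : radial everywhere 1 (fun s => A s * q s * W tau (x s))).
  { apply radial_mult; [apply radial_mult|]; apply HP. }
  destruct Hr as [z2 [_ Hz2]].
  pose proof x_deriv as Hx. pose proof z_deriv as Hz. pose proof th_deriv as Hth.
  assert (Hc : forall s, A s + s * s * A1 s = cos (th s)).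
  { intros s. rewrite <- (is_derive_unique _ _ _ (Hx s)). symmetry. apply is_derive_unique.
    eapply is_derive_eq; [apply deriv_mult; [apply deriv_id|apply HA1; exact I]|cbv beta; ring]. }
  assert (Hsz : forall s, s * (A s * q s * W tau (x s)) = W tau (x s) * sin (th s)).
  { intros s. rewrite (pr_sin _ _ _ _ _ _ HP). unfold x. ring. }
  exists A1, A2, z2. cbv zeta.
  split; [intros s; now apply HA1|]. split; [intros s; now apply HA2|].
  split; [intros s; eapply is_derive_eq; [apply Hz|]; rewrite Hsz; ring|].
  split; [intros s; now apply Hz2|]. split; [exact Hc|]. split; [exact Hsz|].
  intros s. split.
  - assert (E : is_derive (fun s => cos (th s)) s
       ((2 * (cos (th s) * / W tau (x s) + mu) - q s) * - sin (th s))).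
    { apply (deriv_comp cos th); [apply Hth|apply is_derive_cos]. }
    assert (E2 : is_derive (fun s => cos (th s)) s (3 * s * A1 s + s * s * s * A2 s)).
    { apply (is_derive_ext (fun s => A s + s * s * A1 s)); [exact Hc|].
      eapply is_derive_eq.
      - apply (deriv_plus A (fun s => s * s * A1 s)); [now apply HA1|].
        apply deriv_mult; [apply deriv_mult; apply deriv_id|now apply HA2].
      - cbv beta. ring. }
    rewrite <- (is_derive_unique _ _ _ E2), (is_derive_unique _ _ _ E). ring.
  - assert (E : is_derive (fun s => W tau (x s) * sin (th s)) s
       (cos (th s) * (tau * tau * x s / W tau (x s)) * sin (th s) +
        W tau (x s) * ((2 * (cos (th s) * / W tau (x s) + mu) - q s) * cos (th s)))).
    { apply (deriv_mult (fun s => W tau (x s)) (fun s => sin (th s))).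
      - apply (deriv_comp (W tau) x); [apply Hx|apply W_derive].
      - apply (deriv_comp sin th); [apply Hth|apply is_derive_sin]. }
    assert (E2 : is_derive (fun s => W tau (x s) * sin (th s)) s
       (A s * q s * W tau (x s) + s * s * z2 s)).
    { apply (is_derive_ext (fun s => s * (A s * q s * W tau (x s)))); [exact Hsz|].
      eapply is_derive_eq; [apply deriv_mult; [apply deriv_id|now apply Hz2]|].
      cbv beta. ring. }
    rewrite <- (is_derive_unique _ _ _ E2), (is_derive_unique _ _ _ E). ring.
Qed.

(** Differentiating [sin th = x q] at [0] gives [th' = q 0], while the equation gives
    [th' = 2 (1 + mu) - q 0]. *)
Lemma q_at_0 : q 0 = 1 + mu.
Proof.
  assert (E : is_derive (fun s => sin (th s)) 0
     ((2 * (cos (th 0) * / W tau (0 * A 0) + mu) - q 0) * cos (th 0))).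
  { apply (deriv_comp sin th); [apply th_deriv|apply is_derive_sin]. }
  destruct (pr_radial_q _ _ _ _ _ _ HP 1) as [q1 [_ Hq]].
  assert (E2 : is_derive (fun s => sin (th s)) 0 (q 0)).
  { apply (is_derive_ext (fun s => s * A s * q s)).
    - intros t. symmetry. apply (pr_sin _ _ _ _ _ _ HP).
    - eapply is_derive_eq; [apply (deriv_mult x q); [apply x_deriv|now apply Hq]|].
      cbv beta. rewrite (pr_th_0 _ _ _ _ _ _ HP), cos_0. ring. }
  apply is_derive_unique in E. apply is_derive_unique in E2. rewrite E2 in E.
  rewrite (pr_th_0 _ _ _ _ _ _ HP), cos_0, Rmult_0_l in E.
  assert (W tau 0 = 1).
  { unfold W. rewrite !Rmult_0_r, Rplus_0_r. apply sqrt_1. }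
  rewrite H in E. lra.
Qed.

Lemma disk_immersion (D : R -> R -> Prop) (F n : R -> R -> pt) :
  (forall u v, D u v -> locally_2d D u v) ->
  (forall u v, D u v -> F u v = disk_map A z u v /\ n u v = disk_normal tau e A q th u v) ->
  oriented_immersion tau D F n.
Proof.
  intros HD HF.
  destruct radial_derivatives as [A1 [A2 [z2 [HA1 [HA2 [Hz1 [Hz2 [Hc [Hsz _]]]]]]]]].
  cbv zeta in Hz1, Hz2, Hsz. set (z1 := fun s => A s * q s * W tau (x s)) in *.
  assert (HI : forall u v, D u v -> everywhere (rho u v)) by (intros; exact I).
  assert (Hloc : forall u v, D u v -> locally_2d (fun a b => F a b = disk_map A z a b) u v).
  { intros u v Huv. generalize (HD u v Huv). apply locally_2d_impl, locally_2d_forall.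
    intros a b Hab. now apply HF. }
  assert (Hdu : forall u v, D u v -> let r := rho u v in
     du F u v = (A r + u * u * A1 r, u * v * A1 r, u * z1 r) /\
     dv F u v = (u * v * A1 r, A r + v * v * A1 r, v * z1 r)).
  { intros u v Huv. set (d := rho u v + 1).
    assert (Hd : disc d u v).
    { unfold disc. rewrite <- rho_sqr. unfold d. pose proof (rho_pos u v). nra. }
    pose proof (radial_du (disk_map A z) A A1 z z1 d HA1 Hz1 (fun _ _ _ => eq_refl) u v Hd) as H1.
    pose proof (radial_dv (disk_map A z) A A1 z z1 d HA1 Hz1 (fun _ _ _ => eq_refl) u v Hd) as H2.
    cbv zeta in H1, H2. cbv zeta. rewrite <- H1, <- H2.
    pose proof (locally_2d_1d_const_y _ _ _ (Hloc u v Huv)) as L1.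
    pose proof (locally_2d_1d_const_x _ _ _ (Hloc u v Huv)) as L2. cbv beta in L1, L2.
    split; [unfold du|unfold dv]; apply pt_eq; apply Derive_ext_loc;
      [revert L1|revert L1|revert L1|revert L2|revert L2|revert L2];
      apply filter_imp; intros y ->; reflexivity. }
  constructor.
  - intros i. apply (C2_smooth D HD (fun u v => coord i (disk_map A z u v))).
    + intros m. destruct i; unfold disk_map, coord, cx, cy, cz; simpl.
      * apply C2_mult; [apply C2_proj1|apply (C2_radial D everywhere m HI A), HP].
      * apply C2_mult; [apply C2_proj2|apply (C2_radial D everywhere m HI A), HP].
      * apply (C2_radial D everywhere m HI z), HP.
    + intros u v Huv. now rewrite (proj1 (HF u v Huv)).
  - intros u v Huv a b Hab.
    destruct (Hdu u v Huv) as [Eu Ev]. cbv zeta in Eu, Ev. set (r := rho u v) in *.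
    pose proof (Hab ax) as H1. pose proof (Hab ay) as H2. pose proof (Hab az) as H3.
    rewrite Eu, Ev in H1, H2, H3. unfold coord, cx, cy, cz in H1, H2, H3; simpl in H1, H2, H3.
    assert (HA : 0 < A r) by apply HP.
    assert (Hr2 : r * r = u * u + v * v) by apply rho_sqr.
    (* Up to the factor [r], the radial and angular components of the kernel vector [(a, b)]. The
       horizontal coordinates kill [be] and [al cos th], the vertical one kills [al sin th]. *)
    set (al := a * u + b * v). set (be := b * u - a * v).
    assert (Ebe : be = 0).
    { assert (A r * be = 0); [|apply Rmult_integral in H; destruct H; lra].
      unfold be. transitivity (u * (a * (u * v * A1 r) + b * (A r + v * v * A1 r)) -
        v * (a * (A r + u * u * A1 r) + b * (u * v * A1 r))); [ring|rewrite H1, H2; ring]. }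
    assert (Eal : al * cos (th r) = 0).
    { rewrite <- Hc, Hr2. unfold al. transitivity (v * (a * (u * v * A1 r) + b * (A r + v * v * A1 r)) +
        u * (a * (A r + u * u * A1 r) + b * (u * v * A1 r))); [ring|rewrite H1, H2; ring]. }
    assert (Eas : al * sin (th r) = 0).
    { assert (Ew : W tau (x r) * (al * sin (th r)) = 0).
      { transitivity (al * (W tau (x r) * sin (th r))); [ring|]. rewrite <- Hsz.
        change (A r * q r * W tau (x r)) with (z1 r). unfold al. transitivity (r * (a * (u * z1 r) + b * (v * z1 r))); [ring|rewrite H3; ring]. }
      pose proof (W_pos tau (x r)). apply Rmult_integral in Ew. destruct Ew; lra. }
    assert (Eal0 : al = 0).
    { transitivity (al * cos (th r) * cos (th r) + al * sin (th r) * sin (th r)).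
      - transitivity (al * (cos (th r) * cos (th r) + sin (th r) * sin (th r))); [|ring].
        rewrite sqr_cos_sin. ring.
      - rewrite Eal, Eas. ring. }
    assert (Ra : r * r * a = 0).
    { rewrite Hr2. transitivity (u * al - v * be); [unfold al, be; ring|rewrite Eal0, Ebe; ring]. }
    assert (Rb : r * r * b = 0).
    { rewrite Hr2. transitivity (v * al + u * be); [unfold al, be; ring|rewrite Eal0, Ebe; ring]. }
    destruct (Req_dec r 0) as [Hr|Hr].
    + destruct (rho_zero u v Hr) as [-> ->]. rewrite !Rmult_0_l in *.
      split; [assert (a * A r = 0) by lra|assert (b * A r = 0) by lra];
        apply Rmult_integral in H; destruct H; lra.
    + assert (r * r <> 0) by (now apply Rmult_integral_contrapositive_currified).
      split; [apply Rmult_integral in Ra; destruct Ra; [contradiction|assumption]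
             |apply Rmult_integral in Rb; destruct Rb; [contradiction|assumption]].
  - intros i u v Huv.
    apply (continuity_2d_pt_ext_loc (fun a b => coord i (disk_normal tau e A q th a b))).
    { generalize (HD u v Huv). apply locally_2d_impl, locally_2d_forall.
      intros a b Hab. now rewrite (proj2 (HF a b Hab)). }
    assert (HC : C2 D 0 (fun u v => coord i (disk_normal tau e A q th u v))).
    { assert (H0A := pr_radial_A _ _ _ _ _ _ HP 0). assert (H0q := pr_radial_q _ _ _ _ _ _ HP 0).
      assert (H0c := pr_radial_cos _ _ _ _ _ _ HP 0). assert (H0W := pr_radial_W _ _ _ _ _ _ HP 0).
      assert (Hb : radial everywhere 0 (fun r => e * tau * A r * cos (th r) / W tau (r * A r))).
      { apply radial_div; [|apply radial_mult; [apply radial_mult|]|]; try assumption.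
        - intros s _. pose proof (W_pos tau (s * A s)). lra.
        - apply radial_const. }
      assert (Ha : radial everywhere 0 (fun r => - e * A r * q r)).
      { apply radial_mult; [apply radial_mult|]; try assumption. apply radial_const. }
      assert (Hd : radial everywhere 0 (fun r => e * W tau (r * A r) * cos (th r))).
      { apply radial_mult; [apply radial_mult|]; try assumption. apply radial_const. }
      destruct i; unfold disk_normal, coord, cx, cy, cz; simpl.
      - apply (C2_plus D 0 (fun u v => - e * A (rho u v) * q (rho u v) * u)
          (fun u v => - (e * tau * A (rho u v) * cos (th (rho u v)) / W tau (rho u v * A (rho u v)) * v))).
        + apply (C2_mult D 0 (fun u v => - e * A (rho u v) * q (rho u v)) (fun u _ => u)).
          * exact (C2_radial D everywhere 0 HI _ Ha).
          * apply C2_proj1.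
        + split; [|exact I]. intros a b Hab.
          apply (continuity_2d_pt_opp (fun u v => e * tau * A (rho u v) * cos (th (rho u v)) / W tau (rho u v * A (rho u v)) * v)).
          apply (continuity_2d_pt_mult (fun u v => e * tau * A (rho u v) * cos (th (rho u v)) / W tau (rho u v * A (rho u v)))).
          * now apply (C2_radial D everywhere 0 HI _ Hb).
          * apply continuity_2d_pt_id2.
      - apply (C2_plus D 0 (fun u v => - e * A (rho u v) * q (rho u v) * v)
          (fun u v => e * tau * A (rho u v) * cos (th (rho u v)) / W tau (rho u v * A (rho u v)) * u)).
        + apply (C2_mult D 0 (fun u v => - e * A (rho u v) * q (rho u v)) (fun _ v => v)).
          * exact (C2_radial D everywhere 0 HI _ Ha).
          * apply C2_proj2.
        + apply (C2_mult D 0 (fun u v => e * tau * A (rho u v) * cos (th (rho u v)) / W tau (rho u v * A (rho u v))) (fun u _ => u)).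
          * exact (C2_radial D everywhere 0 HI _ Hb).
          * apply C2_proj1.
      - exact (C2_radial D everywhere 0 HI _ Hd). }
    now apply HC.
  - intros u v Huv. destruct (HF u v Huv) as [-> ->].
    destruct (polar_decomposition u v) as [c [s [Hcs [Hu Hv]]]].
    rewrite (disk_map_frame u v c s Hu Hv), (disk_normal_frame u v c s Hu Hv).
    apply unit_normal_unit; [exact Hcs|apply sqr_cos_sin|exact He].
  - intros u v Huv. destruct (Hdu u v Huv) as [Eu Ev]. destruct (HF u v Huv) as [-> ->].
    cbv zeta in Eu, Ev. rewrite Eu, Ev. clear Eu Ev.
    destruct (polar_decomposition u v) as [c [s [Hcs [Hu Hv]]]].
    rewrite (disk_map_frame u v c s Hu Hv), (disk_normal_frame u v c s Hu Hv).
    set (r := rho u v) in *. specialize (Hc r). specialize (Hsz r).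
    pose proof (W_pos tau (x r)) as Hw.
    set (p := (x r * c, x r * s, z r)). set (N := unit_normal tau e (x r) (cos (th r)) (sin (th r)) c s).
    assert (HR : inner tau p (frame c s (cos (th r)) 0 (W tau (x r) * sin (th r))) N = 0).
    { unfold p, N. rewrite inner_unit_normal by exact Hcs. field. lra. }
    assert (HT : inner tau p (frame c s 0 (A r) 0) N = 0).
    { unfold p, N. rewrite inner_unit_normal by exact Hcs. field. lra. }
    assert (Hsym : forall V, inner tau p N V = inner tau p V N).
    { intros V. unfold inner. ring. }
    rewrite !Hsym. rewrite <- Hc, <- Hsz in HR.
    change (A r * q r * W tau (x r)) with (z1 r) in HR.
    (* In terms of the radial and angular vectors of [HR] and [HT], the derivative [du F] is [c]
       times the first minus [s] times the second, and [dv F] is [s] times the first plus [c] times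
       the second. *)
    split.
    + transitivity (c * inner tau p (frame c s (A r + r * r * A1 r) 0 (r * z1 r)) N
        - s * inner tau p (frame c s 0 (A r) 0) N); [|rewrite HR, HT; ring].
      replace (A r + u * u * A1 r, u * v * A1 r, u * z1 r) with
        (lin2 c (- s) (frame c s (A r + r * r * A1 r) 0 (r * z1 r)) (frame c s 0 (A r) 0)).
      * unfold inner, contact, lin2, cx, cy, cz; simpl. ring.
      * unfold lin2, frame, cx, cy, cz; simpl. rewrite Hu, Hv. apply pt_eq.
        -- transitivity (A r * (c * c + s * s) + r * r * A1 r * (c * c)); [ring|rewrite Hcs; ring].
        -- ring.
        -- ring.
    + transitivity (s * inner tau p (frame c s (A r + r * r * A1 r) 0 (r * z1 r)) N
        + c * inner tau p (frame c s 0 (A r) 0) N); [|rewrite HR, HT; ring].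
      replace (u * v * A1 r, A r + v * v * A1 r, v * z1 r) with
        (lin2 s c (frame c s (A r + r * r * A1 r) 0 (r * z1 r)) (frame c s 0 (A r) 0)).
      * unfold inner, contact, lin2, cx, cy, cz; simpl. ring.
      * unfold lin2, frame, cx, cy, cz; simpl. rewrite Hu, Hv. apply pt_eq.
        -- ring.
        -- transitivity (A r * (c * c + s * s) + r * r * A1 r * (s * s)); [ring|rewrite Hcs; ring].
        -- ring.
Qed.

Lemma disk_translator (d u v : R) (F n : R -> R -> pt) : 0 < d -> disc d u v ->
  (forall a b, disc d a b -> F a b = disk_map A z a b) ->
  n u v = disk_normal tau e A q th u v ->
  mean_curvature tau F n u v = inner tau (F u v) (n u v) dz + e * mu.
Proof.
  intros Hd Huv HF Hn.
  destruct radial_derivatives as [A1 [A2 [z2 [HA1 [HA2 [Hz1 [Hz2 [Hc [Hsz Hk]]]]]]]]].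
  cbv zeta in Hz1, Hz2, Hsz, Hk. set (z1 := fun s => A s * q s * W tau (x s)) in *.
  assert (Hin : inner tau (F u v) (n u v) dz =
    e * cos (th (rho u v)) / W tau (x (rho u v))).
  { rewrite Hn, HF by exact Huv.
    destruct (polar_decomposition u v) as [c [s [Hcs [Hu Hv]]]].
    rewrite (disk_map_frame u v c s Hu Hv), (disk_normal_frame u v c s Hu Hv).
    replace dz with (frame c s 0 0 1) by (unfold dz, frame; apply pt_eq; ring).
    transitivity (inner tau (x (rho u v) * c, x (rho u v) * s, z (rho u v)) (frame c s 0 0 1)
      (unit_normal tau e (x (rho u v)) (cos (th (rho u v))) (sin (th (rho u v))) c s));
      [unfold inner; ring|].
    rewrite inner_unit_normal by exact Hcs. pose proof (W_pos tau (x (rho u v))). field. lra. }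
  rewrite Hin. clear Hin.
  (* On the axis the curvature is [e * q 0 = e (1 + mu)] and the normal is [(0, 0, e)]; elsewhere
     the polar formula applies. *)
  destruct (classic ((u, v) = (0, 0))) as [H0|H0].
  - injection H0 as -> ->.
    assert (HW0 : W tau (x 0) = 1).
    { unfold W, x. rewrite Rmult_0_l, !Rmult_0_r, Rplus_0_r. apply sqrt_1. }
    rewrite (mean_curvature_radial_origin tau F A A1 A2 z z1 z2 d HA1 HA2 Hz1 Hz2 HF e);
      [|exact Hd|apply HP|].
    + unfold z1. rewrite q_at_0, rho_0, HW0, (pr_A_0 _ _ _ _ _ _ HP), (pr_th_0 _ _ _ _ _ _ HP), cos_0.
      field.
    + rewrite Hn. unfold disk_normal. rewrite rho_0. fold (x 0).
      rewrite HW0, (pr_th_0 _ _ _ _ _ _ HP), cos_0. apply pt_eq; ring.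
  - set (r := rho u v) in *.
    assert (Hr : 0 < r).
    { destruct (Rle_lt_or_eq_dec 0 r (rho_pos u v)) as [|Hz]; [assumption|].
      destruct (rho_zero u v (eq_sym Hz)) as [-> ->]. now elim H0. }
    assert (HA : 0 < A r) by apply HP.
    destruct (Hk r) as [Hk1 Hk2].
    rewrite (mean_curvature_radial tau F A A1 A2 z z1 z2 d HA1 HA2 Hz1 Hz2 HF e
      (cos (th r)) (sin (th r)) (2 * (cos (th r) * / W tau (x r) + mu) - q r) u v n Huv H0).
    + fold r. rewrite (pr_sin _ _ _ _ _ _ HP r). fold (x r).
      pose proof (W_pos tau (x r)). assert (Hxr : 0 < x r) by now apply Rmult_lt_0_compat.
      field. split; lra.
    + exact HA.
    + apply sqr_cos_sin.
    + apply Hc.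
    + apply Hsz.
    + exact Hk1.
    + exact Hk2.
    + rewrite Hn. apply disk_normal_frame; fold r; field; lra.
Qed.

Lemma strip_immersion (s0 d : R) (D : R -> R -> Prop) (F n : R -> R -> pt) :
  0 < d -> d <= s0 -> (forall u v, D u v <-> Rabs (u - s0) < d) ->
  (forall u v, D u v -> F u v = rot_map (rot_surface tau e A th z) u v /\
     n u v = nrm (rot_surface tau e A th z) u v) ->
  oriented_immersion tau D F n.
Proof.
  intros Hd Hds HDs HF.
  assert (HD : forall u v, D u v -> locally_2d D u v).
  { intros u v Huv. apply HDs in Huv.
    assert (Hp : 0 < d - Rabs (u - s0)) by lra. exists (mkposreal _ Hp). intros a b Ha _.
    apply HDs. simpl in Ha. replace (a - s0) with ((a - u) + (u - s0)) by ring.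
    eapply Rle_lt_trans; [apply Rabs_triang|lra]. }
  assert (Hpos : forall u v, D u v -> 0 < x u).
  { intros u v Huv. apply HDs, Rabs_def2 in Huv. unfold x.
    apply Rmult_lt_0_compat; [lra|apply HP]. }
  assert (Hdu : forall u v, D u v ->
     du F u v = frame (cos v) (sin v) (1 * cos (th u)) 0 (1 * W tau (x u) * sin (th u)) /\
     dv F u v = frame (cos v) (sin v) 0 (x u) 0).
  { intros u v Huv. assert (Hu := proj1 (HDs u v) Huv).
    assert (Hp : 0 < d - Rabs (u - s0)) by lra.
    assert (HF' : forall a b, Rabs (a - u) < d - Rabs (u - s0) ->
       F a b = (x a * cos b, x a * sin b, z a)).
    { intros a b Hab. apply HF, HDs. replace (a - s0) with ((a - u) + (u - s0)) by ring.
      eapply Rle_lt_trans; [apply Rabs_triang|lra]. }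
    assert (Huu : Rabs (u - u) < d - Rabs (u - s0)) by (now rewrite Rminus_diag, Rabs_R0).
    split.
    - apply (polar_du tau F u x z (fun _ => 1) (fun s => cos (th s)) (fun s => sin (th s))
        (d - Rabs (u - s0)) HF'); [| |exact Huu].
      + intros a _. rewrite Rmult_1_l. apply x_deriv.
      + intros a _. eapply is_derive_eq; [apply z_deriv|]. ring.
    - now apply (polar_dv F u x z (d - Rabs (u - s0)) HF'). }
  constructor.
  - intros i. apply (C2_smooth D HD (fun u v => coord i (x u * cos v, x u * sin v, z u))).
    + intros m. assert (Hxm : C2 D m (fun u _ => x u)).
      { unfold x. apply C2_mult; [apply C2_proj1|apply (C2_first D m A), HP]. }
      destruct i; unfold coord, cx, cy, cz; simpl.
      * apply (C2_mult D m (fun u _ => x u) (fun _ v => cos v)); [exact Hxm|apply C2_trig].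
      * apply (C2_mult D m (fun u _ => x u) (fun _ v => sin v)); [exact Hxm|apply C2_trig].
      * apply (C2_first D m z), HP.
    + intros u v Huv. now rewrite (proj1 (HF u v Huv)).
  - intros u v Huv a b Hab. destruct (Hdu u v Huv) as [Eu Ev].
    pose proof (Hab ax) as H1. pose proof (Hab ay) as H2. pose proof (Hab az) as H3.
    rewrite Eu, Ev in H1, H2, H3. unfold coord, frame, cx, cy, cz in H1, H2, H3; simpl in H1, H2, H3.
    pose proof (sqr_sum_trig v) as Hv. pose proof (sqr_cos_sin u) as Hth.
    pose proof (Hpos u v Huv) as Hx. pose proof (W_pos tau (x u)) as Hw.
    assert (Eb : b * x u = 0).
    { transitivity (b * x u * (cos v * cos v + sin v * sin v)); [rewrite Hv; ring|].
      transitivity (cos v * (a * (1 * cos (th u) * sin v + 0 * cos v) + b * (0 * sin v + x u * cos v))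
        - sin v * (a * (1 * cos (th u) * cos v - 0 * sin v) + b * (0 * cos v - x u * sin v)));
        [ring|rewrite H1, H2; ring]. }
    assert (Ea1 : a * cos (th u) = 0).
    { transitivity (a * cos (th u) * (cos v * cos v + sin v * sin v)); [rewrite Hv; ring|].
      transitivity (sin v * (a * (1 * cos (th u) * sin v + 0 * cos v) + b * (0 * sin v + x u * cos v))
        + cos v * (a * (1 * cos (th u) * cos v - 0 * sin v) + b * (0 * cos v - x u * sin v)));
        [ring|rewrite H1, H2; ring]. }
    assert (Ea2 : a * sin (th u) = 0).
    { assert (W tau (x u) * (a * sin (th u)) = 0) by lra.
      apply Rmult_integral in H. destruct H; lra. }
    split.
    + transitivity (a * cos (th u) * cos (th u) + a * sin (th u) * sin (th u)).
      * transitivity (a * (cos (th u) * cos (th u) + sin (th u) * sin (th u))); [rewrite Hth; ring|ring].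
      * rewrite Ea1, Ea2. ring.
    + apply Rmult_integral in Eb. destruct Eb; lra.
  - intros i u v Huv.
    apply (continuity_2d_pt_ext_loc (fun a b => coord i (nrm (rot_surface tau e A th z) a b))).
    { generalize (HD u v Huv). apply locally_2d_impl, locally_2d_forall.
      intros a b Hab. now rewrite (proj2 (HF a b Hab)). }
    assert (H0c := pr_radial_cos _ _ _ _ _ _ HP 0). assert (H0W := pr_radial_W _ _ _ _ _ _ HP 0).
    assert (Hxc : C2 D 0 (fun u _ => x u)).
    { unfold x. apply C2_mult; [apply C2_proj1|apply (C2_first D 0 A), HP]. }
    assert (Hsc : C2 D 0 (fun u _ => sin (th u))).
    { split; [|exact I]. intros a b _.
      apply (continuity_1d_2d_pt_comp (fun u => sin (th u)) (fun u _ => u)); [|apply continuity_2d_pt_id1].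
      apply continuity_pt_continuous, (cont_comp th sin); [|apply continuous_sin].
      eapply is_derive_continuous, th_deriv. }
    assert (Hbc : C2 D 0 (fun u _ => e * tau * x u * cos (th u) / W tau (x u))).
    { apply (C2_mult D 0 (fun u _ => e * tau * x u * cos (th u)) (fun u _ => / W tau (x u))).
      - apply (C2_mult D 0 (fun u _ => e * tau * x u) (fun u _ => cos (th u))).
        + apply (C2_mult D 0 (fun _ _ => e * tau)); [apply C2_const|exact Hxc].
        + exact (C2_first D 0 _ H0c).
      - apply (C2_first D 0 (fun u => / W tau (x u))). apply radial_inv; [|exact H0W].
        intros s _. pose proof (W_pos tau (x s)). lra. }
    assert (Hac : C2 D 0 (fun u _ => - e * sin (th u))).
    { apply (C2_mult D 0 (fun _ _ => - e)); [apply C2_const|exact Hsc]. }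
    assert (HC : C2 D 0 (fun u v => coord i (nrm (rot_surface tau e A th z) u v))).
    { destruct i; unfold rot_surface, unit_normal, frame, coord, cx, cy, cz; simpl.
      - split; [|exact I]. intros a b Hab.
        apply (continuity_2d_pt_minus (fun u v => - e * sin (th u) * cos v)
          (fun u v => e * tau * x u * cos (th u) / W tau (x u) * sin v)).
        + apply (continuity_2d_pt_mult (fun u _ => - e * sin (th u)) (fun _ v => cos v));
            [now apply Hac|now apply (C2_trig D 0)].
        + apply (continuity_2d_pt_mult (fun u _ => e * tau * x u * cos (th u) / W tau (x u)) (fun _ v => sin v));
            [now apply Hbc|now apply (C2_trig D 0)].
      - apply (C2_plus D 0 (fun u v => - e * sin (th u) * sin v)
          (fun u v => e * tau * x u * cos (th u) / W tau (x u) * cos v)).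
        + apply (C2_mult D 0 (fun u _ => - e * sin (th u)) (fun _ v => sin v));
            [exact Hac|apply (C2_trig D 0)].
        + apply (C2_mult D 0 (fun u _ => e * tau * x u * cos (th u) / W tau (x u)) (fun _ v => cos v));
            [exact Hbc|apply (C2_trig D 0)].
      - apply (C2_first D 0 (fun u => e * W tau (u * A u) * cos (th u))).
        apply radial_mult; [apply radial_mult|]; try assumption. apply radial_const. }
    now apply HC.
  - intros u v Huv. destruct (HF u v Huv) as [-> ->].
    apply unit_normal_unit; [apply sqr_sum_trig|apply sqr_cos_sin|exact He].
  - intros u v Huv. destruct (Hdu u v Huv) as [-> ->]. destruct (HF u v Huv) as [-> ->].
    pose proof (W_pos tau (x u)) as Hw.
    set (p := rot_map _ u v). set (N := nrm _ u v).
    assert (Hsym : forall V, inner tau p N V = inner tau p V N).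
    { intros V. unfold inner. ring. }
    rewrite !Hsym. unfold p, N, rot_map, rot_surface. simpl.
    rewrite !inner_unit_normal by apply sqr_sum_trig. fold (x u).
    split; field; lra.
Qed.

Lemma surface_local_param (s : R) (D : R -> R -> Prop) (F n : R -> R -> pt) :
  0 <= s -> local_param (rot_surface tau e A th z) s D F n ->
  (s = 0 /\ exists d, 0 < d /\ (forall u v, D u v <-> disc d u v) /\
     forall u v, disc d u v -> F u v = disk_map A z u v /\ n u v = disk_normal tau e A q th u v) \/
  (0 < s /\ exists d, 0 < d /\ (forall u v, D u v <-> Rabs (u - s) < d) /\
     (forall u v, D u v -> F u v = rot_map (rot_surface tau e A th z) u v /\
        n u v = nrm (rot_surface tau e A th z) u v)).
Proof.
  intros Hs [d Hd Hrad Hdom HD HF|sg d Hd Hrad Hsg Hdom HD HF]; simpl in Hrad.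
  - right. assert (HA : 0 < A s) by apply HP. split; [nra|]. now exists d.
  - assert (HA : 0 < A s) by apply HP.
    assert (Es : s = 0) by (apply Rmult_integral in Hrad; destruct Hrad; lra). subst s.
    left. split; [reflexivity|]. exists d. split; [exact Hd|]. split; [exact HD|].
    (* [sg = -1] would put negative parameters into the domain. *)
    assert (Esg : sg = 1).
    { destruct Hsg as [|E]; [assumption|]. exfalso.
      specialize (Hdom (d / 2)). rewrite E in Hdom. simpl in Hdom.
      rewrite Rabs_right in Hdom by lra. assert (0 <= 0 + -1 * (d / 2)) by (apply Hdom; lra). lra. }
    subst sg. intros u v Huv. destruct (polar_angle u v) as [t [Eu Ev]].
    assert (Hr : 0 <= rho u v < d).
    { split; [apply rho_pos|]. unfold disc in Huv. rewrite <- rho_sqr in Huv.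
      pose proof (rho_pos u v). nra. }
    destruct (HF (rho u v) t Hr) as [E1 E2]. rewrite <- Eu, <- Ev in E1, E2.
    rewrite E1, E2, Rplus_0_l, Rmult_1_l.
    rewrite <- disk_map_rot, <- disk_normal_rot by apply Hr. now rewrite <- Eu, <- Ev.
Qed.

Lemma surface_translator : rotational_translator tau (e * mu) (rot_surface tau e A th z).
Proof.
  split; [constructor|].
  - exists 0. simpl. lra.
  - simpl. intros a b s Ha _ H. lra.
  - simpl. intros s Hs. apply Rmult_le_pos; [exact Hs|]. left. apply HP.
  - simpl. intros s Hs. destruct (Rle_lt_or_eq_dec 0 s Hs) as [Hp|<-].
    + exists (fun u _ => Rabs (u - s) < s), (rot_map (rot_surface tau e A th z)),
        (nrm (rot_surface tau e A th z)). split.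
      * apply (param_off_axis _ _ _ _ _ s); simpl.
        -- exact Hp.
        -- apply Rmult_lt_0_compat; [exact Hp|apply HP].
        -- intros r Hr. apply Rabs_def2 in Hr. lra.
        -- reflexivity.
        -- now split.
      * apply (strip_immersion s s); try assumption; [apply Rle_refl|reflexivity|now split].
    + exists (disc 1), (disk_map A z), (disk_normal tau e A q th). split.
      * apply (param_on_axis _ _ _ _ _ 1 1); simpl.
        -- lra.
        -- ring.
        -- now left.
        -- intros r _. rewrite Rplus_0_l, Rmult_1_l. reflexivity.
        -- reflexivity.
        -- intros r t Hr. rewrite Rplus_0_l, Rmult_1_l. split.
           ++ apply disk_map_rot, Hr.
           ++ apply disk_normal_rot, Hr.
      * apply disk_immersion; [intros u v; apply open_disc_locally|now split].
  - intros s D F n Hs Hloc _ u v Huv.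
    destruct (surface_local_param s D F n Hs Hloc)
      as [[-> [d [Hd [HD HF]]]]|[Hp [d [Hd [HD HF]]]]].
    + apply (disk_translator d); [exact Hd|now apply HD| |].
      * intros a b Hab. now apply HF.
      * apply HF. now apply HD.
    + assert (Hu := proj1 (HD u v) Huv).
      assert (Hdp : 0 < d - Rabs (u - s)) by lra.
      assert (HF' : forall a b, Rabs (a - u) < d - Rabs (u - s) ->
         F a b = (x a * cos b, x a * sin b, z a)).
      { intros a b Hab. apply HF, HD. replace (a - s) with ((a - u) + (u - s)) by ring.
        eapply Rle_lt_trans; [apply Rabs_triang|lra]. }
      destruct Hloc as [d' Hd' Hrad Hdom HD' HF''|sg d' Hd' Hrad Hsg Hdom HD' HF''].
      2:{ simpl in Hrad. assert (0 < A s) by apply HP. nra. }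
      assert (Hu0 : 0 <= u).
      { apply (Hdom u). now apply (HD' u v). }
      (* The strip is open and contained in the half-line of admissible parameters, so it avoids
         [0]. *)
      assert (Hup : 0 < u).
      { destruct Hu0 as [|Hu0]; [assumption|]. exfalso. rewrite <- Hu0 in *.
        assert (Hneg : dom (rot_surface tau e A th z) (- (d' - Rabs (0 - s)) / 2)).
        { apply Hdom. assert (Rabs (0 - s) < d') by now apply (HD' 0 v).
          rewrite Rabs_left in * by lra. rewrite Rabs_left; lra. }
        simpl in Hneg. assert (Rabs (0 - s) < d') by now apply (HD' 0 v). lra. }
      destruct (HF u v Huv) as [EF En].
      set (C := fun s => cos (th s)). set (Sn := fun s => sin (th s)).
      assert (Hx : 0 < x u) by (unfold x; apply Rmult_lt_0_compat; [exact Hup|apply HP]).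
      rewrite (mean_curvature_polar tau e F n u v x z (fun _ => 1) C Sn 0
        (2 * (cos (th u) * / W tau (x u) + mu) - q u) (d - Rabs (u - s)) Hdp HF').
      * rewrite EF, En. unfold rot_map, rot_surface; simpl. fold (x u).
        replace dz with (frame (cos v) (sin v) 0 0 1) by (unfold dz, frame; apply pt_eq; ring).
        transitivity (inner tau (x u * cos v, x u * sin v, z u) (frame (cos v) (sin v) 0 0 1)
          (unit_normal tau e (x u) (cos (th u)) (sin (th u)) (cos v) (sin v)) + e * mu);
          [|unfold inner; ring].
        rewrite inner_unit_normal by apply sqr_sum_trig.
        unfold Sn. rewrite (pr_sin _ _ _ _ _ _ HP u). fold (x u).
        pose proof (W_pos tau (x u)). field. lra.
      * intros a _. rewrite Rmult_1_l. apply x_deriv.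
      * intros a _. eapply is_derive_eq; [apply z_deriv|]. unfold Sn. ring.
      * apply deriv_const.
      * eapply is_derive_eq; [apply (deriv_comp cos th); [apply th_deriv|apply is_derive_cos]|].
        unfold Sn. ring.
      * eapply is_derive_eq; [apply (deriv_comp sin th); [apply th_deriv|apply is_derive_sin]|].
        unfold C. ring.
      * lra.
      * lra.
      * apply sqr_cos_sin.
      * rewrite En. reflexivity.
Qed.

Lemma surface_disk :
  disk_parametrization tau (rot_surface tau e A th z) (disk_map A z) (disk_normal tau e A q th).
Proof.
  split; [|split].
  - apply disk_immersion; [|now split]. intros u v _. now apply locally_2d_forall.
  - reflexivity.
  - intros s t Hs. split; [now apply disk_map_rot|now apply disk_normal_rot].
Qed.

Lemma surface_axis : intersects_axis_with_normal (rot_surface tau e A th z) (0, 0, e).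
Proof.
  exists 0. simpl. split; [lra|]. split; [ring|]. intros t.
  rewrite Rmult_0_l, (pr_th_0 _ _ _ _ _ _ HP), cos_0, sin_0.
  unfold unit_normal, frame, W. rewrite !Rmult_0_r, Rplus_0_r, sqrt_1. apply pt_eq; field.
Qed.
End Surface.

(** * Asymptotics of the profile *)

Definition tends (f : R -> R) (l : R) : Prop :=
  forall eps, 0 < eps -> exists S, forall s, S <= s -> Rabs (f s - l) < eps.

Definition diverges (f : R -> R) : Prop :=
  forall M, exists S, forall s, S <= s -> M < f s.

Lemma is_lim_tends (f : R -> R) (l : R) : is_lim f p_infty l -> tends f l.
Proof.
  intros H eps He. apply is_lim_spec in H. destruct (H (mkposreal eps He)) as [S HS].
  exists (S + 1). intros s Hs. apply HS. lra.
Qed.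

Lemma tends_of_bound (f g : R -> R) (C S l : R) : tends g 0 ->
  (forall s, S <= s -> Rabs (f s - l) <= C * Rabs (g s)) -> tends f l.
Proof.
  intros Hg H eps He. assert (Hc : 0 < Rabs C + 1) by (pose proof (Rabs_pos C); lra).
  destruct (Hg (eps / (Rabs C + 1))) as [S' HS']; [now apply Rdiv_lt_0_compat|].
  exists (Rmax S S'). intros s Hs.
  pose proof (Rmax_l S S'). pose proof (Rmax_r S S').
  specialize (H s ltac:(lra)). specialize (HS' s ltac:(lra)). rewrite Rminus_0_r in HS'.
  apply Rlt_div_r in HS'; [|exact Hc].
  pose proof (Rle_abs C). pose proof (Rabs_pos (g s)). nra.
Qed.

Lemma tends_plus (f g : R -> R) (a b : R) :
  tends f a -> tends g b -> tends (fun s => f s + g s) (a + b).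
Proof.
  intros Hf Hg eps He. destruct (Hf (eps / 2)) as [S HS]; [lra|].
  destruct (Hg (eps / 2)) as [S' HS']; [lra|].
  exists (Rmax S S'). intros s Hs.
  pose proof (Rmax_l S S'). pose proof (Rmax_r S S').
  specialize (HS s ltac:(lra)). specialize (HS' s ltac:(lra)).
  replace (f s + g s - (a + b)) with ((f s - a) + (g s - b)) by ring.
  eapply Rle_lt_trans; [apply Rabs_triang|lra].
Qed.

Lemma tends_eventually_gt (f : R -> R) (l c : R) : tends f l -> c < l ->
  exists S, forall s, S <= s -> c < f s.
Proof.
  intros H Hc. destruct (H (l - c)) as [S HS]; [lra|]. exists S. intros s Hs.
  specialize (HS s Hs). apply Rabs_def2 in HS. lra.
Qed.

Lemma tends_eventually_lt (f : R -> R) (l c : R) : tends f l -> l < c ->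
  exists S, forall s, S <= s -> f s < c.
Proof.
  intros H Hc. destruct (H (c - l)) as [S HS]; [lra|]. exists S. intros s Hs.
  specialize (HS s Hs). apply Rabs_def2 in HS. lra.
Qed.

Lemma diverges_of_deriv (f df : R -> R) (S c : R) : 0 < c ->
  (forall s, S <= s -> is_derive f s (df s)) -> (forall s, S <= s -> c <= df s) -> diverges f.
Proof.
  intros Hc Hf Hd M. exists (S + (Rmax 0 (M - f S) + 1) / c). intros s Hs.
  pose proof (Rmax_l 0 (M - f S)). pose proof (Rmax_r 0 (M - f S)).
  assert (H1 : 0 < (Rmax 0 (M - f S) + 1) / c) by (apply Rdiv_lt_0_compat; lra).
  assert (H2 : f S - c * S <= f s - c * s).
  { apply (nondecreasing_of_deriv (fun s => f s - c * s) (fun s => df s - c)); [lra| | |].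
    - intros r Hr. apply (cont_minus f (fun r => c * r)).
      + eapply is_derive_continuous, Hf. lra.
      + apply (cont_mult (fun _ => c) (fun r => r)); [apply cont_const|apply cont_id].
    - intros r Hr. apply (deriv_minus f (fun r => c * r)); [apply Hf; lra|].
      eapply is_derive_eq; [apply deriv_scal, deriv_id|ring].
    - intros r Hr. specialize (Hd r ltac:(lra)). lra. }
  assert (H3 : c * ((Rmax 0 (M - f S) + 1) / c) = Rmax 0 (M - f S) + 1) by (field; lra).
  assert (c * ((Rmax 0 (M - f S) + 1) / c) <= c * (s - S)) by (apply Rmult_le_compat_l; lra).
  lra.
Qed.

Lemma plane_tends (f : R -> R) (l : R) (h : R -> R -> R) :
  (forall u v, h u v = f (rho u v)) -> tends f l -> tends_at_infinity h l.
Proof.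
  intros Hh Hf P [eps HP]. destruct (Hf eps (cond_pos eps)) as [S HS].
  exists (Rmax S 0 * Rmax S 0). intros u v Huv. cbn [fst snd]. apply HP. rewrite Hh. apply HS.
  rewrite <- rho_sqr in Huv. pose proof (rho_pos u v). pose proof (Rmax_l S 0). pose proof (Rmax_r S 0). nra.
Qed.

Lemma plane_diverges (f : R -> R) (h : R -> R -> R) :
  (forall u v, h u v = f (rho u v)) -> diverges f -> tends_at_infinity h p_infty.
Proof.
  intros Hh Hf P [M HP]. destruct (Hf M) as [S HS].
  exists (Rmax S 0 * Rmax S 0). intros u v Huv. cbn [fst snd]. apply HP. rewrite Hh. apply HS.
  rewrite <- rho_sqr in Huv. pose proof (rho_pos u v). pose proof (Rmax_l S 0). pose proof (Rmax_r S 0). nra.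
Qed.

Lemma plane_diverges_neg (f : R -> R) (h : R -> R -> R) :
  (forall u v, h u v = f (rho u v)) -> diverges (fun s => - f s) -> tends_at_infinity h m_infty.
Proof.
  intros Hh Hf P [M HP]. destruct (Hf (- M)) as [S HS].
  exists (Rmax S 0 * Rmax S 0). intros u v Huv. cbn [fst snd]. apply HP. rewrite Hh.
  assert (- M < - f (rho u v)); [|lra]. apply HS.
  rewrite <- rho_sqr in Huv. pose proof (rho_pos u v). pose proof (Rmax_l S 0). pose proof (Rmax_r S 0). nra.
Qed.

Section Asymptotics.
Variables (tau mu : R) (A q th z : R -> R).
Hypothesis HP : profile tau mu A q th z.

Definition prad (A : R -> R) (s : R) : R := s * A s.
Definition kr (tau mu : R) (A q th : R -> R) (s : R) : R :=
  2 * (cos (th s) * / W tau (prad A s) + mu) - q s.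
Definition Jr (mu : R) (A th : R -> R) (s : R) : R :=
  prad A s * sin (th s) - mu * (prad A s * prad A s).

Notation x := (prad A).
Notation k := (kr tau mu A q th).
Notation J := (Jr mu A th).
Notation w s := (/ W tau (x s)).

Lemma x_deriv (s : R) : is_derive x s (cos (th s)).
Proof. exact (pr_x _ _ _ _ _ _ HP s). Qed.

Lemma th_deriv (s : R) : is_derive th s (k s).
Proof. exact (pr_th _ _ _ _ _ _ HP s). Qed.

Lemma z_deriv (s : R) : is_derive z s (sin (th s) * W tau (x s)).
Proof. exact (pr_z _ _ _ _ _ _ HP s). Qed.

Lemma sin_x_q (s : R) : sin (th s) = x s * q s.
Proof. exact (pr_sin _ _ _ _ _ _ HP s). Qed.

Lemma cos_deriv (s : R) : is_derive (fun s => cos (th s)) s (- (sin (th s) * k s)).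
Proof.
  eapply is_derive_eq; [apply (deriv_comp cos th); [apply th_deriv|apply is_derive_cos]|ring].
Qed.

Lemma sin_deriv (s : R) : is_derive (fun s => sin (th s)) s (cos (th s) * k s).
Proof.
  eapply is_derive_eq; [apply (deriv_comp sin th); [apply th_deriv|apply is_derive_sin]|ring].
Qed.

Lemma x_pos (s : R) : 0 < s -> 0 < x s.
Proof. intros Hs. apply Rmult_lt_0_compat; [exact Hs|apply (pr_A_pos _ _ _ _ _ _ HP)]. Qed.

Lemma x_0 : x 0 = 0.
Proof. apply Rmult_0_l. Qed.

Lemma w_deriv (s : R) : is_derive (fun s => w s) s
  (- (cos (th s) * (tau * tau * x s / (W tau (x s) * W tau (x s) * W tau (x s))))).
Proof.
  eapply is_derive_eq; [apply (deriv_comp (fun x => / W tau x) x); [apply x_deriv|apply Winv_derive]|ring].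
Qed.

Lemma J_deriv (s : R) : is_derive J s (2 * x s * w s * (cos (th s) * cos (th s))).
Proof.
  eapply is_derive_eq.
  - apply (deriv_minus (fun s => x s * sin (th s)) (fun s => mu * (x s * x s))).
    + apply (deriv_mult x (fun s => sin (th s))); [apply x_deriv|apply sin_deriv].
    + apply deriv_scal, deriv_mult; apply x_deriv.
  - cbv beta. unfold kr. rewrite sin_x_q. ring.
Qed.

Lemma J_0 : J 0 = 0.
Proof. unfold Jr. rewrite x_0. ring. Qed.

Lemma J_incr (s r : R) : 0 <= s <= r -> J s <= J r.
Proof.
  intros H. apply (nondecreasing_of_deriv J (fun s => 2 * x s * w s * (cos (th s) * cos (th s)))).
  - lra.
  - intros t _. eapply is_derive_continuous, J_deriv.
  - intros t _. apply J_deriv.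
  - intros t Ht. pose proof (x_pos t ltac:(lra)). pose proof (Winv_bounds tau (x t)).
    apply Rmult_le_pos; [apply Rmult_le_pos; lra|nra].
Qed.

Lemma th_continuous (s : R) : continuous th s.
Proof. eapply is_derive_continuous, th_deriv. Qed.

Lemma cos_pos_near_0 : exists d, 0 < d /\ forall s, Rabs s < d -> / 2 < cos (th s).
Proof.
  assert (Hc : continuous (fun s => cos (th s)) 0) by (eapply is_derive_continuous, cos_deriv).
  assert (H0 : cos (th 0) = 1) by (rewrite (pr_th_0 _ _ _ _ _ _ HP); apply cos_0).
  destruct (proj1 (continuous_eps _ 0) Hc (/ 2)) as [d [Hd Hd']]; [lra|].
  exists d. split; [exact Hd|]. intros s Hs. specialize (Hd' s). rewrite Rminus_0_r in Hd'.
  specialize (Hd' Hs). apply Rabs_def2 in Hd'. rewrite H0 in Hd'. lra.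
Qed.

Lemma J_pos (s : R) : 0 < s -> 0 < J s.
Proof.
  intros Hs. destruct cos_pos_near_0 as [d [Hd Hcos]].
  set (r := Rmin s (d / 2)). pose proof (Rmin_l s (d / 2)). pose proof (Rmin_r s (d / 2)).
  assert (Hr : 0 < r) by (apply Rmin_glb_lt; lra).
  apply Rlt_le_trans with (J r); [|apply J_incr; unfold r in *; lra].
  rewrite <- J_0.
  apply (increasing_of_deriv J (fun s => 2 * x s * w s * (cos (th s) * cos (th s)))).
  - exact Hr.
  - intros t _. eapply is_derive_continuous, J_deriv.
  - intros t _. apply J_deriv.
  - intros t Ht. pose proof (x_pos t ltac:(lra)). pose proof (Winv_bounds tau (x t)).
    assert (/ 2 < cos (th t)) by (apply Hcos; rewrite Rabs_right; unfold r in *; lra).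
    apply Rmult_lt_0_compat; [apply Rmult_lt_0_compat; lra|nra].
Qed.

Lemma x_lower (s : R) : 1 <= s -> 0 <= mu -> J 1 <= x s.
Proof.
  intros Hs Hmu. pose proof (J_incr 1 s ltac:(lra)). pose proof (x_pos s ltac:(lra)).
  pose proof (SIN_bound (th s)). unfold Jr in *.
  assert (x s * sin (th s) <= x s * 1) by (apply Rmult_le_compat_l; lra).
  assert (0 <= mu * (x s * x s)) by (apply Rmult_le_pos; nra). lra.
Qed.

Lemma q_deriv (s : R) : 0 < s ->
  is_derive q s ((cos (th s) * k s - q s * cos (th s)) / x s).
Proof.
  intros Hs. pose proof (x_pos s Hs).
  apply (is_derive_ext_loc (fun s => sin (th s) / x s)).
  - exists (mkposreal s Hs). intros y Hy. assert (Hy' : Rabs (y - s) < s) by exact Hy.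
    apply Rabs_def2 in Hy'. pose proof (x_pos y ltac:(lra)).
    change (sin (th y) / x y = q y). rewrite sin_x_q. field. lra.
  - eapply is_derive_eq.
    + apply (deriv_div (fun s => sin (th s)) x); [apply sin_deriv|apply x_deriv|lra].
    + cbv beta. rewrite sin_x_q. field. lra.
Qed.

Lemma W_le (y c : R) : 0 <= y <= c -> W tau y <= 1 + tau * tau * (c * c).
Proof.
  intros H. pose proof (W_ge_1 tau y). pose proof (W_sqr tau y).
  assert (0 <= tau * tau) by nra.
  assert (tau * tau * (y * y) <= tau * tau * (c * c)) by (apply Rmult_le_compat_l; nra). nra.
Qed.

Lemma cos_sqr_sin_sqr (s : R) : cos (th s) * cos (th s) + sin (th s) * sin (th s) = 1.
Proof. apply sqr_sum_trig. Qed.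

(* A profile staying in a compact set of distances to the axis is asymptotic to a
   curve with [cos th = 0], [th' = 0]. *)
Lemma bounded_profile (c C : R) : 0 < c -> (forall s, 1 <= s -> c <= x s <= C) ->
  tends (fun s => cos (th s)) 0 /\ tends k 0 /\ tends q (2 * mu).
Proof.
  intros Hc Hx.
  assert (HC : 0 < C) by (specialize (Hx 1 (Rle_refl 1)); lra).
  assert (Hq : forall s, 1 <= s -> Rabs (q s) <= / c).
  { intros s Hs. destruct (Hx s Hs) as [H1 H2].
    assert (E : Rabs (x s) * Rabs (q s) <= 1).
    { rewrite <- Rabs_mult, <- sin_x_q. apply Rabs_le, SIN_bound. }
    rewrite (Rabs_right (x s)) in E by lra. pose proof (Rabs_pos (q s)).
    apply (Rmult_le_reg_l c); [lra|]. rewrite Rinv_r by lra. nra. }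
  set (Kb := 2 * (1 + Rabs mu) + / c).
  assert (Hcp : 0 < / c) by (now apply Rinv_0_lt_compat).
  assert (HKb : 0 < Kb) by (unfold Kb; pose proof (Rabs_pos mu); lra).
  assert (Hcos : forall s, Rabs (cos (th s)) <= 1) by (intros; apply Rabs_le, COS_bound).
  assert (Hsin : forall s, Rabs (sin (th s)) <= 1) by (intros; apply Rabs_le, SIN_bound).
  assert (Hw : forall s, Rabs (w s) <= 1).
  { intros s. pose proof (Winv_bounds tau (x s)). apply Rabs_le. lra. }
  assert (Hprod : forall a b M N, Rabs a <= M -> Rabs b <= N -> Rabs (a * b) <= M * N).
  { intros a b M N Ha Hb. rewrite Rabs_mult.
    apply Rmult_le_compat; try apply Rabs_pos; assumption. }
  assert (Hsum : forall a b M N, Rabs a <= M -> Rabs b <= N -> Rabs (a + b) <= M + N).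
  { intros a b M N Ha Hb. eapply Rle_trans; [apply Rabs_triang|lra]. }
  assert (Hopp : forall a M, Rabs a <= M -> Rabs (- a) <= M).
  { intros a M Ha. now rewrite Rabs_Ropp. }
  assert (H2 : Rabs 2 <= 2) by (rewrite Rabs_right; lra).
  assert (Hk : forall s, 1 <= s -> Rabs (k s) <= Kb).
  { intros s Hs. unfold kr, Kb. apply Hsum; [|apply Hopp, Hq, Hs].
    apply Hprod; [exact H2|]. apply Hsum; [|apply Rle_refl].
    replace 1 with (1 * 1) by ring. apply Hprod; [apply Hcos|apply Hw]. }
  assert (Hxa : forall s, 1 <= s -> Rabs (x s) <= C).
  { intros s Hs. specialize (Hx s Hs). rewrite Rabs_right; lra. }
  set (Wb := tau * tau * C).
  assert (Hwd : forall s, 1 <= s ->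
    Rabs (tau * tau * x s / (W tau (x s) * W tau (x s) * W tau (x s))) <= Wb).
  { intros s Hs. pose proof (W_ge_1 tau (x s)). destruct (Hx s Hs).
    assert (1 <= W tau (x s) * W tau (x s) * W tau (x s)) by nra.
    assert (0 <= tau * tau * x s) by (apply Rmult_le_pos; nra).
    rewrite Rabs_right.
    - apply Rle_div_l; [lra|]. unfold Wb.
      assert (tau * tau * x s <= tau * tau * C) by (apply Rmult_le_compat_l; nra). nra.
    - apply Rle_ge. apply Rdiv_le_0_compat; lra. }
  assert (Hlim : exists l : R, is_lim J p_infty l).
  { apply (bounded_monotone_limit J 1 (C + Rabs mu * (C * C))).
    - intros s r Hsr. apply J_incr. lra.
    - intros s Hs. unfold Jr. destruct (Hx s Hs). pose proof (SIN_bound (th s)).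
      pose proof (Rabs_maj2 mu).
      assert (x s * sin (th s) <= C * 1) by (apply Rle_trans with (x s * 1); [apply Rmult_le_compat_l; lra|lra]).
      assert (- mu * (x s * x s) <= Rabs mu * (x s * x s)) by (apply Rmult_le_compat_r; nra).
      assert (Rabs mu * (x s * x s) <= Rabs mu * (C * C)).
      { apply Rmult_le_compat_l; [apply Rabs_pos|nra]. }
      lra. }
  destruct Hlim as [l Hl].
  assert (T1 : tends (fun s => 2 * x s * w s * (cos (th s) * cos (th s))) 0).
  { apply is_lim_tends.
    apply (derivative_vanishes_at_infinity J (fun s => 2 * x s * w s * (cos (th s) * cos (th s)))
      (fun s => (2 * cos (th s) * w s
        + 2 * x s * - (cos (th s) * (tau * tau * x s / (W tau (x s) * W tau (x s) * W tau (x s)))))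
         * (cos (th s) * cos (th s))
        + 2 * x s * w s * (- (sin (th s) * k s) * cos (th s) + cos (th s) * - (sin (th s) * k s)))
      ((2 * 1 * 1 + 2 * C * (1 * Wb)) * (1 * 1) + 2 * C * 1 * (1 * Kb * 1 + 1 * (1 * Kb))) 1 l).
    - intros s _. apply J_deriv.
    - intros s _. apply (deriv_mult (fun s => 2 * x s * w s) (fun s => cos (th s) * cos (th s))).
      + apply (deriv_mult (fun s => 2 * x s) (fun s => w s)).
        * apply deriv_scal, x_deriv.
        * apply w_deriv.
      + apply (deriv_mult (fun s => cos (th s)) (fun s => cos (th s))); apply cos_deriv.
    (* The bound has been written with the same tree of sums and products as the second derivative,
       so it is checked term by term. *)
    - intros s Hs. repeat first [exact H2|apply Hcos|apply Hsin|apply Hw|apply Hk, Hs|apply Hxa, Hs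
        |apply Hwd, Hs|apply Hsum|apply Hopp|apply Hprod].
    - exact Hl. }
  assert (T2 : tends (fun s => cos (th s) * cos (th s)) 0).
  { apply (tends_of_bound _ _ ((1 + tau * tau * (C * C)) / (2 * c)) 1 0 T1).
    intros s Hs. destruct (Hx s Hs). rewrite Rminus_0_r.
    pose proof (W_le (x s) C ltac:(lra)). pose proof (W_pos tau (x s)).
    rewrite !(Rabs_mult (2 * x s * w s)), !(Rabs_right (2 * x s * w s)).
    2:{ apply Rle_ge. pose proof (Winv_bounds tau (x s)). apply Rmult_le_pos; lra. }
    rewrite <- Rmult_assoc. rewrite <- (Rmult_1_l (Rabs (cos (th s) * cos (th s)))) at 1.
    apply Rmult_le_compat_r; [apply Rabs_pos|].
    apply (Rmult_le_reg_r (2 * c * W tau (x s))); [apply Rmult_lt_0_compat; lra|].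
    replace ((1 + tau * tau * (C * C)) / (2 * c) * (2 * x s * w s) * (2 * c * W tau (x s)))
      with ((1 + tau * tau * (C * C)) * (2 * x s)) by (field; split; lra).
    rewrite Rmult_1_l.
    apply Rle_trans with (2 * c * (1 + tau * tau * (C * C))).
    - apply Rmult_le_compat_l; lra.
    - assert (0 <= 1 + tau * tau * (C * C)) by lra. nra. }
  assert (T3 : tends (fun s => cos (th s)) 0).
  { intros eps He. destruct (T2 (eps * eps)) as [S HS]; [nra|]. exists S. intros s Hs.
    specialize (HS s Hs). rewrite Rminus_0_r in *.
    rewrite Rabs_mult in HS. pose proof (Rabs_pos (cos (th s))). nra. }
  (* Barbalat again, now for [cos th] itself, whose limit has just been found. Its second derivative
     involves that of [q], which is bounded because [x >= c]. *)
  assert (T4 : tends (fun s => - (sin (th s) * k s)) 0).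
  { apply is_lim_tends.
    apply (derivative_vanishes_at_infinity (fun s => cos (th s)) (fun s => - (sin (th s) * k s))
      (fun s => - (cos (th s) * k s * k s + sin (th s) *
         (2 * ((- (sin (th s) * k s)) * w s + cos (th s) *
           - (cos (th s) * (tau * tau * x s / (W tau (x s) * W tau (x s) * W tau (x s))))) +
          - ((cos (th s) * k s + - (q s * cos (th s))) * / x s))))
      (1 * Kb * Kb + 1 * (2 * ((1 * Kb) * 1 + 1 * (1 * Wb)) + (1 * Kb + / c * 1) * / c)) 1 0).
    - intros s _. apply cos_deriv.
    - intros s Hs. apply deriv_opp.
      apply (deriv_mult (fun s => sin (th s)) k); [apply sin_deriv|].
      eapply is_derive_eq.
      + apply (deriv_minus (fun s => 2 * (cos (th s) * w s + mu)) q).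
        * apply deriv_scal. apply (deriv_plus (fun s => cos (th s) * w s) (fun _ => mu));
            [|apply deriv_const].
          apply (deriv_mult (fun s => cos (th s)) (fun s => w s)); [apply cos_deriv|apply w_deriv].
        * apply q_deriv. lra.
      + unfold Rdiv. ring.
    - intros s Hs. assert (Hix : Rabs (/ x s) <= / c).
      { destruct (Hx s Hs). rewrite Rabs_right; [apply Rinv_le_contravar; lra|].
        apply Rle_ge, Rlt_le, Rinv_0_lt_compat. lra. }
      repeat first [exact H2|apply Hcos|apply Hsin|apply Hw|apply Hk, Hs|apply Hxa, Hs
        |apply Hq, Hs|exact Hix|apply Hwd, Hs|apply Hsum|apply Hopp|apply Hprod].
    - apply is_lim_spec. intros eps. destruct (T3 eps (cond_pos eps)) as [S HS].
      exists S. intros s Hs. apply HS. lra. }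
  (* In [k = sin^2 th * k + cos^2 th * k] the first term tends to [0] by [T4], the second by [T2]
     since [k] is bounded. *)
  assert (T5 : tends k 0).
  { replace 0 with (0 + 0) by ring.
    assert (Ta : tends (fun s => sin (th s) * (sin (th s) * k s)) 0).
    { apply (tends_of_bound _ _ 1 1 0 T4). intros s Hs. rewrite Rminus_0_r, Rabs_Ropp, (Rabs_mult (sin (th s))).
      specialize (Hsin s). pose proof (Rabs_pos (sin (th s) * k s)). nra. }
    assert (Tb : tends (fun s => cos (th s) * cos (th s) * k s) 0).
    { apply (tends_of_bound _ _ Kb 1 0 T2). intros s Hs. rewrite Rminus_0_r, (Rabs_mult (_ * _)).
      specialize (Hk s Hs). pose proof (Rabs_pos (cos (th s) * cos (th s))). nra. }
    pose proof (tends_plus _ _ _ _ Ta Tb) as Tc.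
    intros eps He. destruct (Tc eps He) as [S HS]. exists S. intros s Hs. specialize (HS s Hs).
    replace (k s) with (sin (th s) * (sin (th s) * k s) + cos (th s) * cos (th s) * k s); [exact HS|].
    transitivity ((cos (th s) * cos (th s) + sin (th s) * sin (th s)) * k s); [ring|].
    rewrite cos_sqr_sin_sqr. ring. }
  split; [exact T3|]. split; [exact T5|].
  assert (Tw : tends (fun s => 2 * (cos (th s) * w s)) 0).
  { apply (tends_of_bound _ _ 2 1 0 T3). intros s _. rewrite Rminus_0_r, !Rabs_mult, (Rabs_right 2) by lra.
    specialize (Hw s). pose proof (Rabs_pos (cos (th s))). pose proof (Rabs_pos (w s)). nra. }
  assert (Tk : tends (fun s => - k s) 0).
  { apply (tends_of_bound _ _ 1 1 0 T5). intros s _. rewrite Rminus_0_r, Rabs_Ropp. lra. }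
  pose proof (tends_plus _ _ _ _ Tw Tk) as Tc.
  intros eps He. destruct (Tc eps He) as [S HS]. exists S. intros s Hs. specialize (HS s Hs).
  replace (q s - 2 * mu) with (2 * (cos (th s) * w s) + - k s - (0 + 0)); [exact HS|].
  unfold kr. ring.
Qed.

(** Divided by [x], the inequality [J > 0] reads [sin th > mu x]. *)
Lemma x_bound_pos (s : R) : 0 < mu -> 0 < s -> x s < / mu /\ 0 < sin (th s).
Proof.
  intros Hmu Hs. pose proof (J_pos s Hs) as HJ. pose proof (x_pos s Hs) as Hx.
  unfold Jr in HJ. assert (H1 : 0 < sin (th s) - mu * x s).
  { apply (Rmult_lt_reg_l (x s)); [exact Hx|]. lra. }
  pose proof (SIN_bound (th s)). split; [|nra].
  apply (Rmult_lt_reg_l mu); [exact Hmu|]. rewrite Rinv_r by lra. lra.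
Qed.

(** [bounded_profile] applies with [J 1 <= x <= 1 / mu]. The positivity of [sin th] selects the
    limit [1], and [x = sin th / q] with [q] tending to [2 mu] gives the radius. *)
Lemma cylinder_limit : 0 < mu ->
  tends x (/ (2 * mu)) /\ tends (fun s => sin (th s)) 1 /\ diverges z.
Proof.
  intros Hmu.
  assert (HJ : 0 < J 1) by (apply J_pos; lra).
  destruct (bounded_profile (J 1) (/ mu) HJ) as [T1 [T2 T3]].
  { intros s Hs. split; [apply x_lower; lra|]. left. apply x_bound_pos; lra. }
  assert (Ts : tends (fun s => sin (th s)) 1).
  { apply (tends_of_bound _ _ 1 1 1 T1). intros s Hs.
    destruct (x_bound_pos s Hmu ltac:(lra)) as [_ Hs0]. pose proof (SIN_bound (th s)).
    pose proof (cos_sqr_sin_sqr s) as E. pose proof (COS_bound (th s)).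
    rewrite Rmult_1_l, Rabs_left1 by lra.
    assert (Ec : Rabs (cos (th s)) * Rabs (cos (th s)) = cos (th s) * cos (th s)).
    { rewrite <- Rabs_mult. apply Rabs_right. nra. }
    pose proof (Rabs_pos (cos (th s))).
    assert (Rabs (cos (th s)) <= 1) by (apply Rabs_le; lra). nra. }
  split; [|split; [exact Ts|]].
  - set (S0 := tends_eventually_gt q (2 * mu) mu T3 ltac:(lra)). destruct S0 as [S0 HS0].
    assert (Tq : tends (fun s => q s - 2 * mu) 0).
    { intros eps He. destruct (T3 eps He) as [S HS]. exists S. intros s Hs. rewrite Rminus_0_r.
      now apply HS. }
    assert (Tsn : tends (fun s => sin (th s) - 1) 0).
    { intros eps He. destruct (Ts eps He) as [S HS]. exists S. intros s Hs. rewrite Rminus_0_r.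
      now apply HS. }
    assert (Td : tends (fun s => Rabs (sin (th s) - 1) + Rabs (q s - 2 * mu)) 0).
    { replace 0 with (0 + 0) by ring. apply tends_plus.
      - apply (tends_of_bound _ _ 1 1 0 Tsn). intros s _. rewrite Rminus_0_r, Rabs_Rabsolu. lra.
      - apply (tends_of_bound _ _ 1 1 0 Tq). intros s _. rewrite Rminus_0_r, Rabs_Rabsolu. lra. }
    apply (tends_of_bound _ _ (/ mu + / (2 * mu * mu)) (Rmax S0 1) (/ (2 * mu)) Td).
    intros s Hs. pose proof (Rmax_l S0 1). pose proof (Rmax_r S0 1).
    specialize (HS0 s ltac:(lra)).
    assert (Ex : x s = sin (th s) / q s) by (rewrite sin_x_q; field; lra).
    rewrite Ex.
    replace (sin (th s) / q s - / (2 * mu)) with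
      ((sin (th s) - 1) * / q s + - (q s - 2 * mu) * / (2 * mu * q s)) by (field; lra).
    set (a := Rabs (sin (th s) - 1)). set (b := Rabs (q s - 2 * mu)).
    assert (0 <= a) by apply Rabs_pos. assert (0 <= b) by apply Rabs_pos.
    rewrite (Rabs_right (a + b)) by lra.
    eapply Rle_trans; [apply Rabs_triang|]. rewrite !Rabs_mult, Rabs_Ropp. fold a b.
    assert (H3 : Rabs (/ q s) <= / mu).
    { rewrite Rabs_right; [apply Rinv_le_contravar; lra|].
      apply Rle_ge, Rlt_le, Rinv_0_lt_compat. lra. }
    assert (H4 : Rabs (/ (2 * mu * q s)) <= / (2 * mu * mu)).
    { assert (0 < 2 * mu * mu) by nra. assert (2 * mu * mu <= 2 * mu * q s) by nra.
      rewrite Rabs_right; [apply Rinv_le_contravar; lra|].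
      apply Rle_ge, Rlt_le, Rinv_0_lt_compat. lra. }
    assert (0 <= / mu) by (apply Rlt_le, Rinv_0_lt_compat; lra).
    assert (0 <= / (2 * mu * mu)) by (apply Rlt_le, Rinv_0_lt_compat; nra).
    nra.
  - destruct (tends_eventually_gt _ 1 (/ 2) Ts ltac:(lra)) as [S HS].
    apply (diverges_of_deriv z (fun s => sin (th s) * W tau (x s)) S (/ 2)); [lra| |].
    + intros s _. apply z_deriv.
    + intros s Hs. specialize (HS s Hs). pose proof (W_ge_1 tau (x s)). nra.
Qed.

(* If [x] were bounded, [q] would tend to [2 mu], and [J = x^2 (q - mu)] would become
   negative. *)
Lemma x_unbounded : mu < 0 -> diverges x.
Proof.
  intros Hmu M. apply NNPP. intros Hn.
  assert (HJ1 : 0 < J 1) by (apply J_pos; lra).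
  set (C := Rmax M 1).
  assert (HC : 1 <= C) by apply Rmax_r. assert (HCM : M <= C) by apply Rmax_l.
  (* If [x] does not diverge, it returns below [M] at arbitrarily late parameters, where [J] is at
     most this constant. Monotonicity extends the bound to all of [J], and a bounded [J] bounds [x]
     because [J >= - mu x^2 - x]. *)
  assert (HJC : forall s, 0 <= s -> J s <= C - mu * (C * C)).
  { intros s Hs. apply Rnot_lt_le. intros Hlt. apply Hn. exists (Rmax s 1). intros r Hr.
    pose proof (Rmax_l s 1). pose proof (Rmax_r s 1).
    pose proof (J_incr s r ltac:(lra)) as HJ. pose proof (x_pos r ltac:(lra)) as Hx.
    apply Rnot_le_lt. intros Hle. unfold Jr at 2 in HJ. pose proof (SIN_bound (th r)).
    assert (x r * sin (th r) <= C * 1).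
    { apply Rle_trans with (x r * 1); [apply Rmult_le_compat_l; lra|lra]. }
    assert (- mu * (x r * x r) <= - mu * (C * C)) by (apply Rmult_le_compat_l; nra). lra. }
  set (B := C - mu * (C * C)) in *.
  assert (HB : 0 < B) by (unfold B; nra).
  assert (Hbd : forall s, 1 <= s -> Rmin 1 (J 1 / (1 - mu)) <= x s <= Rmax (1 + 1) ((1 + B) / (- mu))).
  { intros s Hs. pose proof (x_pos s ltac:(lra)) as Hx. pose proof (J_incr 1 s ltac:(lra)) as H1.
    specialize (HJC s ltac:(lra)). unfold Jr in HJC. unfold Jr at 2 in H1.
    pose proof (SIN_bound (th s)).
    assert (H2 : x s * -1 <= x s * sin (th s) <= x s * 1) by (split; apply Rmult_le_compat_l; lra).
    split.
    - destruct (Rle_dec 1 (x s)) as [|Hx1]; [eapply Rle_trans; [apply Rmin_l|assumption]|].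
      eapply Rle_trans; [apply Rmin_r|]. apply Rle_div_l; [lra|].
      assert (x s * x s <= x s) by nra.
      assert (- mu * (x s * x s) <= - mu * x s) by (apply Rmult_le_compat_l; lra). lra.
    - apply Rnot_lt_le. intros Hlt.
      assert (H3 : 1 + 1 < x s) by (eapply Rle_lt_trans; [apply Rmax_l|exact Hlt]).
      assert (H4 : (1 + B) / (- mu) < x s) by (eapply Rle_lt_trans; [apply Rmax_r|exact Hlt]).
      assert (Hm : 0 < - mu) by lra.
      apply (Rlt_div_l (1 + B) (x s) (- mu) Hm) in H4.
      assert ((1 + B) * x s < x s * - mu * x s) by (apply Rmult_lt_compat_r; lra). nra. }
  assert (Hc : 0 < Rmin 1 (J 1 / (1 - mu))).
  { apply Rmin_glb_lt; [lra|]. apply Rdiv_lt_0_compat; lra. }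
  destruct (bounded_profile _ _ Hc Hbd) as [_ [_ Tq]].
  destruct (tends_eventually_lt q (2 * mu) mu Tq ltac:(lra)) as [S HS].
  set (s := Rmax S 1). pose proof (Rmax_l S 1). pose proof (Rmax_r S 1).
  specialize (HS s ltac:(unfold s; lra)).
  assert (Hs : 0 < s) by (unfold s; lra).
  pose proof (J_pos s Hs) as HJ. pose proof (x_pos s Hs) as Hx.
  unfold Jr in HJ. rewrite sin_x_q in HJ. nra.
Qed.
End Asymptotics.

(** * Properness, completeness and embeddedness of the models *)

Lemma W_ge_abs (tau y : R) : Rabs tau * Rabs y <= W tau y.
Proof.
  rewrite <- Rabs_mult, <- sqrt_Rsqr_abs. apply sqrt_le_1_alt. unfold Rsqr. nra.
Qed.

Section Global.
Variables (tau mu e : R) (A q th z : R -> R).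
Hypothesis Htau : tau <> 0.
Hypothesis He : e * e = 1.
Hypothesis HP : profile tau mu A q th z.

Notation x := (prad A).
Notation S0 := (rot_surface tau e A th z).

(** For [mu >= 0] one has [x sin th >= J], so [z' = W sin th >= |tau| x sin th >= |tau| J 1] from
    [s = 1] on. No bound on [x] enters, which covers [mu = 0]. *)
Lemma height_diverges : 0 <= mu -> diverges z.
Proof.
  intros Hmu. assert (HJ : 0 < Jr mu A th 1) by (apply (J_pos tau mu A q th z HP); lra).
  assert (Ht : 0 < Rabs tau) by now apply Rabs_pos_lt.
  apply (diverges_of_deriv z (fun s => sin (th s) * W tau (x s)) 1 (Rabs tau * Jr mu A th 1)).
  - now apply Rmult_lt_0_compat.
  - intros s _. apply (z_deriv tau mu A q th z HP).
  - intros s Hs. pose proof (x_pos tau mu A q th z HP s ltac:(lra)) as Hx.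
    pose proof (J_incr tau mu A q th z HP 1 s ltac:(lra)) as H1. unfold Jr at 2 in H1.
    pose proof (W_ge_abs tau (x s)) as HW. rewrite (Rabs_right (x s)) in HW by lra.
    assert (0 <= mu * (x s * x s)) by (apply Rmult_le_pos; nra).
    assert (Hs0 : 0 < sin (th s)).
    { apply (Rmult_lt_reg_l (x s)); [exact Hx|]. lra. }
    apply Rle_trans with (sin (th s) * (Rabs tau * x s)); [|apply Rmult_le_compat_l; lra].
    replace (sin (th s) * (Rabs tau * x s)) with (Rabs tau * (x s * sin (th s))) by ring.
    apply Rmult_le_compat_l; lra.
Qed.

Lemma disk_sqdist (u v : R) : sqdist (disk_map A z u v) (0, 0, 0) =
  x (rho u v) * x (rho u v) + z (rho u v) * z (rho u v).
Proof.
  destruct (polar_decomposition u v) as [c [s [Hcs [Hu Hv]]]].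
  rewrite (disk_map_frame A z u v c s Hu Hv).
  unfold sqdist, cx, cy, cz, prad; simpl. set (r := rho u v).
  transitivity (r * A r * (r * A r) * (c * c + s * s) + z r * z r); [ring|rewrite Hcs; ring].
Qed.

(** The height diverges for [mu >= 0], the radius for [mu < 0]. *)
Lemma disk_proper : proper (disk_map A z).
Proof.
  apply (plane_diverges (fun s => x s * x s + z s * z s)).
  - intros u v. apply disk_sqdist.
  - destruct (Rle_dec 0 mu) as [Hmu|Hmu].
    + intros M. destruct (height_diverges Hmu (Rmax M 1)) as [S HS]. exists S.
      intros s Hs. specialize (HS s Hs). pose proof (Rmax_l M 1). pose proof (Rmax_r M 1). nra.
    + intros M. destruct (x_unbounded tau mu A q th z HP ltac:(lra) (Rmax M 1)) as [S HS]. exists S.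
      intros s Hs. specialize (HS s Hs). pose proof (Rmax_l M 1). pose proof (Rmax_r M 1). nra.
Qed.

Lemma continuous_abs_le_sqrt (f : R -> R) (s : R) : continuous f s -> continuous (fun s => sqrt (f s)) s.
Proof. intros Hf. apply (cont_comp f sqrt); [exact Hf|apply continuous_sqrt]. Qed.

(* The orbit-space projection is a Riemannian submersion, and [s] is arc length there. *)
Lemma speed_lower_bound (C Sn X a' b' : R) : C * C + Sn * Sn = 1 ->
  Rabs a' <= sqrt (a' * C * (a' * C) + X * b' * (X * b') +
    (a' * W tau X * Sn - tau * X * (X * b')) * (a' * W tau X * Sn - tau * X * (X * b'))).
Proof.
  intros HC. rewrite <- sqrt_Rsqr_abs. apply sqrt_le_1_alt. unfold Rsqr.
  pose proof (W_sqr tau X) as HW. pose proof (W_pos tau X) as Hw. set (w := W tau X) in *.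
  set (y := X * b'). set (P := a' * w * Sn).
  assert (H : P * P <= w * w * (y * y + (P - tau * X * y) * (P - tau * X * y))).
  { assert (H1 : 0 <= (w * w * y - P * tau * X) * (w * w * y - P * tau * X)) by apply Rle_0_sqr.
    assert (H2 : w * w * (w * w * (y * y + (P - tau * X * y) * (P - tau * X * y)) - P * P) =
      w * w * (w * w * y - P * tau * X) * (w * w * y - P * tau * X)); [|nra].
    replace (w * w) with (1 + tau * tau * (X * X)). ring. }
  assert (H3 : a' * Sn * (a' * Sn) <= y * y + (P - tau * X * y) * (P - tau * X * y)).
  { apply (Rmult_le_reg_l (w * w)); [nra|].
    replace (w * w * (a' * Sn * (a' * Sn))) with (P * P) by (unfold P; ring). exact H. }
  replace (a' * a') with (a' * C * (a' * C) + a' * Sn * (a' * Sn))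
    by (transitivity (a' * a' * (C * C + Sn * Sn)); [ring|rewrite HC; ring]).
  lra.
Qed.

Lemma curve_velocity (a b : R -> R) (w : R) : ex_derive a w -> ex_derive b w ->
  (Derive (fun w => cx (rot_map S0 (a w) (b w))) w,
   Derive (fun w => cy (rot_map S0 (a w) (b w))) w,
   Derive (fun w => cz (rot_map S0 (a w) (b w))) w) =
  frame (cos (b w)) (sin (b w)) (Derive a w * cos (th (a w))) (x (a w) * Derive b w)
    (Derive a w * W tau (x (a w)) * sin (th (a w))).
Proof.
  intros Ha Hb. apply Derive_correct in Ha. apply Derive_correct in Hb.
  assert (Hx : is_derive (fun w => x (a w)) w (Derive a w * cos (th (a w)))).
  { apply (deriv_comp x a); [exact Ha|apply (x_deriv tau mu A q th z HP)]. }
  unfold frame. apply pt_eq; apply is_derive_unique.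
  - eapply is_derive_eq.
    + apply (deriv_mult (fun w => x (a w)) (fun w => cos (b w))); [exact Hx|].
      apply (deriv_comp cos b); [exact Hb|apply is_derive_cos].
    + cbv beta. ring.
  - eapply is_derive_eq.
    + apply (deriv_mult (fun w => x (a w)) (fun w => sin (b w))); [exact Hx|].
      apply (deriv_comp sin b); [exact Hb|apply is_derive_sin].
    + cbv beta. ring.
  - eapply is_derive_eq.
    + apply (deriv_comp z a); [exact Ha|apply (z_deriv tau mu A q th z HP)].
    + ring.
Qed.

(** By [speed_lower_bound] the length of a curve is at least the variation of its profile parameter.
    A divergent curve leaves the compact pieces [[0, c]], so its nonnegative parameter exceeds every
    bound. *)
Lemma surface_complete : complete tau S0.
Proof.
  intros a b Hab Hdiv L.
  set (g := fun w => Derive a w * cos (th (a w)) * (Derive a w * cos (th (a w)))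
    + x (a w) * Derive b w * (x (a w) * Derive b w)
    + (Derive a w * W tau (x (a w)) * sin (th (a w)) - tau * x (a w) * (x (a w) * Derive b w))
    * (Derive a w * W tau (x (a w)) * sin (th (a w)) - tau * x (a w) * (x (a w) * Derive b w))).
  assert (Hcont : forall w, 0 <= w < 1 -> continuous (fun w => sqrt (g w)) w).
  { intros w Hw. destruct (Hab w Hw) as [_ [_ [Ha [Hb [Ca Cb]]]]].
    assert (Hac : continuous a w) by (destruct Ha as [l Hl]; eapply is_derive_continuous, Hl).
    assert (Hxc : continuous (fun w => x (a w)) w).
    { apply (cont_comp a x); [exact Hac|]. eapply is_derive_continuous, (x_deriv tau mu A q th z HP). }
    assert (Hcc : continuous (fun w => cos (th (a w))) w).
    { apply (cont_comp a (fun s => cos (th s))); [exact Hac|].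
      eapply is_derive_continuous, (cos_deriv tau mu A q th z HP). }
    assert (Hsc : continuous (fun w => sin (th (a w))) w).
    { apply (cont_comp a (fun s => sin (th s))); [exact Hac|].
      eapply is_derive_continuous, (sin_deriv tau mu A q th z HP). }
    assert (HWc : continuous (fun w => W tau (x (a w))) w).
    { apply (cont_comp (fun w => x (a w)) (W tau)); [exact Hxc|].
      eapply is_derive_continuous, W_derive. }
    assert (H1 : continuous (fun w => Derive a w * cos (th (a w))) w) by now apply (cont_mult (Derive a)).
    assert (H2 : continuous (fun w => x (a w) * Derive b w) w)
      by now apply (cont_mult (fun w => x (a w)) (Derive b)).
    assert (H3 : continuous (fun w => Derive a w * W tau (x (a w)) * sin (th (a w))
       - tau * x (a w) * (x (a w) * Derive b w)) w).
    { apply (cont_minus (fun w => Derive a w * W tau (x (a w)) * sin (th (a w)))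
        (fun w => tau * x (a w) * (x (a w) * Derive b w))).
      - apply (cont_mult (fun w => Derive a w * W tau (x (a w))) (fun w => sin (th (a w)))); [|exact Hsc].
        now apply (cont_mult (Derive a) (fun w => W tau (x (a w)))).
      - apply (cont_mult (fun w => tau * x (a w)) (fun w => x (a w) * Derive b w)); [|exact H2].
        apply (cont_mult (fun _ => tau) (fun w => x (a w))); [apply cont_const|exact Hxc]. }
    apply continuous_abs_le_sqrt.
    apply (cont_plus (fun w => Derive a w * cos (th (a w)) * (Derive a w * cos (th (a w)))
      + x (a w) * Derive b w * (x (a w) * Derive b w))).
    - apply (cont_plus (fun w => Derive a w * cos (th (a w)) * (Derive a w * cos (th (a w))))
        (fun w => x (a w) * Derive b w * (x (a w) * Derive b w))).
      + exact (cont_mult _ _ w H1 H1).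
      + exact (cont_mult _ _ w H2 H2).
    - exact (cont_mult _ _ w H3 H3). }
  assert (Hlen : forall u, 0 <= u < 1 -> a u - a 0 <= arc_length tau (fun w => rot_map S0 (a w) (b w)) 0 u).
  { intros u Hu. unfold arc_length. cbv zeta.
    assert (Eg : forall w, Rmin 0 u < w < Rmax 0 u ->
      sqrt (g w) = sqrt (inner tau (rot_map S0 (a w) (b w))
         (Derive (fun w => cx (rot_map S0 (a w) (b w))) w,
          Derive (fun w => cy (rot_map S0 (a w) (b w))) w,
          Derive (fun w => cz (rot_map S0 (a w) (b w))) w)
         (Derive (fun w => cx (rot_map S0 (a w) (b w))) w,
          Derive (fun w => cy (rot_map S0 (a w) (b w))) w,
          Derive (fun w => cz (rot_map S0 (a w) (b w))) w))).
    { intros w Hw. rewrite Rmin_left, Rmax_right in Hw by lra.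
      destruct (Hab w ltac:(lra)) as [_ [_ [Ha [Hb _]]]].
      rewrite (curve_velocity a b w Ha Hb). unfold rot_map, rot_surface; simpl.
      rewrite inner_frame by apply sqr_sum_trig. f_equal. }
    rewrite <- (RInt_ext _ _ 0 u Eg).
    assert (Ia : is_RInt (Derive a) 0 u (a u - a 0)).
    { apply (is_RInt_derive a (Derive a)).
      - intros w Hw. rewrite Rmin_left, Rmax_right in Hw by lra. apply Derive_correct.
        now apply (Hab w ltac:(lra)).
      - intros w Hw. rewrite Rmin_left, Rmax_right in Hw by lra. now apply (Hab w ltac:(lra)). }
    rewrite <- (is_RInt_unique _ _ _ _ Ia). apply RInt_le.
    - lra.
    - now exists (a u - a 0).
    - apply (@ex_RInt_continuous R_CompleteNormedModule). intros w Hw.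
      rewrite Rmin_left, Rmax_right in Hw by lra. apply Hcont. lra.
    - intros w Hw. eapply Rle_trans; [apply Rle_abs|]. unfold g.
      apply speed_lower_bound, sqr_sum_trig. }
  destruct (Hdiv 0 (Rmax 0 (a 0 + L))) as [u0 [Hu0 Hu1]].
  { intros s Hs. simpl. lra. }
  set (u := (Rmax u0 0 + 1) / 2).
  assert (Hm : Rmax u0 0 < 1) by (apply Rmax_lub_lt; lra).
  pose proof (Rmax_l u0 0). pose proof (Rmax_r u0 0).
  assert (Hu : 0 <= u < 1) by (unfold u; lra).
  exists u. split; [exact Hu|].
  specialize (Hu1 u ltac:(unfold u; lra)).
  assert (Hau : 0 <= a u) by (destruct (Hab u Hu) as [H1 _]; exact H1).
  pose proof (Rmax_r 0 (a 0 + L)).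
  assert (Rmax 0 (a 0 + L) < a u) by (apply Rnot_le_lt; intros Hle; apply Hu1; lra).
  specialize (Hlen u Hu). lra.
Qed.

Lemma sin_pos (s : R) : 0 < mu -> 0 < s -> 0 < sin (th s).
Proof. intros Hmu Hs. now apply (x_bound_pos tau mu A q th z HP). Qed.

Lemma z_increasing (s r : R) : 0 < mu -> 0 <= s < r -> z s < z r.
Proof.
  intros Hmu H. apply (increasing_of_deriv z (fun s => sin (th s) * W tau (x s))).
  - lra.
  - intros t _. eapply is_derive_continuous, (z_deriv tau mu A q th z HP).
  - intros t _. apply (z_deriv tau mu A q th z HP).
  - intros t Ht. apply Rmult_lt_0_compat; [apply sin_pos; lra|apply W_pos].
Qed.

Lemma z_inverse_continuous (s d : R) : 0 < mu -> 0 <= s -> 0 < d ->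
  exists eta, 0 < eta /\ forall r, 0 <= r -> Rabs (z r - z s) < eta -> Rabs (r - s) < d.
Proof.
  intros Hmu Hs Hd.
  assert (H1 : z s < z (s + d)) by (apply z_increasing; lra).
  assert (H2 : exists eta, 0 < eta /\ forall r, 0 <= r -> r <= s - d -> eta <= z s - z r).
  { destruct (Rle_dec d s) as [Hds|Hds].
    - exists (z s - z (s - d)). pose proof (z_increasing (s - d) s Hmu ltac:(lra)).
      split; [lra|]. intros r Hr Hrd. destruct (Req_dec r (s - d)) as [->|]; [lra|].
      pose proof (z_increasing r (s - d) Hmu ltac:(lra)). lra.
    - exists 1. split; [lra|]. intros. lra. }
  destruct H2 as [eta [He1 He2]].
  exists (Rmin eta (z (s + d) - z s)). split; [apply Rmin_glb_lt; lra|].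
  intros r Hr Hz. pose proof (Rmin_l eta (z (s + d) - z s)). pose proof (Rmin_r eta (z (s + d) - z s)).
  apply Rabs_def2 in Hz. apply Rabs_def1.
  - apply Rnot_le_lt. intros Hle. assert (Hle' : s + d <= r) by lra.
    destruct Hle' as [Hlt|Heq].
    + pose proof (z_increasing (s + d) r Hmu ltac:(lra)). lra.
    + rewrite <- Heq in Hz. lra.
  - apply Rnot_le_lt. intros Hle. specialize (He2 r Hr ltac:(lra)). lra.
Qed.

(** [z] is strictly increasing, so the height determines [rho] continuously; the horizontal
    coordinates divided by [A] at [rho] then recover [u] and [v]. *)
Lemma disk_embedded : 0 < mu -> embedded (disk_map A z).
Proof.
  intros Hmu. split.
  - intros u v u' v' H. unfold disk_map in H. injection H as H1 H2 H3.
    assert (Hr : rho u v = rho u' v').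
    { pose proof (rho_pos u v). pose proof (rho_pos u' v').
      destruct (Rtotal_order (rho u v) (rho u' v')) as [Hlt|[Heq|Hlt]]; [|exact Heq|].
      - pose proof (z_increasing _ _ Hmu (conj H Hlt)). lra.
      - pose proof (z_increasing _ _ Hmu (conj H0 Hlt)). lra. }
    rewrite Hr in H1, H2. pose proof (pr_A_pos _ _ _ _ _ _ HP (rho u' v')).
    split; [apply (Rmult_eq_reg_r (A (rho u' v'))); lra|apply (Rmult_eq_reg_r (A (rho u' v'))); lra].
  - intros u v eps Heps. set (r := rho u v). set (m := A r).
    assert (Hm : 0 < m) by apply (pr_A_pos _ _ _ _ _ _ HP).
    set (B := 1 + Rabs u + Rabs v).
    assert (HB : 1 <= B) by (unfold B; pose proof (Rabs_pos u); pose proof (Rabs_pos v); lra).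
    (* The value of [A] stays above [m / 2] and within [eps m / (8 B)] of [m], where [B] bounds
       [|u|] and [|v|]; together with [d2] this leaves an error of at most [eps / 2] after the
       division by [A]. *)
    set (e1 := Rmin (m / 2) (eps * m / (8 * B))).
    assert (Hem : 0 < eps * m) by now apply Rmult_lt_0_compat.
    assert (He1 : 0 < e1) by (apply Rmin_glb_lt; [lra|apply Rdiv_lt_0_compat; lra]).
    assert (HAc : continuous A r) by now apply (radial_continuous everywhere 0 A r (pr_radial_A _ _ _ _ _ _ HP 0)).
    destruct (proj1 (continuous_eps A r) HAc e1 He1) as [d1 [Hd1 HA1]].
    destruct (z_inverse_continuous r d1 Hmu (rho_pos u v) Hd1) as [eta [Heta Hz]].
    set (d2 := eps * m / 8). assert (Hd2 : 0 < d2) by (unfold d2; lra).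
    exists (Rmin (eta * eta) (d2 * d2)). split; [apply Rmin_glb_lt; nra|].
    intros u' v' Hd. set (r' := rho u' v').
    pose proof (Rmin_l (eta * eta) (d2 * d2)). pose proof (Rmin_r (eta * eta) (d2 * d2)).
    unfold sqdist, disk_map, cx, cy, cz in Hd; simpl in Hd. fold r r' in Hd. rewrite !Rmult_1_r in Hd.
    fold m in Hd. set (m' := A r') in Hd.
    set (X := u' * m' - u * m) in Hd. set (Y := v' * m' - v * m) in Hd. set (Z := z r' - z r) in Hd.
    assert (HX : Rabs X < d2) by (apply Rnot_le_lt; intros Hle;
      assert (d2 * d2 <= Rabs X * Rabs X) by nra; rewrite <- Rabs_mult, Rabs_right in H1; nra).
    assert (HY : Rabs Y < d2) by (apply Rnot_le_lt; intros Hle;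
      assert (d2 * d2 <= Rabs Y * Rabs Y) by nra; rewrite <- Rabs_mult, Rabs_right in H1; nra).
    assert (HZ : Rabs Z < eta) by (apply Rnot_le_lt; intros Hle;
      assert (eta * eta <= Rabs Z * Rabs Z) by nra; rewrite <- Rabs_mult, Rabs_right in H1; nra).
    specialize (HA1 r' (Hz r' (rho_pos u' v') HZ)). fold m m' in HA1.
    assert (Hm' : m / 2 < m').
    { pose proof (Rmin_l (m / 2) (eps * m / (8 * B))) as Hmin. fold e1 in Hmin.
      apply Rabs_def2 in HA1. lra. }
    assert (He1B : e1 * B <= eps * m / 8).
    { pose proof (Rmin_r (m / 2) (eps * m / (8 * B))) as Hmin. fold e1 in Hmin.
      apply Rle_trans with (eps * m / (8 * B) * B); [apply Rmult_le_compat_r; lra|].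
      right. field. lra. }
    assert (Key : forall a a', Rabs a <= B -> Rabs (a' * m' - a * m) < d2 -> Rabs (a' - a) < eps / 2).
    { intros a a' Ha Hd'.
      assert (Hlt : Rabs (a' - a) * m' < eps / 2 * m').
      { rewrite <- (Rabs_right m') at 1 by lra. rewrite <- Rabs_mult.
        replace ((a' - a) * m') with ((a' * m' - a * m) - a * (m' - m)) by ring.
        eapply Rle_lt_trans; [apply Rabs_triang|]. rewrite Rabs_Ropp, (Rabs_mult a).
        assert (Rabs a * Rabs (m' - m) <= B * e1).
        { apply Rmult_le_compat; try apply Rabs_pos; lra. }
        unfold d2 in *. nra. }
      apply Rmult_lt_reg_r in Hlt; lra. }
    assert (Ku : Rabs (u' - u) < eps / 2).
    { apply Key; [unfold B; pose proof (Rabs_pos v); lra|exact HX]. }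
    assert (Kv : Rabs (v' - v) < eps / 2).
    { apply Key; [unfold B; pose proof (Rabs_pos u); lra|exact HY]. }
    apply Rabs_def2 in Ku. apply Rabs_def2 in Kv. unfold disc. nra.
Qed.

Lemma disk_height_diverges : 0 < mu -> tends_at_infinity (fun u v => cz (disk_map A z u v)) p_infty.
Proof.
  intros Hmu. apply (plane_diverges z); [reflexivity|]. now apply height_diverges, Rlt_le.
Qed.

Lemma disk_axis_dist (u v : R) : axis_dist (disk_map A z u v) = x (rho u v).
Proof.
  unfold axis_dist. rewrite <- (sqrt_Rsqr (x (rho u v))).
  2:{ apply Rmult_le_pos; [apply rho_pos|]. left. apply (pr_A_pos _ _ _ _ _ _ HP). }
  f_equal. unfold disk_map, cx, cy, prad, Rsqr; simpl.
  transitivity ((u * u + v * v) * (A (rho u v) * A (rho u v))); [ring|].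
  rewrite <- rho_sqr. ring.
Qed.

Lemma disk_inward (u v : R) :
  inner tau (disk_map A z u v) (disk_normal tau e A q th u v) (inward_normal (disk_map A z u v)) =
  e * sin (th (rho u v)).
Proof.
  destruct (polar_decomposition u v) as [c [s [Hcs [Hu Hv]]]].
  unfold inward_normal. rewrite disk_axis_dist.
  rewrite (disk_normal_frame tau mu e A q th z HP u v c s Hu Hv), (disk_map_frame A z u v c s Hu Hv).
  set (r := rho u v) in *. unfold cx, cy; simpl. fold (prad A r).
  (* On the axis [/ 0 = 0] makes the inward normal the zero vector, and [sin th] vanishes as
     well. *)
  destruct (Req_dec (x r) 0) as [H0|H0].
  - assert (Hr : r = 0).
    { apply NNPP. intros Hr. pose proof (rho_pos u v). fold r in H.
      pose proof (x_pos tau mu A q th z HP r ltac:(lra)). lra. }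
    rewrite H0, Hr, (pr_th_0 _ _ _ _ _ _ HP), sin_0. unfold Rdiv.
    rewrite Rinv_0. unfold inner, contact, cx, cy, cz; simpl. ring.
  - replace (- (x r * c) / x r, - (x r * s) / x r, 0) with (frame c s (-1) 0 0)
      by (unfold frame; apply pt_eq; field; exact H0).
    transitivity (inner tau (x r * c, x r * s, z r) (frame c s (-1) 0 0)
      (unit_normal tau e (x r) (cos (th r)) (sin (th r)) c s)); [unfold inner; ring|].
    rewrite inner_unit_normal by exact Hcs. pose proof (W_pos tau (x r)). field. lra.
Qed.

Lemma disk_converges_to_cylinder : e = 1 -> 0 < mu ->
  converges_to_cylinder tau (/ (2 * mu)) (disk_map A z) (disk_normal tau e A q th).
Proof.
  intros He1 Hmu. destruct (cylinder_limit tau mu A q th z HP Hmu) as [T1 [T2 _]]. split.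
  - apply (plane_tends x); [|exact T1]. intros u v. apply disk_axis_dist.
  - apply (plane_tends (fun s => sin (th s))); [|exact T2].
    intros u v. rewrite disk_inward, He1. ring.
Qed.
End Global.

(** * Vertical cylinders *)

Lemma C2_trig_first (D : R -> R -> Prop) (m : nat) :
  C2 D m (fun u _ => cos u) /\ C2 D m (fun u _ => sin u).
Proof.
  induction m as [|m [IHc IHs]].
  - split; (split; [intros u v _|exact I]);
      [apply (continuity_1d_2d_pt_comp cos (fun u _ => u))|apply (continuity_1d_2d_pt_comp sin (fun u _ => u))];
      try apply continuity_2d_pt_id1; [apply continuity_cos|apply continuity_sin].
  - split; split.
    + intros u v Huv. eapply C2_continuous; eassumption.
    + exists (fun u _ => -1 * sin u), (fun _ _ => 0).
      split; [apply C2_mult; [apply C2_const|exact IHs]|]. split; [apply C2_const|].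
      intros u v _. split; [|apply deriv_const]. auto_derive; [exact I|ring].
    + intros u v Huv. eapply C2_continuous; eassumption.
    + exists (fun u _ => cos u), (fun _ _ => 0). split; [exact IHc|]. split; [apply C2_const|].
      intros u v _. split; [|apply deriv_const]. auto_derive; [exact I|ring].
Qed.

Lemma cylinder_cmc (tau r : R) : 0 < r -> is_cmc tau (/ (2 * r)) (cylinder r) cylinder_normal.
Proof.
  intros Hr.
  assert (Edu : forall a b, du (cylinder r) a b = frame (cos a) (sin a) 0 r 0).
  { intros a b. unfold du, frame, cylinder, cx, cy, cz; simpl.
    apply pt_eq; apply is_derive_unique; (auto_derive; [exact I|ring]). }
  assert (Edv : forall a b, dv (cylinder r) a b = frame (cos a) (sin a) 0 0 1).
  { intros a b. unfold dv, frame, cylinder, cx, cy, cz; simpl.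
    apply pt_eq; apply is_derive_unique; (auto_derive; [exact I|ring]). }
  assert (En : forall a b, cylinder_normal a b = frame (cos a) (sin a) (-1) 0 0).
  { intros a b. unfold cylinder_normal, frame. apply pt_eq; ring. }
  assert (Ep : forall a b, cylinder r a b = (r * cos a, r * sin a, b)) by reflexivity.
  assert (Hopen : forall u v, plane u v -> locally_2d plane u v).
  { intros u v _. now apply locally_2d_forall. }
  split; [constructor|].
  - intros i. apply (C2_smooth plane Hopen (fun a b => coord i (cylinder r a b))); [|reflexivity].
    intros m. destruct i; unfold coord, cylinder, cx, cy, cz; simpl.
    + apply (C2_mult plane m (fun _ _ => r) (fun a _ => cos a)); [apply C2_const|apply C2_trig_first].
    + apply (C2_mult plane m (fun _ _ => r) (fun a _ => sin a)); [apply C2_const|apply C2_trig_first].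
    + apply C2_proj2.
  - intros u v _ a b Hab. pose proof (Hab ax) as H1. pose proof (Hab ay) as H2. pose proof (Hab az) as H3.
    rewrite Edu, Edv in H1, H2, H3. unfold coord, frame, cx, cy, cz in H1, H2, H3; simpl in H1, H2, H3.
    split; [|lra].
    assert (Hz : a * r = 0).
    { transitivity (a * r * (cos u * cos u + sin u * sin u)); [rewrite sqr_sum_trig; ring|].
      transitivity (cos u * (a * (0 * sin u + r * cos u) + b * (0 * sin u + 0 * cos u))
        - sin u * (a * (0 * cos u - r * sin u) + b * (0 * cos u - 0 * sin u))); [ring|rewrite H1, H2; ring]. }
    apply Rmult_integral in Hz. destruct Hz; lra.
  - intros i u v _. assert (HC : C2 plane 0 (fun a b => coord i (cylinder_normal a b))).
    { destruct i; unfold coord, cylinder_normal, cx, cy, cz; simpl.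
      - replace (fun a _ : R => - cos a) with (fun a _ : R => -1 * cos a)
          by (apply functional_extensionality; intros a; apply functional_extensionality; intros; ring).
        apply (C2_mult plane 0 (fun _ _ => -1) (fun a _ => cos a)); [apply C2_const|apply C2_trig_first].
      - replace (fun a _ : R => - sin a) with (fun a _ : R => -1 * sin a)
          by (apply functional_extensionality; intros a; apply functional_extensionality; intros; ring).
        apply (C2_mult plane 0 (fun _ _ => -1) (fun a _ => sin a)); [apply C2_const|apply C2_trig_first].
      - exact (C2_const plane 0 0). }
    now apply HC.
  - intros u v _. rewrite En, Ep, inner_frame by apply sqr_sum_trig. ring.
  - intros u v _. rewrite En, Ep, Edu, Edv, !inner_frame by apply sqr_sum_trig. split; ring.
  - intros u v.
    assert (E1 : du (du (cylinder r)) u v = frame (cos u) (sin u) (- r) 0 0).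
    { unfold du at 1. apply pt_eq.
      - apply (Derive_locally _ (fun a => - (r * sin a))).
        + apply filter_forall. intros y. rewrite Edu. unfold frame, cx; simpl. ring.
        + auto_derive; [exact I|ring].
      - apply (Derive_locally _ (fun a => r * cos a)).
        + apply filter_forall. intros y. rewrite Edu. unfold frame, cy; simpl. ring.
        + auto_derive; [exact I|ring].
      - apply (Derive_locally _ (fun _ => 0)).
        + apply filter_forall. intros y. now rewrite Edu.
        + apply deriv_const. }
    assert (E2 : du (dv (cylinder r)) u v = frame (cos u) (sin u) 0 0 0).
    { unfold du at 1, frame. apply pt_eq.
      - apply (Derive_locally _ (fun _ => 0)).
        + apply filter_forall. intros y. rewrite Edv. unfold frame, cx; simpl. ring.
        + eapply is_derive_eq; [apply deriv_const|ring].
      - apply (Derive_locally _ (fun _ => 0)).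
        + apply filter_forall. intros y. rewrite Edv. unfold frame, cy; simpl. ring.
        + eapply is_derive_eq; [apply deriv_const|ring].
      - apply (Derive_locally _ (fun _ => 1)).
        + apply filter_forall. intros y. now rewrite Edv.
        + apply deriv_const. }
    assert (E3 : dv (dv (cylinder r)) u v = frame (cos u) (sin u) 0 0 0).
    { unfold dv at 1, frame. apply pt_eq.
      - apply (Derive_locally _ (fun _ => 0)).
        + apply filter_forall. intros y. rewrite Edv. unfold frame, cx; simpl. ring.
        + eapply is_derive_eq; [apply deriv_const|ring].
      - apply (Derive_locally _ (fun _ => 0)).
        + apply filter_forall. intros y. rewrite Edv. unfold frame, cy; simpl. ring.
        + eapply is_derive_eq; [apply deriv_const|ring].
      - apply (Derive_locally _ (fun _ => 1)).
        + apply filter_forall. intros y. now rewrite Edv.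
        + apply deriv_const. }
    unfold mean_curvature. cbv zeta. rewrite E1, E2, E3, Edu, Edv, En, Ep, !nabla_inner_formula.
    rewrite !inner_frame, !contact_frame, !twist_frame by apply sqr_sum_trig.
    match goal with |- ?a / (2 * ?b) = _ =>
      replace b with (r * r) by ring; replace a with r by ring end.
    field. lra.
Qed.

(** * Loops of the profile for negative mu *)

(** Outside [[f a, f b]] the inverse is clamped to [a] or [b], which makes it continuous on the
    whole line, the end values included. *)
Lemma increasing_inverse (f : R -> R) (a b : R) : a <= b ->
  (forall s, a <= s <= b -> continuous f s) ->
  (forall s r, a <= s -> s < r -> r <= b -> f s < f r) ->
  exists g : R -> R, (forall y, f a <= y <= f b -> a <= g y <= b /\ f (g y) = y) /\
    (forall s, a <= s <= b -> g (f s) = s) /\ (forall y, continuous g y).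
Proof.
  intros Hab Hc Hi.
  assert (Hex : forall y, exists s, a <= s <= b /\
    ((y < f a /\ s = a) \/ (f b < y /\ s = b) \/ f s = y)).
  { intros y. destruct (Rlt_dec y (f a)) as [H1|H1]; [exists a; lra|].
    destruct (Rlt_dec (f b) y) as [H2|H2]; [exists b; lra|].
    destruct (ivt f a b y Hab Hc) as [c [Hc1 Hc2]]; [lra|]. exists c. split; [exact Hc1|].
    right. now right. }
  set (g := fun y => proj1_sig (constructive_indefinite_description _ (Hex y))).
  assert (Hg : forall y, a <= g y <= b /\
    ((y < f a /\ g y = a) \/ (f b < y /\ g y = b) \/ f (g y) = y)).
  { intros y. exact (proj2_sig (constructive_indefinite_description _ (Hex y))). }
  assert (Hinj : forall s r, a <= s <= b -> a <= r <= b -> f s = f r -> s = r).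
  { intros s r Hs Hr E. destruct (Rtotal_order s r) as [H|[H|H]]; [|exact H|].
    - specialize (Hi s r ltac:(lra) H ltac:(lra)). lra.
    - specialize (Hi r s ltac:(lra) H ltac:(lra)). lra. }
  assert (Hle : forall s r, a <= s -> s <= r -> r <= b -> f s <= f r).
  { intros s r Hs [Hsr| ->] Hr; [left; now apply Hi|lra]. }
  assert (Hin : forall y, f a <= y <= f b -> f (g y) = y).
  { intros y Hy. destruct (Hg y) as [_ [H|[H|H]]]; [lra|lra|exact H]. }
  exists g. split; [|split].
  - intros y Hy. split; [apply Hg|now apply Hin].
  - intros s Hs. apply Hinj; [apply Hg|exact Hs|]. apply Hin. split; apply Hle; lra.
  - intros y. apply continuous_eps. intros eps He. destruct (Hg y) as [Hgy Hy].
    assert (Up : exists d, 0 < d /\ forall y', y' < y + d -> g y' < g y + eps).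
    { destruct (Rlt_dec b (g y + eps)) as [Hb|Hb].
      - exists 1. split; [lra|]. intros y' _. destruct (Hg y') as [H _]. lra.
      - assert (Hyf : y <= f (g y)) by (destruct Hy as [[H1 H2]|[[H1 H2]|H]]; [rewrite H2; lra|lra|lra]).
        assert (Hlt : f (g y) < f (g y + eps)) by (apply Hi; lra).
        exists (f (g y + eps) - y). split; [lra|]. intros y' Hy'.
        apply Rnot_le_lt. intros Hle'. destruct (Hg y') as [H' [[H1 H2]|[[H1 H2]|H]]].
        + lra.
        + assert (f (g y + eps) <= f b) by (apply Hle; lra). lra.
        + assert (f (g y + eps) <= f (g y')) by (apply Hle; lra). lra. }
    assert (Lo : exists d, 0 < d /\ forall y', y - d < y' -> g y - eps < g y').
    { destruct (Rlt_dec (g y - eps) a) as [Hb|Hb].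
      - exists 1. split; [lra|]. intros y' _. destruct (Hg y') as [H _]. lra.
      - assert (Hyf : f (g y) <= y) by (destruct Hy as [[H1 H2]|[[H1 H2]|H]]; [lra|rewrite H2; lra|lra]).
        assert (Hlt : f (g y - eps) < f (g y)) by (apply Hi; lra).
        exists (y - f (g y - eps)). split; [lra|]. intros y' Hy'.
        apply Rnot_le_lt. intros Hle'. destruct (Hg y') as [H' [[H1 H2]|[[H1 H2]|H]]].
        + assert (f a <= f (g y - eps)) by (apply Hle; lra). lra.
        + lra.
        + assert (f (g y') <= f (g y - eps)) by (apply Hle; lra). lra. }
    destruct Up as [d1 [Hd1 Up]], Lo as [d2 [Hd2 Lo]].
    exists (Rmin d1 d2). split; [now apply Rmin_glb_lt|]. intros y' Hy'.
    pose proof (Rmin_l d1 d2). pose proof (Rmin_r d1 d2). apply Rabs_def2 in Hy'.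
    specialize (Up y' ltac:(lra)). specialize (Lo y' ltac:(lra)). apply Rabs_def1; lra.
Qed.

Lemma local_increase (f : R -> R) (c l : R) : is_derive f c l -> 0 < l ->
  exists d, 0 < d /\ (forall s, c - d < s < c -> f s < f c) /\ (forall s, c < s < c + d -> f c < f s).
Proof.
  intros H Hl. apply is_derive_Reals in H. destruct (H l Hl) as [d Hd].
  assert (K : forall h, h <> 0 -> Rabs h < d -> 0 < (f (c + h) - f c) / h).
  { intros h Hh Hhd. specialize (Hd h Hh Hhd). apply Rabs_def2 in Hd. lra. }
  exists d. split; [apply cond_pos|]. split; intros s Hs.
  - specialize (K (s - c) ltac:(lra)). rewrite Rabs_left in K by lra. specialize (K ltac:(lra)).
    replace (c + (s - c)) with s in K by ring.
    apply Rnot_le_lt. intros Hle.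
    assert ((f s - f c) / (s - c) * (s - c) = f s - f c) by (field; lra). nra.
  - specialize (K (s - c) ltac:(lra)). rewrite Rabs_right in K by lra. specialize (K ltac:(lra)).
    replace (c + (s - c)) with s in K by ring.
    apply Rnot_le_lt. intros Hle.
    assert ((f s - f c) / (s - c) * (s - c) = f s - f c) by (field; lra). nra.
Qed.

Lemma local_decrease (f : R -> R) (c l : R) : is_derive f c l -> l < 0 ->
  exists d, 0 < d /\ (forall s, c - d < s < c -> f c < f s) /\ (forall s, c < s < c + d -> f s < f c).
Proof.
  intros H Hl. destruct (local_increase (fun s => - f s) c (- l)) as [d [Hd [H1 H2]]];
    [now apply deriv_opp|lra|].
  exists d. split; [exact Hd|]. split; intros s Hs; [specialize (H1 s Hs)|specialize (H2 s Hs)]; lra.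
Qed.

(* The three arcs [a1, b1], [b1, a2], [a2, b2] are graphs over the [x]-axis.  If no two
   of them met, then over [x b1] the third one would lie above the common end of the first
   two, and over [x a2] the first one above the common end of the last two, so that
   the first and the third one would cross. *)
Lemma loop_crossing (x z : R -> R) (a1 b1 a2 b2 : R) : a1 < b1 -> b1 < a2 -> a2 < b2 ->
  (forall s, continuous x s) -> (forall s, continuous z s) ->
  (forall s r, a1 <= s -> s < r -> r <= b1 -> x s < x r) ->
  (forall s r, b1 <= s -> s < r -> r <= a2 -> x r < x s) ->
  (forall s r, a2 <= s -> s < r -> r <= b2 -> x s < x r) ->
  x a1 < x a2 -> x b1 < x b2 ->
  (exists d, 0 < d /\ (forall s, b1 - d < s < b1 -> z b1 < z s) /\
     (forall s, b1 < s < b1 + d -> z s < z b1)) ->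
  (exists d, 0 < d /\ (forall s, a2 - d < s < a2 -> z s < z a2) /\
     (forall s, a2 < s < a2 + d -> z a2 < z s)) ->
  exists s r, a1 <= s /\ s < r /\ x s = x r /\ z s = z r.
Proof.
  intros H1 H2 H3 Cx Cz I1 I2 I3 Ha Hb [db [Hdb [Zb1 Zb2]]] [da [Hda [Za1 Za2]]].
  destruct (increasing_inverse x a1 b1 ltac:(lra) (fun s _ => Cx s) I1) as [f1 [F1 [F1' C1]]].
  destruct (increasing_inverse x a2 b2 ltac:(lra) (fun s _ => Cx s) I3) as [f2 [F2 [F2' C2]]].
  apply NNPP. intros Hn.
  assert (Hno : forall s r, a1 <= s -> s < r -> x s = x r -> z s = z r -> False).
  { intros s r Hs Hsr Hx Hz. apply Hn. now exists s, r. }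
  assert (Hrange : forall s, b1 <= s <= a2 -> x a2 <= x s <= x b1).
  { intros s Hs. split.
    - destruct (Req_dec s a2) as [->|]; [lra|]. left. apply I2; lra.
    - destruct (Req_dec s b1) as [->|]; [lra|]. left. apply I2; lra. }
  assert (G1 : forall s, b1 <= s <= a2 -> a1 <= f1 (x s) <= b1 /\ x (f1 (x s)) = x s).
  { intros s Hs. apply F1. specialize (Hrange s Hs). lra. }
  assert (G2 : forall s, b1 <= s <= a2 -> a2 <= f2 (x s) <= b2 /\ x (f2 (x s)) = x s).
  { intros s Hs. apply F2. specialize (Hrange s Hs). lra. }
  assert (E1 : f1 (x b1) = b1) by (apply F1'; lra).
  assert (E2 : f2 (x a2) = a2) by (apply F2'; lra).
  assert (Cf1 : forall s, continuous (fun s => f1 (x s)) s) by (intros s; apply (cont_comp x f1); auto).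
  assert (Cf2 : forall s, continuous (fun s => f2 (x s)) s) by (intros s; apply (cont_comp x f2); auto).
  assert (CD1 : forall s, continuous (fun s => z (f1 (x s)) - z s) s).
  { intros s. apply (cont_minus (fun s => z (f1 (x s))) z); [|apply Cz].
    apply (cont_comp (fun s => f1 (x s)) z); auto. }
  assert (CD2 : forall s, continuous (fun s => z (f2 (x s)) - z s) s).
  { intros s. apply (cont_minus (fun s => z (f2 (x s))) z); [|apply Cz].
    apply (cont_comp (fun s => f2 (x s)) z); auto. }
  (* Just after [b1] the middle arc lies below the first one, because [z] decreases through [b1]; a
     change of sign before [a2] would be a crossing of these two arcs. [P2] is the mirror argument
     at [a2]. *)
  assert (P1 : 0 < z (f1 (x a2)) - z a2).
  { destruct (proj1 (continuous_eps _ b1) (Cf1 b1) db Hdb) as [d [Hd Hd']].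
    set (m := Rmin (Rmin d db) (a2 - b1)).
    pose proof (Rmin_l (Rmin d db) (a2 - b1)). pose proof (Rmin_r (Rmin d db) (a2 - b1)).
    pose proof (Rmin_l d db). pose proof (Rmin_r d db).
    assert (Hm : 0 < m) by (repeat apply Rmin_glb_lt; lra).
    set (s := b1 + m / 2).
    assert (Hs : b1 < s < a2 /\ s < b1 + d /\ s < b1 + db) by (unfold s, m in *; lra).
    specialize (Hd' s). rewrite (Rabs_right (s - b1)), E1 in Hd' by lra. specialize (Hd' ltac:(lra)).
    destruct (G1 s ltac:(lra)) as [K1 K2].
    assert (Hpos : 0 < z (f1 (x s)) - z s).
    { specialize (Zb2 s ltac:(lra)). apply Rabs_def2 in Hd'.
      destruct (Req_dec (f1 (x s)) b1) as [->|]; [lra|].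
      specialize (Zb1 (f1 (x s)) ltac:(lra)). lra. }
    apply Rnot_le_lt. intros Hle.
    destruct (ivt (fun s => z (f1 (x s)) - z s) s a2 0) as [c [Hc1 Hc2]];
      [lra|intros; apply CD1|lra|].
    destruct (G1 c ltac:(lra)) as [K3 K4]. apply (Hno (f1 (x c)) c); lra. }
  assert (P2 : 0 < z (f2 (x b1)) - z b1).
  { destruct (proj1 (continuous_eps _ a2) (Cf2 a2) da Hda) as [d [Hd Hd']].
    set (m := Rmin (Rmin d da) (a2 - b1)).
    pose proof (Rmin_l (Rmin d da) (a2 - b1)). pose proof (Rmin_r (Rmin d da) (a2 - b1)).
    pose proof (Rmin_l d da). pose proof (Rmin_r d da).
    assert (Hm : 0 < m) by (repeat apply Rmin_glb_lt; lra).
    set (s := a2 - m / 2).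
    assert (Hs : b1 < s < a2 /\ a2 - d < s /\ a2 - da < s) by (unfold s, m in *; lra).
    specialize (Hd' s). rewrite (Rabs_left (s - a2)), E2 in Hd' by lra. specialize (Hd' ltac:(lra)).
    destruct (G2 s ltac:(lra)) as [K1 K2].
    assert (Hpos : 0 < z (f2 (x s)) - z s).
    { specialize (Za1 s ltac:(lra)). apply Rabs_def2 in Hd'.
      destruct (Req_dec (f2 (x s)) a2) as [->|]; [lra|].
      specialize (Za2 (f2 (x s)) ltac:(lra)). lra. }
    apply Rnot_le_lt. intros Hle.
    destruct (ivt (fun s => z (f2 (x s)) - z s) b1 s 0) as [c [Hc1 Hc2]];
      [lra|intros; apply CD2|lra|].
    destruct (G2 c ltac:(lra)) as [K3 K4]. apply (Hno c (f2 (x c))); lra. }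
  (* The first arc minus the third is negative at [b1] by [P2] and positive at [a2] by [P1]. *)
  destruct (ivt (fun s => z (f1 (x s)) - z (f2 (x s))) b1 a2 0) as [c [Hc1 Hc2]].
  - lra.
  - intros s _. apply (cont_minus (fun s => z (f1 (x s))) (fun s => z (f2 (x s)))).
    + apply (cont_comp (fun s => f1 (x s)) z); auto.
    + apply (cont_comp (fun s => f2 (x s)) z); auto.
  - rewrite E1, E2. lra.
  - destruct (G1 c Hc1) as [K1 K2], (G2 c Hc1) as [K3 K4].
    apply (Hno (f1 (x c)) (f2 (x c))); lra.
Qed.

Section Spiral.
Variables (tau mu : R) (A q th z : R -> R).
Hypothesis Htau : tau <> 0.
Hypothesis Hmu : mu < 0.
Hypothesis HP : profile tau mu A q th z.

Notation x := (prad A).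
Notation k := (kr tau mu A q th).
Notation J := (Jr mu A th).
Notation w s := (/ W tau (x s)).

Let t := Rabs tau.
Let la := - mu.

Lemma t_pos : 0 < t.
Proof. now apply Rabs_pos_lt. Qed.

Lemma t_sqr : tau * tau = t * t.
Proof. unfold t. rewrite <- Rabs_mult. symmetry. apply Rabs_right. nra. Qed.

Lemma W_lower (s : R) : 0 < s -> t * x s <= W tau (x s).
Proof.
  intros Hs. pose proof (W_ge_abs tau (x s)) as H.
  rewrite (Rabs_right (x s)) in H; [exact H|]. apply Rle_ge, Rlt_le, (x_pos tau mu A q th z HP s Hs).
Qed.

Lemma W_upper (s : R) : 0 < s -> W tau (x s) <= 1 + t * x s.
Proof.
  intros Hs. pose proof (x_pos tau mu A q th z HP s Hs). pose proof (W_sqr tau (x s)) as E.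
  rewrite t_sqr in E. pose proof t_pos. pose proof (W_pos tau (x s)).
  assert (0 < t * x s) by (now apply Rmult_lt_0_compat). nra.
Qed.

Lemma w_upper (s : R) : 0 < s -> w s <= / (t * x s).
Proof.
  intros Hs. pose proof (x_pos tau mu A q th z HP s Hs). pose proof t_pos.
  apply Rinv_le_contravar; [now apply Rmult_lt_0_compat|now apply W_lower].
Qed.

Lemma q_bound (s : R) : 0 < s -> Rabs (q s) <= / x s.
Proof.
  intros Hs. pose proof (x_pos tau mu A q th z HP s Hs) as Hx.
  assert (E : Rabs (x s) * Rabs (q s) <= 1).
  { rewrite <- Rabs_mult, <- (sin_x_q tau mu A q th z HP). apply Rabs_le, SIN_bound. }
  rewrite (Rabs_right (x s)) in E by lra.
  apply (Rmult_le_reg_l (x s)); [exact Hx|]. rewrite Rinv_r by lra. exact E.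
Qed.

(* The terms of [th'] other than [2 mu] are O(1 / x). *)
Lemma perturbation_bound (s : R) : 0 < s -> Rabs (2 * (cos (th s) * w s) - q s) <= (2 / t + 1) / x s.
Proof.
  intros Hs. pose proof (x_pos tau mu A q th z HP s Hs) as Hx. pose proof t_pos as Ht.
  eapply Rle_trans; [apply Rabs_triang|]. rewrite Rabs_Ropp.
  pose proof (q_bound s Hs). pose proof (w_upper s Hs) as Hw. pose proof (Winv_bounds tau (x s)).
  assert (Rabs (2 * (cos (th s) * w s)) <= 2 * (1 * / (t * x s))).
  { rewrite !Rabs_mult, (Rabs_right 2), (Rabs_right (w s)) by lra.
    apply Rmult_le_compat_l; [lra|].
    apply Rmult_le_compat; [apply Rabs_pos|lra|apply Rabs_le, COS_bound|exact Hw]. }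
  replace ((2 / t + 1) / x s) with (2 * (1 * / (t * x s)) + / x s) by (field; split; lra). lra.
Qed.

Lemma J_linear (s : R) : 0 <= s -> J s <= 2 * s / t.
Proof.
  intros Hs. pose proof t_pos as Ht.
  assert (H : 2 * 0 / t - J 0 <= 2 * s / t - J s).
  { apply (nondecreasing_of_deriv (fun s => 2 * s / t - J s)
      (fun s => 2 / t - 2 * x s * w s * (cos (th s) * cos (th s)))); [exact Hs| | |].
    - intros r _. apply (cont_minus (fun s => 2 * s / t) J).
      + apply (is_derive_continuous _ _ (2 / t)). auto_derive; [exact I|field; lra].
      + eapply is_derive_continuous, (J_deriv tau mu A q th z HP).
    - intros r _. apply (deriv_minus (fun s => 2 * s / t) J).
      + auto_derive; [exact I|field; lra].
      + apply (J_deriv tau mu A q th z HP).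
    - intros r Hr. pose proof (x_pos tau mu A q th z HP r ltac:(lra)) as Hx.
      pose proof (w_upper r ltac:(lra)) as Hw. pose proof (Winv_bounds tau (x r)).
      pose proof (cos_sqr_sin_sqr th r) as E.
      assert (Hc : 0 <= cos (th r) * cos (th r) <= 1) by nra.
      assert (Hxw : x r * w r <= / t).
      { apply Rle_trans with (x r * / (t * x r)); [apply Rmult_le_compat_l; lra|].
        right. field. split; lra. }
      assert (0 <= x r * w r) by (apply Rmult_le_pos; lra).
      assert (x r * w r * (cos (th r) * cos (th r)) <= / t * 1) by (apply Rmult_le_compat; lra).
      unfold Rdiv. lra. }
  rewrite (J_0 mu A th) in H. unfold Rdiv in *. lra.
Qed.

Let Y (s : R) := z s - cos (th s) * W tau (x s) / (2 * la) + sin (th s) * sin (th s) / (4 * la * la).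

(* The explicit terms of [Y] remove the oscillating part of [z'] to leading order; what
   remains is a drift of the height by about [- |tau| / (2 la)] per unit of arc length. *)
Lemma Y_deriv (s : R) : 0 < s -> is_derive Y s
  (- (sin (th s) * sin (th s) * (W tau (x s) / x s)
      + cos (th s) * cos (th s) * (tau * tau * x s / W tau (x s))) / (2 * la)
   + sin (th s) * cos (th s) * (2 * (cos (th s) * w s) - q s) / (2 * la * la)).
Proof.
  intros Hs. pose proof (x_pos tau mu A q th z HP s Hs) as Hx. pose proof (W_pos tau (x s)) as Hw.
  assert (Hla : 0 < la) by (unfold la; lra).
  eapply is_derive_eq.
  - apply (deriv_plus (fun s => z s - cos (th s) * W tau (x s) / (2 * la))
      (fun s => sin (th s) * sin (th s) / (4 * la * la))).
    + apply (deriv_minus z (fun s => cos (th s) * W tau (x s) / (2 * la))).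
      * apply (z_deriv tau mu A q th z HP).
      * apply (deriv_mult (fun s => cos (th s) * W tau (x s)) (fun _ => / (2 * la))); [|apply deriv_const].
        apply (deriv_mult (fun s => cos (th s)) (fun s => W tau (x s))).
        -- apply (cos_deriv tau mu A q th z HP).
        -- apply (deriv_comp (W tau) x); [apply (x_deriv tau mu A q th z HP)|apply W_derive].
    + apply (deriv_mult (fun s => sin (th s) * sin (th s)) (fun _ => / (4 * la * la)));
        [|apply deriv_const].
      apply (deriv_mult (fun s => sin (th s)) (fun s => sin (th s))); apply (sin_deriv tau mu A q th z HP).
  - cbv beta. unfold kr. replace mu with (- la) by (unfold la; ring).
    assert (Eq : q s = sin (th s) / x s).
    { rewrite (sin_x_q tau mu A q th z HP s). field. lra. }
    rewrite Eq. field. repeat split; lra.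
Qed.

Lemma Y_decreases : exists S, 0 < S /\ forall s, S <= s -> Y s - Y S <= - (t / (4 * la)) * (s - S).
Proof.
  pose proof t_pos as Ht. assert (Hla : 0 < la) by (unfold la; lra).
  assert (H2t : 0 < 2 / t) by (apply Rdiv_lt_0_compat; lra).
  (* [x >= 3 / t] brings [tau^2 x / W] above [3 t / 4], a value that [W / x] exceeds anyway: the
     main term contributes a decrease of at least [3 t / (8 la)]. The second bound limits the
     perturbation to [t / (8 la)], and [t / (4 la)] remains. *)
  set (X0 := Rmax (3 / t) (4 * (2 / t + 1) / (la * t))).
  destruct (x_unbounded tau mu A q th z HP Hmu X0) as [S0 HS0].
  set (S := Rmax S0 1). pose proof (Rmax_l S0 1) as HS1. pose proof (Rmax_r S0 1) as HS2.
  exists S. split; [unfold S; lra|]. intros s Hs.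
  set (d := t / (4 * la)).
  assert (HYd : - Y S - d * S <= - Y s - d * s).
  { apply (nondecreasing_of_deriv (fun s => - Y s - d * s)
      (fun s => - (- (sin (th s) * sin (th s) * (W tau (x s) / x s)
      + cos (th s) * cos (th s) * (tau * tau * x s / W tau (x s))) / (2 * la)
      + sin (th s) * cos (th s) * (2 * (cos (th s) * w s) - q s) / (2 * la * la)) - d)); [exact Hs| | |].
    - intros r Hr. apply (cont_minus (fun s => - Y s) (fun s => d * s)).
      + eapply is_derive_continuous, deriv_opp, Y_deriv. unfold S in *. lra.
      + apply (cont_mult (fun _ => d) (fun s => s)); [apply cont_const|apply cont_id].
    - intros r Hr. apply (deriv_minus (fun s => - Y s) (fun s => d * s)).
      + apply deriv_opp, Y_deriv. unfold S in *. lra.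
      + eapply is_derive_eq; [apply deriv_scal, deriv_id|ring].
    - intros r Hr. assert (Hr0 : 0 < r) by (unfold S in *; lra).
      specialize (HS0 r ltac:(unfold S in *; lra)).
      pose proof (Rmax_l (3 / t) (4 * (2 / t + 1) / (la * t))) as M1. fold X0 in M1.
      pose proof (Rmax_r (3 / t) (4 * (2 / t + 1) / (la * t))) as M2. fold X0 in M2.
      pose proof (x_pos tau mu A q th z HP r Hr0) as Hx.
      pose proof (W_lower r Hr0) as HW1. pose proof (W_upper r Hr0) as HW2.
      pose proof (W_pos tau (x r)) as Hw.
      assert (H3 : 3 <= t * x r).
      { apply Rle_trans with (t * (3 / t)); [right; field; lra|apply Rmult_le_compat_l; lra]. }
      assert (B1 : 3 / 4 * t <= tau * tau * x r / W tau (x r)).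
      { apply (Rle_div_r (3 / 4 * t) (tau * tau * x r) (W tau (x r)) Hw). rewrite t_sqr.
        apply Rle_trans with (3 / 4 * t * (1 + t * x r)); [apply Rmult_le_compat_l; lra|].
        replace (t * t * x r) with (t * (t * x r)) by ring.
        replace (3 / 4 * t * (1 + t * x r)) with (t * (3 / 4 * (1 + t * x r))) by ring.
        apply Rmult_le_compat_l; lra. }
      assert (B2 : 3 / 4 * t <= W tau (x r) / x r).
      { apply (Rle_div_r (3 / 4 * t) (W tau (x r)) (x r) Hx). nra. }
      pose proof (perturbation_bound r Hr0) as HB.
      assert (HB2 : (2 / t + 1) / x r <= la * t / 4).
      { apply Rle_div_l; [exact Hx|].
        apply Rle_trans with (la * t / 4 * (4 * (2 / t + 1) / (la * t))).
        - right. field. repeat split; lra.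
        - assert (0 < la * t) by (now apply Rmult_lt_0_compat). apply Rmult_le_compat_l; lra. }
      pose proof (cos_sqr_sin_sqr th r) as E.
      set (C := cos (th r)) in *. set (Sn := sin (th r)) in *.
      set (p := 2 * (C * w r) - q r) in *.
      assert (HSC : Rabs (Sn * C) <= 1) by (apply Rabs_le; nra).
      assert (HSCp : Sn * C * p <= la * t / 4).
      { eapply Rle_trans; [apply Rle_abs|]. rewrite Rabs_mult.
        pose proof (Rabs_pos p). pose proof (Rabs_pos (Sn * C)). nra. }
      assert (Hbr : 3 / 4 * t <= Sn * Sn * (W tau (x r) / x r) + C * C * (tau * tau * x r / W tau (x r))).
      { replace (3 / 4 * t) with (Sn * Sn * (3 / 4 * t) + C * C * (3 / 4 * t))
          by (transitivity (3 / 4 * t * (C * C + Sn * Sn)); [ring|rewrite E; ring]).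
        apply Rplus_le_compat; apply Rmult_le_compat_l; nra. }
      set (br := Sn * Sn * (W tau (x r) / x r) + C * C * (tau * tau * x r / W tau (x r))) in *.
      assert (K1 : 3 / 4 * t / (2 * la) <= br / (2 * la)).
      { apply Rmult_le_compat_r; [left; apply Rinv_0_lt_compat; lra|exact Hbr]. }
      assert (K2 : Sn * C * p / (2 * la * la) <= la * t / 4 / (2 * la * la)).
      { apply Rmult_le_compat_r; [left; apply Rinv_0_lt_compat; nra|exact HSCp]. }
      assert (K3 : 3 / 4 * t / (2 * la) - la * t / 4 / (2 * la * la) = d) by (unfold d; field; lra).
      replace (- br / (2 * la)) with (- (br / (2 * la))) by (field; lra). lra. }
  lra.
Qed.

(** [Y] drifts linearly, whereas [z - Y] is bounded above by a multiple of [W], which is [O(sqrt s)]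
    by [J_linear]. *)
Lemma height_to_minus_infinity : diverges (fun s => - z s).
Proof.
  pose proof t_pos as Ht. assert (Hla : 0 < la) by (unfold la; lra).
  destruct Y_decreases as [S [HS HY]].
  set (d := t / (4 * la)) in *. assert (Hd : 0 < d) by (apply Rdiv_lt_0_compat; lra).
  set (a := 1 + t * t * / (la * la)). set (b := t * t * (4 / (t * la))).
  assert (Hb : 0 < b).
  { unfold b. assert (0 < 4 / (t * la)) by (apply Rdiv_lt_0_compat; [lra|now apply Rmult_lt_0_compat]).
    apply Rmult_lt_0_compat; nra. }
  assert (HW2 : forall s, 0 < s -> W tau (x s) * W tau (x s) <= a + b * s).
  { intros s Hs. pose proof (J_linear s ltac:(lra)) as HJ. pose proof (x_pos tau mu A q th z HP s Hs).
    unfold Jr in HJ. pose proof (SIN_bound (th s)). fold la in HJ.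
    assert (H1 : x s * -1 <= x s * sin (th s)) by (apply Rmult_le_compat_l; lra).
    assert (H2 : la * (x s * x s) <= 2 * s / t + x s) by (unfold la; lra).
    assert (H3 : x s <= la * (x s * x s) / 2 + / (2 * la)).
    { assert (H4 : 0 <= (la * x s - 1) * (la * x s - 1) / (2 * la)).
      { apply Rdiv_le_0_compat; [apply Rle_0_sqr|lra]. }
      replace ((la * x s - 1) * (la * x s - 1) / (2 * la)) with
        (la * (x s * x s) / 2 + / (2 * la) - x s) in H4 by (field; lra). lra. }
    assert (H4 : x s * x s <= 4 / (t * la) * s + / (la * la)).
    { apply (Rmult_le_reg_l (la / 2)); [lra|].
      replace (la / 2 * (4 / (t * la) * s + / (la * la))) with (2 * s / t + / (2 * la)) by (field; split; lra).
      lra. }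
    rewrite W_sqr, t_sqr. unfold a, b.
    assert (t * t * (x s * x s) <= t * t * (4 / (t * la) * s + / (la * la))).
    { apply Rmult_le_compat_l; [nra|exact H4]. }
    lra. }
  (* The weight in [W <= W^2 / (2 m) + m / 2] for which the part of the bound on [W / (2 la)]
     growing with [s] is exactly half of the drift. *)
  set (m := b / (2 * la * d)). assert (Hm : 0 < m) by (apply Rdiv_lt_0_compat; nra).
  set (C := Y S + d * S + (a / m + m) / (4 * la)).
  assert (Hz : forall s, S <= s -> z s <= C - d / 2 * s).
  { intros s Hs. specialize (HY s Hs). specialize (HW2 s ltac:(lra)).
    assert (E : z s = Y s + cos (th s) * W tau (x s) / (2 * la) - sin (th s) * sin (th s) / (4 * la * la))
      by (unfold Y; ring).
    assert (H1 : 0 <= sin (th s) * sin (th s) / (4 * la * la)) by (apply Rdiv_le_0_compat; nra).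
    assert (H2 : cos (th s) * W tau (x s) / (2 * la) <= W tau (x s) / (2 * la)).
    { apply Rmult_le_compat_r; [left; apply Rinv_0_lt_compat; lra|].
      pose proof (COS_bound (th s)). pose proof (W_pos tau (x s)). nra. }
    assert (H3 : W tau (x s) <= (a + b * s) / (2 * m) + m / 2).
    { apply Rle_trans with (W tau (x s) * W tau (x s) / (2 * m) + m / 2).
      - assert (0 <= (W tau (x s) - m) * (W tau (x s) - m) / (2 * m)).
        { apply Rdiv_le_0_compat; [apply Rle_0_sqr|lra]. }
        replace ((W tau (x s) - m) * (W tau (x s) - m) / (2 * m)) with
          (W tau (x s) * W tau (x s) / (2 * m) + m / 2 - W tau (x s)) in H by (field; lra). lra.
      - apply Rplus_le_compat_r, Rmult_le_compat_r; [left; apply Rinv_0_lt_compat; lra|exact HW2]. }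
    assert (H4 : W tau (x s) / (2 * la) <= ((a + b * s) / (2 * m) + m / 2) / (2 * la)).
    { apply Rmult_le_compat_r; [left; apply Rinv_0_lt_compat; lra|exact H3]. }
    assert (H5 : ((a + b * s) / (2 * m) + m / 2) / (2 * la) = (a / m + m) / (4 * la) + d / 2 * s).
    { unfold m. field. repeat split; lra. }
    unfold C. lra. }
  intros M. exists (Rmax S ((M + C + 1) / (d / 2))). intros s Hs.
  pose proof (Rmax_l S ((M + C + 1) / (d / 2))). pose proof (Rmax_r S ((M + C + 1) / (d / 2))).
  specialize (Hz s ltac:(lra)).
  assert (H1 : M + C + 1 <= d / 2 * s).
  { apply Rle_trans with (d / 2 * ((M + C + 1) / (d / 2))); [right; field; lra|].
    apply Rmult_le_compat_l; lra. }
  lra.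
Qed.

Lemma J_strict (s r : R) : 0 <= s < r -> (forall u, s < u < r -> cos (th u) <> 0) -> J s < J r.
Proof.
  intros H Hc. apply (increasing_of_deriv J (fun s => 2 * x s * w s * (cos (th s) * cos (th s)))).
  - lra.
  - intros t0 _. eapply is_derive_continuous, (J_deriv tau mu A q th z HP).
  - intros t0 _. apply (J_deriv tau mu A q th z HP).
  - intros u Hu. pose proof (x_pos tau mu A q th z HP u ltac:(lra)). pose proof (Winv_bounds tau (x u)).
    specialize (Hc u Hu). assert (0 < cos (th u) * cos (th u)).
    { destruct (Rdichotomy _ _ Hc); nra. }
    apply Rmult_lt_0_compat; [apply Rmult_lt_0_compat; lra|assumption].
Qed.

(** Far from the axis [th' <= - la], so [th] passes successively through [PI / 2], [- PI / 2],
    [- 3 PI / 2] and [- 5 PI / 2], up to a common multiple of [2 PI]. These vertical tangents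
    delimit the three arcs of [loop_crossing]. The parameter [R0] lets the crossings escape to
    infinity, hence be infinite in number. *)
Lemma self_intersection (R0 : R) : exists s r, 0 < s /\ s < r /\ R0 < x s /\ x s = x r /\ z s = z r.
Proof.
  pose proof t_pos as Ht. assert (Hla : 0 < la) by (unfold la; lra).
  assert (H2t : 0 < 2 / t) by (apply Rdiv_lt_0_compat; lra).
  (* [R0] is the prescribed radius, [1 / la] makes [la x^2 - x] increasing in [x], and the last
     bound keeps the terms of [th'] other than [2 mu] below [la]. *)
  set (X0 := Rmax R0 (Rmax (/ la) ((2 / t + 1) / la))).
  destruct (x_unbounded tau mu A q th z HP Hmu X0) as [S0 HS0].
  set (S := Rmax S0 1). pose proof (Rmax_l S0 1). pose proof (Rmax_r S0 1).
  assert (HX : forall s, S <= s -> R0 < x s /\ / la < x s /\ (2 / t + 1) / la < x s).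
  { intros s Hs. specialize (HS0 s ltac:(unfold S in *; lra)).
    pose proof (Rmax_l R0 (Rmax (/ la) ((2 / t + 1) / la))) as M1.
    pose proof (Rmax_r R0 (Rmax (/ la) ((2 / t + 1) / la))) as M2. fold X0 in M1, M2.
    pose proof (Rmax_l (/ la) ((2 / t + 1) / la)). pose proof (Rmax_r (/ la) ((2 / t + 1) / la)).
    lra. }
  assert (HS : 1 <= S) by (unfold S; lra).
  assert (Hk : forall s, S <= s -> k s <= - la).
  { intros s Hs. destruct (HX s Hs) as [_ [_ H1]].
    pose proof (perturbation_bound s ltac:(lra)) as HB.
    assert (Hx : 0 < x s) by (apply (x_pos tau mu A q th z HP); lra).
    assert ((2 / t + 1) / x s <= la).
    { apply (Rlt_div_l (2 / t + 1) (x s) la Hla) in H1.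
      apply (Rle_div_l (2 / t + 1) la (x s) Hx). lra. }
    pose proof (Rle_abs (2 * (cos (th s) * w s) - q s)).
    unfold kr. unfold la in *. lra. }
  assert (Cth : forall s, continuous th s) by (intros; eapply is_derive_continuous, (th_deriv tau mu A q th z HP)).
  assert (Hdec : forall s r, S <= s < r -> la * (r - s) <= th s - th r).
  { intros s r Hsr.
    assert (- th s - la * s <= - th r - la * r); [|lra].
    apply (nondecreasing_of_deriv (fun s => - th s - la * s) (fun s => - k s - la)); [lra| | |].
    - intros u _. apply (cont_minus (fun s => - th s) (fun s => la * s)).
      + apply (cont_comp th Ropp); [apply Cth|]. apply (is_derive_continuous _ _ (-1)).
        auto_derive; [exact I|ring].
      + apply (cont_mult (fun _ => la) (fun s => s)); [apply cont_const|apply cont_id].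
    - intros u _. apply (deriv_minus (fun s => - th s) (fun s => la * s)).
      + apply deriv_opp, (th_deriv tau mu A q th z HP).
      + eapply is_derive_eq; [apply deriv_scal, deriv_id|ring].
    - intros u Hu. specialize (Hk u ltac:(lra)). lra. }
  assert (Hreach : forall y s0, S <= s0 -> y < th s0 -> exists s, s0 < s /\ th s = y).
  { intros y s0 Hs0 Hy. set (s1 := s0 + (th s0 - y) / la).
    assert (Hp : 0 < (th s0 - y) / la) by (apply Rdiv_lt_0_compat; lra).
    assert (Hs1 : th s1 <= y).
    { pose proof (Hdec s0 s1 ltac:(unfold s1; lra)) as H1.
      assert (la * (s1 - s0) = th s0 - y) by (unfold s1; field; lra). lra. }
    destruct (ivt th s0 s1 y) as [c [Hc1 Hc2]]; [unfold s1; lra|intros; apply Cth|lra|].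
    exists c. split; [|exact Hc2]. destruct (Req_dec c s0) as [->|]; lra. }
  pose proof PI_RGT_0 as HPI.
  (* [n] full turns bring the first level [PI / 2 - P] below [th S], so that all four levels are
     reached after [S]. *)
  destruct (INR_unbounded ((PI / 2 - th S) / (2 * PI))) as [n Hn].
  apply (Rlt_div_l (PI / 2 - th S) (INR n) (2 * PI) ltac:(lra)) in Hn.
  set (P := 2 * INR n * PI).
  destruct (Hreach (PI / 2 - P) S ltac:(lra)) as [a1 [Ha1 Ea1]]; [unfold P; lra|].
  destruct (Hreach (- (PI / 2) - P) a1 ltac:(lra)) as [b1 [Hb1 Eb1]]; [lra|].
  destruct (Hreach (- (3 * (PI / 2)) - P) b1 ltac:(lra)) as [a2 [Ha2 Ea2]]; [lra|].
  destruct (Hreach (- (5 * (PI / 2)) - P) a2 ltac:(lra)) as [b2 [Hb2 Eb2]]; [lra|].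
  assert (Hmono : forall s u r, S <= s -> s < u < r -> th r < th u < th s).
  { intros s u r Hs Hu. pose proof (Hdec s u ltac:(lra)). pose proof (Hdec u r ltac:(lra)).
    assert (0 < la * (u - s)) by (apply Rmult_lt_0_compat; lra).
    assert (0 < la * (r - u)) by (apply Rmult_lt_0_compat; lra). lra. }
  assert (Ecos : forall s, cos (th s) = cos (th s + P)).
  { intros s. symmetry. apply cos_period. }
  assert (Esin : forall s, sin (th s) = sin (th s + P)).
  { intros s. symmetry. apply sin_period. }
  assert (C1 : forall u, a1 < u < b1 -> 0 < cos (th u)).
  { intros u Hu. destruct (Hmono a1 u b1 ltac:(lra) Hu). rewrite Ecos. apply cos_gt_0; lra. }
  assert (C2 : forall u, b1 < u < a2 -> cos (th u) < 0).
  { intros u Hu. destruct (Hmono b1 u a2 ltac:(lra) Hu). rewrite Ecos, <- cos_neg.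
    apply cos_lt_0; lra. }
  assert (C3 : forall u, a2 < u < b2 -> 0 < cos (th u)).
  { intros u Hu. destruct (Hmono a2 u b2 ltac:(lra) Hu). rewrite Ecos.
    rewrite <- (cos_period _ 1). simpl INR. apply cos_gt_0; lra. }
  assert (Sa1 : sin (th a1) = 1).
  { rewrite Esin, Ea1. replace (PI / 2 - P + P) with (PI / 2) by ring. apply sin_PI2. }
  assert (Sb1 : sin (th b1) = -1).
  { rewrite Esin, Eb1. replace (- (PI / 2) - P + P) with (- (PI / 2)) by ring.
    now rewrite sin_neg, sin_PI2. }
  assert (Sa2 : sin (th a2) = 1).
  { rewrite Esin, Ea2. replace (- (3 * (PI / 2)) - P + P) with (- (3 * (PI / 2))) by ring.
    rewrite <- (sin_period _ 1). simpl INR.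
    replace (- (3 * (PI / 2)) + 2 * 1 * PI) with (PI / 2) by field. apply sin_PI2. }
  assert (Sb2 : sin (th b2) = -1).
  { rewrite Esin, Eb2. replace (- (5 * (PI / 2)) - P + P) with (- (5 * (PI / 2))) by ring.
    rewrite <- (sin_period _ 1). simpl INR.
    replace (- (5 * (PI / 2)) + 2 * 1 * PI) with (- (PI / 2)) by field. now rewrite sin_neg, sin_PI2. }
  assert (J1 : J a1 < J b1).
  { apply J_strict; [lra|]. intros u Hu. specialize (C1 u Hu). lra. }
  assert (J2 : J b1 < J a2).
  { apply J_strict; [lra|]. intros u Hu. specialize (C2 u Hu). lra. }
  assert (J3 : J a2 < J b2).
  { apply J_strict; [lra|]. intros u Hu. specialize (C3 u Hu). lra. }
  (* Where [sin th = 1], [J = x + la x^2] is increasing in [x]; where [sin th = -1],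
     [J = la x^2 - x] is so beyond [1 / la]. In both cases the strict growth of [J] orders the
     radii. *)
  assert (Xa : x a1 < x a2).
  { assert (J a1 < J a2) as HJ by lra. unfold Jr in HJ. rewrite Sa1, Sa2 in HJ.
    pose proof (x_pos tau mu A q th z HP a1 ltac:(lra)). pose proof (x_pos tau mu A q th z HP a2 ltac:(lra)).
    apply Rnot_le_lt. intros Hle.
    assert (- mu * (x a2 * x a2) <= - mu * (x a1 * x a1)) by (apply Rmult_le_compat_l; nra). lra. }
  assert (Xb : x b1 < x b2).
  { assert (J b1 < J b2) as HJ by lra. unfold Jr in HJ. rewrite Sb1, Sb2 in HJ.
    destruct (HX b1 ltac:(lra)) as [_ [K1 _]]. destruct (HX b2 ltac:(lra)) as [_ [K2 _]].
    assert (L1 : 1 < la * x b1).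
    { apply Rle_lt_trans with (la * / la); [right; field; lra|]. now apply Rmult_lt_compat_l. }
    assert (L2 : 1 < la * x b2).
    { apply Rle_lt_trans with (la * / la); [right; field; lra|]. now apply Rmult_lt_compat_l. }
    apply Rnot_le_lt. intros Hle. unfold la in *.
    assert (0 <= (x b1 - x b2) * (- mu * (x b1 + x b2) - 1)) by (apply Rmult_le_pos; lra). lra. }
  assert (Dx := x_deriv tau mu A q th z HP). assert (Dz := z_deriv tau mu A q th z HP).
  assert (Cx : forall s, continuous x s) by (intros; eapply is_derive_continuous, Dx).
  destruct (loop_crossing x z a1 b1 a2 b2) as [s [r [Hs [Hsr [Ex Ez]]]]]; try assumption.
  - intros s. eapply is_derive_continuous, Dz.
  - intros s r Hs Hsr Hr. apply (increasing_of_deriv x (fun s => cos (th s))); auto.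
    intros u Hu. apply C1. lra.
  - intros s r Hs Hsr Hr. apply Ropp_lt_cancel.
    apply (increasing_of_deriv (fun s => - x s) (fun s => - cos (th s))); auto.
    + intros u _. eapply is_derive_continuous, deriv_opp, Dx.
    + intros u _. apply deriv_opp, Dx.
    + intros u Hu. specialize (C2 u ltac:(lra)). lra.
  - intros s r Hs Hsr Hr. apply (increasing_of_deriv x (fun s => cos (th s))); auto.
    intros u Hu. apply C3. lra.
  - apply (local_decrease z b1 _ (Dz b1)). rewrite Sb1. pose proof (W_pos tau (x b1)). lra.
  - apply (local_increase z a2 _ (Dz a2)). rewrite Sa2. pose proof (W_pos tau (x a2)). lra.
  - exists s, r. split; [lra|]. split; [exact Hsr|]. split; [|now split].
    apply HX. lra.
Qed.

(** A finite list of circles has bounded radii, and there is a crossing beyond any radius. *)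
Lemma disk_self_intersections : infinitely_many_self_intersections (disk_map A z).
Proof.
  intros l.
  assert (Hb : exists B, forall p, In p l -> fst p <= B).
  { induction l as [|p l [B HB]].
    - exists 0. intros p [].
    - exists (Rmax B (fst p)). intros p' [<-|Hp].
      + apply Rmax_r.
      + eapply Rle_trans; [now apply HB|apply Rmax_l]. }
  destruct Hb as [B HB].
  destruct (self_intersection B) as [s [r [Hs [Hsr [HBs [Ex Ez]]]]]].
  assert (Hr1 : rho s 0 = s).
  { unfold rho. rewrite Rmult_0_r, Rplus_0_r. apply sqrt_square. lra. }
  assert (Hr2 : rho r 0 = r).
  { unfold rho. rewrite Rmult_0_r, Rplus_0_r. apply sqrt_square. lra. }
  exists s, 0, r, 0. split; [|split].
  - intros E. injection E as E. lra.
  - unfold disk_map. rewrite Hr1, Hr2. unfold prad in Ex. rewrite Ex, Ez. apply pt_eq; ring.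
  - intros Hin. specialize (HB _ Hin). cbn [fst] in HB.
    rewrite (disk_axis_dist tau mu A q th z HP), Hr1 in HB. lra.
Qed.

Lemma disk_axis_dist_unbounded : axis_dist_unbounded (disk_map A z).
Proof.
  intros C. destruct (x_unbounded tau mu A q th z HP Hmu C) as [S HS].
  exists (Rmax S 0), 0. rewrite (disk_axis_dist tau mu A q th z HP).
  assert (E : rho (Rmax S 0) 0 = Rmax S 0).
  { unfold rho. rewrite Rmult_0_r, Rplus_0_r. apply sqrt_square, Rmax_r. }
  rewrite E. apply HS, Rmax_l.
Qed.

Lemma disk_height_to_minus_infinity : tends_at_infinity (fun u v => cz (disk_map A z u v)) m_infty.
Proof. apply (plane_diverges_neg z); [reflexivity|]. apply height_to_minus_infinity. Qed.
End Spiral.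

(** * The surface as a graph near the axis *)

Lemma is_derive_inverse (f g : R -> R) (y l : R) : l <> 0 -> is_derive f (g y) l ->
  continuous g y -> locally y (fun y' => f (g y') = y') -> is_derive g y (/ l).
Proof.
  intros Hl Hf Hg [d0 Hd0].
  apply is_derive_Reals in Hf. apply is_derive_Reals. intros eps He.
  destruct (proj1 (continuous_eps (fun v => / v) l)
    (cont_inv (fun v => v) l (cont_id l) Hl) eps He) as [eta [Heta Hinv]].
  destruct (Hf eta Heta) as [d1 Hd1].
  destruct (proj1 (continuous_eps g y) Hg d1 (cond_pos d1)) as [d2 [Hd2 Hg2]].
  assert (Hd : 0 < Rmin d0 d2) by (apply Rmin_glb_lt; [apply cond_pos|exact Hd2]).
  exists (mkposreal _ Hd). intros h Hh Hhd. simpl in Hhd.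
  pose proof (Rmin_l d0 d2). pose proof (Rmin_r d0 d2).
  assert (E1 : f (g (y + h)) = y + h).
  { apply Hd0. change (Rabs (y + h - y) < d0). replace (y + h - y) with h by ring. lra. }
  assert (E0 : f (g y) = y).
  { apply Hd0. change (Rabs (y - y) < d0). rewrite Rminus_diag, Rabs_R0. apply cond_pos. }
  set (j := g (y + h) - g y).
  assert (Hj : j <> 0).
  { intros E. apply Hh. assert (g (y + h) = g y) by (unfold j in E; lra). rewrite H1, E0 in E1. lra. }
  assert (Hjd : Rabs j < d1).
  { apply Hg2. replace (y + h - y) with h by ring. lra. }
  specialize (Hd1 j Hj Hjd). replace (g y + j) with (g (y + h)) in Hd1 by (unfold j; ring).
  rewrite E1, E0 in Hd1. replace (y + h - y) with h in Hd1 by ring.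
  specialize (Hinv _ Hd1).
  replace (j / h) with (/ (h / j)); [exact Hinv|]. field. now split.
Qed.

Lemma radial_sub (I I' : R -> Prop) (m : nat) : (forall s, I' s -> I s) ->
  forall f, radial I m f -> radial I' m f.
Proof.
  intros H. induction m as [|m IH]; intros f Hf.
  - intros s Hs. apply Hf. now apply H.
  - destruct Hf as [g [Hg Hd]]. exists g. split; [now apply IH|]. intros s Hs. apply Hd. now apply H.
Qed.

Lemma rho_scal (u v c : R) : 0 <= c -> rho (u * c) (v * c) = rho u v * c.
Proof.
  intros Hc. unfold rho. replace (u * c * (u * c) + v * c * (v * c)) with ((u * u + v * v) * (c * c)) by ring.
  rewrite sqrt_mult by nra. now rewrite sqrt_square.
Qed.

Lemma disc_rho (d u v : R) : 0 < d -> disc d u v <-> rho u v < d.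
Proof.
  intros Hd. unfold disc. rewrite <- rho_sqr. pose proof (rho_pos u v). split; intros H0; nra.
Qed.

Section Graph.
Variables (tau mu : R) (A q th z : R -> R).
Hypothesis Htau : tau <> 0.
Hypothesis HP : profile tau mu A q th z.

Notation x := (prad A).

Lemma prad_odd (s : R) : x (- s) = - x s.
Proof. unfold prad. rewrite (pr_A_even _ _ _ _ _ _ HP). ring. Qed.

(** At [mu = -1] one has [q 0 = 0], so the value of [q] on the axis does not decide. Instead [(x sin
    th)' = 2 x cos th (cos th / W + mu)], and [W > 1] off the axis because [tau <> 0]: the bracket
    is negative for every [mu <= -1]. *)
Lemma sin_neg_near_axis : mu <= -1 -> exists d, 0 < d /\ forall s, 0 < s < d -> sin (th s) < 0.
Proof.
  intros Hmu. destruct (cos_pos_near_0 tau mu A q th z HP) as [d [Hd Hc]].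
  exists d. split; [exact Hd|]. intros s Hs.
  assert (Hx : forall r, 0 < r -> 0 < x r) by (intros; now apply (x_pos tau mu A q th z HP)).
  assert (Hd1 : forall r, is_derive (fun r => - (x r * sin (th r))) r
     (- (2 * x r * cos (th r) * (cos (th r) * / W tau (x r) + mu)))).
  { intros r. apply deriv_opp. eapply is_derive_eq.
    - apply (deriv_mult x (fun r => sin (th r))); [apply (x_deriv tau mu A q th z HP)|apply (sin_deriv tau mu A q th z HP)].
    - cbv beta. unfold kr. rewrite (sin_x_q tau mu A q th z HP). ring. }
  assert (H : - (x 0 * sin (th 0)) < - (x s * sin (th s))).
  { apply (increasing_of_deriv (fun r => - (x r * sin (th r)))
      (fun r => - (2 * x r * cos (th r) * (cos (th r) * / W tau (x r) + mu)))); [lra| | |].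
    - intros r _. eapply is_derive_continuous, Hd1.
    - intros r _. apply Hd1.
    - intros r Hr. specialize (Hc r). rewrite Rabs_right in Hc by lra. specialize (Hc ltac:(lra)).
      pose proof (Hx r ltac:(lra)) as Hxr. pose proof (COS_bound (th r)).
      assert (Hw : / W tau (x r) < 1).
      { rewrite <- Rinv_1. apply Rinv_lt_contravar; [pose proof (W_pos tau (x r)); lra|].
        pose proof (W_sqr tau (x r)). pose proof (W_pos tau (x r)).
        assert (0 < tau * tau) by (destruct (Rdichotomy _ _ Htau); nra).
        assert (0 < tau * tau * (x r * x r)) by (apply Rmult_lt_0_compat; nra). nra. }
      pose proof (Winv_bounds tau (x r)).
      assert (cos (th r) * / W tau (x r) < 1) by nra.
      assert (0 < 2 * x r * cos (th r)) by (apply Rmult_lt_0_compat; lra). nra. }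
  rewrite (x_0 A), Rmult_0_l in H. specialize (Hx s ltac:(lra)). nra.
Qed.

(** Here [sin th = x q] with [q 0 = 1 + mu > 0] settles the sign. *)
Lemma sin_pos_near_axis : -1 < mu -> exists d, 0 < d /\ forall s, 0 < s < d -> 0 < sin (th s).
Proof.
  intros Hmu.
  assert (Hq : continuous q 0) by now apply (radial_continuous everywhere 0 q 0 (pr_radial_q _ _ _ _ _ _ HP 0)).
  assert (H0 : q 0 = 1 + mu) by apply (q_at_0 tau mu A q th z HP).
  destruct (proj1 (continuous_eps q 0) Hq (1 + mu)) as [d [Hd Hd']]; [lra|].
  exists d. split; [exact Hd|]. intros s Hs. specialize (Hd' s).
  rewrite Rminus_0_r, Rabs_right, H0 in Hd' by lra. specialize (Hd' ltac:(lra)). apply Rabs_def2 in Hd'.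
  rewrite (sin_x_q tau mu A q th z HP). apply Rmult_lt_0_compat; [|lra].
  apply (x_pos tau mu A q th z HP). lra.
Qed.

(** [x] is odd and strictly increasing on [[- d, d]], where [cos th > 0]; with [g] its inverse, the
    surface is the graph of [z (g (rho a b))]. Using both signs of the parameter makes [g]
    differentiable at [0]. *)
Lemma local_graph (side : pt -> Prop) (d0 : R) : 0 < d0 ->
  (forall a b s, 0 < s < d0 -> side (a, b, z s)) ->
  local_vertical_graph (disk_map A z) 0 0 side.
Proof.
  intros Hd0 Hside. destruct (cos_pos_near_0 tau mu A q th z HP) as [d1 [Hd1 Hc1]].
  set (d := Rmin d0 d1 / 2).
  assert (Hm : 0 < Rmin d0 d1) by now apply Rmin_glb_lt.
  pose proof (Rmin_l d0 d1). pose proof (Rmin_r d0 d1).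
  assert (Hd : 0 < d /\ d < d0 /\ d < d1) by (unfold d; lra).
  assert (Hcos : forall s, - d <= s <= d -> 0 < cos (th s)).
  { intros s Hs. assert (/ 2 < cos (th s)); [|lra]. apply Hc1. apply Rabs_def1; lra. }
  assert (Hx1 := x_deriv tau mu A q th z HP).
  assert (Cx : forall s, continuous x s) by (intros; eapply is_derive_continuous, Hx1).
  assert (Ix : forall s r, - d <= s -> s < r -> r <= d -> x s < x r).
  { intros s r Hs Hsr Hr. apply (increasing_of_deriv x (fun s => cos (th s))); auto.
    intros u Hu. apply Hcos. lra. }
  destruct (increasing_inverse x (- d) d ltac:(lra) (fun s _ => Cx s) Ix) as [g [G1 [G2 Cg]]].
  set (ep := x d) in *.
  assert (Hep : 0 < ep) by (apply (x_pos tau mu A q th z HP); lra).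
  assert (Hneg : x (- d) = - ep) by apply prad_odd.
  assert (G3 : forall y, Rabs y < ep -> Rabs (g y) < d /\ x (g y) = y).
  { intros y Hy. apply Rabs_def2 in Hy. destruct (G1 y ltac:(lra)) as [K1 K2]. split; [|exact K2].
    apply Rabs_def1.
    - destruct (Req_dec (g y) d) as [E|]; [|lra]. rewrite E in K2. unfold ep in Hy. lra.
    - destruct (Req_dec (g y) (- d)) as [E|]; [|lra]. rewrite E in K2. lra. }
  assert (G4 : forall y, 0 <= y < ep -> 0 <= g y < d).
  { intros y Hy. destruct (G3 y) as [K1 K2]; [rewrite Rabs_right; lra|].
    apply Rabs_def2 in K1. split; [|lra]. apply Rnot_lt_le. intros Hlt.
    assert (x (g y) < x 0) by (apply Ix; lra). rewrite (x_0 A) in *. lra. }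
  set (I0 := fun s => Rabs s < d). set (I1 := fun y => Rabs y < ep).
  (* If [f' = s f1], then [g' = 1 / cos th] and [g y = y / A] give [y * f1 / (A cos th)], evaluated
     at [g y], as the derivative of the composite: smoothness in the square of the arc length
     becomes smoothness in the square of the radius. *)
  assert (Hrad : forall m f, radial I0 m f -> radial I1 m (fun y => f (g y))).
  { induction m as [|m IH]; intros f Hf.
    - intros y Hy. apply (cont_comp g f); [apply Cg|]. apply Hf. now apply G3.
    - destruct Hf as [f1 [Hf1 Hf2]].
      exists (fun y => (fun s => f1 s / (A s * cos (th s))) (g y)). split.
      + apply (IH (fun s => f1 s / (A s * cos (th s)))). apply radial_div; [|exact Hf1|].
        * intros s Hs. apply Rabs_def2 in Hs. pose proof (Hcos s ltac:(lra)).
          pose proof (pr_A_pos _ _ _ _ _ _ HP s). apply Rmult_integral_contrapositive_currified; lra.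
        * apply radial_mult; apply (radial_sub everywhere); try (now intros).
          -- exact (pr_radial_A _ _ _ _ _ _ HP m).
          -- exact (pr_radial_cos _ _ _ _ _ _ HP m).
      + intros y Hy. destruct (G3 y Hy) as [K1 K2].
        assert (K1' := K1). apply Rabs_def2 in K1'. pose proof (Hcos (g y) ltac:(lra)) as Hcy.
        pose proof (pr_A_pos _ _ _ _ _ _ HP (g y)) as HAy.
        eapply is_derive_eq.
        * apply (deriv_comp f g); [|now apply Hf2].
          apply (is_derive_inverse x g y (cos (th (g y)))); [lra|apply Hx1|apply Cg|].
          assert (Hpy : 0 < ep - Rabs y) by (unfold I1 in Hy; lra).
          exists (mkposreal _ Hpy). intros y' Hy'. apply G3.
          assert (Hy2 : Rabs (y' - y) < ep - Rabs y) by exact Hy'.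
          replace y' with ((y' - y) + y) by ring. eapply Rle_lt_trans; [apply Rabs_triang|lra].
        * set (s := g y) in *. rewrite <- K2. unfold prad. field. split; lra. }
  exists d, ep, (fun a b => z (g (rho a b))).
  split; [lra|]. split; [exact Hep|]. split; [|split; [|split]].
  - apply (C2_smooth (disc ep) (fun u v => open_disc_locally ep u v) (fun a b => z (g (rho a b)))); [|easy].
    intros m. apply (C2_radial (disc ep) I1 m) with (f := fun y => z (g y)).
    + intros u v Huv. apply disc_rho in Huv; [|exact Hep].
      unfold I1. rewrite Rabs_right; [exact Huv|apply Rle_ge, rho_pos].
    + apply Hrad. apply (radial_sub everywhere); [now intros|]. exact (pr_radial_z _ _ _ _ _ _ HP m).
  - intros u v Huv. rewrite !Rminus_0_r in Huv. apply disc_rho in Huv; [|lra].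
    assert (HA : 0 < A (rho u v)) by apply (pr_A_pos _ _ _ _ _ _ HP).
    unfold disk_map, cx, cy, cz; cbn [fst snd].
    assert (E : rho (u * A (rho u v)) (v * A (rho u v)) = x (rho u v)) by (apply rho_scal; lra).
    pose proof (rho_pos u v). split.
    + apply disc_rho; [exact Hep|]. rewrite E. apply Ix; lra.
    + rewrite E, G2 by lra. reflexivity.
  - intros a b Hab. apply disc_rho in Hab; [|exact Hep].
    pose proof (rho_pos a b) as Hr. set (r := rho a b) in *.
    destruct (G4 r ltac:(lra)) as [K1 K2]. destruct (G3 r) as [_ K3]; [rewrite Rabs_right; lra|].
    set (s := g r) in *. assert (HA : 0 < A s) by apply (pr_A_pos _ _ _ _ _ _ HP).
    exists (a * / A s, b * / A s).
    assert (Er : rho (a * / A s) (b * / A s) = s).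
    { rewrite rho_scal by (left; now apply Rinv_0_lt_compat). fold r. rewrite <- K3. unfold prad. field. lra. }
    split; [split|].
    + cbn [fst snd]. rewrite !Rminus_0_r. apply disc_rho; [lra|]. rewrite Er. exact K2.
    + cbn [fst snd]. unfold disk_map. rewrite Er. apply pt_eq; [field; lra|field; lra|reflexivity].
    + intros [u v] [Hd2 HF]. cbn [fst snd] in *. rewrite !Rminus_0_r in Hd2.
      apply disc_rho in Hd2; [|lra]. unfold disk_map in HF. injection HF as E1 E2 _.
      assert (HAu : 0 < A (rho u v)) by apply (pr_A_pos _ _ _ _ _ _ HP).
      assert (E : r = x (rho u v)).
      { unfold r. rewrite <- E1, <- E2. apply rho_scal. lra. }
      assert (Es : s = rho u v).
      { unfold s. rewrite E. apply G2. pose proof (rho_pos u v). lra. }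
      rewrite Es in *. rewrite <- E1, <- E2. f_equal; field; lra.
  - intros a b Hab Hne. apply disc_rho in Hab; [|exact Hep]. apply Hside.
    destruct (G4 (rho a b)) as [K1 K2]; [split; [apply rho_pos|exact Hab]|].
    split; [|lra]. destruct K1 as [|K1]; [assumption|]. exfalso. apply Hne.
    destruct (G3 (rho a b)) as [_ K3]; [rewrite Rabs_right; [exact Hab|apply Rle_ge, rho_pos]|].
    rewrite <- K1, (x_0 A) in K3. destruct (rho_zero a b (eq_sym K3)) as [-> ->]. reflexivity.
Qed.

Lemma z_strict (s : R) (sg : R) : 0 < s -> (forall r, 0 < r < s -> 0 < sg * sin (th r)) ->
  sg * z 0 < sg * z s.
Proof.
  intros Hs H. assert (Hz := z_deriv tau mu A q th z HP).
  apply (increasing_of_deriv (fun r => sg * z r) (fun r => sg * (sin (th r) * W tau (x r)))); [exact Hs| | |].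
  - intros r _. eapply is_derive_continuous, deriv_scal, Hz.
  - intros r _. apply deriv_scal, Hz.
  - intros r Hr. specialize (H r Hr). pose proof (W_pos tau (x r)). rewrite <- Rmult_assoc.
    now apply Rmult_lt_0_compat.
Qed.

Lemma disk_graph (u0 v0 z0 : R) : disk_map A z u0 v0 = (0, 0, z0) ->
  (mu <= -1 -> local_vertical_graph (disk_map A z) u0 v0 (above_downwards_plane z0)) /\
  (-1 < mu -> local_vertical_graph (disk_map A z) u0 v0 (below_downwards_plane z0)).
Proof.
  intros H. unfold disk_map in H. injection H as H1 H2 H3.
  pose proof (pr_A_pos _ _ _ _ _ _ HP (rho u0 v0)).
  assert (u0 = 0) by (apply Rmult_integral in H1; destruct H1; lra).
  assert (v0 = 0) by (apply Rmult_integral in H2; destruct H2; lra).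
  subst u0 v0. rewrite rho_0 in H3. subst z0. split; intros Hmu.
  - destruct (sin_neg_near_axis Hmu) as [d [Hd Hs]]. apply (local_graph _ d Hd).
    intros a b s Hsd. unfold above_downwards_plane, cz; cbn [snd].
    assert (-1 * z 0 < -1 * z s); [|lra]. apply z_strict; [lra|].
    intros r Hr. specialize (Hs r ltac:(lra)). lra.
  - destruct (sin_pos_near_axis Hmu) as [d [Hd Hs]]. apply (local_graph _ d Hd).
    intros a b s Hsd. unfold below_downwards_plane, cz; cbn [snd].
    assert (1 * z 0 < 1 * z s); [|lra]. apply z_strict; [lra|].
    intros r Hr. specialize (Hs r ltac:(lra)). lra.
Qed.
End Graph.

(** * Surfaces off the axis *)

(** Orthogonality to the circle fixes the angular component, [b = tau x kp] with [kp] the contact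
    component. What remains is the vector [(a, y)] with [y = w kp]: it has unit length and is
    orthogonal to [(C, Sn)], hence equals [e (- Sn, C)]. *)
Lemma unit_normal_characterization (tau x v C Sn c s z : R) (N : pt) :
  x <> 0 -> v <> 0 -> C * C + Sn * Sn = 1 -> c * c + s * s = 1 ->
  let p := (x * c, x * s, z) in
  inner tau p N N = 1 ->
  inner tau p N (frame c s (v * C) 0 (v * W tau x * Sn)) = 0 ->
  inner tau p N (frame c s 0 x 0) = 0 ->
  let e := inner tau p N (unit_normal tau 1 x C Sn c s) in
  (e = 1 \/ e = -1) /\ N = unit_normal tau e x C Sn c s.
Proof.
  intros Hx Hv HC Hcs p H1 H2 H3 e. destruct N as [[n1 n2] n3].
  set (a := n1 * c + n2 * s). set (b := n2 * c - n1 * s).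
  assert (EN : (n1, n2, n3) = frame c s a b n3).
  { unfold frame, a, b. apply pt_eq; [| |reflexivity].
    - transitivity (n1 * (c * c + s * s)); [rewrite Hcs; ring|ring].
    - transitivity (n2 * (c * c + s * s)); [rewrite Hcs; ring|ring]. }
  unfold e. rewrite EN in *. clear EN e. unfold p in *.
  rewrite inner_unit_normal by exact Hcs.
  rewrite inner_frame in H1, H2, H3 by exact Hcs.
  pose proof (W_pos tau x) as Hw. pose proof (W_sqr tau x) as HW. set (w := W tau x) in *.
  set (kp := n3 - tau * x * b) in *.
  assert (Hb : b = tau * x * kp).
  { apply (Rmult_eq_reg_l x); [|exact Hx]. lra. }
  assert (En3 : n3 = w * w * kp).
  { assert (n3 = kp + tau * x * b) by (unfold kp; ring). rewrite H, Hb, HW. ring. }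
  set (y := kp * w).
  assert (E1 : a * C + y * Sn = 0).
  { apply (Rmult_eq_reg_l v); [|exact Hv]. unfold y. lra. }
  assert (E2 : a * a + y * y = 1).
  { rewrite <- H1, Hb. unfold y. transitivity (a * a + kp * kp * (w * w)); [ring|]. rewrite HW. ring. }
  assert (Ee : 1 * (n3 * C / w - a * Sn) = y * C - a * Sn).
  { rewrite En3. unfold y. field. lra. }
  rewrite Ee. set (e := y * C - a * Sn).
  assert (Ha : a = - e * Sn).
  { unfold e. transitivity (a * (C * C + Sn * Sn) - C * (a * C + y * Sn)); [rewrite HC, E1; ring|ring]. }
  assert (Hy : y = e * C).
  { unfold e. transitivity (y * (C * C + Sn * Sn) - Sn * (a * C + y * Sn)); [rewrite HC, E1; ring|ring]. }
  split.
  - assert (He : e * e = 1).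
    { transitivity (a * a + y * y); [|exact E2]. rewrite Ha, Hy.
      transitivity (e * e * (C * C + Sn * Sn)); [rewrite HC; ring|ring]. }
    assert (Hf : (e - 1) * (e + 1) = 0) by lra.
    apply Rmult_integral in Hf. destruct Hf; [left|right]; lra.
  - unfold unit_normal. fold w. f_equal.
    + exact Ha.
    + rewrite Hb. transitivity (tau * x * y / w); [unfold y; field; lra|rewrite Hy; field; lra].
    + rewrite En3. transitivity (w * y); [unfold y; ring|rewrite Hy; ring].
Qed.

(** The speed in the orbit metric [dx^2 + dz^2 / W^2], so that [slope_cos] and [slope_sin] belong to
    the slope angle. The angle itself, which would require a continuous choice, is never formed for
    an arbitrary surface. *)
Definition speed (tau : R) (S : rot_data) (s : R) : R :=
  sqrt (Derive (rad S) s * Derive (rad S) s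
        + Derive (hgt S) s / W tau (rad S s) * (Derive (hgt S) s / W tau (rad S s))).
Definition slope_cos (tau : R) (S : rot_data) (s : R) : R :=
  Derive (rad S) s / speed tau S s.
Definition slope_sin (tau : R) (S : rot_data) (s : R) : R :=
  Derive (hgt S) s / W tau (rad S s) / speed tau S s.

Definition has_normal (tau e : R) (S : rot_data) (s : R) : Prop := forall t,
  nrm S s t = unit_normal tau e (rad S s) (slope_cos tau S s) (slope_sin tau S s) (cos t) (sin t).

Lemma ex_diff_second (h : R -> R -> R) (u v : R) : ex_diff_n h 2 u v ->
  ex_derive (fun a => h a v) u /\ ex_derive (fun a => Derive (fun b => h b v) a) u.
Proof.
  intros [_ [H1 [_ [[_ [H2 _]] _]]]]. split; [exact H1|exact H2].
Qed.

Lemma deriv_sqrt (f : R -> R) (s a : R) : is_derive f s a -> 0 < f s ->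
  is_derive (fun s => sqrt (f s)) s (a / (2 * sqrt (f s))).
Proof.
  intros Hf H0. pose proof (sqrt_lt_R0 _ H0).
  eapply is_derive_eq; [apply (is_derive_sqrt f _ _ Hf H0)|]. field. lra.
Qed.

Lemma unit_normal_sign (tau e e' x C Sn c s z : R) : c * c + s * s = 1 -> C * C + Sn * Sn = 1 ->
  inner tau (x * c, x * s, z) (unit_normal tau e x C Sn c s) (unit_normal tau e' x C Sn c s) = e * e'.
Proof.
  intros Hcs HC. unfold unit_normal at 1. rewrite inner_unit_normal by exact Hcs.
  pose proof (W_pos tau x). transitivity (e * e' * (C * C + Sn * Sn)); [field; lra|rewrite HC; ring].
Qed.

Section OffAxis.
Variables (tau lam : R) (S : rot_data) (s : R).
Hypothesis HS : rotational_translator tau lam S.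
Hypothesis Hdom : dom S s.
Hypothesis Hrad : 0 < rad S s.

(** Everything is read off the slice [t = 0] of a local parametrization. The rank condition tested
    on [(0, 1)] excludes the axis at neighbouring parameters, and tested on [(1, 0)] it excludes a
    vanishing velocity. *)
Lemma off_axis_regular : exists d, 0 < d /\ forall u, Rabs (u - s) < d -> dom S u /\ 0 < rad S u /\
  ex_derive (rad S) u /\ ex_derive (hgt S) u /\
  ex_derive (Derive (rad S)) u /\ ex_derive (Derive (hgt S)) u /\ 0 < speed tau S u.
Proof.
  destruct HS as [HR _]. destruct (rot_immersed _ _ HR s Hdom) as [D [F [n [Hloc Him]]]].
  destruct Hloc as [d Hd Hr Hds HD HF|sg d Hd Hr _ _ _ _]; [|lra].
  exists d. split; [exact Hd|]. intros u Hu.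
  assert (Hl := locally_abs_lt s d u Hu).
  assert (HDu : D u 0) by now apply HD.
  assert (HF0 : forall y, Rabs (y - s) < d -> F y 0 = (rad S y, 0, hgt S y)).
  { intros y Hy. destruct (HF y 0) as [-> _]; [now apply HD|]. unfold rot_map.
    rewrite cos_0, sin_0. apply pt_eq; ring. }
  destruct (ex_diff_second _ u 0 (imm_smooth _ _ _ _ Him ax 2%nat u 0 HDu)) as [Ex1 Ex2].
  destruct (ex_diff_second _ u 0 (imm_smooth _ _ _ _ Him az 2%nat u 0 HDu)) as [Ez1 Ez2].
  assert (Lx : forall a, Rabs (a - s) < d -> locally a (fun y => coord ax (F y 0) = rad S y)).
  { intros a Ha. generalize (locally_abs_lt s d a Ha). apply filter_imp. intros y Hy. now rewrite HF0. }
  assert (Lz : forall a, Rabs (a - s) < d -> locally a (fun y => coord az (F y 0) = hgt S y)).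
  { intros a Ha. generalize (locally_abs_lt s d a Ha). apply filter_imp. intros y Hy. now rewrite HF0. }
  assert (Hdu : du F u 0 = (Derive (rad S) u, 0, Derive (hgt S) u)).
  { unfold du. apply pt_eq.
    - apply Derive_ext_loc. now apply Lx.
    - apply (Derive_locally _ (fun _ => 0)); [|apply deriv_const].
      generalize Hl. apply filter_imp. intros y Hy. now rewrite HF0.
    - apply Derive_ext_loc. now apply Lz. }
  assert (Hdv : dv F u 0 = (0, rad S u, 0)).
  { unfold dv. assert (HFu : forall b, F u b = (rad S u * cos b, rad S u * sin b, hgt S u)).
    { intros b. destruct (HF u b) as [-> _]; [now apply HD|reflexivity]. }
    apply pt_eq.
    - apply (Derive_locally _ (fun b => rad S u * cos b)).
      + apply filter_forall. intros b. now rewrite HFu.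
      + auto_derive; [exact I|]. rewrite sin_0. ring.
    - apply (Derive_locally _ (fun b => rad S u * sin b)).
      + apply filter_forall. intros b. now rewrite HFu.
      + auto_derive; [exact I|]. rewrite cos_0. ring.
    - apply (Derive_locally _ (fun _ => hgt S u)); [|apply deriv_const].
      apply filter_forall. intros b. now rewrite HFu. }
  assert (Hdomu : dom S u) by now apply Hds.
  split; [exact Hdomu|]. split.
  { destruct (rot_half_plane _ _ HR u Hdomu) as [|H0]; [assumption|]. exfalso.
    destruct (imm_rank _ _ _ _ Him u 0 HDu 0 1) as [_ Hb]; [|lra].
    intros i. rewrite Hdu, Hdv. destruct i; unfold coord, cx, cy, cz; simpl; lra. }
  split; [apply (ex_derive_ext_loc (fun a => coord ax (F a 0))); [now apply Lx|exact Ex1]|].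
  split; [apply (ex_derive_ext_loc (fun a => coord az (F a 0))); [now apply Lz|exact Ez1]|].
  split.
  { apply (ex_derive_ext_loc (fun a => Derive (fun b => coord ax (F b 0)) a)); [|exact Ex2].
    generalize Hl. apply filter_imp. intros y Hy. apply Derive_ext_loc. now apply Lx. }
  split.
  { apply (ex_derive_ext_loc (fun a => Derive (fun b => coord az (F b 0)) a)); [|exact Ez2].
    generalize Hl. apply filter_imp. intros y Hy. apply Derive_ext_loc. now apply Lz. }
  apply sqrt_lt_R0. pose proof (W_pos tau (rad S u)) as Hw.
  set (x1 := Derive (rad S) u) in *. set (z1 := Derive (hgt S) u) in *.
  assert (H0 : 0 <= x1 * x1 + z1 / W tau (rad S u) * (z1 / W tau (rad S u))).
  { apply Rplus_le_le_0_compat; apply Rle_0_sqr. }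
  destruct H0 as [|H0]; [assumption|exfalso].
  pose proof (Rle_0_sqr x1) as Q1. pose proof (Rle_0_sqr (z1 / W tau (rad S u))) as Q2.
  unfold Rsqr in Q1, Q2.
  assert (Hx1 : x1 = 0) by (apply Rsqr_0_uniq; unfold Rsqr; lra).
  assert (Hzw : z1 / W tau (rad S u) = 0) by (apply Rsqr_0_uniq; unfold Rsqr; lra).
  assert (Hz1 : z1 = 0).
  { replace z1 with (z1 / W tau (rad S u) * W tau (rad S u)) by (field; lra). rewrite Hzw. ring. }
  destruct (imm_rank _ _ _ _ Him u 0 HDu 1 0) as [Ha _]; [|lra].
  intros i. rewrite Hdu, Hdv, Hx1, Hz1. destruct i; unfold coord, cx, cy, cz; simpl; ring.
Qed.

Lemma slope_unit (u : R) : 0 < speed tau S u ->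
  slope_cos tau S u * slope_cos tau S u + slope_sin tau S u * slope_sin tau S u = 1.
Proof.
  intros Hv. unfold slope_cos, slope_sin.
  assert (E : speed tau S u * speed tau S u = Derive (rad S) u * Derive (rad S) u
        + Derive (hgt S) u / W tau (rad S u) * (Derive (hgt S) u / W tau (rad S u))).
  { apply sqrt_sqrt. apply Rplus_le_le_0_compat; apply Rle_0_sqr. }
  set (v := speed tau S u) in *. set (x1 := Derive (rad S) u) in *.
  set (y1 := Derive (hgt S) u / W tau (rad S u)) in *.
  transitivity ((x1 * x1 + y1 * y1) / (v * v)); [field; lra|]. rewrite <- E. field. lra.
Qed.

Lemma rad_derive (u : R) : 0 < speed tau S u -> ex_derive (rad S) u ->
  is_derive (rad S) u (speed tau S u * slope_cos tau S u).
Proof.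
  intros Hv H. apply Derive_correct in H. eapply is_derive_eq; [exact H|].
  unfold slope_cos. field. lra.
Qed.

Lemma hgt_derive (u : R) : 0 < speed tau S u -> ex_derive (hgt S) u ->
  is_derive (hgt S) u (speed tau S u * W tau (rad S u) * slope_sin tau S u).
Proof.
  intros Hv H. apply Derive_correct in H. eapply is_derive_eq; [exact H|].
  unfold slope_sin. pose proof (W_pos tau (rad S u)). field. split; lra.
Qed.

Lemma slope_derivable (u : R) : 0 < speed tau S u -> ex_derive (rad S) u ->
  ex_derive (Derive (rad S)) u -> ex_derive (Derive (hgt S)) u ->
  ex_derive (speed tau S) u /\ ex_derive (slope_cos tau S) u /\ ex_derive (slope_sin tau S) u.
Proof.
  intros Hv Hx [x2 Hx2] [z2 Hz2]. apply Derive_correct in Hx.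
  pose proof (W_pos tau (rad S u)) as Hw.
  assert (HW : is_derive (fun u => W tau (rad S u)) u
     (Derive (rad S) u * (tau * tau * rad S u / W tau (rad S u)))).
  { apply (deriv_comp (W tau) (rad S)); [exact Hx|apply W_derive]. }
  assert (Hy : exists y2, is_derive (fun u => Derive (hgt S) u / W tau (rad S u)) u y2).
  { eexists. apply (deriv_div (Derive (hgt S)) (fun u => W tau (rad S u))); [exact Hz2|exact HW|lra]. }
  destruct Hy as [y2 Hy].
  assert (Hs : ex_derive (speed tau S) u).
  { eexists. apply (deriv_sqrt (fun u => Derive (rad S) u * Derive (rad S) u
        + Derive (hgt S) u / W tau (rad S u) * (Derive (hgt S) u / W tau (rad S u)))).
    - apply (deriv_plus (fun u => Derive (rad S) u * Derive (rad S) u)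
        (fun u => Derive (hgt S) u / W tau (rad S u) * (Derive (hgt S) u / W tau (rad S u)))).
      + apply (deriv_mult (Derive (rad S)) (Derive (rad S))); exact Hx2.
      + apply (deriv_mult (fun u => Derive (hgt S) u / W tau (rad S u))
          (fun u => Derive (hgt S) u / W tau (rad S u))); exact Hy.
    - apply Rnot_le_lt. intros Hle. unfold speed in Hv. rewrite sqrt_neg_0 in Hv by exact Hle. lra. }
  split; [exact Hs|]. destruct Hs as [v1 Hs]. split.
  - eexists. apply (deriv_div (Derive (rad S)) (speed tau S)); [exact Hx2|exact Hs|lra].
  - eexists. apply (deriv_div (fun u => Derive (hgt S) u / W tau (rad S u)) (speed tau S));
      [exact Hy|exact Hs|lra].
Qed.

(** [unit_normal_characterization] gives a sign at each point. It is continuous in each variable, so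
    [sign_constant] moves first [u] to [s] at fixed [t], then [t] to [0]. *)
Lemma off_axis_normal : exists d e, 0 < d /\ (e = 1 \/ e = -1) /\
  forall u, Rabs (u - s) < d -> has_normal tau e S u.
Proof.
  destruct off_axis_regular as [d1 [Hd1 Hreg]].
  destruct HS as [HR _]. destruct (rot_immersed _ _ HR s Hdom) as [D [F [n [Hloc Him]]]].
  destruct Hloc as [d2 Hd2 Hr Hds HD HF|sg d2 Hd2 Hr _ _ _ _]; [|lra].
  set (d := Rmin d1 d2). pose proof (Rmin_l d1 d2). pose proof (Rmin_r d1 d2).
  assert (Hd : 0 < d) by now apply Rmin_glb_lt.
  set (C := slope_cos tau S). set (Sn := slope_sin tau S). set (v := speed tau S).
  set (e := fun u t => inner tau (rad S u * cos t, rad S u * sin t, hgt S u) (nrm S u t)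
     (unit_normal tau 1 (rad S u) (C u) (Sn u) (cos t) (sin t))).
  assert (He : forall u t, Rabs (u - s) < d -> (e u t = 1 \/ e u t = -1) /\
    nrm S u t = unit_normal tau (e u t) (rad S u) (C u) (Sn u) (cos t) (sin t)).
  { intros u t Hu. destruct (Hreg u ltac:(unfold d in *; lra)) as [_ [Hx [_ [_ [_ [_ Hv]]]]]].
    assert (HDu : D u t) by (apply HD; unfold d in *; lra).
    assert (Hpd : 0 < d - Rabs (u - s)) by lra.
    assert (Hin : forall a, Rabs (a - u) < d - Rabs (u - s) -> Rabs (a - s) < d).
    { intros a Ha. replace (a - s) with ((a - u) + (u - s)) by ring.
      eapply Rle_lt_trans; [apply Rabs_triang|lra]. }
    assert (HF' : forall a b, Rabs (a - u) < d - Rabs (u - s) ->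
       F a b = (rad S a * cos b, rad S a * sin b, hgt S a)).
    { intros a b Ha. specialize (Hin a Ha). destruct (HF a b) as [-> _]; [|reflexivity].
      apply HD. unfold d in *; lra. }
    assert (Huu : Rabs (u - u) < d - Rabs (u - s)) by (now rewrite Rminus_diag, Rabs_R0).
    assert (Edu : du F u t = frame (cos t) (sin t) (v u * C u) 0 (v u * W tau (rad S u) * Sn u)).
    { apply (polar_du tau F u (rad S) (hgt S) v C Sn (d - Rabs (u - s)) HF'); [| |exact Huu].
      - intros a Ha. specialize (Hin a Ha). destruct (Hreg a ltac:(unfold d in *; lra)) as [_ [_ [E1 [_ [_ [_ E2]]]]]].
        now apply rad_derive.
      - intros a Ha. specialize (Hin a Ha). destruct (Hreg a ltac:(unfold d in *; lra)) as [_ [_ [_ [E1 [_ [_ E2]]]]]].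
        now apply hgt_derive. }
    assert (Edv : dv F u t = frame (cos t) (sin t) 0 (rad S u) 0).
    { now apply (polar_dv F u (rad S) (hgt S) (d - Rabs (u - s)) HF'). }
    destruct (HF u t HDu) as [EF En].
    pose proof (imm_normal_unit _ _ _ _ Him u t HDu) as N1.
    destruct (imm_normal_orthogonal _ _ _ _ Him u t HDu) as [N2 N3].
    rewrite Edu in N2. rewrite Edv in N3. rewrite EF, En in N1, N2, N3. unfold rot_map in N1, N2, N3.
    apply (unit_normal_characterization tau (rad S u) (v u) (C u) (Sn u) (cos t) (sin t) (hgt S u) (nrm S u t));
      try assumption; try (unfold v in *; lra); [now apply slope_unit|apply sqr_sum_trig]. }
  assert (Hcx : forall u, Rabs (u - s) < d -> continuous (rad S) u /\ continuous (hgt S) u /\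
      continuous C u /\ continuous Sn u).
  { intros u Hu. destruct (Hreg u ltac:(unfold d in *; lra)) as [_ [_ [[l1 E1] [[l2 E2] [E3 [E4 Hv]]]]]].
    destruct (slope_derivable u Hv (ex_intro _ l1 E1) E3 E4) as [_ [[l3 E5] [l4 E6]]].
    repeat split; eapply is_derive_continuous; eassumption. }
  assert (Hnc : forall i u t, Rabs (u - s) < d -> continuity_2d_pt (fun a b => coord i (nrm S a b)) u t).
  { intros i u t Hu. apply (continuity_2d_pt_ext_loc (fun a b => coord i (n a b))).
    - assert (Hpd : 0 < d - Rabs (u - s)) by lra. exists (mkposreal _ Hpd). intros a b Ha _.
      simpl in Ha. destruct (HF a b) as [_ ->]; [|reflexivity]. apply HD.
      replace (a - s) with ((a - u) + (u - s)) by ring.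
      eapply Rle_lt_trans; [apply Rabs_triang|unfold d in *; lra].
    - apply (imm_normal_continuous _ _ _ _ Him). apply HD. unfold d in *; lra. }
  assert (H1d : forall h u t, continuity_2d_pt h u t ->
    continuous (fun a => h a t) u /\ continuous (fun b => h u b) t).
  { intros h u t Hh. split; apply continuous_eps; intros eps Heps; destruct (Hh (mkposreal eps Heps)) as [r Hrr];
      exists r; (split; [apply cond_pos|]); intros y Hy; apply Hrr; try assumption;
      rewrite Rminus_diag, Rabs_R0; apply cond_pos. }
  assert (Hinner : forall (px py pz n1 n2 n3 m1 m2 m3 : R -> R) a,
     continuous px a -> continuous py a -> continuous pz a -> continuous n1 a -> continuous n2 a ->
     continuous n3 a -> continuous m1 a -> continuous m2 a -> continuous m3 a ->
     continuous (fun a => inner tau (px a, py a, pz a) (n1 a, n2 a, n3 a) (m1 a, m2 a, m3 a)) a).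
  { intros. unfold inner, contact, cx, cy, cz; simpl.
    continuity_arith. }
  assert (Hsplit : forall u t, nrm S u t = (coord ax (nrm S u t), coord ay (nrm S u t), coord az (nrm S u t))).
  { intros u t. destruct (nrm S u t) as [[n1 n2] n3]. reflexivity. }
  assert (Cu : forall t u, Rabs (u - s) < d -> continuous (fun u => e u t) u).
  { intros t u Hu. destruct (Hcx u Hu) as [K1 [K2 [K3 K4]]].
    assert (KW : continuous (fun u => W tau (rad S u)) u).
    { apply (cont_comp (rad S) (W tau)); [exact K1|]. eapply is_derive_continuous, W_derive. }
    assert (KWi : continuous (fun u => / W tau (rad S u)) u).
    { apply cont_inv; [exact KW|]. pose proof (W_pos tau (rad S u)). lra. }
    unfold e, unit_normal, frame.
    apply (continuous_ext (fun u => inner tau (rad S u * cos t, rad S u * sin t, hgt S u)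
      (coord ax (nrm S u t), coord ay (nrm S u t), coord az (nrm S u t))
      (- 1 * Sn u * cos t - 1 * tau * rad S u * C u / W tau (rad S u) * sin t,
       - 1 * Sn u * sin t + 1 * tau * rad S u * C u / W tau (rad S u) * cos t,
       1 * W tau (rad S u) * C u))); [intros a; now rewrite <- Hsplit|].
    apply (Hinner (fun u => rad S u * cos t) (fun u => rad S u * sin t) (hgt S)
      (fun u => coord ax (nrm S u t)) (fun u => coord ay (nrm S u t)) (fun u => coord az (nrm S u t))
      (fun u => - 1 * Sn u * cos t - 1 * tau * rad S u * C u / W tau (rad S u) * sin t)
      (fun u => - 1 * Sn u * sin t + 1 * tau * rad S u * C u / W tau (rad S u) * cos t)
      (fun u => 1 * W tau (rad S u) * C u));
      try exact K2; try (apply (H1d (fun a b => coord ax (nrm S a b)) u t), Hnc; exact Hu);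
      try (apply (H1d (fun a b => coord ay (nrm S a b)) u t), Hnc; exact Hu);
      try (apply (H1d (fun a b => coord az (nrm S a b)) u t), Hnc; exact Hu);
      continuity_arith. }
  assert (Ct : forall t, continuous (fun t => e s t) t).
  { intros t. assert (Hs0 : Rabs (s - s) < d) by now rewrite Rminus_diag, Rabs_R0.
    unfold e, unit_normal, frame.
    apply (continuous_ext (fun t => inner tau (rad S s * cos t, rad S s * sin t, hgt S s)
      (coord ax (nrm S s t), coord ay (nrm S s t), coord az (nrm S s t))
      (- 1 * Sn s * cos t - 1 * tau * rad S s * C s / W tau (rad S s) * sin t,
       - 1 * Sn s * sin t + 1 * tau * rad S s * C s / W tau (rad S s) * cos t,
       1 * W tau (rad S s) * C s))); [intros a; now rewrite <- Hsplit|].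
    pose proof (continuous_cos t) as Kc. pose proof (continuous_sin t) as Ks.
    apply (Hinner (fun t => rad S s * cos t) (fun t => rad S s * sin t) (fun _ => hgt S s)
      (fun t => coord ax (nrm S s t)) (fun t => coord ay (nrm S s t)) (fun t => coord az (nrm S s t))
      (fun t => - 1 * Sn s * cos t - 1 * tau * rad S s * C s / W tau (rad S s) * sin t)
      (fun t => - 1 * Sn s * sin t + 1 * tau * rad S s * C s / W tau (rad S s) * cos t)
      (fun _ => 1 * W tau (rad S s) * C s));
      try (apply (H1d (fun a b => coord ax (nrm S a b)) s t), Hnc; exact Hs0);
      try (apply (H1d (fun a b => coord ay (nrm S a b)) s t), Hnc; exact Hs0);
      try (apply (H1d (fun a b => coord az (nrm S a b)) s t), Hnc; exact Hs0);
      continuity_arith. }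
  exists d, (e s 0). split; [exact Hd|].
  assert (Hs0 : Rabs (s - s) < d) by now rewrite Rminus_diag, Rabs_R0.
  split; [now apply He|]. intros u Hu t.
  destruct (He u t Hu) as [_ ->]. f_equal.
  transitivity (e s t).
  - apply (sign_constant (fun u => e u t) u s).
    + intros a Ha. apply Cu. apply Rabs_def2 in Hu. unfold Rmin, Rmax in Ha.
      destruct (Rle_dec u s); apply Rabs_def1; lra.
    + intros a Ha. apply He. apply Rabs_def2 in Hu. unfold Rmin, Rmax in Ha.
      destruct (Rle_dec u s); apply Rabs_def1; lra.
  - apply (sign_constant (fun t => e s t) t 0).
    + intros a _. apply Ct.
    + intros a _. now apply He.
Qed.

(** A unit vector [(C, Sn)] has derivative [v k (- Sn, C)] for some [k]. The translator equation
    with [H = e (k + Sn / x) / 2] and [<N, d/dz> = e C / W] then determines [k], as [e^2 = 1]. *)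
Lemma off_axis_equation (e : R) : e = 1 \/ e = -1 -> has_normal tau e S s ->
  let k := 2 * (slope_cos tau S s * / W tau (rad S s) + e * lam) - slope_sin tau S s / rad S s in
  is_derive (slope_cos tau S) s (- (speed tau S s * slope_sin tau S s * k)) /\
  is_derive (slope_sin tau S) s (speed tau S s * slope_cos tau S s * k).
Proof.
  intros He Hn k0. destruct off_axis_regular as [d1 [Hd1 Hreg]].
  destruct HS as [HR HT]. destruct (rot_immersed _ _ HR s Hdom) as [D [F [n [Hloc Him]]]].
  assert (HH := HT s D F n Hdom Hloc Him).
  destruct Hloc as [d2 Hd2 Hr Hds HD HF|sg d2 Hd2 Hr _ _ _ _]; [|lra].
  set (d := Rmin d1 d2). pose proof (Rmin_l d1 d2). pose proof (Rmin_r d1 d2).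
  assert (Hd : 0 < d) by now apply Rmin_glb_lt.
  set (C := slope_cos tau S) in *. set (Sn := slope_sin tau S) in *. set (v := speed tau S) in *.
  assert (Hs0 : Rabs (s - s) < d1) by now rewrite Rminus_diag, Rabs_R0.
  destruct (Hreg s Hs0) as [_ [_ [E1 [E2 [E3 [E4 Hv]]]]]].
  destruct (slope_derivable s Hv E1 E3 E4) as [Dv [DC DS]].
  fold C in DC. fold Sn in DS. fold v in Dv, Hv.
  apply Derive_correct in Dv. apply Derive_correct in DC. apply Derive_correct in DS.
  set (v1 := Derive v s) in *. set (C1 := Derive C s) in *. set (S1 := Derive Sn s) in *.
  assert (HC : C s * C s + Sn s * Sn s = 1) by now apply slope_unit.
  assert (Horth : C s * C1 + Sn s * S1 = 0).
  { assert (Dd : is_derive (fun u => C u * C u + Sn u * Sn u) s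
       (C1 * C s + C s * C1 + (S1 * Sn s + Sn s * S1))).
    { apply (deriv_plus (fun u => C u * C u) (fun u => Sn u * Sn u));
        [now apply (deriv_mult C C)|now apply (deriv_mult Sn Sn)]. }
    assert (Dd0 : is_derive (fun u => C u * C u + Sn u * Sn u) s 0).
    { apply (is_derive_ext_loc (fun _ => 1)); [|apply deriv_const].
      exists (mkposreal d1 Hd1). intros u Hu. symmetry. apply slope_unit. now apply (Hreg u). }
    apply is_derive_unique in Dd. apply is_derive_unique in Dd0. lra. }
  set (k := (C s * S1 - Sn s * C1) / v s).
  assert (EC : C1 = - (v s * Sn s * k)).
  { unfold k. transitivity (C1 * (C s * C s + Sn s * Sn s) - C s * (C s * C1 + Sn s * S1));
      [rewrite HC, Horth; ring|field; lra]. }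
  assert (ES : S1 = v s * C s * k).
  { unfold k. transitivity (S1 * (C s * C s + Sn s * Sn s) - Sn s * (C s * C1 + Sn s * S1));
      [rewrite HC, Horth; ring|field; lra]. }
  assert (HDs : D s 0) by (apply HD; rewrite Rminus_diag, Rabs_R0; exact Hd2).
  destruct (HF s 0 HDs) as [EF En].
  specialize (HH s 0 HDs).
  assert (Hmc : mean_curvature tau F n s 0 = e * (k + Sn s / rad S s) / 2).
  { apply (mean_curvature_polar tau e F n s 0 (rad S) (hgt S) v C Sn v1 k d Hd).
    - intros a b Ha. destruct (HF a b) as [-> _]; [|reflexivity]. apply HD. unfold d in *; lra.
    - intros a Ha. destruct (Hreg a ltac:(unfold d in *; lra)) as [_ [_ [K1 [_ [_ [_ K2]]]]]].
      now apply rad_derive.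
    - intros a Ha. destruct (Hreg a ltac:(unfold d in *; lra)) as [_ [_ [_ [K1 [_ [_ K2]]]]]].
      now apply hgt_derive.
    - exact Dv.
    - rewrite <- EC. exact DC.
    - rewrite <- ES. exact DS.
    - lra.
    - lra.
    - exact HC.
    - rewrite En. apply Hn. }
  assert (Hnu : inner tau (F s 0) (n s 0) dz = e * C s / W tau (rad S s)).
  { rewrite EF, En, Hn. unfold rot_map.
    replace dz with (frame (cos 0) (sin 0) 0 0 1) by (unfold dz, frame; apply pt_eq; ring).
    fold C Sn.
    transitivity (inner tau (rad S s * cos 0, rad S s * sin 0, hgt S s) (frame (cos 0) (sin 0) 0 0 1)
      (unit_normal tau e (rad S s) (C s) (Sn s) (cos 0) (sin 0))); [unfold inner; ring|].
    rewrite inner_unit_normal by apply sqr_sum_trig. pose proof (W_pos tau (rad S s)). field. lra. }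
  rewrite Hmc, Hnu in HH.
  assert (Ek : k = k0).
  { unfold k0. pose proof (W_pos tau (rad S s)).
    assert (e * e = 1) by (destruct He as [-> | ->]; ring).
    transitivity (e * e * k); [rewrite H2; ring|].
    replace (e * e * k) with (2 * e * (e * (k + Sn s / rad S s) / 2) - e * e * (Sn s / rad S s)) by (field; lra).
    rewrite HH, H2.
    transitivity (2 * (e * e * C s / W tau (rad S s) + e * lam) - 1 * (Sn s / rad S s));
      [unfold Rdiv; ring|rewrite H2; unfold Rdiv; ring]. }
  rewrite <- Ek, <- EC, <- ES. now split.
Qed.
End OffAxis.

(** * Comparison with the model *)

Definition rlim (f : R -> R) (l : R) : Prop := filterlim f (at_right 0) (locally l).

Lemma rlim_eps (f : R -> R) (l : R) : rlim f l <->
  forall eps, 0 < eps -> exists d, 0 < d /\ forall r, 0 < r < d -> Rabs (f r - l) < eps.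
Proof.
  split.
  - intros H eps He. destruct (proj1 (filterlim_locally f l) H (mkposreal eps He)) as [d Hd].
    exists d. split; [apply cond_pos|]. intros r Hr. apply (Hd r); [|apply Hr].
    change (Rabs (r - 0) < d). rewrite Rminus_0_r, Rabs_right; lra.
  - intros H. apply filterlim_locally. intros eps. destruct (H eps (cond_pos eps)) as [d [Hd Hd']].
    exists (mkposreal d Hd). intros r Hr Hr0. apply Hd'. split; [exact Hr0|].
    assert (Hr' : Rabs (r - 0) < d) by exact Hr. rewrite Rminus_0_r in Hr'.
    apply Rabs_def2 in Hr'. lra.
Qed.

Lemma rlim_const (c : R) : rlim (fun _ => c) c.
Proof. apply filterlim_const. Qed.

Lemma rlim_id : rlim (fun r => r) 0.
Proof.
  apply rlim_eps. intros eps He. exists eps. split; [exact He|]. intros r Hr.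
  rewrite Rminus_0_r, Rabs_right; lra.
Qed.

Lemma rlim_plus (f g : R -> R) (a b : R) : rlim f a -> rlim g b -> rlim (fun r => f r + g r) (a + b).
Proof. intros Hf Hg. exact (filterlim_comp_2 f g Rplus Hf Hg (@filterlim_plus _ R_NormedModule a b)). Qed.

Lemma rlim_mult (f g : R -> R) (a b : R) : rlim f a -> rlim g b -> rlim (fun r => f r * g r) (a * b).
Proof. intros Hf Hg. exact (filterlim_comp_2 f g Rmult Hf Hg (@filterlim_mult R_AbsRing a b)). Qed.

Lemma rlim_comp (f g : R -> R) (a : R) : rlim f a -> continuous g a -> rlim (fun r => g (f r)) (g a).
Proof. intros Hf Hg. exact (filterlim_comp _ _ _ f g _ _ _ Hf Hg). Qed.

Lemma rlim_continuous (g : R -> R) : continuous g 0 -> rlim g (g 0).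
Proof. intros Hg. apply (rlim_comp (fun r => r) g 0); [apply rlim_id|exact Hg]. Qed.

Lemma rlim_minus (f g : R -> R) (a b : R) : rlim f a -> rlim g b -> rlim (fun r => f r - g r) (a - b).
Proof.
  intros Hf Hg. apply rlim_plus; [exact Hf|].
  apply (rlim_comp g Ropp); [exact Hg|]. apply (is_derive_continuous _ _ (-1)).
  auto_derive; [exact I|ring].
Qed.

Lemma rlim_inv (f : R -> R) (a : R) : rlim f a -> a <> 0 -> rlim (fun r => / f r) (/ a).
Proof.
  intros Hf Ha. apply (rlim_comp f (fun y => / y)); [exact Hf|].
  apply (cont_inv (fun y => y)); [apply cont_id|exact Ha].
Qed.

Lemma rlim_ext (f g : R -> R) (l d : R) : 0 < d -> (forall r, 0 < r < d -> f r = g r) ->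
  rlim f l -> rlim g l.
Proof.
  intros Hd H Hf. apply rlim_eps. intros eps He.
  destruct (proj1 (rlim_eps f l) Hf eps He) as [d' [Hd' Hd'']].
  exists (Rmin d d'). split; [now apply Rmin_glb_lt|]. intros r Hr.
  pose proof (Rmin_l d d'). pose proof (Rmin_r d d'). rewrite <- H by lra. apply Hd''. lra.
Qed.

Lemma rlim_bounded (f : R -> R) (l : R) : rlim f l ->
  exists d, 0 < d /\ forall r, 0 < r < d -> Rabs (f r) <= Rabs l + 1.
Proof.
  intros H. destruct (proj1 (rlim_eps f l) H 1 Rlt_0_1) as [d [Hd Hd']].
  exists d. split; [exact Hd|]. intros r Hr. specialize (Hd' r Hr).
  replace (f r) with ((f r - l) + l) by ring. eapply Rle_trans; [apply Rabs_triang|lra].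
Qed.

Lemma rlim_gt (f : R -> R) (l c : R) : rlim f l -> c < l ->
  exists d, 0 < d /\ forall r, 0 < r < d -> c < f r.
Proof.
  intros H Hc. destruct (proj1 (rlim_eps f l) H (l - c)) as [d [Hd Hd']]; [lra|].
  exists d. split; [exact Hd|]. intros r Hr. specialize (Hd' r Hr). apply Rabs_def2 in Hd'. lra.
Qed.

Lemma bounded_compact (f : R -> R) (a b : R) : a <= b ->
  (forall r, a <= r <= b -> continuous f r) -> exists B, 0 <= B /\ forall r, a <= r <= b -> Rabs (f r) <= B.
Proof.
  intros Hab Hc. destruct (continuity_ab_maj (fun r => Rabs (f r)) a b Hab) as [m [Hm _]].
  - intros r Hr. apply continuity_pt_continuous, (cont_comp f Rabs); [now apply Hc|apply continuous_Rabs].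
  - exists (Rabs (f m)). split; [apply Rabs_pos|exact Hm].
Qed.

Lemma bounded_half_open (f : R -> R) (d b B0 : R) : 0 < d ->
  (forall r, 0 < r < d -> Rabs (f r) <= B0) -> (forall r, 0 < r <= b -> continuous f r) ->
  exists B, 0 <= B /\ forall r, 0 < r <= b -> Rabs (f r) <= B.
Proof.
  intros Hd HB Hc. destruct (Rle_dec (d / 2) b) as [Hdb|Hdb].
  - destruct (bounded_compact f (d / 2) b Hdb) as [B [HB1 HB2]].
    + intros r Hr. apply Hc. lra.
    + exists (Rmax B B0). split; [eapply Rle_trans; [exact HB1|apply Rmax_l]|].
      intros r Hr. destruct (Rlt_le_dec r (d / 2)).
      * eapply Rle_trans; [apply HB; lra|apply Rmax_r].
      * eapply Rle_trans; [apply HB2; lra|apply Rmax_l].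
  - exists (Rabs B0). split; [apply Rabs_pos|]. intros r Hr.
    eapply Rle_trans; [apply HB; lra|apply Rle_abs].
Qed.

Section Comparison.
Variables (tau mu : R) (A q th z : R -> R).
Hypothesis HP : profile tau mu A q th z.
Variables (x C Sn v l : R -> R) (r2 p K d0 : R).
Let k (r : R) := 2 * (C r * / W tau (x r) + mu) - Sn r / x r.
Hypothesis Hp : 0 < p.
Hypothesis Hd0 : 0 < d0.
Hypothesis Hx : forall r, 0 < r <= r2 -> 0 < x r.
Hypothesis Hv : forall r, 0 < r <= r2 -> 0 < v r.
Hypothesis HC : forall r, 0 < r <= r2 -> C r * C r + Sn r * Sn r = 1.
Hypothesis Dx : forall r, 0 < r <= r2 -> is_derive x r (v r * C r).
Hypothesis DC : forall r, 0 < r <= r2 -> is_derive C r (- (v r * Sn r * k r)).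
Hypothesis DS : forall r, 0 < r <= r2 -> is_derive Sn r (v r * C r * k r).
Hypothesis Dl : forall r, 0 < r <= r2 -> is_derive l r (v r).
Hypothesis Cv : forall r, 0 < r <= r2 -> continuous v r.
Hypothesis HSx : forall r, 0 < r < d0 -> Rabs (Sn r) <= K * x r.
Hypothesis Lx : rlim (fun r => x r / r) p.
Hypothesis Ll : rlim (fun r => l r / r) p.
Hypothesis LC : rlim C 1.
Hypothesis Lv : rlim v p.

(* [x], [C], [Sn] are the data of an arbitrary surface with parameter [r], speed [v] and
   arc length [l]; [X], [cos T], [sin T] those of the model at the same arc length.  The
   relative error [eta] is needed because [k] is singular at [x = 0]. *)
Let X (r : R) := prad A (l r).
Let T (r : R) := th (l r).
Let Q (r : R) := q (l r).
Let KM (r : R) := kr tau mu A q th (l r).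
Let u (r : R) := Sn r - sin (T r).
Let c (r : R) := C r - cos (T r).
Let eta (r : R) := 1 - X r / x r.

Lemma cmp_l0 : rlim l 0.
Proof.
  apply (rlim_ext (fun r => l r / r * r) l 0 1); [lra| |].
  - intros r Hr. field. lra.
  - replace 0 with (p * 0) by ring. apply rlim_mult; [exact Ll|apply rlim_id].
Qed.

Lemma cmp_x0 : rlim x 0.
Proof.
  apply (rlim_ext (fun r => x r / r * r) x 0 1); [lra| |].
  - intros r Hr. field. lra.
  - replace 0 with (p * 0) by ring. apply rlim_mult; [exact Lx|apply rlim_id].
Qed.

Lemma cmp_ratio : rlim (fun r => X r / x r) 1.
Proof.
  apply (rlim_ext (fun r => l r / r * A (l r) * / (x r / r)) _ 1 (Rmin 1 (Rabs r2 + 1))).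
  - pose proof (Rabs_pos r2). apply Rmin_glb_lt; lra.
  - intros r Hr. unfold X, prad. destruct (Req_dec (x r) 0) as [E|E].
    + rewrite E. unfold Rdiv. rewrite Rmult_0_l, Rinv_0. ring.
    + field. split; [exact E|lra].
  - replace 1 with (p * A 0 * / p) by (rewrite (pr_A_0 _ _ _ _ _ _ HP); field; lra).
    apply rlim_mult; [apply rlim_mult; [exact Ll|]|apply rlim_inv; [exact Lx|lra]].
    apply (rlim_comp l A 0); [exact cmp_l0|].
    now apply (radial_continuous everywhere 0 A 0 (pr_radial_A _ _ _ _ _ _ HP 0)).
Qed.

Lemma cmp_T0 : rlim T 0.
Proof.
  rewrite <- (pr_th_0 _ _ _ _ _ _ HP). apply (rlim_comp l th 0); [exact cmp_l0|].
  apply (th_continuous tau mu A q th z HP).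
Qed.

Lemma cmp_Sn0 : rlim Sn 0.
Proof.
  apply rlim_eps. intros eps He.
  destruct (proj1 (rlim_eps x 0) cmp_x0 (eps / (Rabs K + 1))) as [d [Hd Hd']].
  { apply Rdiv_lt_0_compat; [exact He|]. pose proof (Rabs_pos K). lra. }
  exists (Rmin d d0). split; [now apply Rmin_glb_lt|]. intros r Hr.
  pose proof (Rmin_l d d0). pose proof (Rmin_r d d0).
  specialize (Hd' r ltac:(lra)). specialize (HSx r ltac:(lra)). rewrite Rminus_0_r in *.
  pose proof (Rabs_pos K). pose proof (Rle_abs K). pose proof (Rle_abs (x r)). pose proof (Rabs_pos (x r)).
  apply Rlt_div_r in Hd'; [|lra].
  assert (K * x r <= Rabs K * Rabs (x r)) by (rewrite <- Rabs_mult; apply Rle_abs). nra.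
Qed.

Lemma cmp_energy_zero : rlim (fun r => u r * u r + c r * c r + eta r * eta r) 0.
Proof.
  assert (Lu : rlim u 0).
  { replace 0 with (0 - sin 0) by (rewrite sin_0; ring). apply rlim_minus; [exact cmp_Sn0|].
    apply (rlim_comp T sin 0); [exact cmp_T0|apply continuous_sin]. }
  assert (Lc : rlim c 0).
  { replace 0 with (1 - cos 0) by (rewrite cos_0; ring). apply rlim_minus; [exact LC|].
    apply (rlim_comp T cos 0); [exact cmp_T0|apply continuous_cos]. }
  assert (Le : rlim eta 0).
  { replace 0 with (1 - 1) by ring. apply rlim_minus; [apply rlim_const|exact cmp_ratio]. }
  replace 0 with (0 * 0 + 0 * 0 + 0 * 0) by ring.
  apply rlim_plus; [apply rlim_plus|]; now apply rlim_mult.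
Qed.

Lemma cmp_dX (r : R) : 0 < r <= r2 -> is_derive X r (v r * cos (T r)).
Proof. intros Hr. apply (deriv_comp (prad A) l); [now apply Dl|apply (x_deriv tau mu A q th z HP)]. Qed.

Lemma cmp_du (r : R) : 0 < r <= r2 -> is_derive u r (v r * (C r * k r - cos (T r) * KM r)).
Proof.
  intros Hr. eapply is_derive_eq.
  - apply (deriv_minus Sn (fun r => sin (T r))); [now apply DS|].
    apply (deriv_comp (fun s => sin (th s)) l); [now apply Dl|apply (sin_deriv tau mu A q th z HP)].
  - unfold T, KM. ring.
Qed.

Lemma cmp_dc (r : R) : 0 < r <= r2 -> is_derive c r (- (v r * (Sn r * k r - sin (T r) * KM r))).
Proof.
  intros Hr. eapply is_derive_eq.
  - apply (deriv_minus C (fun r => cos (T r))); [now apply DC|].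
    apply (deriv_comp (fun s => cos (th s)) l); [now apply Dl|apply (cos_deriv tau mu A q th z HP)].
  - unfold T, KM. ring.
Qed.

Lemma cmp_deta (r : R) : 0 < r <= r2 -> is_derive eta r (v r / x r * (c r - eta r * C r)).
Proof.
  intros Hr. pose proof (Hx r Hr). eapply is_derive_eq.
  - apply (deriv_minus (fun _ => 1) (fun r => X r / x r)); [apply deriv_const|].
    apply (deriv_div X x); [now apply cmp_dX|now apply Dx|lra].
  - unfold c, eta. field. lra.
Qed.

(** Since [sin T = X Q] and [X / x = 1 - eta], the singular terms differ by
    [Sn / x - Q = u / x - Q eta]. Only [u / x] is still singular, and it enters with the sign that
    damps the error. *)
Lemma cmp_k (r : R) : 0 < r <= r2 ->
  k r - KM r = 2 * (c r * / W tau (x r) + cos (T r) * (/ W tau (x r) - / W tau (X r)))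
    - u r / x r + Q r * eta r.
Proof.
  intros Hr. pose proof (Hx r Hr). pose proof (W_pos tau (x r)). pose proof (W_pos tau (X r)).
  assert (E : sin (T r) = X r * Q r) by apply (sin_x_q tau mu A q th z HP).
  assert (Eu : u r / x r = Sn r / x r - X r / x r * Q r) by (unfold u; rewrite E; field; lra).
  rewrite Eu. unfold k, KM, kr, c, eta. fold (X r) (T r) (Q r). unfold Rdiv. ring.
Qed.

(* Near the axis [C + cos T > 1], so [c = - u (Sn + sin T) / (C + cos T)] is [O(x u)]. *)
Lemma cmp_c_over_x : exists B, 0 <= B /\ forall r, 0 < r <= r2 -> Rabs (c r) / x r <= B * (Rabs (u r) + Rabs (c r)).
Proof.
  assert (HQ0 : rlim Q (q 0)).
  { apply (rlim_comp l q 0); [exact cmp_l0|].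
    now apply (radial_continuous everywhere 0 q 0 (pr_radial_q _ _ _ _ _ _ HP 0)). }
  destruct (rlim_bounded Q _ HQ0) as [d1 [Hd1 HQ]]. set (B3 := Rabs (q 0) + 1) in *.
  destruct (rlim_bounded _ _ cmp_ratio) as [d2 [Hd2 HX]]. rewrite Rabs_R1 in HX.
  destruct (rlim_gt C 1 (/ 2) LC ltac:(lra)) as [d3 [Hd3 HC3]].
  assert (LT : rlim (fun r => cos (T r)) 1).
  { rewrite <- cos_0. apply (rlim_comp T cos 0); [exact cmp_T0|apply continuous_cos]. }
  destruct (rlim_gt _ 1 (/ 2) LT ltac:(lra)) as [d4 [Hd4 HT4]].
  set (d := Rmin (Rmin d0 d1) (Rmin d2 (Rmin d3 d4))).
  assert (Hd : 0 < d) by (repeat apply Rmin_glb_lt; assumption).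
  assert (Hdd : d <= d0 /\ d <= d1 /\ d <= d2 /\ d <= d3 /\ d <= d4).
  { unfold d. repeat split;
    repeat first [apply Rle_refl | (eapply Rle_trans; [apply Rmin_l|]; apply Rle_refl)
      | (eapply Rle_trans; [apply Rmin_l|]; apply Rmin_r) | (eapply Rle_trans; [apply Rmin_l|]; apply Rmin_l)
      | (eapply Rle_trans; [apply Rmin_r|]) | apply Rmin_l | apply Rmin_r]. }
  set (Bn := Rabs K + 2 * B3).
  assert (HBn : 0 <= Bn) by (unfold Bn, B3; pose proof (Rabs_pos K); pose proof (Rabs_pos (q 0)); lra).
  assert (Near : forall r, 0 < r <= r2 -> r < d -> Rabs (c r) / x r <= Bn * Rabs (u r)).
  { intros r Hr Hrd. pose proof (Hx r Hr) as Hxr.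
    specialize (HSx r ltac:(lra)). specialize (HQ r ltac:(lra)). specialize (HX r ltac:(lra)).
    specialize (HC3 r ltac:(lra)). specialize (HT4 r ltac:(lra)).
    assert (E : c r * (C r + cos (T r)) = - (u r * (Sn r + sin (T r)))).
    { unfold c, u. pose proof (HC r Hr). pose proof (cos_sqr_sin_sqr th (l r)) as E2. fold (T r) in E2. lra. }
    assert (ET : sin (T r) = X r * Q r) by apply (sin_x_q tau mu A q th z HP).
    assert (HXr : Rabs (X r) <= 2 * x r).
    { unfold Rdiv in HX. rewrite Rabs_mult, Rabs_inv, (Rabs_right (x r)) in HX by lra.
      apply (Rmult_le_reg_r (/ x r)); [now apply Rinv_0_lt_compat|].
      replace (2 * x r * / x r) with 2 by (field; lra). lra. }
    assert (Hsum : Rabs (Sn r + sin (T r)) <= Bn * x r).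
    { eapply Rle_trans; [apply Rabs_triang|]. rewrite ET, Rabs_mult.
      assert (K * x r <= Rabs K * x r) by (apply Rmult_le_compat_r; [lra|apply Rle_abs]).
      assert (Rabs (X r) * Rabs (Q r) <= 2 * x r * B3) by (apply Rmult_le_compat; try apply Rabs_pos; assumption).
      unfold Bn. lra. }
    apply Rle_div_l; [exact Hxr|].
    apply Rle_trans with (Rabs (c r) * (C r + cos (T r))).
    - pose proof (Rabs_pos (c r)). nra.
    - rewrite <- (Rabs_right (C r + cos (T r))) by lra. rewrite <- Rabs_mult, E, Rabs_Ropp, Rabs_mult.
      replace (Bn * Rabs (u r) * x r) with (Rabs (u r) * (Bn * x r)) by ring.
      apply Rmult_le_compat_l; [apply Rabs_pos|exact Hsum]. }
  destruct (Rle_dec d r2) as [Hdr|Hdr].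
  - destruct (bounded_compact (fun r => / x r) d r2 Hdr) as [B [HB1 HB2]].
    { intros r Hr. apply cont_inv; [|pose proof (Hx r ltac:(lra)); lra].
      eapply is_derive_continuous, Dx. lra. }
    exists (Bn + B). split; [lra|]. intros r Hr. pose proof (Rabs_pos (u r)). pose proof (Rabs_pos (c r)).
    destruct (Rlt_le_dec r d) as [H1|H1].
    + specialize (Near r Hr H1). nra.
    + specialize (HB2 r ltac:(lra)). pose proof (Rle_abs (/ x r)). unfold Rdiv. nra.
  - exists Bn. split; [exact HBn|]. intros r Hr. specialize (Near r Hr ltac:(lra)).
    pose proof (Rabs_pos (u r)). pose proof (Rabs_pos (c r)). nra.
Qed.

Lemma young (a b : R) : Rabs a * Rabs b <= (a * a + b * b) / 2.
Proof.
  assert (Ea : Rabs a * Rabs a = a * a) by (rewrite <- Rabs_mult; apply Rabs_right; nra).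
  assert (Eb : Rabs b * Rabs b = b * b) by (rewrite <- Rabs_mult; apply Rabs_right; nra).
  pose proof (Rle_0_sqr (Rabs a - Rabs b)). unfold Rsqr in *. lra.
Qed.

(** The energy [D = u^2 + c^2 + eta^2] satisfies [D' <= L D] with a constant that stays finite at
    the axis: the singular terms [- u^2 C / x] and [- eta^2 C / x] are negative where [C > 0],
    [eta c / x] is tamed by [cmp_c_over_x], and [c u Sn / x] by [|Sn| <= K x]. As [D] tends to [0]
    on the axis, it vanishes. *)
Lemma comparison (r : R) : 0 < r <= r2 ->
  x r = prad A (l r) /\ C r = cos (th (l r)) /\ Sn r = sin (th (l r)).
Proof.
  intros Hr.
  assert (Cx : forall r, 0 < r <= r2 -> continuous x r) by (intros; eapply is_derive_continuous, Dx; assumption).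
  assert (CC : forall r, 0 < r <= r2 -> continuous C r) by (intros; eapply is_derive_continuous, DC; assumption).
  assert (CS : forall r, 0 < r <= r2 -> continuous Sn r) by (intros; eapply is_derive_continuous, DS; assumption).
  assert (Cl : forall r, 0 < r <= r2 -> continuous l r) by (intros; eapply is_derive_continuous, Dl; assumption).
  assert (Cix : forall r, 0 < r <= r2 -> continuous (fun r => / x r) r).
  { intros s Hs. apply cont_inv; [now apply Cx|]. pose proof (Hx s Hs). lra. }
  destruct (rlim_bounded x 0 cmp_x0) as [e1 [He1 HB1]].
  destruct (bounded_half_open x e1 r2 _ He1 HB1 Cx) as [B1 [HB1p HB1']].
  destruct (rlim_bounded v p Lv) as [e2 [He2 HB2]].
  destruct (bounded_half_open v e2 r2 _ He2 HB2 Cv) as [B2 [HB2p HB2']].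
  assert (HSx' : exists B, 0 <= B /\ forall r, 0 < r <= r2 -> Rabs (Sn r / x r) <= B).
  { destruct (Rle_dec r2 0) as [Hr2|Hr2]; [exists 0; split; [lra|intros; lra]|].
    apply (bounded_half_open (fun r => Sn r / x r) (Rmin d0 r2) r2 (Rabs K)).
    - apply Rmin_glb_lt; lra.
    - intros s Hs. pose proof (Rmin_l d0 r2). pose proof (Rmin_r d0 r2). pose proof (Hx s ltac:(lra)) as Hxs.
      specialize (HSx s ltac:(lra)). unfold Rdiv. rewrite Rabs_mult, Rabs_inv, (Rabs_right (x s)) by lra.
      apply Rle_div_l; [exact Hxs|]. pose proof (Rle_abs K). nra.
    - intros s Hs. apply (cont_mult Sn (fun r => / x r)); auto. }
  destruct HSx' as [B3 [HB3p HB3]].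
  assert (HQ0 : rlim Q (q 0)).
  { apply (rlim_comp l q 0); [exact cmp_l0|].
    now apply (radial_continuous everywhere 0 q 0 (pr_radial_q _ _ _ _ _ _ HP 0)). }
  destruct (rlim_bounded Q _ HQ0) as [e4 [He4 HB4]].
  destruct (bounded_half_open Q e4 r2 _ He4 HB4) as [B4 [HB4p HB4']].
  { intros s Hs. apply (cont_comp l q); [now apply Cl|].
    now apply (radial_continuous everywhere 0 q _ (pr_radial_q _ _ _ _ _ _ HP 0)). }
  set (B5 := 2 * (1 + Rabs mu) + B4).
  assert (HB5 : forall r, 0 < r <= r2 -> Rabs (KM r) <= B5).
  { intros s Hs. unfold KM, kr, B5. eapply Rle_trans; [apply Rabs_triang|]. rewrite Rabs_Ropp.
    apply Rplus_le_compat; [|now apply HB4'].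
    rewrite Rabs_mult, (Rabs_right 2) by lra. apply Rmult_le_compat_l; [lra|].
    eapply Rle_trans; [apply Rabs_triang|]. apply Rplus_le_compat_r. rewrite Rabs_mult.
    pose proof (Winv_bounds tau (prad A (l s))). rewrite (Rabs_right (/ _)) by lra.
    assert (Rabs (cos (th (l s))) <= 1) by (apply Rabs_le, COS_bound).
    pose proof (Rabs_pos (cos (th (l s)))). nra. }
  assert (HB5p : 0 <= B5) by (unfold B5; pose proof (Rabs_pos mu); lra).
  destruct (rlim_gt C 1 0 LC Rlt_0_1) as [e6 [He6 HC6]].
  (* A one-sided bound: near the axis [C > 0], so the quotient is negative however small [x] is. *)
  assert (HCx : exists B, 0 <= B /\ forall r, 0 < r <= r2 -> - C r / x r <= B).
  { destruct (Rle_dec e6 r2) as [He|He].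
    - destruct (bounded_compact (fun r => / x r) e6 r2 He) as [B [HBp HB]]; [intros; apply Cix; lra|].
      exists B. split; [exact HBp|]. intros s Hs. pose proof (Hx s Hs) as Hxs.
      pose proof (Rinv_0_lt_compat _ Hxs). destruct (Rlt_le_dec s e6).
      + specialize (HC6 s ltac:(lra)). unfold Rdiv. nra.
      + specialize (HB s ltac:(lra)). pose proof (Rle_abs (/ x s)). pose proof (HC s Hs).
        assert (-1 <= C s) by nra. unfold Rdiv. nra.
    - exists 0. split; [lra|]. intros s Hs. specialize (HC6 s ltac:(lra)). pose proof (Hx s Hs) as Hxs.
      pose proof (Rinv_0_lt_compat _ Hxs). unfold Rdiv. nra. }
  destruct HCx as [B6 [HB6p HB6]].
  destruct cmp_c_over_x as [B7 [HB7p HB7]].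
  set (M := 2 + 2 * (1 + tau * tau) * B1).
  assert (HM : 0 <= M) by (unfold M; nra).
  set (D := fun r => u r * u r + c r * c r + eta r * eta r).
  set (dD := fun r => 2 * v r * (u r * (C r * k r - cos (T r) * KM r)
     - c r * (Sn r * k r - sin (T r) * KM r) + eta r * (c r - eta r * C r) / x r)).
  set (L0 := 3 * M + 2 * B4 + 2 * B5 + 2 * B6 + B3 + 3 * B7 + 1).
  assert (HDz : D r = 0).
  { apply (gronwall_zero D dD (2 * B2 * L0) 0 r2); [| | | |exact Hr].
    - intros s Hs. eapply is_derive_eq.
      + apply (deriv_plus (fun r => u r * u r + c r * c r) (fun r => eta r * eta r)).
        * apply (deriv_plus (fun r => u r * u r) (fun r => c r * c r)).
          -- apply (deriv_mult u u); now apply cmp_du.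
          -- apply (deriv_mult c c); now apply cmp_dc.
        * apply (deriv_mult eta eta); now apply cmp_deta.
      + unfold dD. pose proof (Hx s Hs). field. lra.
    - intros s _. unfold D. nra.
    - intros s Hs. pose proof (Hx s Hs) as Hxs. pose proof (Hv s Hs) as Hvs.
      pose proof (HC s Hs) as HCs. specialize (HB1' s Hs). specialize (HB2' s Hs). specialize (HB3 s Hs).
      specialize (HB4' s Hs). specialize (HB5 s Hs). specialize (HB6 s Hs). specialize (HB7 s Hs).
      pose proof (cmp_k s Hs) as Ek.
      set (P := 2 * (c s * / W tau (x s) + cos (T s) * (/ W tau (x s) - / W tau (X s)))) in *.
      assert (HPb : Rabs P <= M * (Rabs (c s) + Rabs (eta s))).
      { unfold P. rewrite Rabs_mult, (Rabs_right 2) by lra.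
        assert (H1 : Rabs (c s * / W tau (x s)) <= Rabs (c s)).
        { rewrite Rabs_mult. pose proof (Winv_bounds tau (x s)). rewrite (Rabs_right (/ _)) by lra.
          pose proof (Rabs_pos (c s)). nra. }
        assert (H2 : Rabs (cos (T s) * (/ W tau (x s) - / W tau (X s))) <=
          (1 + tau * tau) * B1 * Rabs (eta s)).
        { rewrite Rabs_mult. pose proof (Winv_lipschitz tau (x s) (X s)) as H2.
          assert (Exe : x s - X s = x s * eta s) by (unfold eta; field; lra).
          rewrite Exe, Rabs_mult in H2.
          assert (Rabs (cos (T s)) <= 1) by (apply Rabs_le, COS_bound).
          pose proof (Rabs_pos (/ W tau (x s) - / W tau (X s))). pose proof (Rabs_pos (cos (T s))).
          assert (Rabs (x s) * Rabs (eta s) <= B1 * Rabs (eta s)) by (apply Rmult_le_compat_r; [apply Rabs_pos|exact HB1']).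
          assert ((1 + tau * tau) * (Rabs (x s) * Rabs (eta s)) <= (1 + tau * tau) * (B1 * Rabs (eta s)))
            by (apply Rmult_le_compat_l; nra).
          nra. }
        assert (H3 : Rabs (c s * / W tau (x s) + cos (T s) * (/ W tau (x s) - / W tau (X s))) <=
          Rabs (c s) + (1 + tau * tau) * B1 * Rabs (eta s)).
        { eapply Rle_trans; [apply Rabs_triang|lra]. }
        pose proof (Rabs_pos (c s)). pose proof (Rabs_pos (eta s)). unfold M.
        assert (0 <= (1 + tau * tau) * B1) by (apply Rmult_le_pos; nra). nra. }
      assert (Hk : k s = KM s + P - u s / x s + Q s * eta s) by lra.
      unfold dD.
      assert (Es : sin (T s) = Sn s - u s) by (unfold u; ring).
      assert (Ec : cos (T s) = C s - c s) by (unfold c; ring).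
      rewrite Es, Ec, Hk.
      set (U := u s) in *. set (c' := c s) in *. set (h := eta s) in *. set (Kk := KM s) in *.
      set (qq := Q s) in *. set (CC0 := C s) in *. set (S0 := Sn s) in *. set (xx := x s) in *.
      (* The terms in [KM] cancel, because a common rotation of both unit vectors does not change
         [u^2 + c^2]. *)
      replace (U * (CC0 * (Kk + P - U / xx + qq * h) - (CC0 - c') * Kk)
        - c' * (S0 * (Kk + P - U / xx + qq * h) - (S0 - U) * Kk) + h * (c' - h * CC0) / xx)
        with (U * CC0 * P + U * U * (- CC0 / xx) + U * CC0 * qq * h
          - c' * S0 * P + c' * U * (S0 / xx) - c' * S0 * qq * h + h * (c' / xx) + h * h * (- CC0 / xx))
        by (field; lra).
      assert (HC1 : Rabs CC0 <= 1) by (apply Rabs_le; nra).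
      assert (HS1 : Rabs S0 <= 1) by (apply Rabs_le; nra).
      assert (Y1 := young U c'). assert (Y2 := young U h). assert (Y3 := young c' h).
      assert (Y4 := young c' c'). assert (Y5 := young h h). assert (Y6 := young U U).
      pose proof (Rabs_pos U) as pU. pose proof (Rabs_pos c') as pc. pose proof (Rabs_pos h) as ph.
      pose proof (Rle_0_sqr U) as sU. pose proof (Rle_0_sqr c') as sc. pose proof (Rle_0_sqr h) as sh.
      unfold Rsqr in sU, sc, sh.
      unfold D. fold U c' h. set (DD := U * U + c' * c' + h * h).
      assert (T1 : U * CC0 * P <= M * DD).
      { eapply Rle_trans; [apply Rle_abs|]. rewrite !Rabs_mult.
        apply Rle_trans with (Rabs U * 1 * (M * (Rabs c' + Rabs h))).
        - apply Rmult_le_compat; [apply Rmult_le_pos; apply Rabs_pos|apply Rabs_pos| |exact HPb].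
          apply Rmult_le_compat_l; assumption.
        - replace (Rabs U * 1 * (M * (Rabs c' + Rabs h))) with (M * (Rabs U * Rabs c' + Rabs U * Rabs h)) by ring.
          apply Rmult_le_compat_l; [exact HM|unfold DD; lra]. }
      assert (T2 : U * U * (- CC0 / xx) <= B6 * DD).
      { apply Rle_trans with (U * U * B6); [apply Rmult_le_compat_l; assumption|].
        rewrite Rmult_comm. apply Rmult_le_compat_l; [exact HB6p|unfold DD; lra]. }
      assert (T3 : U * CC0 * qq * h <= B4 * DD).
      { eapply Rle_trans; [apply Rle_abs|]. rewrite !Rabs_mult.
        apply Rle_trans with (Rabs U * 1 * B4 * Rabs h).
        - apply Rmult_le_compat_r; [exact ph|]. apply Rmult_le_compat; try assumption.
          + apply Rmult_le_pos; apply Rabs_pos.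
          + apply Rabs_pos.
          + apply Rmult_le_compat_l; assumption.
        - replace (Rabs U * 1 * B4 * Rabs h) with (B4 * (Rabs U * Rabs h)) by ring.
          apply Rmult_le_compat_l; [exact HB4p|unfold DD; lra]. }
      assert (T4 : - (c' * S0 * P) <= 2 * M * DD).
      { eapply Rle_trans; [apply Rle_abs|]. rewrite Rabs_Ropp, !Rabs_mult.
        apply Rle_trans with (Rabs c' * 1 * (M * (Rabs c' + Rabs h))).
        - apply Rmult_le_compat; [apply Rmult_le_pos; apply Rabs_pos|apply Rabs_pos| |exact HPb].
          apply Rmult_le_compat_l; assumption.
        - replace (Rabs c' * 1 * (M * (Rabs c' + Rabs h))) with (M * (Rabs c' * Rabs c' + Rabs c' * Rabs h)) by ring.
          rewrite (Rmult_comm 2), Rmult_assoc. apply Rmult_le_compat_l; [exact HM|unfold DD; lra]. }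
      assert (T5 : c' * U * (S0 / xx) <= B3 * DD).
      { eapply Rle_trans; [apply Rle_abs|]. rewrite Rabs_mult, (Rabs_mult c').
        apply Rle_trans with (Rabs c' * Rabs U * B3).
        - apply Rmult_le_compat_l; [apply Rmult_le_pos; apply Rabs_pos|exact HB3].
        - rewrite Rmult_comm. apply Rmult_le_compat_l; [exact HB3p|unfold DD; lra]. }
      assert (T6 : - (c' * S0 * qq * h) <= B4 * DD).
      { eapply Rle_trans; [apply Rle_abs|]. rewrite Rabs_Ropp, !Rabs_mult.
        apply Rle_trans with (Rabs c' * 1 * B4 * Rabs h).
        - apply Rmult_le_compat_r; [exact ph|]. apply Rmult_le_compat; try assumption.
          + apply Rmult_le_pos; apply Rabs_pos.
          + apply Rabs_pos.
          + apply Rmult_le_compat_l; assumption.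
        - replace (Rabs c' * 1 * B4 * Rabs h) with (B4 * (Rabs c' * Rabs h)) by ring.
          apply Rmult_le_compat_l; [exact HB4p|unfold DD; lra]. }
      assert (T7 : h * (c' / xx) <= 2 * B7 * DD).
      { eapply Rle_trans; [apply Rle_abs|]. rewrite Rabs_mult. unfold Rdiv at 1.
        rewrite Rabs_mult, Rabs_inv, (Rabs_right xx) by lra.
        apply Rle_trans with (Rabs h * (B7 * (Rabs U + Rabs c'))).
        - apply Rmult_le_compat_l; [exact ph|exact HB7].
        - replace (Rabs h * (B7 * (Rabs U + Rabs c'))) with (B7 * (Rabs U * Rabs h + Rabs c' * Rabs h)) by ring.
          rewrite (Rmult_comm 2), Rmult_assoc. apply Rmult_le_compat_l; [exact HB7p|unfold DD; lra]. }
      assert (T8 : h * h * (- CC0 / xx) <= B6 * DD).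
      { apply Rle_trans with (h * h * B6); [apply Rmult_le_compat_l; assumption|].
        rewrite Rmult_comm. apply Rmult_le_compat_l; [exact HB6p|unfold DD; lra]. }
      assert (HDD : 0 <= DD) by (unfold DD; lra).
      match goal with |- 2 * v s * ?e <= _ => assert (Hsum : e <= L0 * DD) end.
      { apply Rle_trans with (M * DD + B6 * DD + B4 * DD + 2 * M * DD + B3 * DD + B4 * DD + 2 * B7 * DD + B6 * DD); [lra|].
        unfold L0. nra. }
      assert (HL0 : 0 <= L0 * DD).
      { apply Rmult_le_pos; [|exact HDD]. unfold L0. lra. }
      pose proof (Rle_abs (v s)).
      apply Rle_trans with (2 * v s * (L0 * DD)).
      + apply Rmult_le_compat_l; [lra|exact Hsum].
      + rewrite (Rmult_assoc (2 * B2)). apply Rmult_le_compat_r; [exact HL0|lra].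
    - intros eps He. destruct (proj1 (rlim_eps D 0) cmp_energy_zero eps He) as [d [Hd Hd']].
      exists d. split; [exact Hd|]. intros s Hs. specialize (Hd' s ltac:(lra)).
      apply Rabs_def2 in Hd'. lra. }
  unfold D in HDz.
  assert (Hu : u r = 0) by (apply Rsqr_0_uniq; unfold Rsqr; nra).
  assert (Hc : c r = 0) by (apply Rsqr_0_uniq; unfold Rsqr; nra).
  assert (He : eta r = 0) by (apply Rsqr_0_uniq; unfold Rsqr; nra).
  pose proof (Hx r Hr). split; [|split].
  - assert (E : x r * eta r = x r - X r) by (unfold eta; field; lra).
    rewrite He in E. unfold X in E. lra.
  - unfold c, T in Hc. lra.
  - unfold u, T in Hu. lra.
Qed.
End Comparison.

Lemma rlim_quotient (f : R -> R) (l : R) : is_derive f 0 l -> f 0 = 0 -> rlim (fun r => f r / r) l.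
Proof.
  intros Hf H0. apply rlim_eps. intros eps He. apply is_derive_Reals in Hf.
  destruct (Hf eps He) as [d Hd]. exists d. split; [apply cond_pos|]. intros r Hr.
  specialize (Hd r ltac:(lra)). rewrite Rplus_0_l, H0, Rminus_0_r in Hd. apply Hd.
  rewrite Rabs_right; lra.
Qed.

(** * Surfaces meeting the axis *)

Section OnAxis.
Variables (tau : R) (S : rot_data) (s0 : R).
Hypothesis HR : is_rotational_surface tau S.
Hypothesis Hdom : dom S s0.
Hypothesis Hrad : rad S s0 = 0.

(** The disk chart is smooth across the axis, unlike the profile. Along its first coordinate line
    the radius extends to [f] and the height to an even function [g]. Hence [g' = 0] at the axis,
    the tangent plane is horizontal, and the rank condition forces [f' <> 0]; all limits are read
    off [f] and [g]. *)
Lemma on_axis : exists sg d rho e K, 0 < d /\ (sg = 1 \/ sg = -1) /\ 0 < rho /\ (e = 1 \/ e = -1) /\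
  (forall r, Rabs r < d -> (dom S (s0 + sg * r) <-> 0 <= r)) /\
  (forall t, nrm S s0 t = (0, 0, e)) /\
  rlim (fun r => rad S (s0 + sg * r) / r) rho /\
  rlim (fun r => hgt S (s0 + sg * r)) (hgt S s0) /\
  rlim (fun r => speed tau S (s0 + sg * r)) rho /\
  rlim (fun r => sg * slope_cos tau S (s0 + sg * r)) 1 /\
  rlim (fun r => cz (nrm S (s0 + sg * r) 0)) e /\
  (forall r, 0 < r < d -> Rabs (sg * slope_sin tau S (s0 + sg * r)) <= K * rad S (s0 + sg * r)).
Proof.
  destruct (rot_immersed _ _ HR s0 Hdom) as [D [F [n [Hloc Him]]]].
  destruct Hloc as [d Hd Hr _ _ _|sg d Hd _ Hsg Hds HD HF]; [lra|].
  assert (Hsg2 : sg * sg = 1) by (destruct Hsg as [-> | ->]; ring).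
  set (f := fun u => cx (F u 0)). set (g := fun u => cz (F u 0)).
  assert (HD0 : D 0 0) by (apply HD; unfold disc; nra).
  assert (HDu : forall u, Rabs u < d -> D u 0).
  { intros u Hu. apply HD. unfold disc. apply Rabs_def2 in Hu. nra. }
  assert (Ex : forall u, Rabs u < d -> ex_derive f u /\ ex_derive (Derive f) u).
  { intros u Hu. exact (ex_diff_second _ u 0 (imm_smooth _ _ _ _ Him ax 2%nat u 0 (HDu u Hu))). }
  assert (Ez : forall u, Rabs u < d -> ex_derive g u /\ ex_derive (Derive g) u).
  { intros u Hu. exact (ex_diff_second _ u 0 (imm_smooth _ _ _ _ Him az 2%nat u 0 (HDu u Hu))). }
  assert (F0 : forall r, 0 <= r < d -> F r 0 = (rad S (s0 + sg * r), 0, hgt S (s0 + sg * r)) /\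
     n r 0 = nrm S (s0 + sg * r) 0).
  { intros r Hr. destruct (HF r 0 Hr) as [E1 E2]. rewrite cos_0, sin_0, Rmult_1_r, Rmult_0_r in E1, E2.
    rewrite E1, E2. split; [|reflexivity]. unfold rot_map. rewrite cos_0, sin_0. apply pt_eq; ring. }
  assert (F0' : forall r, 0 <= r < d -> F r 0 = (rad S (s0 + sg * r), 0, hgt S (s0 + sg * r)))
    by (intros; now apply F0).
  assert (Fpi : forall r, 0 <= r < d -> F (- r) 0 = (- rad S (s0 + sg * r), 0, hgt S (s0 + sg * r))).
  { intros r Hr. destruct (HF r PI Hr) as [E1 _]. rewrite cos_PI, sin_PI, Rmult_0_r in E1.
    replace (r * -1) with (- r) in E1 by ring. rewrite E1. unfold rot_map. rewrite cos_PI, sin_PI.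
    apply pt_eq; ring. }
  assert (Fp : forall r, 0 <= r < d -> F 0 r = (0, rad S (s0 + sg * r), hgt S (s0 + sg * r))).
  { intros r Hr. destruct (HF r (PI / 2) Hr) as [E1 _]. rewrite cos_PI2, sin_PI2, Rmult_0_r, Rmult_1_r in E1.
    rewrite E1. unfold rot_map. rewrite cos_PI2, sin_PI2. apply pt_eq; ring. }
  assert (Fm : forall r, 0 <= r < d -> F 0 (- r) = (0, - rad S (s0 + sg * r), hgt S (s0 + sg * r))).
  { intros r Hr. destruct (HF r (- (PI / 2)) Hr) as [E1 _].
    rewrite cos_neg, sin_neg, cos_PI2, sin_PI2, Rmult_0_r in E1.
    replace (r * - (1)) with (- r) in E1 by ring. rewrite E1. unfold rot_map.
    rewrite cos_neg, sin_neg, cos_PI2, sin_PI2. apply pt_eq; ring. }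
  assert (Ff : forall r, 0 <= r < d -> f r = rad S (s0 + sg * r)).
  { intros r Hr. unfold f. now rewrite (proj1 (F0 r Hr)). }
  assert (Fg : forall r, 0 <= r < d -> g r = hgt S (s0 + sg * r)).
  { intros r Hr. unfold g. now rewrite (proj1 (F0 r Hr)). }
  assert (f0 : f 0 = 0).
  { rewrite Ff by lra. replace (s0 + sg * 0) with s0 by ring. exact Hrad. }
  (* The rotation by [PI] exchanges the points of parameters [u] and [- u] and preserves heights. *)
  assert (Hgev : forall u, Rabs u < d -> g (- u) = g u).
  { intros u Hu. apply Rabs_def2 in Hu. unfold g. destruct (Rle_dec 0 u).
    - rewrite (Fpi u), (F0' u) by lra. reflexivity.
    - replace (F u 0) with (F (- - u) 0) by (f_equal; ring). rewrite (Fpi (- u)), (F0' (- u)) by lra. reflexivity. }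
  assert (HF0u : forall u, Rabs u < d -> F u 0 = (f u, 0, g u)).
  { intros u Hu. apply Rabs_def2 in Hu. unfold f, g. destruct (Rle_dec 0 u).
    - rewrite (F0' u) by lra. reflexivity.
    - replace (F u 0) with (F (- - u) 0) by (f_equal; ring). rewrite (Fpi (- u)) by lra. reflexivity. }
  assert (HF0v : forall u, Rabs u < d -> F 0 u = (0, f u, g u)).
  { intros u Hu. apply Rabs_def2 in Hu. unfold f, g. destruct (Rle_dec 0 u).
    - rewrite (F0' u), (Fp u) by lra. reflexivity.
    - replace (F u 0) with (F (- - u) 0) by (f_equal; ring). replace (F 0 u) with (F 0 (- - u)) by (f_equal; ring).
      rewrite (Fpi (- u)), (Fm (- u)) by lra. reflexivity. }
  assert (R0d : Rabs 0 < d) by now rewrite Rabs_R0.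
  assert (Loc : locally 0 (fun u => Rabs u < d)).
  { exists (mkposreal d Hd). intros u Hu. assert (Hu' : Rabs (u - 0) < d) by exact Hu.
    now rewrite Rminus_0_r in Hu'. }
  set (p := Derive f 0).
  assert (Df : is_derive f 0 p) by (apply Derive_correct, Ex; exact R0d).
  assert (Dg : is_derive g 0 (Derive g 0)) by (apply Derive_correct, Ez; exact R0d).
  assert (g1 : Derive g 0 = 0).
  { assert (H : is_derive g 0 (- Derive g 0)).
    { apply (is_derive_ext_loc (fun u => g (- u))).
      - revert Loc. apply filter_imp. exact Hgev.
      - eapply is_derive_eq; [apply (deriv_comp g (fun u => - u) 0 (- (1)))|].
        + apply (deriv_opp (fun u => u)). apply deriv_id.
        + rewrite Ropp_0. exact Dg.
        + ring. }
    apply is_derive_unique in H. lra. }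
  rewrite g1 in Dg.
  assert (Edu : du F 0 0 = (p, 0, 0)).
  { unfold du. apply pt_eq; [reflexivity| |exact g1].
    apply (Derive_locally _ (fun _ => 0)); [|apply deriv_const].
    revert Loc. apply filter_imp. intros u Hu. now rewrite HF0u. }
  assert (Edv : dv F 0 0 = (0, p, 0)).
  { unfold dv. apply pt_eq.
    - apply (Derive_locally _ (fun _ => 0)); [|apply deriv_const].
      revert Loc. apply filter_imp. intros u Hu. now rewrite HF0v.
    - apply (Derive_locally _ f); [|exact Df].
      revert Loc. apply filter_imp. intros u Hu. now rewrite HF0v.
    - apply (Derive_locally _ g); [|exact Dg].
      revert Loc. apply filter_imp. intros u Hu. now rewrite HF0v. }
  assert (Hp0 : p <> 0).
  { intros Hp. destruct (imm_rank _ _ _ _ Him 0 0 HD0 1 0) as [H1 _]; [|lra].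
    intros i. rewrite Edu, Edv, Hp. destruct i; unfold coord, cx, cy, cz; simpl; ring. }
  assert (Lx : rlim (fun r => f r / r) p) by now apply rlim_quotient.
  (* [rad] is nonnegative, so its right quotient cannot have a negative limit. *)
  assert (Hp : 0 < p).
  { destruct (Rtotal_order p 0) as [Hneg|[H|H]]; [exfalso|contradiction|exact H].
    destruct (proj1 (rlim_eps _ _) Lx (- p)) as [d1 [Hd1 H1]]; [lra|].
    pose proof (Rmin_l d d1). pose proof (Rmin_r d d1).
    assert (H2 : 0 < Rmin d d1) by now apply Rmin_glb_lt.
    set (r := Rmin d d1 / 2). specialize (H1 r ltac:(unfold r; lra)). apply Rabs_def2 in H1.
    assert (Hfr : 0 <= f r).
    { rewrite Ff by (unfold r; lra). apply (rot_half_plane _ _ HR). apply Hds; [|unfold r; lra].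
      apply Rabs_def1; unfold r; lra. }
    assert (0 <= f r / r) by (apply Rle_mult_inv_pos; [exact Hfr|unfold r; lra]). lra. }
  assert (En : forall t, nrm S s0 t = n 0 0).
  { intros t. destruct (HF 0 t) as [_ E]; [lra|]. rewrite !Rmult_0_l in E. rewrite E.
    f_equal. ring. }
  assert (EF : F 0 0 = (0, 0, g 0)) by (rewrite HF0u, f0 by exact R0d; reflexivity).
  pose proof (imm_normal_unit _ _ _ _ Him 0 0 HD0) as N1.
  destruct (imm_normal_orthogonal _ _ _ _ Him 0 0 HD0) as [N2 N3].
  set (e := cz (n 0 0)).
  assert (Hn : n 0 0 = (0, 0, e) /\ e * e = 1).
  { rewrite EF, Edu in *. rewrite Edv in N3. unfold e.
    destruct (n 0 0) as [[n1 n2] n3]. unfold inner, contact, cx, cy, cz in *; simpl in *.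
    assert (H1 : n1 = 0) by (apply (Rmult_eq_reg_r p); [lra|exact Hp0]).
    assert (H2 : n2 = 0) by (apply (Rmult_eq_reg_r p); [lra|exact Hp0]).
    subst. split; [reflexivity|lra]. }
  destruct Hn as [Hn He].
  assert (He1 : e = 1 \/ e = -1).
  { assert (H : (e - 1) * (e + 1) = 0) by lra. apply Rmult_integral in H. destruct H; [left|right]; lra. }
  assert (Hin : forall r y, 0 < r < d -> Rabs (y - (s0 + sg * r)) < Rmin r (d - r) ->
    0 < sg * (y - s0) < d /\ y = s0 + sg * (sg * (y - s0))).
  { intros r y Hr Hy. pose proof (Rmin_l r (d - r)). pose proof (Rmin_r r (d - r)).
    split; [|transitivity (s0 + sg * sg * (y - s0)); [rewrite Hsg2; ring|ring]].
    apply Rabs_def2 in Hy. destruct Hsg as [-> | ->]; lra. }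
  assert (Eder : forall (h k : R -> R), (forall r, 0 <= r < d -> k r = h (s0 + sg * r)) ->
     (forall r, Rabs r < d -> ex_derive k r) ->
     forall r, 0 < r < d -> Derive h (s0 + sg * r) = sg * Derive k r).
  { intros h k Hk Hek r Hr.
    apply (Derive_locally _ (fun y => k (sg * (y - s0)))).
    - assert (H : 0 < Rmin r (d - r)) by (apply Rmin_glb_lt; lra).
      exists (mkposreal _ H). intros y Hy. destruct (Hin r y Hr Hy) as [H1 H2].
      rewrite Hk by lra. now rewrite <- H2.
    - apply (deriv_comp k (fun y => sg * (y - s0)) _ sg (Derive k r)).
      + auto_derive; [exact I|ring].
      + replace (sg * (s0 + sg * r - s0)) with r by (transitivity (sg * sg * r); [rewrite Hsg2; ring|ring]).
        apply Derive_correct, Hek. rewrite Rabs_right; lra. }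
  assert (Erad : forall r, 0 < r < d -> Derive (rad S) (s0 + sg * r) = sg * Derive f r).
  { apply Eder; [exact Ff|]. intros r Hr. now apply Ex. }
  assert (Ehgt : forall r, 0 < r < d -> Derive (hgt S) (s0 + sg * r) = sg * Derive g r).
  { apply Eder; [exact Fg|]. intros r Hr. now apply Ez. }
  set (V := fun r => sqrt (Derive f r * Derive f r + Derive g r / W tau (f r) * (Derive g r / W tau (f r)))).
  assert (EV : forall r, 0 < r < d -> speed tau S (s0 + sg * r) = V r).
  { intros r Hr. unfold speed, V. rewrite Erad, Ehgt, (Ff r) by lra. f_equal.
    pose proof (W_pos tau (rad S (s0 + sg * r))).
    transitivity (sg * sg * (Derive f r * Derive f r + Derive g r / W tau (rad S (s0 + sg * r)) * (Derive g r / W tau (rad S (s0 + sg * r)))));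
      [field; lra|rewrite Hsg2; ring]. }
  assert (Lf0 : rlim f 0).
  { rewrite <- f0. apply rlim_continuous. eapply is_derive_continuous, Df. }
  assert (Lf1 : rlim (Derive f) p).
  { apply rlim_continuous. destruct (proj2 (Ex 0 R0d)) as [l Hl]. eapply is_derive_continuous, Hl. }
  pose proof (Derive_correct _ _ (proj2 (Ez 0 R0d))) as Dg2. set (g2 := Derive (Derive g) 0) in *.
  assert (Lg1 : rlim (Derive g) 0).
  { rewrite <- g1. apply rlim_continuous. eapply is_derive_continuous, Dg2. }
  assert (Lg2 : rlim (fun r => Derive g r / r) g2) by now apply rlim_quotient.
  assert (HW0 : W tau 0 = 1) by (unfold W; rewrite !Rmult_0_r, Rplus_0_r; apply sqrt_1).
  assert (LWi : rlim (fun r => / W tau (f r)) 1).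
  { replace 1 with (/ 1) by field. apply rlim_inv; [|lra]. rewrite <- HW0.
    apply (rlim_comp f (W tau)); [exact Lf0|]. eapply is_derive_continuous, W_derive. }
  assert (LV : rlim V p).
  { replace p with (sqrt (p * p + 0 * 1 * (0 * 1))).
    2:{ replace (p * p + 0 * 1 * (0 * 1)) with (p * p) by ring. apply sqrt_square. lra. }
    apply (rlim_comp (fun r => Derive f r * Derive f r + Derive g r / W tau (f r) * (Derive g r / W tau (f r))) sqrt).
    - apply rlim_plus; [now apply rlim_mult|].
      apply rlim_mult; apply rlim_mult; assumption.
    - apply continuous_sqrt. }
  (* As [Derive g r / r] tends to the second derivative of [g], the quotient of [slope_sin] by the
     radius stays bounded. This is the estimate [|Sn| <= K x] on which the comparison rests. *)
  assert (LSx : rlim (fun r => Derive g r / r * / W tau (f r) * / V r * / (f r / r)) (g2 * 1 * / p * / p)).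
  { apply rlim_mult; [apply rlim_mult; [now apply rlim_mult|now apply rlim_inv]|now apply rlim_inv]. }
  destruct (rlim_bounded _ _ LSx) as [d1 [Hd1 HSx]].
  destruct (rlim_gt _ _ 0 Lx Hp) as [d2 [Hd2 Hfx]].
  destruct (rlim_gt _ _ 0 LV Hp) as [d3 [Hd3 HVp]].
  set (K := Rabs (g2 * 1 * / p * / p) + 1) in *.
  set (dd := Rmin d (Rmin d1 (Rmin d2 d3))).
  assert (Hdd : 0 < dd) by (repeat apply Rmin_glb_lt; assumption).
  assert (dd <= d /\ dd <= d1 /\ dd <= d2 /\ dd <= d3) as [K1 [K2 [K3 K4]]].
  { unfold dd. pose proof (Rmin_l d (Rmin d1 (Rmin d2 d3))). pose proof (Rmin_r d (Rmin d1 (Rmin d2 d3))).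
    pose proof (Rmin_l d1 (Rmin d2 d3)). pose proof (Rmin_r d1 (Rmin d2 d3)).
    pose proof (Rmin_l d2 d3). pose proof (Rmin_r d2 d3). lra. }
  exists sg, dd, p, e, K. split; [exact Hdd|]. split; [exact Hsg|]. split; [exact Hp|]. split; [exact He1|].
  split; [intros r Hr; apply Hds; lra|].
  split; [intros t; rewrite En; exact Hn|].
  split; [apply (rlim_ext (fun r => f r / r) _ p d Hd); [intros r Hr; now rewrite Ff by lra|exact Lx]|].
  split.
  { apply (rlim_ext g _ _ d Hd); [intros r Hr; now rewrite Fg by lra|].
    replace (hgt S s0) with (g 0); [apply rlim_continuous; eapply is_derive_continuous, Dg|].
    rewrite Fg by lra. f_equal. ring. }
  split; [apply (rlim_ext V _ p d Hd); [intros r Hr; now rewrite EV by lra|exact LV]|].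
  split.
  { apply (rlim_ext (fun r => Derive f r * / V r) _ 1 d Hd).
    - intros r Hr. unfold slope_cos. rewrite Erad, EV by lra.
      transitivity (sg * sg * (Derive f r * / V r)); [rewrite Hsg2; ring|unfold Rdiv; ring].
    - replace 1 with (p * / p) by (field; lra). apply rlim_mult; [exact Lf1|now apply rlim_inv]. }
  split.
  { apply (rlim_ext (fun r => cz (n r 0)) _ e d Hd); [intros r Hr; now rewrite (proj2 (F0 r ltac:(lra)))|].
    apply (rlim_continuous (fun r => cz (n r 0))). apply continuous_eps. intros eps Heps.
    destruct (imm_normal_continuous _ _ _ _ Him az 0 0 HD0 (mkposreal eps Heps)) as [r Hr].
    exists r. split; [apply cond_pos|]. intros y Hy. apply (Hr y 0); [exact Hy|].
    rewrite Rminus_diag, Rabs_R0. apply cond_pos. }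
  intros r Hr. specialize (HSx r ltac:(lra)). specialize (Hfx r ltac:(lra)). specialize (HVp r ltac:(lra)).
  assert (Hfr : 0 < f r).
  { replace (f r) with (f r / r * r) by (field; lra). apply Rmult_lt_0_compat; lra. }
  assert (E : sg * slope_sin tau S (s0 + sg * r) = Derive g r / r * / W tau (f r) * / V r * / (f r / r) * f r).
  { unfold slope_sin. rewrite Ehgt, EV, <- Ff by lra. pose proof (W_pos tau (f r)).
    transitivity (sg * sg * (Derive g r / W tau (f r) / V r)); [field; lra|rewrite Hsg2; field; lra]. }
  rewrite E, Rabs_mult, <- Ff, (Rabs_right (f r)) by lra. apply Rmult_le_compat_r; lra.
Qed.
End OnAxis.

Lemma has_normal_unique (tau e e' : R) (S : rot_data) (s : R) :
  e = 1 \/ e = -1 -> e' = 1 \/ e' = -1 -> 0 < speed tau S s ->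
  has_normal tau e S s -> has_normal tau e' S s -> e = e'.
Proof.
  intros He He' Hv H H'.
  assert (Hcs : cos 0 * cos 0 + sin 0 * sin 0 = 1) by (rewrite cos_0, sin_0; ring).
  assert (HC := slope_unit tau S s Hv).
  assert (E := unit_normal_sign tau e e' (rad S s) _ _ _ _ (hgt S s) Hcs HC).
  rewrite <- (H 0), <- (H' 0) in E. rewrite (H 0) in E.
  rewrite (unit_normal_sign tau e e (rad S s) _ _ _ _ (hgt S s) Hcs HC) in E.
  destruct He as [-> | ->], He' as [-> | ->]; lra.
Qed.

(** * Following a translator away from the axis *)

Section FromAxis.
Variables (tau lam : R) (S : rot_data) (s0 sg d rho e K : R).
Hypothesis HS : rotational_translator tau lam S.
Hypothesis Hdom : dom S s0.
Hypothesis Hrad : rad S s0 = 0.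
Hypothesis Hd : 0 < d.
Hypothesis Hsg : sg = 1 \/ sg = -1.
Hypothesis Hrho : 0 < rho.
Hypothesis He : e = 1 \/ e = -1.
Hypothesis Hnear : forall r, Rabs r < d -> (dom S (s0 + sg * r) <-> 0 <= r).
Hypothesis Hnrm : forall t, nrm S s0 t = (0, 0, e).

(** The parameter [r] always runs away from the axis. For [sg = -1] this reverses the profile,
    whence the factor [sg] in [C] and [Sn]; the normal of sign [sg * e] with respect to the original
    slope has sign [e] with respect to the new one. *)
Let par (r : R) := s0 + sg * r.
Let x (r : R) := rad S (par r).
Let h (r : R) := hgt S (par r).
Let v (r : R) := speed tau S (par r).
Let C (r : R) := sg * slope_cos tau S (par r).
Let Sn (r : R) := sg * slope_sin tau S (par r).
Let Dm (r : R) := dom S (par r).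
Let mu := e * lam.
Let k (r : R) := 2 * (C r * / W tau (x r) + mu) - Sn r / x r.

Hypothesis Lx : rlim (fun r => x r / r) rho.
Hypothesis Lh : rlim h (hgt S s0).
Hypothesis Lv : rlim v rho.
Hypothesis LC : rlim C 1.
Hypothesis Ln : rlim (fun r => cz (nrm S (par r) 0)) e.
Hypothesis HSx : forall r, 0 < r < d -> Rabs (Sn r) <= K * x r.

Lemma sg_sqr : sg * sg = 1.
Proof. destruct Hsg as [-> | ->]; ring. Qed.

Lemma Dm_interval (a b r : R) : Dm a -> Dm b -> a <= r <= b -> Dm r.
Proof.
  intros Ha Hb Hr. unfold Dm, par in *. destruct HS as [HR _].
  destruct Hsg as [-> | ->].
  - apply (rot_interval _ _ HR (s0 + 1 * a) (s0 + 1 * b)); [exact Ha|exact Hb|lra].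
  - apply (rot_interval _ _ HR (s0 + -1 * b) (s0 + -1 * a)); [exact Hb|exact Ha|lra].
Qed.

Lemma Dm_0 : Dm 0.
Proof. unfold Dm, par. rewrite Rmult_0_r, Rplus_0_r. exact Hdom. Qed.

Lemma Dm_nonneg (r : R) : Dm r -> 0 <= r.
Proof.
  intros H. apply Rnot_lt_le. intros Hr.
  set (r1 := Rmax r (- (d / 2))).
  assert (r <= r1 /\ - (d / 2) <= r1 /\ r1 < 0) as [K1 [K2 K3]].
  { unfold r1. split; [apply Rmax_l|]. split; [apply Rmax_r|]. apply Rmax_lub_lt; lra. }
  assert (H1 : Dm r1) by (apply (Dm_interval r 0); [exact H|exact Dm_0|lra]).
  apply (Hnear r1) in H1; [lra|]. apply Rabs_def1; lra.
Qed.

Lemma x_at_0 : x 0 = 0.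
Proof. unfold x, par. rewrite Rmult_0_r, Rplus_0_r. exact Hrad. Qed.

Lemma regular (r : R) : Dm r -> 0 < x r -> exists d1 eps, 0 < d1 /\ (eps = 1 \/ eps = -1) /\
  forall y, Rabs (y - r) < d1 -> Dm y /\ 0 < x y /\ 0 < v y /\ has_normal tau eps S (par y).
Proof.
  intros Hr Hx. destruct (off_axis_regular tau lam S (par r) HS Hr Hx) as [d1 [Hd1 H1]].
  destruct (off_axis_normal tau lam S (par r) HS Hr Hx) as [d2 [eps [Hd2 [Heps H2]]]].
  exists (Rmin d1 d2), eps. split; [now apply Rmin_glb_lt|]. split; [exact Heps|]. intros y Hy.
  pose proof (Rmin_l d1 d2). pose proof (Rmin_r d1 d2).
  assert (E : Rabs (par y - par r) = Rabs (y - r)).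
  { unfold par. replace (s0 + sg * y - (s0 + sg * r)) with (sg * (y - r)) by ring.
    rewrite Rabs_mult. destruct Hsg as [-> | ->]; [rewrite Rabs_R1|rewrite (Rabs_left (-1)) by lra]; ring. }
  destruct (H1 (par y)) as [P1 [P2 [_ [_ [_ [_ P3]]]]]]; [lra|].
  repeat split; try assumption. apply H2. lra.
Qed.

Lemma par_deriv (r : R) : is_derive par r sg.
Proof. unfold par. auto_derive; [exact I|ring]. Qed.

Lemma axis_ode (r : R) : Dm r -> 0 < x r -> has_normal tau (sg * e) S (par r) ->
  0 < v r /\ C r * C r + Sn r * Sn r = 1 /\ continuous v r /\
  is_derive x r (v r * C r) /\ is_derive C r (- (v r * Sn r * k r)) /\
  is_derive Sn r (v r * C r * k r) /\ is_derive h r (v r * W tau (x r) * Sn r).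
Proof.
  intros Hr Hx Hn. destruct (off_axis_regular tau lam S (par r) HS Hr Hx) as [d1 [Hd1 H1]].
  destruct (H1 (par r)) as [_ [_ [E1 [E2 [E3 [E4 Hv]]]]]]; [now rewrite Rminus_diag, Rabs_R0|].
  assert (Hse : sg * e = 1 \/ sg * e = -1).
  { destruct Hsg as [-> | ->], He as [-> | ->]; lra. }
  destruct (off_axis_equation tau lam S (par r) HS Hr Hx (sg * e) Hse Hn) as [DC DS].
  pose proof sg_sqr as Hs2.
  assert (Hk : 2 * (slope_cos tau S (par r) * / W tau (rad S (par r)) + sg * e * lam) -
      slope_sin tau S (par r) / rad S (par r) = sg * k r).
  { unfold k, C, Sn, mu, x in *. pose proof (W_pos tau (rad S (par r))).
    transitivity (2 * (sg * sg * slope_cos tau S (par r) * / W tau (rad S (par r)) + sg * (e * lam)) -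
      sg * sg * slope_sin tau S (par r) / rad S (par r)); [rewrite Hs2; field; lra|field; lra]. }
  rewrite Hk in DC, DS.
  split; [exact Hv|]. split.
  { unfold C, Sn. transitivity (sg * sg * (slope_cos tau S (par r) * slope_cos tau S (par r) +
      slope_sin tau S (par r) * slope_sin tau S (par r))); [ring|].
    rewrite Hs2, (slope_unit tau S (par r) Hv). ring. }
  split.
  { apply (cont_comp par (speed tau S)); [eapply is_derive_continuous, par_deriv|].
    destruct (slope_derivable tau S (par r) Hv E1 E3 E4) as [[l Hl] _]. eapply is_derive_continuous, Hl. }
  split; [|split; [|split]].
  - eapply is_derive_eq; [apply (deriv_comp (rad S) par); [apply par_deriv|apply (rad_derive tau); assumption]|].
    unfold v, C. ring.
  - eapply is_derive_eq.
    + apply (deriv_scal sg (fun r => slope_cos tau S (par r))), (deriv_comp (slope_cos tau S) par);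
        [apply par_deriv|exact DC].
    + unfold v, Sn. transitivity (- (sg * sg * (speed tau S (par r) * (sg * slope_sin tau S (par r)) * k r))); [ring|].
      rewrite Hs2. ring.
  - eapply is_derive_eq.
    + apply (deriv_scal sg (fun r => slope_sin tau S (par r))), (deriv_comp (slope_sin tau S) par);
        [apply par_deriv|exact DS].
    + unfold v, C. transitivity (sg * sg * (speed tau S (par r) * (sg * slope_cos tau S (par r)) * k r)); [ring|].
      rewrite Hs2. ring.
  - eapply is_derive_eq; [apply (deriv_comp (hgt S) par); [apply par_deriv|apply (hgt_derive tau); assumption]|].
    unfold v, Sn, x. ring.
Qed.

Lemma near_axis : exists a, 0 < a <= d /\ forall r, 0 < r < a ->
  Dm r /\ 0 < x r /\ has_normal tau (sg * e) S (par r) /\ / 2 < C r.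
Proof.
  destruct (rlim_gt _ _ 0 Lx Hrho) as [d1 [Hd1 H1]].
  destruct (rlim_gt C 1 (/ 2) LC) as [d2 [Hd2 H2]]; [lra|].
  destruct (proj1 (rlim_eps _ _) Ln 1 Rlt_0_1) as [d3 [Hd3 H3]].
  set (a := Rmin d (Rmin d1 (Rmin d2 d3))).
  assert (Ha : 0 < a) by (repeat apply Rmin_glb_lt; assumption).
  assert (a <= d /\ a <= d1 /\ a <= d2 /\ a <= d3) as [K1 [K2 [K3 K4]]].
  { unfold a. pose proof (Rmin_l d (Rmin d1 (Rmin d2 d3))). pose proof (Rmin_r d (Rmin d1 (Rmin d2 d3))).
    pose proof (Rmin_l d1 (Rmin d2 d3)). pose proof (Rmin_r d1 (Rmin d2 d3)).
    pose proof (Rmin_l d2 d3). pose proof (Rmin_r d2 d3). lra. }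
  exists a. split; [lra|]. intros r Hr.
  assert (Hr1 : Dm r) by (apply Hnear; [rewrite Rabs_right; lra|lra]).
  specialize (H1 r ltac:(lra)). specialize (H2 r ltac:(lra)). specialize (H3 r ltac:(lra)).
  assert (Hx : 0 < x r).
  { replace (x r) with (x r / r * r) by (field; lra). apply Rmult_lt_0_compat; lra. }
  split; [exact Hr1|]. split; [exact Hx|]. split; [|exact H2].
  destruct (regular r Hr1 Hx) as [d4 [eps [Hd4 [Heps H4]]]].
  destruct (H4 r) as [_ [_ [_ Hn]]]; [now rewrite Rminus_diag, Rabs_R0|].
  replace (sg * e) with eps; [exact Hn|].
  (* The vertical component of the normal is [eps W slope_cos], within [1] of [e], while
     [sg * slope_cos > 1/2]: hence [eps * sg] has the sign of [e]. *)
  rewrite (Hn 0) in H3. unfold unit_normal, frame, cz in H3. simpl in H3.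
  apply Rabs_def2 in H3. pose proof (W_ge_1 tau (x r)) as HW. fold (x r) in H3.
  unfold C in H2. set (w := W tau (x r)) in *. set (c := slope_cos tau S (par r)) in *.
  destruct Hsg as [-> | ->], He as [-> | ->], Heps as [-> | ->]; try ring; exfalso; nra.
Qed.

Let J (r : R) := x r * Sn r - mu * (x r * x r).

(* The monotonicity of [J] keeps the profile away from the axis. *)
Lemma J_axis_deriv (r : R) : Dm r -> 0 < x r -> has_normal tau (sg * e) S (par r) ->
  is_derive J r (2 * v r * x r * (C r * C r) / W tau (x r)).
Proof.
  intros Hr Hx Hn. destruct (axis_ode r Hr Hx Hn) as [_ [_ [_ [Dx [_ [DS _]]]]]].
  unfold J. eapply is_derive_eq.
  - apply (deriv_minus (fun r => x r * Sn r) (fun r => mu * (x r * x r))).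
    + apply (deriv_mult x Sn); [exact Dx|exact DS].
    + apply (deriv_scal mu (fun r => x r * x r)), (deriv_mult x x); exact Dx.
  - unfold k. pose proof (W_pos tau (x r)). field. lra.
Qed.

(** Continuous induction along the profile: positivity of the radius and the sign of the normal are
    what make [J] nondecreasing, and [J] in turn keeps the radius above a fixed [xm]. *)
Lemma axis_free (r : R) : 0 < r -> Dm r -> 0 < x r /\ has_normal tau (sg * e) S (par r).
Proof.
  destruct near_axis as [a0 [Ha0 Hnr]].
  set (a := a0 / 2).
  assert (DJ : forall y, 0 < y < a0 -> is_derive J y (2 * v y * x y * (C y * C y) / W tau (x y))).
  { intros y Hy. destruct (Hnr y Hy) as [H1 [H2 [H3 _]]]. now apply J_axis_deriv. }
  assert (Jpos : forall y, Dm y -> 0 < x y -> has_normal tau (sg * e) S (par y) ->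
    0 <= 2 * v y * x y * (C y * C y) / W tau (x y)).
  { intros y H1 H2 H3. destruct (axis_ode y H1 H2 H3) as [Hv _].
    apply Rmult_le_pos; [|apply Rlt_le, Rinv_0_lt_compat, W_pos].
    apply Rmult_le_pos; [|apply Rle_0_sqr]. nra. }
  assert (Lx0 : rlim x 0).
  { apply (rlim_ext (fun r => x r / r * r) x 0 1); [lra| |].
    - intros y Hy. field. lra.
    - replace 0 with (rho * 0) by ring. apply rlim_mult; [exact Lx|apply rlim_id]. }
  (* [J] is strictly increasing on [(0, a0)], and [- J <= M x^2] tends to [0] at the axis. *)
  assert (HJ : 0 < J a).
  { assert (Hinc : forall y z, 0 < y < z -> z < a0 -> J y < J z).
    { intros y z Hy Hz. apply (increasing_of_deriv J (fun y => 2 * v y * x y * (C y * C y) / W tau (x y))); [lra| | |].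
      - intros w Hw. eapply is_derive_continuous, DJ. lra.
      - intros w Hw. apply DJ. lra.
      - intros w Hw. destruct (Hnr w ltac:(lra)) as [H1 [H2 [H3 H4]]].
        destruct (axis_ode w H1 H2 H3) as [Hv _].
        apply Rdiv_lt_0_compat; [|apply W_pos].
        assert (0 < v w * x w) by (apply Rmult_lt_0_compat; assumption).
        assert (0 < C w * C w) by nra. nra. }
    assert (H1 : J (a / 2) < J a) by (apply Hinc; unfold a; lra).
    apply Rle_lt_trans with (2 := H1). apply Rnot_lt_le. intros H2.
    set (M := Rabs K + Rabs mu).
    destruct (proj1 (rlim_eps x 0) Lx0 (Rmin 1 (- J (a / 2) / (M + 1)))) as [d1 [Hd1 H3]].
    { assert (0 <= M) by (unfold M; pose proof (Rabs_pos K); pose proof (Rabs_pos mu); lra).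
      apply Rmin_glb_lt; [lra|]. apply Rdiv_lt_0_compat; lra. }
    set (y := Rmin d1 (a / 2) / 2).
    assert (Hy : 0 < y /\ y < d1 /\ y < a / 2).
    { unfold y. pose proof (Rmin_l d1 (a / 2)). pose proof (Rmin_r d1 (a / 2)).
      assert (0 < Rmin d1 (a / 2)) by (apply Rmin_glb_lt; unfold a; lra). lra. }
    specialize (H3 y ltac:(lra)). rewrite Rminus_0_r in H3.
    destruct (Hnr y ltac:(unfold a in *; lra)) as [_ [Hx _]]. rewrite Rabs_right in H3 by lra.
    pose proof (Rmin_l 1 (- J (a / 2) / (M + 1))). pose proof (Rmin_r 1 (- J (a / 2) / (M + 1))).
    assert (H4 : J y < J (a / 2)) by (apply Hinc; unfold a in *; lra).
    assert (H5 : Rabs (Sn y) <= K * x y) by (apply HSx; unfold a in *; lra).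
    assert (H6 : - J y <= M * x y * x y).
    { unfold J, M. pose proof (Rle_abs K). pose proof (Rle_abs mu).
      pose proof (Rle_abs (- Sn y)) as H8. rewrite Rabs_Ropp in H8.
      assert (0 <= x y * x y) by nra.
      assert (x y * - Sn y <= x y * (K * x y)) by (apply Rmult_le_compat_l; lra).
      assert (K * (x y * x y) <= Rabs K * (x y * x y)) by (apply Rmult_le_compat_r; assumption).
      assert (mu * (x y * x y) <= Rabs mu * (x y * x y)) by (apply Rmult_le_compat_r; assumption). lra. }
    assert (HM : 0 <= M) by (unfold M; pose proof (Rabs_pos K); pose proof (Rabs_pos mu); lra).
    assert (H7 : x y * (M + 1) < - J (a / 2)).
    { apply Rlt_div_r; lra. }
    assert (M * x y * x y <= M * x y) by (assert (0 <= M * x y) by nra; nra). nra. }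
  (* [J <= x + |mu| x^2] converts a lower bound for [J] into one for [x]; for [x < 1] the quadratic
     term is at most [|mu| x]. *)
  set (xm := Rmin 1 (J a / (1 + Rabs mu))).
  assert (Hmu : 0 < 1 + Rabs mu) by (pose proof (Rabs_pos mu); lra).
  assert (Hxm : 0 < xm) by (apply Rmin_glb_lt; [lra|now apply Rdiv_lt_0_compat]).
  intros Hr HD. destruct (Rlt_le_dec r a0) as [Hlt|Hge]; [destruct (Hnr r) as [_ [H1 [H2 _]]]; [lra|now split]|].
  revert HD. apply (real_induction (fun r => Dm r -> 0 < x r /\ has_normal tau (sg * e) S (par r)) a);
    [| |unfold a; lra].
  - clear r Hr Hge. intros r Har IH HD.
    destruct (Rlt_le_dec r a0) as [Hlt|Hge]; [destruct (Hnr r) as [_ [H1 [H2 _]]]; [unfold a in *; lra|now split]|].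
    assert (Har' : a < r) by (unfold a; lra).
    assert (HDy : forall y, 0 <= y <= r -> Dm y) by (intros; apply (Dm_interval 0 r); [exact Dm_0|exact HD|lra]).
    assert (Hlow : forall y, a <= y < r -> xm <= x y).
    { intros y Hy. destruct (IH y Hy (HDy y ltac:(unfold a in *; lra))) as [Hx Hn].
      assert (HJy : J a <= J y).
      { apply (nondecreasing_of_deriv J (fun y => 2 * v y * x y * (C y * C y) / W tau (x y))); [lra| | |].
        - intros w Hw. destruct (IH w ltac:(lra) (HDy w ltac:(unfold a in *; lra))) as [H1 H2].
          eapply is_derive_continuous, J_axis_deriv; [apply HDy; unfold a in *; lra|exact H1|exact H2].
        - intros w Hw. destruct (IH w ltac:(lra) (HDy w ltac:(unfold a in *; lra))) as [H1 H2].
          apply J_axis_deriv; [apply HDy; unfold a in *; lra|exact H1|exact H2].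
        - intros w Hw. destruct (IH w ltac:(lra) (HDy w ltac:(unfold a in *; lra))) as [H1 H2].
          apply Jpos; [apply HDy; unfold a in *; lra|exact H1|exact H2]. }
      destruct (axis_ode y (HDy y ltac:(unfold a in *; lra)) Hx Hn) as [_ [HC1 _]].
      destruct (Rlt_le_dec (x y) 1) as [H1|H1]; [|apply Rle_trans with 1; [apply Rmin_l|exact H1]].
      apply Rle_trans with (J a / (1 + Rabs mu)); [apply Rmin_r|].
      apply Rle_div_l; [exact Hmu|].
      assert (HSb : Sn y <= 1) by nra.
      assert (J y <= x y + Rabs mu * (x y * x y)).
      { unfold J. pose proof (Rle_abs (- mu)) as H2. rewrite Rabs_Ropp in H2.
        assert (0 <= x y * x y) by nra.
        assert (- mu * (x y * x y) <= Rabs mu * (x y * x y)) by (apply Rmult_le_compat_r; assumption). nra. }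
      assert (Rabs mu * (x y * x y) <= Rabs mu * x y).
      { apply Rmult_le_compat_l; [apply Rabs_pos|nra]. }
      lra. }
    destruct HS as [HR HT].
    assert (Hxr : 0 < x r).
    (* On returning to the axis the profile would stop there, so the chart at [par r] runs
       backwards, [sg' = - sg], and the radius at parameters just before [r] would fall below
       [xm]. *)
    { destruct (rot_half_plane _ _ HR (par r) HD) as [H|H]; [exact H|exfalso]. symmetry in H.
      destruct (on_axis tau S (par r) HR HD H) as
        [sg' [d' [rho' [e' [K' [Hd' [Hsg' [_ [_ [Hn' [_ [Lx' _]]]]]]]]]]]].
      set (y := Rmin d' (r - a) / 2).
      assert (Hy : 0 < y /\ y < d' /\ y < r - a).
      { unfold y. pose proof (Rmin_l d' (r - a)). pose proof (Rmin_r d' (r - a)).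
        assert (0 < Rmin d' (r - a)) by (apply Rmin_glb_lt; lra). lra. }
      assert (Es : sg' = - sg).
      { destruct (Req_dec sg' sg) as [E|E];
          [|destruct Hsg as [-> | ->], Hsg' as [-> | ->]; try ring; exfalso; apply E; reflexivity].
        exfalso. assert (H1 : 0 <= - y); [|lra].
        apply (Hn' (- y)); [apply Rabs_def1; lra|].
        assert (H2 : Dm (r - y)) by (apply HDy; unfold a in *; lra).
        unfold Dm, par in H2. rewrite E. unfold par.
        replace (s0 + sg * r + sg * - y) with (s0 + sg * (r - y)) by ring. exact H2. }
      assert (Lx'' : rlim (fun r' => rad S (par r + sg' * r')) 0).
      { apply (rlim_ext (fun r' => rad S (par r + sg' * r') / r' * r') _ 0 1); [lra| |].
        - intros w Hw. field. lra.
        - replace 0 with (rho' * 0) by ring. apply rlim_mult; [exact Lx'|apply rlim_id]. }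
      destruct (proj1 (rlim_eps _ 0) Lx'' xm Hxm) as [d1 [Hd1 H1]].
      set (w := Rmin d1 (r - a) / 2).
      assert (Hw : 0 < w /\ w < d1 /\ w < r - a).
      { unfold w. pose proof (Rmin_l d1 (r - a)). pose proof (Rmin_r d1 (r - a)).
        assert (0 < Rmin d1 (r - a)) by (apply Rmin_glb_lt; lra). lra. }
      specialize (H1 w ltac:(lra)). rewrite Rminus_0_r in H1.
      replace (par r + sg' * w) with (par (r - w)) in H1 by (rewrite Es; unfold par; ring).
      specialize (Hlow (r - w) ltac:(lra)). unfold x in Hlow.
      rewrite Rabs_right in H1 by lra. lra. }
    split; [exact Hxr|].
    (* The sign is constant around [r], and at the earlier parameter [r - w] it is known to be
       [sg * e]. *)
    destruct (regular r HD Hxr) as [d1 [eps [Hd1 [Heps H1]]]].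
    set (w := Rmin d1 (r - a) / 2).
    assert (Hw : 0 < w /\ w < d1 /\ w < r - a).
    { unfold w. pose proof (Rmin_l d1 (r - a)). pose proof (Rmin_r d1 (r - a)).
      assert (0 < Rmin d1 (r - a)) by (apply Rmin_glb_lt; lra). lra. }
    destruct (H1 (r - w)) as [Q1 [Q2 [Q3 Q4]]]; [apply Rabs_def1; lra|].
    destruct (IH (r - w) ltac:(lra) Q1) as [_ Q5].
    assert (Hse : sg * e = 1 \/ sg * e = -1) by (destruct Hsg as [-> | ->], He as [-> | ->]; lra).
    rewrite <- (has_normal_unique tau eps (sg * e) S (par (r - w)) Heps Hse Q3 Q4 Q5).
    apply H1. now rewrite Rminus_diag, Rabs_R0.
  - clear r Hr Hge. intros r Har IH.
    destruct (classic (Dm r)) as [HD|HD].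
    + destruct (IH HD) as [Hx Hn]. destruct (regular r HD Hx) as [d1 [eps [Hd1 [Heps H1]]]].
      exists d1. split; [exact Hd1|]. intros y Hy _.
      destruct (H1 r) as [_ [_ [Q3 Q4]]]; [now rewrite Rminus_diag, Rabs_R0|].
      assert (Hse : sg * e = 1 \/ sg * e = -1) by (destruct Hsg as [-> | ->], He as [-> | ->]; lra).
      rewrite <- (has_normal_unique tau eps (sg * e) S (par r) Heps Hse Q3 Q4 Hn).
      destruct (H1 y) as [_ [Q1 [_ Q2]]]; [apply Rabs_def1; lra|]. now split.
    + exists 1. split; [lra|]. intros y Hy HDy. exfalso. apply HD.
      apply (Dm_interval 0 y); [exact Dm_0|exact HDy|unfold a in *; lra].
Qed.

(** The speed has the limit [rho] on the axis, but no prescribed value there. Extended by [rho] to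
    the left it is continuous at [0], so the arc length [ell] has a two-sided derivative at the
    axis. *)
Let vhat (r : R) := if Rle_dec r 0 then rho else v r.
Let ell (r : R) : R := RInt vhat 0 r.
Let E (r : R) := r <= 0 \/ Dm r.

Lemma vhat_pos_arg (r : R) : 0 < r -> vhat r = v r.
Proof. intros H. unfold vhat. destruct (Rle_dec r 0); [lra|reflexivity]. Qed.

Lemma vhat_nonpos_arg (r : R) : r <= 0 -> vhat r = rho.
Proof. intros H. unfold vhat. destruct (Rle_dec r 0); [reflexivity|lra]. Qed.

Lemma Dm_between (a r : R) : Dm r -> 0 <= a <= r -> Dm a.
Proof. intros H Ha. apply (Dm_interval 0 r); [exact Dm_0|exact H|exact Ha]. Qed.

Lemma E_lower (r y : R) : E r -> y <= r -> E y.
Proof.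
  intros Hr Hy. destruct (Rle_dec y 0) as [H|H]; [now left|right].
  destruct Hr as [Hr|Hr]; [lra|]. apply (Dm_between y r Hr). lra.
Qed.

Lemma E_open (r : R) : E r -> exists d1, 0 < d1 /\ forall y, Rabs (y - r) < d1 -> E y.
Proof.
  intros Hr. destruct (Rle_dec r 0) as [H|H].
  - exists d. split; [exact Hd|]. intros y Hy. apply Rabs_def2 in Hy.
    destruct (Rle_dec y 0) as [H1|H1]; [now left|right]. apply Hnear; [rewrite Rabs_right; lra|lra].
  - destruct Hr as [Hr|Hr]; [lra|]. destruct (axis_free r ltac:(lra) Hr) as [Hx _].
    destruct (regular r Hr Hx) as [d1 [eps [Hd1 [_ H1]]]]. exists d1. split; [exact Hd1|].
    intros y Hy. right. now apply H1.
Qed.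

Lemma v_props (r : R) : 0 < r -> Dm r -> 0 < x r /\
  0 < v r /\ C r * C r + Sn r * Sn r = 1 /\ continuous v r /\
  is_derive x r (v r * C r) /\ is_derive C r (- (v r * Sn r * k r)) /\
  is_derive Sn r (v r * C r * k r) /\ is_derive h r (v r * W tau (x r) * Sn r).
Proof.
  intros Hr HD. destruct (axis_free r Hr HD) as [Hx Hn]. split; [exact Hx|]. now apply axis_ode.
Qed.

Lemma vhat_continuous (r : R) : E r -> continuous vhat r.
Proof.
  intros Hr. destruct (Rtotal_order r 0) as [H|[H|H]].
  - apply (continuous_ext_loc _ (fun _ => rho)); [|apply cont_const].
    assert (H' : 0 < - r) by lra. exists (mkposreal _ H'). intros y Hy.
    assert (Hy' : Rabs (y - r) < - r) by exact Hy. apply Rabs_def2 in Hy'.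
    symmetry. apply vhat_nonpos_arg. lra.
  - subst r. apply continuous_eps. intros eps Heps.
    destruct (proj1 (rlim_eps v rho) Lv eps Heps) as [d1 [Hd1 H1]]. exists d1. split; [exact Hd1|].
    intros y Hy. rewrite Rminus_0_r in Hy. rewrite (vhat_nonpos_arg 0) by lra.
    destruct (Rle_dec y 0) as [Hy0|Hy0].
    + rewrite vhat_nonpos_arg by exact Hy0. now rewrite Rminus_diag, Rabs_R0.
    + rewrite vhat_pos_arg by lra. apply H1. apply Rabs_def2 in Hy. lra.
  - destruct Hr as [Hr|Hr]; [lra|]. destruct (v_props r H Hr) as [_ [_ [_ [Hc _]]]].
    apply (continuous_ext_loc _ v); [|exact Hc].
    exists (mkposreal _ H). intros y Hy. assert (Hy' : Rabs (y - r) < r) by exact Hy.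
    apply Rabs_def2 in Hy'. symmetry. apply vhat_pos_arg. lra.
Qed.

Lemma ell_deriv (r : R) : E r -> is_derive ell r (vhat r).
Proof.
  intros Hr. apply (is_derive_RInt vhat ell 0 r); [|now apply vhat_continuous].
  destruct (E_open r Hr) as [d1 [Hd1 H1]]. exists (mkposreal d1 Hd1). intros y Hy.
  apply (RInt_correct vhat 0 y). apply (ex_RInt_continuous vhat). intros w Hw. apply vhat_continuous.
  apply (E_lower (Rmax 0 y)); [|apply Hw].
  unfold Rmax. destruct (Rle_dec 0 y); [now apply H1|left; lra].
Qed.

Lemma ell_0 : ell 0 = 0.
Proof. unfold ell. exact (RInt_point 0 vhat). Qed.

Lemma ell_continuous (r : R) : E r -> continuous ell r.
Proof. intros Hr. eapply is_derive_continuous, ell_deriv, Hr. Qed.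

Lemma ell_increasing (a b : R) : Dm b -> 0 <= a < b -> ell a < ell b.
Proof.
  intros Hb Hab. apply (increasing_of_deriv ell vhat); [lra| | |].
  - intros y Hy. apply ell_continuous, (E_lower b); [now right|lra].
  - intros y Hy. apply ell_deriv, (E_lower b); [now right|lra].
  - intros y Hy. rewrite vhat_pos_arg by lra. apply v_props; [lra|]. apply (Dm_between y b Hb). lra.
Qed.

Lemma ell_nonneg (r : R) : Dm r -> 0 <= ell r.
Proof.
  intros Hr. destruct (Dm_nonneg r Hr) as [H|<-]; [|rewrite ell_0; lra].
  pose proof (ell_increasing 0 r Hr ltac:(lra)) as H1. rewrite ell_0 in H1. lra.
Qed.

(** * Identification with the model, and completeness *)

Section Model.
Variables (A q th z : R -> R).
Hypothesis HP : profile tau mu A q th z.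

Lemma model_match (r : R) : 0 < r -> Dm r ->
  x r = prad A (ell r) /\ C r = cos (th (ell r)) /\ Sn r = sin (th (ell r)).
Proof.
  intros Hr HD.
  assert (HD' : forall y, 0 < y <= r -> 0 < y /\ Dm y).
  { intros y Hy. split; [lra|]. apply (Dm_between y r HD). lra. }
  apply (comparison tau mu A q th z HP x C Sn v ell r rho K d Hrho Hd); try assumption; try lra;
    try (intros y Hy; apply v_props; apply (HD' y Hy)).
  - intros y Hy. destruct (HD' y Hy) as [H1 H2]. rewrite <- vhat_pos_arg by exact H1.
    apply ell_deriv. now right.
  - apply rlim_quotient; [|exact ell_0]. rewrite <- (vhat_nonpos_arg 0) by lra. apply ell_deriv. left. lra.
Qed.

Lemma model_height (r : R) : Dm r -> h r = z (ell r) + hgt S s0.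
Proof.
  intros HD. destruct (Dm_nonneg r HD) as [Hr|<-].
  2:{ rewrite ell_0, (pr_z_0 _ _ _ _ _ _ HP). unfold h, par. rewrite Rmult_0_r, !Rplus_0_r, Rplus_0_l. reflexivity. }
  set (g := fun y => h y - z (ell y)).
  assert (Dg : forall y, 0 < y <= r -> is_derive g y 0).
  { intros y Hy. assert (HDy : Dm y) by (apply (Dm_between y r HD); lra).
    destruct (v_props y ltac:(lra) HDy) as [_ [_ [_ [_ [_ [_ [_ Dh]]]]]]].
    destruct (model_match y ltac:(lra) HDy) as [Ex [_ ES]].
    eapply is_derive_eq.
    - apply (deriv_minus h (fun y => z (ell y))); [exact Dh|].
      apply (deriv_comp z ell); [apply ell_deriv; now right|apply (z_deriv tau mu A q th z HP)].
    - rewrite vhat_pos_arg by lra. fold (prad A (ell y)). rewrite <- Ex, <- ES. ring. }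
  assert (Lg : rlim g (hgt S s0)).
  { replace (hgt S s0) with (hgt S s0 - z 0) by (rewrite (pr_z_0 _ _ _ _ _ _ HP); ring).
    apply rlim_minus; [exact Lh|]. rewrite <- ell_0.
    apply (rlim_comp ell z); [apply rlim_continuous, ell_continuous; left; lra|].
    eapply is_derive_continuous, (z_deriv tau mu A q th z HP). }
  assert (Eg : g r = hgt S s0).
  { apply NNPP. intros Hne. assert (Habs : 0 < Rabs (g r - hgt S s0)) by (apply Rabs_pos_lt; lra).
    destruct (proj1 (rlim_eps g _) Lg _ Habs) as [d1 [Hd1 H1]].
    set (y := Rmin d1 r / 2).
    assert (Hy : 0 < y /\ y < d1 /\ y < r).
    { unfold y. pose proof (Rmin_l d1 r). pose proof (Rmin_r d1 r).
      assert (0 < Rmin d1 r) by (apply Rmin_glb_lt; lra). lra. }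
    specialize (H1 y ltac:(lra)).
    rewrite (constant_of_deriv g y r) in H1; [lra|lra| |].
    - intros w Hw. eapply is_derive_continuous, Dg. lra.
    - intros w Hw. apply Dg. lra. }
  unfold g in Eg. lra.
Qed.

Lemma model_radius (r : R) : Dm r -> x r = prad A (ell r).
Proof.
  intros HD. destruct (Dm_nonneg r HD) as [Hr|<-]; [now apply model_match|].
  rewrite ell_0, x_at_0. unfold prad. ring.
Qed.

Lemma model_normal (r t : R) : Dm r ->
  nrm S (par r) t = nrm (rot_surface tau e A th z) (ell r) t.
Proof.
  intros HD. simpl. fold (prad A (ell r)). destruct (Dm_nonneg r HD) as [Hr|<-].
  - destruct (axis_free r Hr HD) as [_ Hn]. destruct (model_match r Hr HD) as [Ex [EC ES]].
    rewrite (Hn t), <- Ex, <- EC, <- ES. unfold unit_normal, C, Sn, x.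
    f_equal; unfold Rdiv; ring.
  - rewrite ell_0. unfold par. rewrite Rmult_0_r, Rplus_0_r, Hnrm. unfold prad.
    rewrite Rmult_0_l, (pr_th_0 _ _ _ _ _ _ HP), cos_0, sin_0.
    unfold unit_normal, frame, W. rewrite !Rmult_0_r, Rplus_0_r, sqrt_1. apply pt_eq; field.
Qed.

Lemma par_inverse (s : R) : par (sg * (s - s0)) = s.
Proof. unfold par. transitivity (s0 + sg * sg * (s - s0)); [ring|]. rewrite sg_sqr. ring. Qed.

Lemma axis_piece :
  piece_via (fun s => ell (sg * (s - s0))) (hgt S s0) S (rot_surface tau e A th z).
Proof.
  assert (HDm : forall s, dom S s -> Dm (sg * (s - s0))).
  { intros s Hs. unfold Dm. now rewrite par_inverse. }
  split; [|split].
  - intros s Hs. apply (filterlim_filter_le_1 (F := locally s)); [apply filter_le_within|].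
    apply (cont_comp (fun s => sg * (s - s0)) ell).
    + apply (is_derive_continuous _ _ sg). auto_derive; [exact I|ring].
    + apply ell_continuous. right. now apply HDm.
  - intros s s' Hs Hs' Heq. apply HDm in Hs. apply HDm in Hs'.
    assert (H : sg * (s - s0) = sg * (s' - s0)).
    { pose proof (Dm_nonneg _ Hs). pose proof (Dm_nonneg _ Hs').
      destruct (Rtotal_order (sg * (s - s0)) (sg * (s' - s0))) as [H1|[H1|H1]]; [exfalso|exact H1|exfalso].
      - pose proof (ell_increasing _ _ Hs' (conj H H1)). lra.
      - pose proof (ell_increasing _ _ Hs (conj H0 H1)). lra. }
    rewrite <- (par_inverse s), <- (par_inverse s'). now rewrite H.
  - intros s Hs. pose proof (HDm s Hs) as HD.
    split; [now apply ell_nonneg|].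
    pose proof (model_radius _ HD) as H1. pose proof (model_height _ HD) as H2.
    assert (H3 := fun t => model_normal _ t HD).
    unfold x in H1. unfold h in H2. rewrite par_inverse in H1, H2, H3.
    split; [exact H1|]. split; [exact H2|exact H3].
Qed.

Lemma x_le_ell (r : R) : Dm r -> x r <= ell r.
Proof.
  intros HD. rewrite (model_radius r HD). pose proof (ell_nonneg r HD) as H.
  assert (H1 : 0 - prad A 0 <= ell r - prad A (ell r)).
  { apply (nondecreasing_of_deriv (fun s => s - prad A s) (fun s => 1 - cos (th s)) 0 (ell r) H).
    - intros s _. apply (cont_minus (fun s => s) (prad A)); [apply cont_id|].
      eapply is_derive_continuous, (x_deriv tau mu A q th z HP).
    - intros s _. apply (deriv_minus (fun s => s) (prad A)); [apply deriv_id|apply (x_deriv tau mu A q th z HP)].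
    - intros s _. pose proof (COS_bound (th s)). lra. }
  unfold prad in H1 at 1. lra.
Qed.

(** The velocity of a meridian has length [v sqrt (C^2 + W^2 Sn^2) <= v W], and [x <= ell < y]
    bounds [W] by its value at [y]. So arc length in the orbit space controls length in the ambient
    metric as long as it stays bounded. *)
Lemma meridian_length (c c1 : R -> R) (y u : R) :
  (forall w, w < 1 -> is_derive c w (c1 w) /\ continuous c1 w) ->
  (forall w, 0 <= w < 1 -> 0 < c w /\ Dm (c w) /\ 0 <= c1 w) ->
  (forall r, Dm r -> ell r < y) -> 0 <= u < 1 ->
  arc_length tau (fun w => rot_map S (par (c w)) 0) 0 u <= W tau y * y.
Proof.
  intros Dc Hc Hy Hu.
  set (N := fun r => sqrt (C r * C r + (W tau (x r) * Sn r) * (W tau (x r) * Sn r))).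
  set (G := fun w => c1 w * v (c w) * N (c w)).
  set (B := fun w => W tau y * (c1 w * v (c w))).
  assert (HG : forall w, 0 <= w < 1 ->
    sqrt (inner tau (rot_map S (par (c w)) 0)
      (Derive (fun w => cx (rot_map S (par (c w)) 0)) w, Derive (fun w => cy (rot_map S (par (c w)) 0)) w,
       Derive (fun w => cz (rot_map S (par (c w)) 0)) w)
      (Derive (fun w => cx (rot_map S (par (c w)) 0)) w, Derive (fun w => cy (rot_map S (par (c w)) 0)) w,
       Derive (fun w => cz (rot_map S (par (c w)) 0)) w)) = G w).
  { intros w Hw. destruct (Hc w Hw) as [H1 [H2 H3]]. destruct (Dc w ltac:(lra)) as [H4 _].
    destruct (v_props (c w) H1 H2) as [Hx [Hv [HC1 [_ [Dx [_ [_ Dh]]]]]]].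
    assert (E1 : Derive (fun w => cx (rot_map S (par (c w)) 0)) w = c1 w * (v (c w) * C (c w))).
    { apply is_derive_unique. eapply is_derive_eq.
      - apply (deriv_mult (fun w => x (c w)) (fun _ => cos 0)); [|apply deriv_const].
        apply (deriv_comp x c); [exact H4|exact Dx].
      - rewrite cos_0. ring. }
    assert (E2 : Derive (fun w => cy (rot_map S (par (c w)) 0)) w = 0).
    { apply is_derive_unique. eapply is_derive_eq.
      - apply (deriv_mult (fun w => x (c w)) (fun _ => sin 0)); [|apply deriv_const].
        apply (deriv_comp x c); [exact H4|exact Dx].
      - rewrite sin_0. ring. }
    assert (E3 : Derive (fun w => cz (rot_map S (par (c w)) 0)) w = c1 w * (v (c w) * W tau (x (c w)) * Sn (c w))).
    { apply is_derive_unique. apply (deriv_comp h c); [exact H4|exact Dh]. }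
    rewrite E1, E2, E3. unfold inner, contact, rot_map, cx, cy, cz; simpl. rewrite sin_0, cos_0.
    unfold G, N.
    rewrite <- (sqrt_square (c1 w * v (c w))) by nra. rewrite <- sqrt_mult_alt by nra.
    f_equal. fold (x (c w)). ring. }
  assert (HN : forall r, 0 < r -> Dm r -> 0 <= N r <= W tau y /\ continuous N r).
  { intros r Hr HD. destruct (v_props r Hr HD) as [Hx [_ [HC1 [_ [Dx [DC [DS _]]]]]]].
    split; [split; [apply sqrt_pos|]|].
    - assert (HWy : W tau (x r) <= W tau y).
      { apply W_incr. pose proof (x_le_ell r HD). pose proof (Hy r HD). lra. }
      pose proof (W_ge_1 tau (x r)) as HW1. pose proof (W_pos tau y) as HWp.
      rewrite <- (sqrt_square (W tau y)) by lra. apply sqrt_le_1_alt.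
      set (w := W tau (x r)) in *. apply Rle_trans with (w * w); [|nra].
      replace (w * w) with (w * w * (C r * C r + Sn r * Sn r)) by (rewrite HC1; ring).
      assert (1 <= w * w) by nra. pose proof (Rle_0_sqr (C r)) as HC2. unfold Rsqr in HC2. nra.
    - apply (cont_comp (fun r => C r * C r + (W tau (x r) * Sn r) * (W tau (x r) * Sn r)) sqrt); [|apply continuous_sqrt].
      assert (KC : continuous C r) by (eapply is_derive_continuous, DC).
      assert (KS : continuous Sn r) by (eapply is_derive_continuous, DS).
      assert (KW : continuous (fun r => W tau (x r)) r).
      { apply (cont_comp x (W tau)); [eapply is_derive_continuous, Dx|eapply is_derive_continuous, W_derive]. }
      assert (KP : continuous (fun r => W tau (x r) * Sn r) r) by now apply (cont_mult (fun r => W tau (x r)) Sn).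
      apply (cont_plus (fun r => C r * C r) (fun r => (W tau (x r) * Sn r) * (W tau (x r) * Sn r))).
      + now apply (cont_mult C C).
      + now apply (cont_mult (fun r => W tau (x r) * Sn r) (fun r => W tau (x r) * Sn r)). }
  assert (Kcv : forall w, 0 <= w < 1 -> continuous (fun w => c1 w * v (c w)) w).
  { intros w Hw. destruct (Hc w Hw) as [H1 [H2 H3]]. destruct (Dc w ltac:(lra)) as [H4 H5].
    apply (cont_mult c1 (fun w => v (c w))); [exact H5|].
    apply (cont_comp c v); [eapply is_derive_continuous, H4|]. now apply v_props. }
  assert (IG : ex_RInt G 0 u).
  { apply (ex_RInt_continuous G). intros w Hw. rewrite Rmin_left, Rmax_right in Hw by lra.
    destruct (Hc w ltac:(lra)) as [H1 [H2 H3]]. destruct (Dc w ltac:(lra)) as [H4 H5].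
    apply (cont_mult (fun w => c1 w * v (c w)) (fun w => N (c w))); [apply Kcv; lra|].
    apply (cont_comp c N); [eapply is_derive_continuous, H4|]. now apply HN. }
  assert (IB : is_RInt B 0 u (W tau y * ell (c u) - W tau y * ell (c 0))).
  { apply (is_RInt_derive (fun w => W tau y * ell (c w)) B).
    - intros w Hw. rewrite Rmin_left, Rmax_right in Hw by lra.
      destruct (Hc w ltac:(lra)) as [H1 [H2 H3]]. destruct (Dc w ltac:(lra)) as [H4 H5].
      unfold B. apply (deriv_scal (W tau y) (fun w => ell (c w))). apply (deriv_comp ell c); [exact H4|].
      rewrite <- vhat_pos_arg by exact H1. apply ell_deriv. now right.
    - intros w Hw. rewrite Rmin_left, Rmax_right in Hw by lra.
      apply (cont_mult (fun _ => W tau y) (fun w => c1 w * v (c w))); [apply cont_const|apply Kcv; lra]. }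
  unfold arc_length. rewrite (RInt_ext _ G).
  2:{ intros w Hw. rewrite Rmin_left, Rmax_right in Hw by lra. apply HG. lra. }
  apply Rle_trans with (W tau y * ell (c u) - W tau y * ell (c 0)).
  - apply (is_RInt_le G B 0 u); [lra|exact (RInt_correct G 0 u IG)|exact IB|].
    intros w Hw. destruct (Hc w ltac:(lra)) as [H1 [H2 H3]].
    destruct (HN (c w) H1 H2) as [[H4 H5] _]. destruct (v_props (c w) H1 H2) as [_ [Hv _]].
    unfold G, B. rewrite (Rmult_comm (W tau y)). apply Rmult_le_compat_l; [|exact H5]. nra.
  - pose proof (W_pos tau y). destruct (Hc u Hu) as [_ [H2 _]]. destruct (Hc 0 ltac:(lra)) as [_ [H3 _]].
    pose proof (Hy _ H2). pose proof (ell_nonneg _ H3). nra.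
Qed.

Lemma no_short_end (c c1 : R -> R) (y : R) : complete tau S ->
  (forall w, w < 1 -> is_derive c w (c1 w) /\ continuous c1 w) ->
  (forall w, 0 <= w < 1 -> 0 < c w /\ Dm (c w) /\ 0 <= c1 w) ->
  (forall a b, (forall r, a <= r <= b -> dom S r) -> exists u0, u0 < 1 /\
     forall u, u0 < u < 1 -> ~ (a <= par (c u) <= b)) ->
  ~ (forall r, Dm r -> ell r < y).
Proof.
  intros Hcomp Dc Hc Hesc Hy.
  destruct (Hcomp (fun u => par (c u)) (fun _ => 0)) with (L := W tau y * y) as [u [Hu HL]].
  - intros u Hu. destruct (Hc u Hu) as [H1 [H2 H3]].
    assert (Da : forall w, w < 1 -> is_derive (fun u => par (c u)) w (c1 w * sg)).
    { intros w Hw. apply (deriv_comp par c); [now apply Dc|apply par_deriv]. }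
    split; [exact H2|]. split; [now apply v_props|].
    split; [exists (c1 u * sg); apply Da; lra|]. split; [apply ex_derive_const|].
    split.
    + apply (continuous_ext_loc _ (fun w => c1 w * sg)).
      * assert (H : 0 < 1 - u) by lra. exists (mkposreal _ H). intros w Hw.
        assert (Hw' : Rabs (w - u) < 1 - u) by exact Hw. apply Rabs_def2 in Hw'.
        symmetry. apply is_derive_unique, Da. lra.
      * apply (cont_mult c1 (fun _ => sg)); [apply Dc; lra|apply cont_const].
    + apply (continuous_ext (fun _ => 0)); [|apply cont_const].
      intros w. symmetry. apply Derive_const.
  - exact Hesc.
  - pose proof (meridian_length c c1 y u Dc Hc Hy Hu). lra.
Qed.

(** Otherwise a meridian running into the open end of the domain, be it a finite endpoint or
    infinity, would be a divergent curve of length at most [y] times [W] at [y]. *)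
Lemma end_reached (y : R) : complete tau S -> ~ (forall r, Dm r -> ell r < y).
Proof.
  intros Hcomp. destruct (classic (exists b, 0 < b /\ ~ Dm b /\ forall r, 0 <= r < b -> Dm r)) as [[b [Hb [Hb1 Hb2]]]|Hno].
  - apply (no_short_end (fun u => b - b / 2 * (1 - u)) (fun _ => b / 2) y Hcomp).
    + intros w _. split; [auto_derive; [exact I|ring]|apply cont_const].
    + intros w Hw. assert (0 < b - b / 2 * (1 - w) < b) by nra.
      split; [lra|]. split; [apply Hb2; lra|lra].
    + intros a1 b1 Hab. destruct (Rle_dec a1 b1) as [Hle|Hle]; [|exists 0; split; [lra|intros; lra]].
      assert (Hout : par b < a1 \/ b1 < par b).
      { destruct (Rlt_le_dec (par b) a1); [now left|right]. apply Rnot_le_lt. intros H.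
        apply Hb1. apply Hab. lra. }
      (* The distance from [par b] to [[a1, b1]]; after [1 - 2 g / b] the curve is closer than that
         to [par b]. *)
      set (g := Rmax (a1 - par b) (par b - b1)).
      assert (Hg : 0 < g).
      { unfold g. destruct Hout; [apply Rlt_le_trans with (2 := Rmax_l _ _)|apply Rlt_le_trans with (2 := Rmax_r _ _)]; lra. }
      exists (1 - 2 * g / b). split.
      { assert (0 < 2 * g / b) by (apply Rdiv_lt_0_compat; lra). lra. }
      intros u Hu. assert (Hbu : 0 < b / 2 * (1 - u) < g).
      { split; [nra|]. replace g with (b / 2 * (2 * g / b)) by (field; lra). apply Rmult_lt_compat_l; lra. }
      unfold par in *. set (t := b / 2 * (1 - u)) in *.
      assert (Hgd : g = a1 - (s0 + sg * b) \/ g = s0 + sg * b - b1).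
      { unfold g, Rmax. destruct (Rle_dec _ _); [now right|now left]. }
      destruct Hsg as [-> | ->], Hgd; lra.
  - assert (Hall : forall r, 0 <= r -> Dm r).
    { apply (real_induction Dm 0).
      - intros s Hs H. apply NNPP. intros Hn. apply Hno. exists s. split; [|split; [exact Hn|]].
        { destruct Hs as [Hs|<-]; [exact Hs|exfalso; apply Hn, Dm_0]. }
        intros r Hr. now apply H.
      - intros s Hs H. destruct (E_open s (or_intror H)) as [d1 [Hd1 H1]]. exists d1. split; [exact Hd1|].
        intros r Hr. destruct (H1 r) as [H2|H2]; [apply Rabs_def1; lra| |exact H2].
        replace r with 0 by lra. exact Dm_0. }
    (* The domain is a whole half-line; this curve starts at [1] and leaves every bounded
       interval. *)
    apply (no_short_end (fun u => / (1 - u)) (fun u => / ((1 - u) * (1 - u))) y Hcomp).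
    + intros w Hw. split.
      * auto_derive; [lra|]. field. lra.
      * apply (cont_inv (fun u => (1 - u) * (1 - u))); [|nra].
        apply (is_derive_continuous _ _ (- 2 * (1 - w))). auto_derive; [exact I|ring].
    + intros w Hw. assert (0 < / (1 - w)) by (apply Rinv_0_lt_compat; lra).
      split; [assumption|]. split; [apply Hall; lra|]. apply Rlt_le, Rinv_0_lt_compat. nra.
    + intros a1 b1 _. set (M := 1 + Rabs (a1 - s0) + Rabs (b1 - s0)).
      assert (HM : 1 <= M) by (unfold M; pose proof (Rabs_pos (a1 - s0)); pose proof (Rabs_pos (b1 - s0)); lra).
      exists (1 - / M). split; [pose proof (Rinv_0_lt_compat M); lra|].
      intros u Hu. assert (HMu : M < / (1 - u)).
      { rewrite <- (Rinv_inv M). apply Rinv_lt_contravar; [|lra].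
        apply Rmult_lt_0_compat; [lra|apply Rinv_0_lt_compat; lra]. }
      unfold par, M in *. pose proof (Rle_abs (a1 - s0)) as P1. pose proof (Rle_abs (b1 - s0)) as P2.
      pose proof (Rle_abs (- (a1 - s0))) as P3. pose proof (Rle_abs (- (b1 - s0))) as P4.
      rewrite Rabs_Ropp in P3, P4. set (t := / (1 - u)) in *.
      pose proof (Rabs_pos (a1 - s0)). pose proof (Rabs_pos (b1 - s0)).
      destruct Hsg as [-> | ->]; lra.
Qed.

Lemma axis_same : complete tau S -> same_surface S (rot_surface tau e A th z).
Proof.
  intros Hcomp. exists (fun s => ell (sg * (s - s0))), (hgt S s0). split; [exact axis_piece|].
  intros y Hy. simpl in Hy.
  assert (Hr : exists r, Dm r /\ y <= ell r).
  { apply NNPP. intros Hno. apply (end_reached y Hcomp). intros r HD. apply Rnot_le_lt. intros H.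
    apply Hno. now exists r. }
  destruct Hr as [r [HD Hr]]. pose proof (Dm_nonneg r HD) as Hr0.
  destruct (ivt ell 0 r y Hr0) as [r1 [Hr1 E1]].
  - intros w Hw. apply ell_continuous. right. apply (Dm_between w r HD). lra.
  - left. rewrite ell_0. lra.
  - exists (par r1). split; [apply (Dm_between r1 r HD); lra|].
    replace (sg * (par r1 - s0)) with r1; [exact E1|].
    unfold par. transitivity (sg * sg * r1); [rewrite sg_sqr; ring|ring].
Qed.
End Model.
End FromAxis.

(** The profile is quantified after the sign, so that every surface can be compared with the two
    profiles fixed once for all by the theorem. *)
Lemma axis_uniqueness (tau lam : R) (S : rot_data) (s0 : R) :
  rotational_translator tau lam S -> dom S s0 -> rad S s0 = 0 ->
  exists e, (e = 1 \/ e = -1) /\ (forall t, nrm S s0 t = (0, 0, e)) /\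
  forall A q th z, profile tau (e * lam) A q th z ->
    piece_of S (rot_surface tau e A th z) /\
    (complete tau S -> same_surface S (rot_surface tau e A th z)).
Proof.
  intros HS Hdom Hrad.
  destruct (on_axis tau S s0 (proj1 HS) Hdom Hrad) as
    [sg [d [rho [e [K [Hd [Hsg [Hrho [He [Hnear [Hnrm [Lx [Lh [Lv [LC [Ln HSx]]]]]]]]]]]]]]]].
  exists e. split; [exact He|]. split; [exact Hnrm|]. intros A q th z HP. split.
  - eexists. eexists. eapply (axis_piece tau lam S s0 sg d rho e K); eassumption.
  - eapply (axis_same tau lam S s0 sg d rho e K); eassumption.
Qed.

Theorem theorem1p3 (tau lambda : R) (Htau : tau <> 0) :
  exists (Mp Mm : rot_data) (Fp np Fm nm : R -> R -> pt),
    (rotational_translator tau lambda Mp /\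
     complete tau Mp /\
     intersects_axis_with_normal Mp dz /\
     forall S : rot_data,
       rotational_translator tau lambda S ->
       intersects_axis_with_normal S dz -> piece_of S Mp) /\
    (rotational_translator tau lambda Mm /\
     complete tau Mm /\
     intersects_axis_with_normal Mm minus_dz /\
     forall S : rot_data,
       rotational_translator tau lambda S ->
       intersects_axis_with_normal S minus_dz -> piece_of S Mm) /\
    (forall S : rot_data,
       rotational_translator tau lambda S ->
       complete tau S ->
       intersects_axis S ->
       same_surface S Mp \/ same_surface S Mm) /\
    (disk_parametrization tau Mp Fp np /\ proper Fp) /\
    (disk_parametrization tau Mm Fm nm /\ proper Fm) /\
    (0 < lambda ->
       embedded Fp /\
       tends_at_infinity (fun u v => cz (Fp u v)) p_infty /\
       is_cmc tau lambda (cylinder (/ (2 * lambda))) cylinder_normal /\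
       converges_to_cylinder tau (/ (2 * lambda)) Fp np) /\
    (0 < lambda ->
       infinitely_many_self_intersections Fm /\
       tends_at_infinity (fun u v => cz (Fm u v)) m_infty /\
       axis_dist_unbounded Fm) /\
    (forall u0 v0 z0 : R, Fm u0 v0 = (0, 0, z0) ->
       (1 <= lambda ->
          local_vertical_graph Fm u0 v0 (above_downwards_plane z0)) /\
       (lambda < 1 ->
          local_vertical_graph Fm u0 v0 (below_downwards_plane z0))).
Proof.
  destruct (profile_exists tau lambda) as [Ap [qp [tp [zp Pp]]]].
  (* For the downward orientation [mu = - lambda] and [e = -1], so that [e * mu] is again
     [lambda]. *)
  destruct (profile_exists tau (- lambda)) as [Am [qm [tm [zm Pm]]]].
  assert (Hp : 1 * 1 = 1) by ring. assert (Hm : -1 * -1 = 1) by ring.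
  assert (Ep : 1 * lambda = lambda) by ring. assert (Em : -1 * lambda = - lambda) by ring.
  exists (rot_surface tau 1 Ap tp zp), (rot_surface tau (-1) Am tm zm).
  exists (disk_map Ap zp), (disk_normal tau 1 Ap qp tp), (disk_map Am zm), (disk_normal tau (-1) Am qm tm).
  split.
  { split; [rewrite <- Ep at 1; exact (surface_translator tau lambda 1 Ap qp tp zp Hp Pp)|].
    split; [exact (surface_complete tau lambda 1 Ap qp tp zp Pp)|].
    split; [exact (surface_axis tau lambda 1 Ap qp tp zp Pp)|].
    intros S HS [s [H1 [H2 H3]]]. destruct (axis_uniqueness tau lambda S s HS H1 H2) as [e [_ [H4 H5]]].
    assert (e = 1) as -> by (specialize (H4 0); rewrite H3 in H4; injection H4; auto).
    apply (H5 Ap qp tp zp). rewrite Ep. exact Pp. }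
  split.
  { split; [replace lambda with (-1 * - lambda) by ring; exact (surface_translator tau (- lambda) (-1) Am qm tm zm Hm Pm)|].
    split; [exact (surface_complete tau (- lambda) (-1) Am qm tm zm Pm)|].
    split; [exact (surface_axis tau (- lambda) (-1) Am qm tm zm Pm)|].
    intros S HS [s [H1 [H2 H3]]]. destruct (axis_uniqueness tau lambda S s HS H1 H2) as [e [_ [H4 H5]]].
    assert (e = -1) as -> by (specialize (H4 0); rewrite H3 in H4; injection H4; auto).
    apply (H5 Am qm tm zm). rewrite Em. exact Pm. }
  split.
  { intros S HS Hcomp [s [H1 H2]]. destruct (axis_uniqueness tau lambda S s HS H1 H2) as [e [He [_ H5]]].
    destruct He as [-> | ->].
    - left. apply (H5 Ap qp tp zp); [rewrite Ep; exact Pp|exact Hcomp].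
    - right. apply (H5 Am qm tm zm); [rewrite Em; exact Pm|exact Hcomp]. }
  split; [split; [exact (surface_disk tau lambda 1 Ap qp tp zp Hp Pp)|exact (disk_proper tau lambda Ap qp tp zp Htau Pp)]|].
  split; [split; [exact (surface_disk tau (- lambda) (-1) Am qm tm zm Hm Pm)|exact (disk_proper tau (- lambda) Am qm tm zm Htau Pm)]|].
  split.
  { intros Hl. split; [exact (disk_embedded tau lambda Ap qp tp zp Pp Hl)|].
    split; [exact (disk_height_diverges tau lambda Ap qp tp zp Htau Pp Hl)|].
    assert (Hr : 0 < / (2 * lambda)) by (apply Rinv_0_lt_compat; lra). split.
    - replace lambda with (/ (2 * / (2 * lambda))) at 1 by (field; lra). now apply cylinder_cmc.
    - exact (disk_converges_to_cylinder tau lambda 1 Ap qp tp zp Pp eq_refl Hl). }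
  split.
  { intros Hl. assert (Hmu : - lambda < 0) by lra.
    split; [exact (disk_self_intersections tau (- lambda) Am qm tm zm Htau Hmu Pm)|].
    split; [exact (disk_height_to_minus_infinity tau (- lambda) Am qm tm zm Htau Hmu Pm)|].
    exact (disk_axis_dist_unbounded tau (- lambda) Am qm tm zm Hmu Pm). }
  intros u0 v0 z0 HF. destruct (disk_graph tau (- lambda) Am qm tm zm Htau Pm u0 v0 z0 HF) as [H1 H2].
  split; intros H; [apply H1|apply H2]; lra.
Qed.
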